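(* Let $V$ be a complex-valued function on $[-1,1]$ extending holomorphically to a domain $D\subset\mathbb{C}$ containing $[-1,1]$, let $\beta\in(-1,1)$ and $\delta>0$, and assume that hypotheses (H1) and (H3) described in the context hold. Then there exist $R,\varepsilon>0$ such that for every $E_0\in\mathbb{C}$ with $|E_0|\ge R$ and $|\mathrm{Im}\,E_0|\le\varepsilon|E_0|$: $$\mathrm{Re}\int_{-1}^\beta\sqrt{V(x)-i\delta-E_0}\,dx=0\quad\text{or}\quad\mathrm{Re}\int_\beta^1\sqrt{V(x)+i\delta-E_0}\,dx=0$$ if and only if $E_0\in\lim_h\mathrm{Sp}(H^h_\delta)$.
   Context: $H^h_\delta=H^h_{\delta,\beta}=-h^2\frac{d^2}{dx^2}+V_{\delta,\beta}(x)$ on $L^2([-1,1])$, where $V_{\delta,\beta}(x)=V(x)+i\delta$ for $x>\beta$ and $V_{\delta,\beta}(x)=V(x)-i\delta$ for $x<\beta$, with domain $\{u\in L^2([-1,1]): u''\in L^2([-1,1]),\ u(-1)=u(1)=0\}$. $\lim_h\mathrm{Sp}(H^h_\delta)$ is the set of all $E_0\in\mathbb{C}$ for which there exist $h_j\to0$ and $E_{h_j}\in\mathrm{Sp}(H^{h_j}_\delta)$ with $E_{h_j}\to E_0$. Square roots in the integrals are continuous branches on the interval of integration (the conditions do not depend on the sign). A turning point (for $E$) is a zero of $V-E$. The Stokes line starting from $x$ is $\{y:\mathrm{Re}\int_x^y(V(t)-E)^{1/2}dt=0\}$; Stokes lines are integral curves of the vector field $s(x)=i\,\overline{(V(x)-E)^{1/2}}$.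 (H1) For any $\Omega\subset\mathbb{C}$, if $V^{-1}(\Omega)$ is bounded then $\Omega$ is relatively compact. (H3) If $E$ is large enough with small imaginary part (i.e. there are $R_0,\varepsilon_0>0$ such that for all $E$ with $|E|\ge R_0$, $|\mathrm{Im}\,E|\le\varepsilon_0|E|$), then $1$, $-1$ and $\beta$ belong to the same Stokes region: there are paths from $-1$ to $\beta$ and from $1$ to $\beta$ that do not intersect the Stokes lines issuing from the turning points. *)

(* Defs.v *)
From HB Require Import structures.
From mathcomp Require Import all_boot all_order all_algebra.
From mathcomp Require Import all_classical all_reals all_analysis.
From mathcomp Require Import complex.

Set Implicit Arguments.
Unset Strict Implicit.
Unset Printing Implicit Defensive.

Import Order.TTheory GRing.Theory Num.Theory.
Import numFieldNormedType.Exports.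

Local Open Scope classical_set_scope.
Local Open Scope ring_scope.
Local Open Scope complex_scope.

(* The normed (hence topological) structure of R[i] over itself, as for every
   numFieldType. *)
HB.instance Definition _ (R : rcfType) := NormedModule.copy R[i] R[i]^o.

Section Defs.
Variable R : realType.
Implicit Types (f g u v : R -> R[i]) (V : R[i] -> R[i]) (D : set R[i]).

Local Notation mu := (@lebesgue_measure R).
Local Notation I := (`[(-1)%R : R, 1%R]%classic).

Definition cabs (z : R[i]) : R := ComplexField.Normc.normc z.

Definition cint (a b : R) f : R[i] :=
  Rintegral mu `[a, b] (fun x => complex.Re (f x))
  +i* Rintegral mu `[a, b] (fun x => complex.Im (f x)).

(* [f] is an indefinite integral of [f'] on [a, b]. For [f'] continuous this
   says that [f] is C^1 with derivative [f']; for [f'] integrable, that [f] is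
   absolutely continuous with derivative [f'] almost everywhere. *)
Definition indefinite_integral (a b : R) f f' : Prop :=
  forall x, x \in `[a, b] -> f x = f a + cint a x f'.

(** L^2([-1, 1]); its elements are represented by functions [R -> R[i]], equal
    when they agree almost everywhere on [-1, 1]. *)

Definition ae_eqI f g : Prop :=
  {ae mu, forall x, x \in `[-1, 1] -> f x = g x}.

Definition inL2 f : Prop :=
  [/\ measurable_fun I (fun x => complex.Re (f x)),
      measurable_fun I (fun x => complex.Im (f x)) &
      (\int[mu]_(x in I) (cabs (f x) ^+ 2)%:E < +oo)%E].

Definition L2norm f : R :=
  Num.sqrt (Rintegral mu I (fun x => cabs (f x) ^+ 2)).

(* An unbounded operator [T] on L^2([-1, 1]) is given by its graph: [T u g]
   means that [u] is in the domain of [T] and that [T u = g] in L^2. *)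
Definition resolvent_set (T : (R -> R[i]) -> (R -> R[i]) -> Prop) : set R[i] :=
  [set z |
    let Tz u f := T u (fun x => f x + z * u x) in
    [/\ forall f, inL2 f -> exists u, Tz u f,
        forall u v f, Tz u f -> Tz v f -> ae_eqI u v &
        exists C : R, forall u f, Tz u f -> L2norm u <= C * L2norm f]].

Definition spectrum (T : (R -> R[i]) -> (R -> R[i]) -> Prop) : set R[i] :=
  ~` resolvent_set T.

Definition shifted_potential (delta beta : R) V (x : R) : R[i] :=
  if beta < x then V x%:C + delta *i else V x%:C - delta *i.

(* The graph of -h^2 u'' + V_{delta,beta} u with Dirichlet conditions. An element
   of the domain is represented by its C^1 representative [u], so that its
   values at -1 and 1 make sense. *)
Definition schrodinger (delta beta : R) V (h : R) u g : Prop :=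
  [/\ inL2 u, inL2 g, u (-1) = 0, u 1 = 0 &
      exists u' u'',
        [/\ inL2 u'',
            indefinite_integral (-1) 1 u u',
            indefinite_integral (-1) 1 u' u'' &
            ae_eqI g (fun x => - (h ^+ 2)%:C * u'' x
                               + shifted_potential delta beta V x * u x)]].

Definition lim_spectrum (Sp : R -> set R[i]) : set R[i] :=
  [set E0 | exists (h : nat -> R) (E : nat -> R[i]),
    [/\ forall j, 0 < h j, h @ \oo --> (0 : R),
        forall j, Sp (h j) (E j) & E @ \oo --> E0]].

Definition sqrt_branch (a b : R) f (p : R -> R[i]) : Prop :=
  {within `[a, b], continuous p} /\
  (forall x, x \in `[a, b] -> p x ^+ 2 = f x).

Definition Re_int_sqrt_eq0 (a b : R) f : Prop :=
  exists p, sqrt_branch a b f p /\ complex.Re (cint a b p) = 0.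

Definition holomorphic_on D V : Prop :=
  forall z, D z -> derivable V z 1.

Definition turning_points D V (E : R[i]) : set R[i] :=
  [set z | D z /\ V z - E = 0].

(* The primitive of (V - E)^(1/2) is multivalued on D, so the equation
   Re int_x^y (V - E)^(1/2) = 0 is understood along the line itself: [y] is
   reached from [x] by a C^1 curve in D along which the real part of the action,
   computed with a continuous branch of the root, stays equal to 0. Equivalently
   the velocity [c'] is everywhere a real multiple of the Stokes field
   i * conj ((V - E)^(1/2)), up to the zeros of V - E, where the root vanishes. *)
Definition stokes_line D V (E x : R[i]) : set R[i] :=
  [set y | exists c c' p : R -> R[i],
    [/\ c 0 = x /\ c 1 = y,
        forall t, t \in `[0, 1] -> D (c t),
        {within `[0, 1], continuous c'} /\ indefinite_integral 0 1 c c',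
        sqrt_branch 0 1 (fun t => V (c t) - E) p &
        forall s, s \in `[0, 1] -> complex.Re (cint 0 s (fun t => p t * c' t)) = 0]].

Definition same_stokes_region D V (E x y : R[i]) : Prop :=
  exists c : R -> R[i],
    [/\ {within `[0, 1], continuous c}, c 0 = x, c 1 = y &
        forall t, t \in `[0, 1] ->
          D (c t) /\ forall z, turning_points D V E z -> ~ stokes_line D V E z (c t)].

Definition hyp_H1 D V : Prop :=
  forall Omega : set R[i],
    bounded_set (D `&` V @^-1` Omega) -> precompact Omega.

Definition hyp_H3 D V (beta : R) : Prop :=
  exists R0 eps0 : R, [/\ 0 < R0, 0 < eps0 &
    forall E : R[i], R0 <= cabs E -> `|complex.Im E| <= eps0 * cabs E ->
      same_stokes_region D V E (-1) beta%:C /\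
      same_stokes_region D V E 1 beta%:C].

End Defs.

(* Main.v *)
Require Import Defs.
From mathcomp Require Import all_boot all_order all_algebra.
From mathcomp Require Import all_classical all_reals all_analysis.
From mathcomp Require Import measurable_realfun.
From mathcomp Require Import complex.
From mathcomp Require Import ring lra.

(* E is an eigenvalue of the operator iff the Wronskian at beta of the solutions
   u_- and u_+ of -h^2 u'' + (V -+ i delta - E) u = 0 with Dirichlet data at -1 and
   at 1 vanishes, and this Wronskian is an entire function of E.

   When |E_0| is large, U - E with U = V -+ i delta stays close to -E_0 on a fixed
   complex neighbourhood of [-1, 1] for E near E_0. Hence (U - E)^(1/4) has a
   holomorphic branch there, and each arm [-1, beta], [beta, 1] can be deformed into
   a path on which the action int (U - E)^(1/2) is an affine function of the
   parameter. Along this path the Liouville-Green method gives, uniformly for E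
   near E_0,
     u_-+ ~ (h / a) sinh (sigma / h),   u_-+' ~ (p / a) cosh (sigma / h),
   with sigma the action of the arm and p^2 = U(beta) - E, up to a relative error
   O(h).

   If both Re sigma are nonzero at E_0, the Wronskian divided by its exponential
   growth tends to a nonzero multiple of p_+ - p_-, and p_+^2 - p_-^2 = 2 i delta. If
   one or both of them vanish, then in discs of radius O(h) centred at suitable
   points within O(h) of E_0 the Wronskian, divided by its growth, is close to a
   multiple of sinh, so it has a zero there by comparing its modulus at the centre and
   on the circle. *)

Set Implicit Arguments.
Unset Strict Implicit.
Unset Printing Implicit Defensive.

Import Order.TTheory GRing.Theory Num.Theory.
Import numFieldNormedType.Exports.
Local Open Scope classical_set_scope.
Local Open Scope ring_scope.
Local Open Scope complex_scope.

(** * Complex calculus *)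

(** The actions run from the endpoints towards [beta], so the right one has the opposite orientation
    and [s1 - s2] is the action across the whole of [-1, 1]. When both real parts vanish, neither
    arm dominates: the reduced Wronskian p2 sinh T1 cosh T2 - p1 cosh T1 sinh T2 differs from p2
    sinh (T1 - T2) by a multiple of p2 - p1, which does not tend to 0 with h. Only the size of E_0
    makes this term harmless. Hence a bound [k] on the relative distance of both momenta to one
    square root of - E_0 is fixed first, small enough for the square roots, for the deformation of
    the paths and for this comparison, and |E_0| is then taken large in terms of [k]. The asymptotic
    formulas come with bounds on their errors, but only the Wronskian itself is known to be
    holomorphic in E. Zeros are therefore produced by the minimum modulus principle, from an upper
    bound at the centre of a disc and a lower bound on its circle. With E = E_0 + h x the scaled
    actions are affine in x up to O(h), so these discs have a fixed radius in x and their centres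
    stay bounded in x as h tends to 0. *)

Notation cRe z := (@complex.Re (Real.sort _) z).
Notation cIm z := (@complex.Im (Real.sort _) z).

Definition ci {R : realType} : R[i] := 0 +i* 1.

Section Modulus.
Context {R : realType}.
Implicit Types (z w : R[i]) (x y : R).

Global Arguments cabs : simpl never.

Lemma cabs_ge0 z : 0 <= cabs z.
Proof. by case: z => a b; rewrite /cabs /= sqrtr_ge0. Qed.

Lemma cabs0 : cabs (0 : R[i]) = 0.
Proof. exact: ComplexField.Normc.normc0. Qed.

Lemma cabs1 : cabs (1 : R[i]) = 1.
Proof. exact: ComplexField.Normc.normc1. Qed.

Lemma cabs_eq0 z : (cabs z == 0) = (z == 0).
Proof.
apply/eqP/eqP => [/ComplexField.Normc.eq0_normc //|->]; exact: cabs0.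
Qed.

Lemma cabs_gt0 z : (0 < cabs z) = (z != 0).
Proof. by rewrite lt_def cabs_eq0 cabs_ge0 andbT. Qed.

Lemma cabsM z w : cabs (z * w) = cabs z * cabs w.
Proof. exact: ComplexField.Normc.normcM. Qed.

Lemma cabsV z : cabs z^-1 = (cabs z)^-1.
Proof. exact: ComplexField.Normc.normcV. Qed.

Lemma cabsX z n : cabs (z ^+ n) = cabs z ^+ n.
Proof. by elim: n => [|n IH]; rewrite ?expr0 ?cabs1 // !exprS cabsM IH. Qed.

Lemma cabsN z : cabs (- z) = cabs z.
Proof. exact: normcN. Qed.

Lemma cabsD z w : cabs (z + w) <= cabs z + cabs w.
Proof. exact: le_normcD. Qed.

Lemma cabsB z w : cabs (z - w) = cabs (w - z).
Proof. by rewrite -cabsN opprB. Qed.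

Lemma cabs_triangle z w : cabs z <= cabs w + cabs (z - w).
Proof. by rewrite -[X in cabs X <= _](subrKC w) cabsD. Qed.

Lemma cabs_dist z w t : cabs (z - w) <= cabs (z - t) + cabs (t - w).
Proof. by rewrite -[z - w](subrKA t) cabsD. Qed.

Lemma cabs_sub_le z w : cabs (z - w) <= cabs z + cabs w.
Proof. by rewrite (le_trans (cabsD _ _)) // cabsN. Qed.

Lemma cabs_real x : cabs x%:C = `|x|.
Proof. by rewrite /cabs /= expr0n /= addr0 sqrtr_sqr. Qed.

Lemma cabs_nat n : cabs (n%:R : R[i]) = n%:R.
Proof. by rewrite -(rmorph_nat (real_complex R)) cabs_real ger0_norm ?ler0n. Qed.

Lemma complexP z w :
  cRe z = cRe w -> cIm z = cIm w -> z = w.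
Proof. by case: z => a b; case: w => c d /= -> ->. Qed.

Lemma ci2 : ci * ci = -1 :> R[i].
Proof. by apply: complexP; rewrite /= !(mul0r, mulr0, mulr1, add0r, subr0, oppr0). Qed.

Lemma cabs_ci : cabs (ci : R[i]) = 1.
Proof. by rewrite /cabs /ci /= expr0n expr1n /= add0r sqrtr1. Qed.

Lemma cabs_sqr z : cabs z ^+ 2 = cRe z ^+ 2 + cIm z ^+ 2.
Proof. by case: z => a b; rewrite /cabs /= sqr_sqrtr // addr_ge0 // sqr_ge0. Qed.

Lemma Re_le_cabs z : `|cRe z| <= cabs z.
Proof.
rewrite -(ler_pXn2r (n := 2)) ?nnegrE ?cabs_ge0 //.
by rewrite cabs_sqr real_normK ?num_real // lerDl sqr_ge0.
Qed.

Lemma Im_le_cabs z : `|cIm z| <= cabs z.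
Proof.
rewrite -(ler_pXn2r (n := 2)) ?nnegrE ?cabs_ge0 //.
by rewrite cabs_sqr real_normK ?num_real // lerDr sqr_ge0.
Qed.

Lemma cabs_le_ReIm z : cabs z <= `|cRe z| + `|cIm z|.
Proof.
rewrite -(ler_pXn2r (n := 2)) ?nnegrE ?cabs_ge0 ?addr_ge0 //.
rewrite cabs_sqr -[X in X + _]real_normK ?num_real //.
rewrite -[X in _ + X <= _]real_normK ?num_real //.
have := normr_ge0 (cRe z); have := normr_ge0 (cIm z); nra.
Qed.

Lemma cabs_conj z : cabs (conjc z) = cabs z.
Proof. by case: z => a b; rewrite /cabs /= sqrrN. Qed.

Lemma cReM z w :
  cRe (z * w) = cRe z * cRe w - cIm z * cIm w.
Proof. by case: z => a b; case: w. Qed.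

Lemma cImM z w :
  cIm (z * w) = cRe z * cIm w + cIm z * cRe w.
Proof. by case: z => a b; case: w. Qed.

Lemma cReD z w : cRe (z + w) = cRe z + cRe w.
Proof. by case: z => a b; case: w. Qed.

Lemma cImD z w : cIm (z + w) = cIm z + cIm w.
Proof. by case: z => a b; case: w. Qed.

Lemma cReN z : cRe (- z) = - cRe z.
Proof. by case: z. Qed.

Lemma cImN z : cIm (- z) = - cIm z.
Proof. by case: z. Qed.

Lemma complex_ReIm z : z = (cRe z)%:C + ci * (cIm z)%:C.
Proof. exact: complexE. Qed.

Lemma mul_conj z : conjc z * z = (cabs z ^+ 2)%:C.
Proof.
by rewrite cabs_sqr; case: z => a b; apply: complexP => /=; ring.
Qed.

Lemma cabs_small z : (forall e, 0 < e -> cabs z <= e) -> z = 0.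
Proof.
move=> H; apply/eqP; rewrite -cabs_eq0 eq_le cabs_ge0 andbT.
by apply/ler_addgt0Pr => e e0; rewrite add0r H.
Qed.

End Modulus.

(** * Relative derivatives and continuity, with their rules *)

Section Calculus.
Context {R : realType} {T : Type}.
Variable e : T -> R[i].
Implicit Types (A B : set T) (f g : T -> R[i]) (t s : T) (l m : R[i]).

(* Derivatives and continuity relative to a set of parameters [t : T], which are
   seen as complex numbers through [e]; used with [e = id] on complex domains
   and with the inclusion of the reals on real intervals. *)
Definition wd A f t l := forall eps : R, 0 < eps -> exists2 d : R, 0 < d &
  forall s, A s -> cabs (e s - e t) < d ->
    cabs (f s - f t - (e s - e t) * l) <= eps * cabs (e s - e t).

Definition wc A f t := forall eps : R, 0 < eps -> exists2 d : R, 0 < d &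
  forall s, A s -> cabs (e s - e t) < d -> cabs (f s - f t) <= eps.

Lemma wd_sub A B f t l : A `<=` B -> wd B f t l -> wd A f t l.
Proof.
move=> AB H eps e0; have [d d0 Hd] := H _ e0; exists d => // s As.
by apply: Hd; exact: AB.
Qed.

Lemma wc_sub A B f t : A `<=` B -> wc B f t -> wc A f t.
Proof.
move=> AB H eps e0; have [d d0 Hd] := H _ e0; exists d => // s As.
by apply: Hd; exact: AB.
Qed.

Lemma wd_ext A f g t l : A t -> (forall s, A s -> f s = g s) ->
  wd A f t l -> wd A g t l.
Proof.
move=> At fg H eps e0; have [d d0 Hd] := H _ e0; exists d => // s As.
by rewrite -!fg //; apply: Hd.
Qed.

Lemma wc_ext A f g t : A t -> (forall s, A s -> f s = g s) ->
  wc A f t -> wc A g t.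
Proof.
move=> At fg H eps e0; have [d d0 Hd] := H _ e0; exists d => // s As.
by rewrite -!fg //; apply: Hd.
Qed.

Lemma wd_eq A f t l m : wd A f t l -> l = m -> wd A f t m.
Proof. by move=> H <-. Qed.

Lemma wd_lip A f t l : wd A f t l -> exists2 d : R, 0 < d &
  forall s, A s -> cabs (e s - e t) < d ->
    cabs (f s - f t) <= (1 + cabs l) * cabs (e s - e t).
Proof.
move=> H; have [d d0 Hd] := H 1 ltr01; exists d => // s As sd.
have := Hd s As sd; have := cabs_triangle (f s - f t) ((e s - e t) * l).
by rewrite cabsM; lra.
Qed.

Lemma wd_wc A f t l : wd A f t l -> wc A f t.
Proof.
move=> /wd_lip[d d0 H] eps e0.
have l0 : 0 < 1 + cabs l by rewrite ltr_pwDl // cabs_ge0.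
exists (Num.min d (eps / (1 + cabs l))); first by rewrite lt_min d0 divr_gt0.
move=> s As; rewrite lt_min => /andP[sd se]; apply: (le_trans (H s As sd)).
by rewrite mulrC -ler_pdivlMr // ltW.
Qed.

Lemma wd_cst A (c : R[i]) t : wd A (fun=> c) t 0.
Proof.
move=> eps e0; exists 1 => // s _ _.
by rewrite subrr mulr0 subrr cabs0 mulr_ge0 ?cabs_ge0 // ltW.
Qed.

Lemma wc_cst A (c : R[i]) t : wc A (fun=> c) t.
Proof. exact: wd_wc (wd_cst A c t). Qed.

Lemma wd_id A t : wd A e t 1.
Proof.
move=> eps e0; exists 1 => // s _ _.
by rewrite mulr1 subrr cabs0 mulr_ge0 ?cabs_ge0 // ltW.
Qed.

Lemma wc_id A t : wc A e t.
Proof. exact: wd_wc (wd_id A t). Qed.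

Lemma wdD A f g t l m : wd A f t l -> wd A g t m ->
  wd A (fun s => f s + g s) t (l + m).
Proof.
move=> Hf Hg eps e0; have e2 : 0 < eps / 2 by rewrite divr_gt0.
have [d1 d10 H1] := Hf _ e2; have [d2 d20 H2] := Hg _ e2.
exists (Num.min d1 d2); first by rewrite lt_min d10.
move=> s As; rewrite lt_min => /andP[/(H1 s As) h1 /(H2 s As) h2].
rewrite (_ : _ - _ - _ = (f s - f t - (e s - e t) * l)
                       + (g s - g t - (e s - e t) * m)); last by ring.
by apply: (le_trans (cabsD _ _)); lra.
Qed.

Lemma wcD A f g t : wc A f t -> wc A g t -> wc A (fun s => f s + g s) t.
Proof.
move=> Hf Hg eps e0; have e2 : 0 < eps / 2 by rewrite divr_gt0.
have [d1 d10 H1] := Hf _ e2; have [d2 d20 H2] := Hg _ e2.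
exists (Num.min d1 d2); first by rewrite lt_min d10.
move=> s As; rewrite lt_min => /andP[/(H1 s As) h1 /(H2 s As) h2].
rewrite (_ : _ - _ = (f s - f t) + (g s - g t)); last by ring.
by apply: (le_trans (cabsD _ _)); lra.
Qed.

Lemma wd_bounded A f t l : wd A f t l -> exists2 d : R, 0 < d &
  forall s, A s -> cabs (e s - e t) < d -> cabs (f s) <= 1 + cabs (f t).
Proof.
move=> /wd_wc/(_ 1 ltr01)[d d0 H]; exists d => // s As sd.
by rewrite (le_trans (cabs_triangle _ (f t))) // addrC lerD2r H.
Qed.

Lemma wdM A f g t l m : wd A f t l -> wd A g t m ->
  wd A (fun s => f s * g s) t (l * g t + f t * m).
Proof.
move=> Hf Hg eps e0.
(* [K] dominates every factor by which the three error terms below are multiplied. *)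
pose K := 1 + cabs (f t) + cabs (g t) + cabs l.
have Fl := cabs_ge0 (f t); have Gl := cabs_ge0 (g t); have ll := cabs_ge0 l.
have K0 : 0 < K by rewrite /K; lra.
have e2 : 0 < eps / (3 * K) by rewrite divr_gt0 // mulr_gt0.
have [d1 d10 H1] := Hf _ e2; have [d2 d20 H2] := Hg _ e2.
have [d3 d30 H3] := wd_wc Hg e2; have [d4 d40 H4] := wd_bounded Hg.
exists (Num.min (Num.min d1 d4) (Num.min d2 d3)); first by rewrite !lt_min d10 d20 d30 d40.
move=> s As; rewrite !lt_min => /andP[/andP[/(H1 s As) h1 /(H4 s As) h4]].
move=> /andP[/(H2 s As) h2 /(H3 s As) h3].
rewrite (_ : _ - _ - _ = (f s - f t - (e s - e t) * l) * g s
   + f t * (g s - g t - (e s - e t) * m) + (e s - e t) * l * (g s - g t)); last by ring.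
apply: (le_trans (cabsD _ _)); apply: (le_trans (lerD (cabsD _ _) (lexx _))).
rewrite !cabsM.
move: h1 h2 h3; set a := eps / (3 * K) => h1 h2 h3.
have aK : a * K = eps / 3 by rewrite /a; field; rewrite gt_eqF.
have -> : eps = 3 * (a * K) by rewrite aK; field.
set k := cabs (e s - e t) in h1 h2 *; have k0 : 0 <= k by exact: cabs_ge0.
have a0 : 0 <= a by rewrite ltW.
have t1 := ler_pM (cabs_ge0 _) (cabs_ge0 _) h1 h4.
have t2 := ler_pM Fl (cabs_ge0 _) (lexx _) h2.
have t3 := ler_pM (mulr_ge0 k0 ll) (cabs_ge0 _) (lexx _) h3.
have ak : 0 <= a * k by exact: mulr_ge0.
apply: (le_trans (lerD (lerD t1 t2) t3)).
rewrite -subr_ge0 (_ : _ - _ = a * k * (2 + 2 * cabs (f t) + 2 * cabs (g t) + 2 * cabs l)).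
  by rewrite mulr_ge0 //; lra.
by rewrite /K; ring.
Qed.

Lemma wcM A f g t : wc A f t -> wc A g t -> wc A (fun s => f s * g s) t.
Proof.
move=> Hf Hg eps e0.
pose K := 1 + cabs (f t) + cabs (g t).
have Fl := cabs_ge0 (f t); have Gl := cabs_ge0 (g t).
have K0 : 0 < K by rewrite /K; lra.
have e2 : 0 < eps / (2 * K) by rewrite divr_gt0 // mulr_gt0.
have [d1 d10 H1] := Hf _ e2; have [d2 d20 H2] := Hg _ e2.
have [d3 d30 H3] := Hg _ ltr01.
exists (Num.min d1 (Num.min d2 d3)); first by rewrite !lt_min d10 d20 d30.
move=> s As; rewrite !lt_min => /and3P[/(H1 s As) h1 /(H2 s As) h2 /(H3 s As) h3].
rewrite (_ : _ - _ = (f s - f t) * g s + f t * (g s - g t)); last by ring.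
apply: (le_trans (cabsD _ _)); rewrite !cabsM.
move: h1 h2; set a := eps / (2 * K) => h1 h2.
have aK : a * K = eps / 2 by rewrite /a; field; rewrite gt_eqF.
have -> : eps = 2 * (a * K) by rewrite aK; field.
have a0 : 0 <= a by rewrite ltW.
have h4 : cabs (g s) <= 1 + cabs (g t) by have := cabs_triangle (g s) (g t); lra.
have t1 := ler_pM (cabs_ge0 _) (cabs_ge0 _) h1 h4.
have t2 := ler_pM Fl (cabs_ge0 _) (lexx _) h2.
apply: (le_trans (lerD t1 t2)).
rewrite -subr_ge0 (_ : _ - _ = a * (1 + cabs (f t) + cabs (g t))).
  by rewrite mulr_ge0 //; lra.
by rewrite /K; ring.
Qed.

Lemma wdZ A (c : R[i]) f t l : wd A f t l -> wd A (fun s => c * f s) t (c * l).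
Proof.
by move=> H; apply: (wd_eq (wdM (wd_cst A c t) H)); rewrite mul0r add0r.
Qed.

Lemma wcZ A (c : R[i]) f t : wc A f t -> wc A (fun s => c * f s) t.
Proof. by move=> H; exact: (wcM (wc_cst A c t) H). Qed.

Lemma wdN A f t l : wd A f t l -> wd A (fun s => - f s) t (- l).
Proof.
move=> H eps e0; have [d d0 Hd] := H _ e0; exists d => // s As sd.
rewrite (_ : _ - _ - _ = - (f s - f t - (e s - e t) * l)); last by ring.
by rewrite cabsN Hd.
Qed.

Lemma wcN A f t : wc A f t -> wc A (fun s => - f s) t.
Proof.
move=> H eps e0; have [d d0 Hd] := H _ e0; exists d => // s As sd.
by rewrite -opprD cabsN Hd.
Qed.

Lemma wdB A f g t l m : wd A f t l -> wd A g t m ->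
  wd A (fun s => f s - g s) t (l - m).
Proof. by move=> Hf Hg; apply: wdD => //; apply: wdN. Qed.

Lemma wcB A f g t : wc A f t -> wc A g t -> wc A (fun s => f s - g s) t.
Proof. by move=> Hf Hg; apply: wcD => //; apply: wcN. Qed.

Lemma wc_away A f t : wc A f t -> f t != 0 -> exists2 d : R, 0 < d &
  forall s, A s -> cabs (e s - e t) < d -> cabs (f t) / 2 <= cabs (f s).
Proof.
move=> H; rewrite -cabs_gt0 => ft0.
have [|d d0 Hd] := H (cabs (f t) / 2); first by rewrite divr_gt0.
exists d => // s As sd; have := Hd s As sd.
by have := cabs_triangle (f t) (f s); rewrite (cabsB (f t)); lra.
Qed.

Lemma wdV A f t l : wd A f t l -> f t != 0 ->
  wd A (fun s => (f s)^-1) t (- l / f t ^+ 2).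
Proof.
move=> Hf ft0 eps e0; have [d1 d10 H1] := wc_away (wd_wc Hf) ft0.
set F := cabs (f t) in H1; have F0 : 0 < F by rewrite cabs_gt0.
have l0 := cabs_ge0 l.
have K0 : 0 < 1 + cabs l by lra.
have e2 : 0 < eps * F ^+ 2 / (4 * (1 + cabs l)).
  by rewrite divr_gt0 ?mulr_gt0 ?exprn_gt0.
have e3 : 0 < eps * F ^+ 3 / (4 * (1 + cabs l)).
  by rewrite divr_gt0 ?mulr_gt0 ?exprn_gt0.
have [d2 d20 H2] := Hf _ e2; have [d3 d30 H3] := wd_wc Hf e3.
exists (Num.min d1 (Num.min d2 d3)); first by rewrite !lt_min d10 d20 d30.
move=> s As; rewrite !lt_min => /and3P[/(H1 s As) h1 /(H2 s As) h2 /(H3 s As) h3].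
have fs0 : f s != 0 by rewrite -cabs_gt0 (lt_le_trans _ h1) // divr_gt0.
rewrite (_ : _ - _ - _ = - (f s - f t - (e s - e t) * l) / (f s * f t)
   + (e s - e t) * l * (f s - f t) / (f s * f t ^+ 2)); last first.
  by field; rewrite fs0 ft0.
have fF : 0 < F / 2 by rewrite divr_gt0.
have G0 : 0 < cabs (f s) by exact: lt_le_trans h1.
set G := cabs (f s) in h1 G0.
apply: (le_trans (cabsD _ _)); rewrite !(cabsM, cabsV, cabsN, cabsX) -/F -/G.
set k := cabs (e s - e t) in h2 *; have k0 : 0 <= k by exact: cabs_ge0.
set L := 1 + cabs l in K0 h2 h3.
have b1 : (G * F)^-1 <= 2 / F ^+ 2.
  rewrite -[X in _ <= X]invf_div lef_pV2 ?posrE ?divr_gt0 ?mulr_gt0 ?exprn_gt0 //.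
  by rewrite expr2; nra.
have b2 : (G * F ^+ 2)^-1 <= 2 / F ^+ 3.
  rewrite -[X in _ <= X]invf_div lef_pV2 ?posrE ?divr_gt0 ?mulr_gt0 ?exprn_gt0 //.
  rewrite exprSr; have : 0 < F ^+ 2 by rewrite exprn_gt0.
  by nra.
have i1 : 0 <= (G * F)^-1 by rewrite invr_ge0 mulr_ge0 // ltW.
have i2 : 0 <= (G * F ^+ 2)^-1 by rewrite invr_ge0 mulr_ge0 ?exprn_ge0 // ltW.
have t1 := ler_pM (cabs_ge0 _) i1 h2 b1.
have t2 := ler_pM (mulr_ge0 (mulr_ge0 k0 l0) (cabs_ge0 _)) i2
             (ler_wpM2l (mulr_ge0 k0 l0) h3) b2.
apply: (le_trans (lerD t1 t2)).
rewrite -subr_ge0 (_ : _ - _ = eps * k * (1 - (1 + cabs l) / (2 * L))); last first.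
  by field; rewrite !gt_eqF.
apply: mulr_ge0; first by rewrite mulr_ge0 // ltW.
by rewrite subr_ge0 ler_pdivrMr ?mulr_gt0 // /L; lra.
Qed.

Lemma wcV A f t : wc A f t -> f t != 0 -> wc A (fun s => (f s)^-1) t.
Proof.
move=> Hf ft0 eps e0; have [d1 d10 H1] := wc_away Hf ft0.
set F := cabs (f t) in H1; have F0 : 0 < F by rewrite cabs_gt0.
have e2 : 0 < eps * F ^+ 2 / 2 by rewrite divr_gt0 ?mulr_gt0 ?exprn_gt0.
have [d2 d20 H2] := Hf _ e2.
exists (Num.min d1 d2); first by rewrite !lt_min d10 d20.
move=> s As; rewrite !lt_min => /andP[/(H1 s As) h1 /(H2 s As) h2].
have G0 : 0 < cabs (f s) by rewrite (lt_le_trans _ h1) // divr_gt0.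
have fs0 : f s != 0 by rewrite -cabs_gt0.
rewrite (_ : _ - _ = - (f s - f t) / (f s * f t)); last by field; rewrite fs0 ft0.
rewrite cabsM cabsV cabsM cabsN -/F ler_pdivrMr ?mulr_gt0 //.
apply: (le_trans h2); rewrite expr2 -mulrA; apply: ler_wpM2l; first exact: ltW.
by have := ler_wpM2r (ltW F0) h1; lra.
Qed.

End Calculus.


Section Composition.
Context {R : realType} {T S : Type}.
Variables (e : T -> R[i]) (k : S -> R[i]).

(* [phi] is [f] read through the embedding [k]: this covers curves
   [T -> R[i]] ([k = id]) and real changes of variables. *)
Lemma wd_comp (A : set T) (B : set S) (f : T -> S) (g : S -> R[i]) t l m :
  (forall s, A s -> B (f s)) ->
  wd e A (fun s => k (f s)) t l -> wd k B g (f t) m ->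
  wd e A (fun s => g (f s)) t (m * l).
Proof.
move=> AB Hf Hg eps e0.
have l0 := cabs_ge0 l; have m0 := cabs_ge0 m.
have [d1 d10 H1] := wd_lip Hf.
have e2 : 0 < eps / (2 * (1 + cabs m)) by rewrite divr_gt0 // mulr_gt0; lra.
have [d2 d20 H2] := Hf _ e2.
have e3 : 0 < eps / (2 * (1 + cabs l)) by rewrite divr_gt0 // mulr_gt0; lra.
have [d3 d30 H3] := Hg _ e3.
have d40 : 0 < d3 / (1 + cabs l) by rewrite divr_gt0; lra.
exists (Num.min (Num.min d1 d2) (d3 / (1 + cabs l))); first by rewrite !lt_min d10 d20.
move=> s As; rewrite !lt_min => /andP[/andP[/(H1 s As) h1 /(H2 s As) h2] h4].
have h5 : cabs (k (f s) - k (f t)) < d3.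
  by rewrite (le_lt_trans h1) // mulrC -ltr_pdivlMr //; lra.
have h3 := H3 _ (AB _ As) h5.
rewrite (_ : _ - _ - _ = (g (f s) - g (f t) - (k (f s) - k (f t)) * m)
   + (k (f s) - k (f t) - (e s - e t) * l) * m); last by ring.
apply: (le_trans (cabsD _ _)); rewrite cabsM.
set K := cabs (e s - e t) in h1 h2 *; have k0 : 0 <= K by exact: cabs_ge0.
apply: (@le_trans _ _ (eps / (2 * (1 + cabs l)) * ((1 + cabs l) * K)
   + eps / (2 * (1 + cabs m)) * K * cabs m)).
  apply: lerD; first by rewrite (le_trans h3) // ler_wpM2l // ltW.
  by rewrite ler_wpM2r.
rewrite -subr_ge0 (_ : _ - _ = eps * K / (2 * (1 + cabs m))); last first.
  by field; rewrite !gt_eqF //; lra.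
by apply: divr_ge0; [apply: mulr_ge0 => //; exact: ltW | lra].
Qed.

Lemma wc_comp (A : set T) (B : set S) (f : T -> S) (g : S -> R[i]) t :
  (forall s, A s -> B (f s)) ->
  wc e A (fun s => k (f s)) t -> wc k B g (f t) -> wc e A (fun s => g (f s)) t.
Proof.
move=> AB Hf Hg eps e0; have [d1 d10 H1] := Hg _ e0.
have d2 : 0 < d1 / 2 by rewrite divr_gt0.
have [d d0 H] := Hf _ d2; exists d => // s As sd; apply: H1; first exact: AB.
by apply: (le_lt_trans (H s As sd)); rewrite ltr_pdivrMr //; lra.
Qed.

End Composition.

(** * Mean value inequality and primitives on a real interval *)

Section RealVariable.
Context {R : realType}.
Implicit Types (a b x y t : R) (F f : R -> R[i]) (phi d g dg : R -> R).

Definition seg a b : set R := [set x | a <= x <= b].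

Definition rwd := @wd R R (real_complex R).
Definition rwc := @wc R R (real_complex R).

Lemma cabs_rdist x y : cabs (x%:C - y%:C) = `|x - y|.
Proof. by rewrite -rmorphB cabs_real. Qed.

(** Increments of the parameter are real, so taking real parts commutes with multiplying the
    derivative by them. *)
Lemma wd_Re (T : Type) (e : T -> R[i]) (A : set T) (F : T -> R[i]) (t : T) l :
  (forall s, cIm (e s) = 0) ->
  wd e A F t l -> wd e A (fun s => (cRe (F s))%:C) t (cRe l)%:C.
Proof.
move=> eR H eps e0; have [dd d0 Hd] := H _ e0; exists dd => // s As sd.
apply: (le_trans _ (Hd s As sd)); apply: (le_trans _ (Re_le_cabs _)).
rewrite (_ : _ - _ - _ = (cRe (F s - F t - (e s - e t) * l))%:C); first by rewrite cabs_real.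
by apply: complexP; rewrite /= !(cReD, cReN, cImD, cImN) !(cReM, cImM) !(cReD, cReN, cImD, cImN) !eR /=; ring.
Qed.

(** With a slack slope [eta' > 0], the set of points where [phi] has grown by at most [eta'] times
    the distance to [a] contains its supremum [c]; if [c < b], the derivative at [c], being at most
    0, lets the set extend past [c]. Derivatives relative to [seg a b] are enough for this, so the
    endpoints need no separate treatment. *)
Lemma mono a b phi d : a <= b ->
  (forall x, a <= x <= b -> rwd (seg a b) (fun t => (phi t)%:C) x (d x)%:C) ->
  (forall x, a <= x <= b -> d x <= 0) -> phi b <= phi a.
Proof.
move=> ab Hd dle; apply/ler_addgt0Pr => eta eta0.
pose eta' := eta / (b - a + 1).
have ba1 : 0 < b - a + 1 by lra.
have eta'0 : 0 < eta' by rewrite divr_gt0.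
pose S : set R := [set x | a <= x <= b /\ phi x <= phi a + eta' * (x - a)].
have Sa : S a by rewrite /S /= lexx ab subrr mulr0 addr0.
have supS : has_sup S.
  by split; [exists a | exists b => x [/andP[]]].
pose c := sup S.
have ac : a <= c by exact: (ub_le_sup supS.2 Sa).
have cb : c <= b by apply: (ge_sup supS.1) => x [/andP[]].
have cab : a <= c <= b by rewrite ac.
have [dl dl0 Hc] := Hd c cab eta' eta'0.
have Hc' x : a <= x <= b -> `|x - c| < dl ->
    `|phi x - phi c - (x - c) * d c| <= eta' * `|x - c|.
  move=> xab xc; rewrite -[`|x - c|]cabs_rdist -cabs_real !rmorphB rmorphM.
  by rewrite !rmorphB; apply: Hc => //; rewrite cabs_rdist.
have Sc : S c.
  split => //; have [x [xab Hx] xc] := sup_adherent dl0 supS.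
  have xlec : x <= c by exact: (ub_le_sup supS.2).
  have xc0 : `|x - c| = c - x by rewrite ler0_norm ?subr_le0 // opprB.
  have := Hc' x xab; rewrite xc0 => h.
  have {h}: `|phi x - phi c - (x - c) * d c| <= eta' * (c - x).
    by apply: h; rewrite -/c in xc; lra.
  rewrite ler_norml => /andP[h1 h2].
  have := dle _ cab => dc; nra.
suff cb' : c = b by have := Sc.2; rewrite cb' /eta'; 
  have : eta / (b - a + 1) * (b - a) <= eta; [rewrite mulrAC ler_pdivrMr //; nra|lra].
apply/eqP; rewrite eq_le cb /= leNgt; apply/negP => cltb.
pose x := Num.min b (c + dl / 2).
have cx : c < x by rewrite lt_min cltb ltrDl divr_gt0.
have xb : x <= b by rewrite ge_min lexx.
have xd : x <= c + dl / 2 by rewrite ge_min lexx orbT.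
have : x <= c.
  apply: (ub_le_sup supS.2); split; first by rewrite xb andbT; lra.
  have xc0 : `|x - c| = x - c by rewrite ger0_norm // subr_ge0 ltW.
  have := Hc' x; rewrite xc0 xb andbT => h.
  have {h}: `|phi x - phi c - (x - c) * d c| <= eta' * (x - c).
    by apply: h; lra.
  rewrite ler_norml => /andP[h1 h2].
  have := dle _ cab => dc; have := Sc.2; nra.
by rewrite leNgt cx.
Qed.

(** A complex number [c] of modulus at most 1 rotates the increment of [F] onto the positive real
    axis; the real function Re (c F) - g is then nonincreasing by [mono]. *)
Lemma mean_value_ineq a b F dF g dg : a <= b ->
  (forall x, a <= x <= b -> rwd (seg a b) F x (dF x)) ->
  (forall x, a <= x <= b -> rwd (seg a b) (fun t => (g t)%:C) x (dg x)%:C) ->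
  (forall x, a <= x <= b -> cabs (dF x) <= dg x) ->
  cabs (F b - F a) <= g b - g a.
Proof.
move=> ab HF Hg le; set D := F b - F a.
have [c c1 cD] : exists2 c : R[i], cabs c <= 1 & cRe (c * D) = cabs D.
  have [->|D0] := eqVneq D 0; first by exists 0; rewrite ?mul0r ?cabs0.
  exists (conjc D / (cabs D)%:C).
    rewrite cabsM cabs_conj cabsV cabs_real ger0_norm ?cabs_ge0 // divff //.
    by rewrite cabs_eq0.
  rewrite mulrAC mul_conj -rmorphV ?unitfE ?cabs_eq0 // -rmorphM /=.
  by rewrite expr2 mulfK // cabs_eq0.
suff : cRe (c * F b) - g b <= cRe (c * F a) - g a.
  by move=> H; rewrite -cD /D mulrBr cReD cReN; lra.
apply: (@mono a b (fun t => cRe (c * F t) - g t) (fun t => cRe (c * dF t) - dg t)) => //.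
- move=> x xab; rewrite rmorphB /=.
  apply: (@wd_ext _ _ _ _ (fun t => (cRe (c * F t))%:C - (g t)%:C)) => //.
    by move=> s _; rewrite rmorphB.
  by apply: wdB; [apply: wd_Re => //; apply: wdZ; exact: HF | exact: Hg].
- move=> x xab; rewrite subr_le0; apply: (le_trans _ (le _ xab)).
  apply: (le_trans (ler_norm _)); apply: (le_trans (Re_le_cabs _)).
  by rewrite cabsM ler_piMl ?cabs_ge0.
Qed.

Lemma rwd_id A x : rwd A (fun t => t%:C) x 1.
Proof. exact: wd_id. Qed.

Lemma mean_value_bound a b F dF M : a <= b ->
  (forall x, a <= x <= b -> rwd (seg a b) F x (dF x)) ->
  (forall x, a <= x <= b -> cabs (dF x) <= M) ->
  cabs (F b - F a) <= M * (b - a).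
Proof.
move=> ab HF le; rewrite mulrBr.
apply: (@mean_value_ineq a b F dF (fun t => M * t) (fun=> M)) => // x xab.
rewrite -[M%:C]mulr1; apply: (@wd_ext _ _ _ _ (fun t => M%:C * t%:C)) => //.
  by move=> s _; rewrite rmorphM.
by apply: wdZ; exact: rwd_id.
Qed.

Lemma zero_deriv_eq a b F : a <= b ->
  (forall x, a <= x <= b -> rwd (seg a b) F x 0) -> F b = F a.
Proof.
move=> ab H; apply/eqP; rewrite -subr_eq0 -cabs_eq0 eq_le cabs_ge0 andbT.
have := @mean_value_bound a b F (fun=> 0) 0 ab H; rewrite mul0r; apply => *.
by rewrite cabs0.
Qed.

Lemma same_deriv_eq a b F G f : a <= b ->
  (forall x, a <= x <= b -> rwd (seg a b) F x (f x)) ->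
  (forall x, a <= x <= b -> rwd (seg a b) G x (f x)) ->
  F b - F a = G b - G a.
Proof.
move=> ab HF HG; have H : F b - G b = F a - G a.
  apply: (@zero_deriv_eq a b (fun t => F t - G t)) => // x xab.
  by apply: (wd_eq (wdB (HF x xab) (HG x xab))); rewrite subrr.
have /eqP := H; rewrite subr_eq => /eqP ->; ring.
Qed.

Lemma is_derive_rwd (f : R -> R) x l : is_derive x 1 f l ->
  rwd setT (fun t => (f t)%:C) x l%:C.
Proof.
move=> [dfx fl] eps e0.
have /cvgrPdist_le /(_ _ e0) [dl dl0 H] : h^-1 *: (f (h *: 1 + x) - f x) @[h --> 0^'] --> l.
  by rewrite -fl; exact: dfx.
exists dl => // y _; rewrite cabs_rdist => yd.
rewrite -!rmorphB -rmorphM -rmorphB !cabs_real.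
have [->|yx] := eqVneq y x; first by rewrite !subrr mul0r subrr normr0 mulr0.
have yx0 : y - x != 0 by rewrite subr_eq0.
have := H (y - x); rewrite /= sub0r normrN => /(_ yd yx0).
rewrite [_ *: 1]mulr1 subrK distrC => h.
rewrite -ler_pdivrMr ?normr_gt0 // -normf_div.
by apply: le_trans h; rewrite le_eqVlt; apply/orP; left; apply/eqP; congr `|_|;
   rewrite [_ *: _]mulrC; field.
Qed.

Lemma rwc_continuous (phi : R -> R) x :
  rwc setT (fun t => (phi t)%:C) x -> {for x, continuous phi}.
Proof.
move=> H; apply/cvgrPdist_le => e e0; have [dl dl0 Hd] := H e e0.
near=> y; rewrite distrC -cabs_rdist; apply: Hd => //; rewrite cabs_rdist distrC.
near: y; apply/nbhs_ballP; exists dl.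
Unshelve. all: by end_near. Qed.

Lemma rwc_within a b (phi : R -> R) :
  (forall x, a <= x <= b -> rwc (seg a b) (fun t => (phi t)%:C) x) ->
  {within `[a, b], continuous phi}.
Proof.
move=> H; apply/subspace_continuousP => x /=; rewrite in_itv /= => xab.
apply/cvgrPdist_le => e e0; have [dl dl0 Hd] := H x xab e e0.
near=> y; rewrite distrC -cabs_rdist; apply: Hd; first (change (a <= y <= b)).
  have : `[a, b]%classic y by near: y; exact: withinT.
  by rewrite /= in_itv.
rewrite cabs_rdist distrC; near: y; apply: cvg_within.
by apply/nbhs_ballP; exists dl.
Unshelve. all: by end_near. Qed.

Lemma seg_max a b F : a <= b ->
  (forall x, a <= x <= b -> rwc (seg a b) F x) ->
  exists2 c, a <= c <= b & forall x, a <= x <= b -> cabs (F x) <= cabs (F c).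
Proof.
move=> ab H; have := @EVT_max R (fun t => cabs (F t)) a b ab.
have cF : {within `[a, b], continuous (fun t => cabs (F t))}.
  apply: rwc_within => x xab e e0; have [d d0 Hd] := H x xab e e0.
  exists d => // s As sd; rewrite cabs_rdist.
  apply: (le_trans _ (Hd s As sd)); rewrite ler_norml.
  have := cabs_triangle (F s) (F x); have := cabs_triangle (F x) (F s).
  by rewrite (cabsB (F x)); lra.
move=> /(_ cF)[c cab Hc]; exists c; first by rewrite in_itv /= in cab.
by move=> x xab; apply: Hc; rewrite in_itv.
Qed.

Lemma seg_bounded a b F : a <= b ->
  (forall x, a <= x <= b -> rwc (seg a b) F x) ->
  exists2 M, 0 < M & forall x, a <= x <= b -> cabs (F x) <= M.
Proof.
move=> ab /(seg_max ab)[c cab H]; exists (1 + cabs (F c)).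
  by have := cabs_ge0 (F c); lra.
by move=> x xab; have := H x xab; lra.
Qed.

Lemma clamp_dist a b (s x : R) : a <= b ->
  `|Num.max a (Num.min s b) - Num.max a (Num.min x b)| <= `|s - x|.
Proof.
wlog sx : s x / s <= x.
  by move=> W; have [h|/ltW h] := leP s x; [exact: W|rewrite (distrC (Num.max _ _)) (distrC s); exact: W].
move=> ab; rewrite (distrC s) (ger0_norm (_ : 0 <= x - s)) ?subr_ge0 // ler_norml.
rewrite !maxEle !minEle.
by case: (lerP s b) => h1; case: (lerP x b) => h2; case: (lerP a s) => h3;
  case: (lerP a x) => h4; rewrite ?ab /=; lra.
Qed.

(** Composing with the projection onto [[a, b]] extends [F] to a function continuous on the whole
    line, to which the fundamental theorem of calculus applies even at [a] and [b]. *)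
Lemma rwc_clamp a b F : a <= b ->
  (forall x, a <= x <= b -> rwc (seg a b) F x) ->
  forall x, rwc setT (fun t => F (Num.max a (Num.min t b))) x.
Proof.
move=> ab H x e e0.
have cl t : a <= Num.max a (Num.min t b) <= b.
  by rewrite le_max lexx ge_max ab ge_min lexx orbT.
have [d d0 Hd] := H _ (cl x) e e0; exists d => // s _; rewrite cabs_rdist => sd.
apply: Hd; first exact: cl.
rewrite cabs_rdist; apply: le_lt_trans sd; exact: clamp_dist.
Qed.

Lemma rwc_Re A F x : rwc A F x -> rwc A (fun t => (cRe (F t))%:C) x.
Proof.
move=> H e e0; have [d d0 Hd] := H e e0; exists d => // s As sd.
apply: (le_trans _ (Hd s As sd)); rewrite -rmorphB cabs_real.
by rewrite -cReN -cReD; exact: Re_le_cabs.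
Qed.

Lemma rwc_Im A F x : rwc A F x -> rwc A (fun t => (cIm (F t))%:C) x.
Proof.
move=> H e e0; have [d d0 Hd] := H e e0; exists d => // s As sd.
apply: (le_trans _ (Hd s As sd)); rewrite -rmorphB cabs_real.
by rewrite -cImN -cImD; exact: Im_le_cabs.
Qed.

(** Integration starts at [a - 1] so that each point of [[a, b]], including [a], lies strictly to
    the right of the origin of the integral. *)
Lemma real_primitive a b (phi : R -> R) :
  (forall x, rwc setT (fun t => (phi t)%:C) x) ->
  let Phi y := (\int[@lebesgue_measure R]_(t in `[(a - 1)%R, y]) phi t)%R in
  forall x, a <= x <= b -> rwd setT (fun t => (Phi t)%:C) x (phi x)%:C.
Proof.
move=> H Phi; have cphi : continuous phi by move=> x; exact: rwc_continuous.
move=> x /andP[ax xb]; apply: is_derive_rwd.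
have [] := @continuous_FTC1_closed R phi (a - 1) x (x + 1).
- by rewrite ltrDl.
- apply: continuous_compact_integrable; first exact: segment_compact.
  exact: continuous_subspaceT.
- by lra.
- exact: cphi.
by move=> Dx E; apply: DeriveDef; [exact: Dx|rewrite -derive1E; exact: E].
Qed.

Lemma primitive_exists a b f : a <= b ->
  (forall x, a <= x <= b -> rwc (seg a b) f x) ->
  exists F : R -> R[i], forall x, a <= x <= b -> rwd (seg a b) F x (f x).
Proof.
move=> ab /(rwc_clamp ab) H.
have [P1 H1] := ex_intro (fun P : R -> R => forall x, a <= x <= b ->
  rwd setT (fun t => (P t)%:C) x _) _ (@real_primitive a b _ (fun x => rwc_Re (H x))).
have [P2 H2] := ex_intro (fun P : R -> R => forall x, a <= x <= b ->
  rwd setT (fun t => (P t)%:C) x _) _ (@real_primitive a b _ (fun x => rwc_Im (H x))).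
exists (fun t => (P1 t)%:C + ci * (P2 t)%:C) => x xab.
have cx : Num.max a (Num.min x b) = x.
  by case/andP: xab => ax xb; rewrite min_l // max_r.
rewrite [f x]complex_ReIm; apply: wdD.
  by have := H1 x xab; rewrite cx; exact: wd_sub.
by apply: wdZ; have := H2 x xab; rewrite cx; exact: wd_sub.
Qed.

(* The oriented integral, also for [b < a]; a junk value if [f] has no primitive. *)
Definition intg f a b : R[i] :=
  let P := get [set F : R -> R[i] | forall x, Num.min a b <= x <= Num.max a b ->
                rwd (seg (Num.min a b) (Num.max a b)) F x (f x)] in
  P b - P a.

(** All primitives of [f] between [a] and [b] have the same increment, so the one picked by [get]
    can be traded for any primitive on a larger interval. One primitive on [[A, B]] then serves
    several integrals, whatever the order of their bounds. *)
Lemma intgE f a b A B F : A <= a <= B -> A <= b <= B ->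
  (forall x, A <= x <= B -> rwd (seg A B) F x (f x)) ->
  intg f a b = F b - F a.
Proof.
move=> aAB bAB HF; rewrite /intg; set S := [set _ | _].
have sub : seg (Num.min a b) (Num.max a b) `<=` seg A B.
  move=> x /andP[]; rewrite ge_min le_max => h1 h2; apply/andP; split.
    by case/orP: h1; lra.
  by case/orP: h2; lra.
have SG : S (get S).
  apply: getPex; exists F => x xab; apply: (wd_sub sub); apply: HF; exact: sub.
have SF : S F by move=> x xab; apply: (wd_sub sub); apply: HF; exact: sub.
move: SG SF; rewrite /S /=; have [ab|ab] := leP a b.
  by move=> h1 h2; apply: (same_deriv_eq ab h1 h2).
move=> h1 h2; apply/eqP; rewrite -eqr_opp !opprB; apply/eqP.
by apply: (same_deriv_eq (ltW ab) h1 h2).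
Qed.

End RealVariable.

Section Integral.
Context {R : realType}.
Implicit Types (a b c x y M : R) (f g : R -> R[i]).

Definition rcont a b f := forall x, a <= x <= b -> rwc (seg a b) f x.

Lemma rcont_sub a b c x f : a <= c -> x <= b -> rcont a b f -> rcont c x f.
Proof.
move=> ac xb H y /andP[cy yx].
apply: (@wc_sub _ _ _ _ (seg a b)); last by apply: H; lra.
by move=> s /andP[h1 h2]; apply/andP; split; lra.
Qed.

Lemma intg_add A B f a b c : rcont A B f ->
  A <= a <= B -> A <= b <= B -> A <= c <= B ->
  intg f a b + intg f b c = intg f a c.
Proof.
move=> fc ha hb hc.
have AB : A <= B by lra.
have [F HF] := primitive_exists AB fc.
by rewrite !(intgE _ _ HF) //; ring.
Qed.

Lemma intg_sym A B f a b : rcont A B f -> A <= a <= B -> A <= b <= B ->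
  intg f a b = - intg f b a.
Proof.
move=> fc ha hb.
have AB : A <= B by lra.
have [F HF] := primitive_exists AB fc.
by rewrite !(intgE _ _ HF) //; ring.
Qed.

Lemma intgD A B f g a b : rcont A B f -> rcont A B g ->
  A <= a <= B -> A <= b <= B ->
  intg (fun t => f t + g t) a b = intg f a b + intg g a b.
Proof.
move=> fc gc ha hb.
have AB : A <= B by lra.
have [F HF] := primitive_exists AB fc.
have [G HG] := primitive_exists AB gc.
rewrite (intgE _ _ HF) // (intgE _ _ HG) //.
rewrite (@intgE _ _ _ _ A B (fun t => F t + G t)) //; first by ring.
by move=> x xAB; apply: wdD; [exact: HF | exact: HG].
Qed.

Lemma intgZ A B f k a b : rcont A B f -> A <= a <= B -> A <= b <= B ->
  intg (fun t => k * f t) a b = k * intg f a b.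
Proof.
move=> fc ha hb.
have AB : A <= B by lra.
have [F HF] := primitive_exists AB fc.
rewrite (intgE _ _ HF) // (@intgE _ _ _ _ A B (fun t => k * F t)) //; first by ring.
by move=> x xAB; apply: wdZ; exact: HF.
Qed.

Lemma intg_cst k a b : intg (fun=> k) a b = k * (b - a)%:C.
Proof.
rewrite (@intgE _ _ _ _ (Num.min a b) (Num.max a b) (fun t => k * t%:C)).
- by rewrite rmorphB; ring.
- by rewrite ge_min le_max lexx.
- by rewrite ge_min le_max lexx !orbT.
by move=> x _; rewrite -[X in rwd _ _ _ X]mulr1; apply: wdZ; exact: rwd_id.
Qed.

Lemma intg_bound A B f a b M : rcont A B f -> A <= a <= B -> A <= b <= B ->
  (forall x, Num.min a b <= x <= Num.max a b -> cabs (f x) <= M) ->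
  cabs (intg f a b) <= M * `|b - a|.
Proof.
move=> fc ha hb H.
have AB : A <= B by lra.
have [F HF] := primitive_exists AB fc.
rewrite (intgE _ _ HF) //.
have HF' x y z : A <= x -> y <= B -> x <= z <= y -> rwd (seg x y) F z (f z).
  move=> Ax yB /andP[xz zy]; apply: (@wd_sub _ _ _ _ (seg A B)).
    by move=> s /andP[h1 h2]; apply/andP; split; lra.
  by apply: HF; lra.
have [ab|ab] := leP a b.
  rewrite ger0_norm ?subr_ge0 //.
  apply: (@mean_value_bound _ a b F f) => // x xab; first by apply: HF'; lra.
  by apply: H; rewrite min_l // max_r.
rewrite ltr0_norm ?subr_lt0 // opprB cabsB.
apply: (@mean_value_bound _ b a F f) => [||x xab]; first exact: ltW.
  by move=> x xab; apply: HF'; lra.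
by apply: H; rewrite (min_r (ltW ab)) (max_l (ltW ab)).
Qed.

End Integral.

(** * Bisection of rectangles *)

Section Bisection.
Context {R : realType}.
Implicit Types (a b c d x y : R).

Lemma half_pow_small (C eps : R) : 0 < eps -> exists n, C / 2 ^+ n < eps.
Proof.
move=> e0; have [C0|C0] := leP C 0.
  by exists 0%N; rewrite expr0 divr1; lra.
exists (Num.bound (C / eps)); rewrite ltr_pdivrMr ?exprn_gt0 //.
rewrite mulrC -ltr_pdivrMr //.
have h : C / eps < (Num.bound (C / eps))%:R by apply: archi_boundP; rewrite divr_ge0 // ltW.
by apply: (lt_trans h); rewrite -natrX ltr_nat ltn_expl.
Qed.

Let rect := (R * R * R * R)%type.

(** If [P] failed on the whole rectangle, it would fail on one of its quarters, and so on; these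
    nested rectangles shrink to a point, near which the local hypothesis gives [P]. *)
Lemma rect_bisection (P : R -> R -> R -> R -> Prop) a0 b0 c0 d0 :
  a0 <= b0 -> c0 <= d0 ->
  (forall a b c d, a0 <= a -> a <= b -> b <= b0 -> c0 <= c -> c <= d -> d <= d0 ->
     let m := (a + b) / 2 in let n := (c + d) / 2 in
     P a m c n -> P m b c n -> P a m n d -> P m b n d -> P a b c d) ->
  (forall x y, a0 <= x <= b0 -> c0 <= y <= d0 -> exists2 dl, 0 < dl &
     forall a b c d, a0 <= a -> a <= x <= b -> b <= b0 ->
       c0 <= c -> c <= y <= d -> d <= d0 -> b - a < dl -> d - c < dl ->
       P a b c d) ->
  P a0 b0 c0 d0.
Proof.
move=> ab0 cd0 Hsplit Hloc; apply: contrapT => nP.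
pose Q (s : rect) := let: (a, b, c, d) := s in
  [/\ a0 <= a, a <= b & b <= b0] /\ [/\ c0 <= c, c <= d & d <= d0] /\ ~ P a b c d.
pose sub (s s' : rect) := let: (a, b, c, d) := s in let: (a', b', c', d') := s' in
  [/\ a <= a', b' <= b & b' - a' = (b - a) / 2] /\
  [/\ c <= c', d' <= d & d' - c' = (d - c) / 2].
have step : forall s, exists s', Q s -> Q s' /\ sub s s'.
  move=> [[[a b] c] d]; have [Qs|nQ] := pselect (Q (a, b, c, d)); last by exists (a,b,c,d).
  have [[h1 h2 h3] [[h4 h5 h6] nPs]] := Qs.
  pose m := (a + b) / 2; pose n := (c + d) / 2.
  have [am mb m1 m2] : [/\ a <= m, m <= b, m - a = (b - a) / 2 & b - m = (b - a) / 2].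
    by rewrite /m; split; lra.
  have [cn nd n1 n2] : [/\ c <= n, n <= d, n - c = (d - c) / 2 & d - n = (d - c) / 2].
    by rewrite /n; split; lra.
  have m3 := le_trans h1 am; have m4 := le_trans mb h3.
  have n3 := le_trans h4 cn; have n4 := le_trans nd h6.
  have [p1|p1] := pselect (P a m c n); last first.
    by exists (a, m, c, n) => _; rewrite /Q /sub; do !split.
  have [p2|p2] := pselect (P m b c n); last first.
    by exists (m, b, c, n) => _; rewrite /Q /sub; do !split.
  have [p3|p3] := pselect (P a m n d); last first.
    by exists (a, m, n, d) => _; rewrite /Q /sub; do !split.
  have [p4|p4] := pselect (P m b n d); last first.
    by exists (m, b, n, d) => _; rewrite /Q /sub; do !split.
  by exfalso; apply: nPs; exact: Hsplit.
have [nxt Hnxt] := choice step.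
pose s n := iter n nxt (a0, b0, c0, d0).
have Qs n : Q (s n).
  by elim: n => [|n IH]; [rewrite /s /= | exact: (Hnxt _ IH).1].
have subs n : sub (s n) (s n.+1) by exact: (Hnxt _ (Qs n)).2.
pose A n := (s n).1.1.1; pose B n := (s n).1.1.2.
pose C n := (s n).1.2; pose D n := (s n).2.
have sE n : s n = (A n, B n, C n, D n) by rewrite /A /B /C /D; case: (s n) => [[[]]].
have Q1 n : [/\ a0 <= A n, A n <= B n & B n <= b0] /\ [/\ c0 <= C n, C n <= D n & D n <= d0].
  by have := Qs n; rewrite sE => -[? [? _]].
have nPn n : ~ P (A n) (B n) (C n) (D n) by have := Qs n; rewrite sE => -[_ []].
have S1 n : [/\ A n <= A n.+1, B n.+1 <= B n & B n.+1 - A n.+1 = (B n - A n) / 2] /\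
  [/\ C n <= C n.+1, D n.+1 <= D n & D n.+1 - C n.+1 = (D n - C n) / 2].
  by have := subs n; rewrite !sE.
have A_mono n k : A n <= A (n + k)%N.
  elim: k => [|k IH]; rewrite ?addn0 // addnS (le_trans IH) //; by case: (S1 (n + k)%N) => -[].
have B_mono n k : B (n + k)%N <= B n.
  elim: k => [|k IH]; rewrite ?addn0 // addnS (le_trans _ IH) //; by case: (S1 (n + k)%N) => -[].
have C_mono n k : C n <= C (n + k)%N.
  elim: k => [|k IH]; rewrite ?addn0 // addnS (le_trans IH) //; by case: (S1 (n + k)%N) => _ [].
have D_mono n k : D (n + k)%N <= D n.
  elim: k => [|k IH]; rewrite ?addn0 // addnS (le_trans _ IH) //; by case: (S1 (n + k)%N) => _ [].
have AB n k : A n <= B k.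
  by apply: (le_trans (A_mono n k)); rewrite addnC; apply: (le_trans _ (B_mono k n)); case: (Q1 (k + n)%N) => -[].
have CD n k : C n <= D k.
  by apply: (le_trans (C_mono n k)); rewrite addnC; apply: (le_trans _ (D_mono k n)); case: (Q1 (k + n)%N) => _ [].
pose x := sup (range A); pose y := sup (range C).
have hsA : has_sup (range A) by split; [exists (A 0%N); exists 0%N | exists (B 0%N) => _ [n _ <-]].
have hsC : has_sup (range C) by split; [exists (C 0%N); exists 0%N | exists (D 0%N) => _ [n _ <-]].
have xA n : A n <= x <= B n.
  apply/andP; split; first by apply: (ub_le_sup hsA.2); exists n.
  by apply: (ge_sup hsA.1) => _ [k _ <-].
have yC n : C n <= y <= D n.
  apply/andP; split; first by apply: (ub_le_sup hsC.2); exists n.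
  by apply: (ge_sup hsC.1) => _ [k _ <-].
have wAB n : B n - A n = (b0 - a0) / 2 ^+ n.
  elim: n => [|n IH]; first by rewrite expr0 divr1.
  by case: (S1 n) => -[_ _ ->] _; rewrite IH exprS; field; rewrite expf_neq0.
have wCD n : D n - C n = (d0 - c0) / 2 ^+ n.
  elim: n => [|n IH]; first by rewrite expr0 divr1.
  by case: (S1 n) => _ [_ _ ->]; rewrite IH exprS; field; rewrite expf_neq0.
have [dl dl0 Hdl] := Hloc x y (xA 0%N) (yC 0%N).
have [n Hn] := half_pow_small (b0 - a0 + (d0 - c0)) dl0.
have [[q1 q2 q3] [q4 q5 q6]] := Q1 n.
have i0 : 0 < (2 ^+ n)^-1 :> R by rewrite invr_gt0 exprn_gt0.
apply: (nPn n); apply: Hdl => //.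
  rewrite wAB; apply: le_lt_trans Hn; apply: ler_wpM2r; [exact: ltW|lra].
by rewrite wCD; apply: le_lt_trans Hn; apply: ler_wpM2r; [exact: ltW|lra].
Qed.

End Bisection.

(** * Goursat's theorem *)

Section ComplexVariable.
Context {R : realType}.
Implicit Types (a b c d x y : R) (z w : R[i]) (f F : R[i] -> R[i]) (N : set R[i]).

Definition cwd := @wd R R[i] id.
Definition cwc := @wc R R[i] id.

Definition deriv_on N f df := forall z, N z -> cwd N f z (df z).

Definition box a b c d : set R[i] := [set z | a < cRe z < b /\ c < cIm z < d].
Definition cbox a b c d : set R[i] := [set z | a <= cRe z <= b /\ c <= cIm z <= d].

Lemma rwd_horiz A x y : rwd A (fun t => t +i* y) x 1.
Proof.
move=> eps e0; exists 1 => // s _ _.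
rewrite (_ : _ - _ - _ = 0); last by apply: complexP => /=; ring.
by rewrite cabs0 mulr_ge0 ?cabs_ge0 // ltW.
Qed.

Lemma rwd_vert A x y : rwd A (fun t => x +i* t) y ci.
Proof.
move=> eps e0; exists 1 => // s _ _.
rewrite (_ : _ - _ - _ = 0); last by apply: complexP => /=; ring.
by rewrite cabs0 mulr_ge0 ?cabs_ge0 // ltW.
Qed.

Lemma rwd_path A N f (g : R -> R[i]) x l m :
  (forall s, A s -> N (g s)) -> rwd A g x l -> cwd N f (g x) m ->
  rwd A (fun t => f (g t)) x (m * l).
Proof. exact: wd_comp. Qed.

Lemma rwc_path A N f (g : R -> R[i]) x :
  (forall s, A s -> N (g s)) -> rwc A g x -> cwc N f (g x) ->
  rwc A (fun t => f (g t)) x.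
Proof. exact: wc_comp. Qed.

Lemma rcont_horiz N f a b y : (forall z, N z -> cwc N f z) ->
  (forall x, a <= x <= b -> N (x +i* y)) -> rcont a b (fun t => f (t +i* y)).
Proof.
move=> fc HN x xab; apply: (@rwc_path _ N); first by move=> s; exact: HN.
  exact: wd_wc (rwd_horiz _ _ _).
by apply: fc; exact: HN.
Qed.

Lemma rcont_vert N f x c d : (forall z, N z -> cwc N f z) ->
  (forall y, c <= y <= d -> N (x +i* y)) -> rcont c d (fun t => f (x +i* t)).
Proof.
move=> fc HN y ycd; apply: (@rwc_path _ N); first by move=> s; exact: HN.
  exact: wd_wc (rwd_vert _ _ _).
by apply: fc; exact: HN.
Qed.

(** This is the contour integral of [f] along the boundary of the rectangle, counterclockwise; the
    factor [ci] is dz on the vertical sides. *)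
Definition rect_int f a b c d : R[i] :=
  intg (fun t => f (t +i* c)) a b - intg (fun t => f (t +i* d)) a b
  + ci * (intg (fun t => f (b +i* t)) c d - intg (fun t => f (a +i* t)) c d).

Section Rectangle.
Variables (a0 b0 c0 d0 : R) (f : R[i] -> R[i]).
Let K := cbox a0 b0 c0 d0.
Hypothesis fc : forall z, K z -> cwc K f z.

Let hcont a b y : a0 <= a -> b <= b0 -> c0 <= y <= d0 ->
  rcont a b (fun t => f (t +i* y)).
Proof.
move=> h1 h2 h3; apply: (@rcont_horiz K) => // x /andP[ax xb].
by split => //=; lra.
Qed.

Let vcont c d x : c0 <= c -> d <= d0 -> a0 <= x <= b0 ->
  rcont c d (fun t => f (x +i* t)).
Proof.
move=> h1 h2 h3; apply: (@rcont_vert K) => // y /andP[cy yd].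
by split => //=; lra.
Qed.

(** Every inner side is shared by two of the four rectangles and is traversed once in each
    direction. *)
Lemma rect_int_split a b c d m n : a0 <= a -> a <= m <= b -> b <= b0 ->
  c0 <= c -> c <= n <= d -> d <= d0 ->
  rect_int f a b c d = rect_int f a m c n + rect_int f m b c n
                     + rect_int f a m n d + rect_int f m b n d.
Proof.
move=> h1 h2 h3 h4 h5 h6; rewrite /rect_int.
have H y : c0 <= y <= d0 -> intg (fun t => f (t +i* y)) a m
    + intg (fun t => f (t +i* y)) m b = intg (fun t => f (t +i* y)) a b.
  by move=> hy; apply: (intg_add (hcont h1 h3 hy)); lra.
have V x : a0 <= x <= b0 -> intg (fun t => f (x +i* t)) c n
    + intg (fun t => f (x +i* t)) n d = intg (fun t => f (x +i* t)) c d.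
  by move=> hx; apply: (intg_add (vcont h4 h6 hx)); lra.
have hc : c0 <= c <= d0 by lra.
have hd : c0 <= d <= d0 by lra.
have ha : a0 <= a <= b0 by lra.
have hb : a0 <= b <= b0 by lra.
rewrite -(H _ hc) -(H _ hd) -(V _ ha) -(V _ hb); ring.
Qed.

Lemma rect_int_bound a b c d M : a0 <= a -> a <= b -> b <= b0 ->
  c0 <= c -> c <= d -> d <= d0 ->
  (forall z, cbox a b c d z -> cabs (f z) <= M) ->
  cabs (rect_int f a b c d) <= 2 * M * ((b - a) + (d - c)).
Proof.
move=> h1 h2 h3 h4 h5 h6 HM; rewrite /rect_int.
have H y : c <= y <= d -> cabs (intg (fun t => f (t +i* y)) a b) <= M * (b - a).
  move=> hy; rewrite -[b - a]ger0_norm ?subr_ge0 //.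
  apply: (intg_bound (hcont h1 h3 _)); try lra.
  by rewrite min_l // max_r // => x hx; apply: HM.
have V x : a <= x <= b -> cabs (intg (fun t => f (x +i* t)) c d) <= M * (d - c).
  move=> hx; rewrite -[d - c]ger0_norm ?subr_ge0 //.
  apply: (intg_bound (vcont h4 h6 _)); try lra.
  by rewrite min_l // max_r // => y hy; apply: HM.
apply: (le_trans (cabsD _ _)); rewrite cabsM cabs_ci mul1r.
have := cabs_sub_le (intg (fun t => f (t +i* c)) a b) (intg (fun t => f (t +i* d)) a b).
have := cabs_sub_le (intg (fun t => f (b +i* t)) c d) (intg (fun t => f (a +i* t)) c d).
have := H c; have := H d; have := V a; have := V b.
rewrite !lexx h2 h5 => /(_ isT) ? /(_ isT) ? /(_ isT) ? /(_ isT) ?; lra.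
Qed.

End Rectangle.

Lemma rect_int_primitive a b c d f F : a <= b -> c <= d ->
  deriv_on (cbox a b c d) F f -> rect_int f a b c d = 0.
Proof.
move=> ab cd HF; rewrite /rect_int.
have H y : c <= y <= d -> intg (fun t => f (t +i* y)) a b = F (b +i* y) - F (a +i* y).
  move=> hy; apply: (@intgE _ _ _ _ a b (fun t => F (t +i* y))); rewrite ?lexx ?ab //.
  move=> x hx; rewrite -[X in rwd _ _ _ X]mulr1.
  by apply: (@rwd_path _ (cbox a b c d)); [split|exact: rwd_horiz|apply: HF].
have V x : a <= x <= b -> ci * intg (fun t => f (x +i* t)) c d = F (x +i* d) - F (x +i* c).
  move=> hx.
  rewrite (@intgE _ _ _ _ c d (fun t => - ci * F (x +i* t))) ?lexx ?cd //.
    by rewrite -mulrBr mulrA mulrN ci2 opprK mul1r.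
  move=> y hy.
  have -> : f (x +i* y) = - ci * (f (x +i* y) * ci).
    by rewrite mulrCA mulNr ci2 opprK mulr1.
  apply: wdZ; apply: (@rwd_path _ (cbox a b c d)); [by split|exact: rwd_vert|].
  exact: HF.
rewrite mulrBr !H ?V ?lexx ?ab ?cd //; ring.
Qed.

Lemma rect_intD a b c d f g : a <= b -> c <= d ->
  (forall z, cbox a b c d z -> cwc (cbox a b c d) f z) ->
  (forall z, cbox a b c d z -> cwc (cbox a b c d) g z) ->
  rect_int (fun z => f z + g z) a b c d = rect_int f a b c d + rect_int g a b c d.
Proof.
move=> ab cd fc gc; rewrite /rect_int.
have H y : c <= y <= d -> intg (fun t => f (t +i* y) + g (t +i* y)) a b
    = intg (fun t => f (t +i* y)) a b + intg (fun t => g (t +i* y)) a b.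
  move=> hy; apply: (@intgD _ a b (fun t => f (t +i* y)) (fun t => g (t +i* y)));
    rewrite ?lexx ?ab //.
    by apply: (rcont_horiz fc) => x hx; split.
  by apply: (rcont_horiz gc) => x hx; split.
have V x : a <= x <= b -> intg (fun t => f (x +i* t) + g (x +i* t)) c d
    = intg (fun t => f (x +i* t)) c d + intg (fun t => g (x +i* t)) c d.
  move=> hx; apply: (@intgD _ c d (fun t => f (x +i* t)) (fun t => g (x +i* t)));
    rewrite ?lexx ?cd //.
    by apply: (rcont_vert fc) => y hy; split.
  by apply: (rcont_vert gc) => y hy; split.
rewrite !H ?V ?lexx ?ab ?cd //; ring.
Qed.

Lemma cbox_sub a b c d a' b' c' d' : a <= a' -> b' <= b -> c <= c' -> d' <= d ->
  cbox a' b' c' d' `<=` cbox a b c d.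
Proof.
by move=> h1 h2 h3 h4 z [/andP[h5 h6] /andP[h7 h8]]; split; apply/andP; split; lra.
Qed.

Lemma cbox_dist a b c d z w : cbox a b c d z -> cbox a b c d w ->
  cabs (w - z) <= (b - a) + (d - c).
Proof.
move=> [z1 z2] [w1 w2]; apply: (le_trans (cabs_le_ReIm _)).
rewrite cReD cImD cReN cImN; apply: lerD; rewrite ler_norml; apply/andP; split; lra.
Qed.

(** Near a point, [f] differs from its affine Taylor polynomial by [eps] times the distance, and the
    polynomial has a primitive, so the integral over a small rectangle is at most [eps] times the
    square of its half perimeter. Cutting a rectangle into four equal parts preserves the sum of
    these squares, so bisection carries the bound to the whole rectangle. *)
Lemma goursat a b c d f df : a <= b -> c <= d ->
  deriv_on (cbox a b c d) f df -> rect_int f a b c d = 0.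
Proof.
move=> ab cd Hf; set K := cbox a b c d in Hf.
have fc : forall z, K z -> cwc K f z by move=> z Kz; exact: wd_wc (Hf z Kz).
apply: cabs_small => e e0.
pose S := 1 + (b - a + (d - c)) ^+ 2.
have S0 : 0 < S by rewrite /S; have := sqr_ge0 (b - a + (d - c)); lra.
pose eps := e / S.
have eps0 : 0 < eps by rewrite divr_gt0.
suff : cabs (rect_int f a b c d) <= eps * (b - a + (d - c)) ^+ 2.
  move=> /le_trans; apply; rewrite /eps mulrAC ler_pdivrMr // ler_wpM2l ?(ltW e0) //.
  by rewrite /S; lra.
apply: (@rect_bisection R (fun a' b' c' d' =>
  cabs (rect_int f a' b' c' d') <= eps * (b' - a' + (d' - c')) ^+ 2)) => //.
  move=> a' b' c' d' h1 h2 h3 h4 h5 h6 m n q1 q2 q3 q4.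
  rewrite (@rect_int_split a b c d f fc a' b' c' d' m n) //; try (rewrite /m /n; lra).
  apply: (le_trans (cabsD _ _)); apply: (le_trans (lerD (cabsD _ _) (lexx _))).
  apply: (le_trans (lerD (lerD (cabsD _ _) (lexx _)) (lexx _))).
  apply: (le_trans (lerD (lerD (lerD q1 q2) q3) q4)).
  by rewrite le_eqVlt; apply/orP; left; apply/eqP; rewrite /m /n; field.
move=> x y hx hy.
have Kz : K (x +i* y) by split.
have e4 : 0 < eps / 2 by rewrite divr_gt0.
have [dl dl0 Hdl] := Hf _ Kz _ e4; exists (dl / 2); first by rewrite divr_gt0.
move=> a' b' c' d' h1 h2 h3 h4 h5 h6 h7 h8.
set z0 := x +i* y in Kz Hdl; set l := df z0 in Hdl.
set K' := cbox a' b' c' d'; have K'K : K' `<=` K by apply: cbox_sub.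
have h2' : a' <= b' by lra.
have h5' : c' <= d' by lra.
have fc' z : K' z -> cwc K' f z by move=> K'z; apply: (wc_sub K'K); apply: fc; exact: K'K.
(* The opposite of the Taylor polynomial: adding it leaves the integral unchanged and makes the
   integrand small. *)
pose aff z := - (f z0 + (z - z0) * l).
have affD z : cwd K' (fun z => - (f z0 * z + 2^-1 * l * ((z - z0) * (z - z0)))) z (aff z).
  have D1 : cwd K' (fun z => z - z0) z 1.
    by apply: (wd_eq (wdB (wd_id id K' z) (wd_cst id K' z0 z))); rewrite subr0.
  apply: (wd_eq (wdN (wdD (wdZ (f z0) (wd_id id K' z)) (wdZ (2^-1 * l) (wdM D1 D1))))).
  by rewrite /aff; field.
have affC z : K' z -> cwc K' aff z.
  move=> _; apply: wcN; apply: wcD; first exact: wc_cst.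
  by apply: wcM; [apply: wcB; [exact: wc_id|exact: wc_cst] | exact: wc_cst].
have -> : rect_int f a' b' c' d' = rect_int (fun z => f z + aff z) a' b' c' d'.
  rewrite rect_intD // (@rect_int_primitive _ _ _ _ aff _ h2' h5' (fun z _ => affD z)).
  by rewrite addr0.
have -> : eps * (b' - a' + (d' - c')) ^+ 2 =
   2 * (eps / 2 * (b' - a' + (d' - c'))) * (b' - a' + (d' - c')) by field.
apply: (@rect_int_bound a' b' c' d' _ _ a' b' c' d') => //.
  by move=> z K'z; apply: wcD; [exact: fc'|exact: affC].
move=> z K'z; have K'z0 : K' z0 by split.
have zz0 := cbox_dist K'z0 K'z.
have := Hdl z (K'K _ K'z); rewrite /= => /(_ _)/le_trans h.
rewrite (_ : f z + aff z = f z - f z0 - (z - z0) * l); last by rewrite /aff; ring.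
apply: h; first by apply: (le_lt_trans zz0); lra.
by apply: ler_wpM2l => //; exact: ltW.
Qed.

End ComplexVariable.

(** * Primitives of holomorphic functions on a box *)

Section Primitive.
Context {R : realType}.
Implicit Types (a b c d x y : R) (z w : R[i]) (f F : R[i] -> R[i]) (K N : set R[i]).

Lemma rwd_segment A z w (t : R) : rwd A (fun t => z + t%:C * (w - z)) t (w - z).
Proof.
apply: (wd_eq (wdD (wd_cst _ _ _ _) (wdM (rwd_id A t) (wd_cst _ _ _ _)))).
by rewrite mul1r mulr0 addr0 add0r.
Qed.

Lemma segment_mean_value K f df z w M :
  (forall t : R, 0 <= t <= 1 -> K (z + t%:C * (w - z))) -> deriv_on K f df ->
  (forall t : R, 0 <= t <= 1 -> cabs (df (z + t%:C * (w - z))) <= M) ->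
  cabs (f w - f z) <= M * cabs (w - z).
Proof.
move=> HK Hf HM; pose g t := f (z + t%:C * (w - z)).
have -> : f w - f z = g 1 - g 0.
  by rewrite /g mul1r mul0r addr0 subrKC.
have := @mean_value_bound R 0 1 g (fun t => df (z + t%:C * (w - z)) * (w - z))
  (M * cabs (w - z)) ler01.
rewrite subr0 mulr1; apply.
  move=> t t01; apply: (@rwd_path _ _ K); [exact: HK|exact: rwd_segment|].
  by apply: Hf; exact: HK.
by move=> t t01; rewrite cabsM; apply: ler_wpM2r; [exact: cabs_ge0|exact: HM].
Qed.

Lemma convex_lt (u v t k l : R) : 0 <= t <= 1 -> k < u < l -> k < v < l ->
  k < u + t * (v - u) < l.
Proof.
move=> /andP[t0 t1] /andP[h1 h2] /andP[h3 h4]; have [uv|uv] := leP u v.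
  have p1 : 0 <= t * (v - u) by rewrite mulr_ge0 // subr_ge0.
  have p2 : t * (v - u) <= v - u by rewrite ler_piMl // subr_ge0.
  by lra.
have p1 : 0 <= t * (u - v) by rewrite mulr_ge0 // subr_ge0 ltW.
have p2 : t * (u - v) <= u - v by rewrite ler_piMl // subr_ge0 ltW.
by rewrite -[t * _]opprK -mulrN opprB; lra.
Qed.

Lemma box_convex a b c d z w (t : R) : 0 <= t <= 1 ->
  box a b c d z -> box a b c d w -> box a b c d (z + t%:C * (w - z)).
Proof.
move: z w => [z1 z2] [w1 w2] t01 [/= h1 h2] [/= h3 h4].
by rewrite /box /= !(mul0r, subr0, addr0); split; apply: convex_lt.
Qed.

(** The vertices may come in any order, because exchanging two parallel sides only changes the sign
    of the integral. *)
Lemma rect_int0 a b c d f df x1 x2 y1 y2 : deriv_on (box a b c d) f df ->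
  a < x1 < b -> a < x2 < b -> c < y1 < d -> c < y2 < d ->
  rect_int f x1 x2 y1 y2 = 0.
Proof.
move=> Hf hx1 hx2 hy1 hy2.
have fc : forall z, box a b c d z -> cwc (box a b c d) f z.
  by move=> z Kz; exact: wd_wc (Hf z Kz).
wlog x12 : x1 x2 hx1 hx2 / x1 <= x2.
  move=> H; have [h|/ltW h] := leP x1 x2; first exact: H.
  have := H _ _ hx2 hx1 h; rewrite /rect_int.
  have Hc y : c < y < d -> intg (fun t => f (t +i* y)) x1 x2 = - intg (fun t => f (t +i* y)) x2 x1.
    move=> hy; apply: (@intg_sym _ x2 x1); rewrite ?lexx ?h //.
    by apply: (rcont_horiz fc) => x hx; split => //=; lra.
  rewrite !Hc // => H'; apply/eqP; rewrite -oppr_eq0; apply/eqP; rewrite -[RHS]H'; ring.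
wlog y12 : y1 y2 hy1 hy2 / y1 <= y2.
  move=> H; have [h|/ltW h] := leP y1 y2; first exact: H.
  have := H _ _ hy2 hy1 h; rewrite /rect_int.
  have Hc x : a < x < b -> intg (fun t => f (x +i* t)) y1 y2 = - intg (fun t => f (x +i* t)) y2 y1.
    move=> hx; apply: (@intg_sym _ y2 y1); rewrite ?lexx ?h //.
    by apply: (rcont_vert fc) => y hy; split => //=; lra.
  rewrite !Hc // => H'; apply/eqP; rewrite -oppr_eq0; apply/eqP; rewrite -[RHS]H'; ring.
apply: (@goursat _ _ _ _ _ f df) => // z [h1 h2].
have sub : cbox x1 x2 y1 y2 `<=` box a b c d by move=> w [h3 h4]; split; lra.
by apply: (wd_sub sub); apply: Hf; apply: sub.
Qed.

Lemma between3 (lo hi u v w t : R) : lo < u < hi -> lo < v < hi -> lo < w < hi ->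
  Num.min u (Num.min v w) <= t <= Num.max u (Num.max v w) -> lo < t < hi.
Proof.
move=> /andP[u1 u2] /andP[v1 v2] /andP[w1 w2] /andP[t1 t2].
by rewrite (lt_le_trans _ t1) ?(le_lt_trans t2) ?lt_min ?gt_max ?u1 ?v1 ?w1 ?u2 ?v2 ?w2.
Qed.

Lemma between2 (lo hi u v t : R) : lo < u < hi -> lo < v < hi ->
  Num.min u v <= t <= Num.max u v -> lo < t < hi.
Proof. by move=> hu hv ht; apply: (between3 hu hu hv); rewrite minA maxA minxx maxxx. Qed.

Lemma between_dist (u v t : R) : Num.min u v <= t <= Num.max u v -> `|t - u| <= `|v - u|.
Proof.
rewrite ge_min le_max => /andP[h1 h2]; have [uv|uv] := leP u v.
  rewrite (ger0_norm (_ : 0 <= v - u)) ?subr_ge0 // ger0_norm; first by case/orP: h2; lra.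
  by case/orP: h1; lra.
rewrite (ltr0_norm (_ : v - u < 0)) ?subr_lt0 // ler0_norm; first by case/orP: h1; lra.
by case/orP: h2; lra.
Qed.

(** The primitive integrates horizontally at the height of [z0], then vertically. By Goursat, its
    increment from [z] to [w] is the integral of [f] along the horizontal side through [z] followed
    by the vertical side ending at [w], where [f] is close to [f z]. *)
Lemma box_primitive a b c d f df : deriv_on (box a b c d) f df ->
  exists F, deriv_on (box a b c d) F f.
Proof.
set N := box a b c d => Hf.
have [[z0 Nz0]|nN] := pselect (exists z, N z); last first.
  by exists f => z Nz; exfalso; apply: nN; exists z.
have fc : forall z, N z -> cwc N f z by move=> z Nz; exact: wd_wc (Hf z Nz).
pose H y x1 x2 := intg (fun t => f (t +i* y)) x1 x2.
pose V x y1 y2 := intg (fun t => f (x +i* t)) y1 y2.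
have hc y x1 x2 : c < y < d -> a < x1 < b -> a < x2 < b ->
    rcont (Num.min x1 x2) (Num.max x1 x2) (fun t => f (t +i* y)).
  by move=> hy h1 h2; apply: (rcont_horiz fc) => x hx; split => //=; exact: between2 hx.
have vc x y1 y2 : a < x < b -> c < y1 < d -> c < y2 < d ->
    rcont (Num.min y1 y2) (Num.max y1 y2) (fun t => f (x +i* t)).
  by move=> hx h1 h2; apply: (rcont_vert fc) => y hy; split => //=; exact: between2 hy.
have mm (u v : R) : (Num.min u v <= u <= Num.max u v) * (Num.min u v <= v <= Num.max u v).
  by rewrite !ge_min !le_max !lexx !orbT.
exists (fun z => H (cIm z0) (cRe z0) (cRe z) + ci * V (cRe z) (cIm z0) (cIm z)).
move=> z Nz eps e0.
have e2 : 0 < eps / 2 by rewrite divr_gt0.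
have [dl dl0 Hdl] := fc z Nz _ e2.
exists (dl / 2); first by rewrite divr_gt0.
move=> w Nw; rewrite /= => wz.
set x0 := cRe z0; set y0 := cIm z0; set x1 := cRe z; set y1 := cIm z.
set x2 := cRe w; set y2 := cIm w.
have [zx zy] := Nz; have [wx wy] := Nw; have [z0x z0y] := Nz0.
have E1 : H y0 x0 x2 = H y0 x0 x1 + H y0 x1 x2.
  rewrite /H (intg_add (A := Num.min x0 (Num.min x1 x2)) (B := Num.max x0 (Num.max x1 x2))) //.
  - by apply: (rcont_horiz fc) => x hx; split => //=; exact: between3 hx.
  - by rewrite ge_min le_max lexx.
  - by rewrite !ge_min !le_max !lexx !orbT.
  - by rewrite !ge_min !le_max !lexx !orbT.
have E2 : V x2 y0 y2 = V x2 y0 y1 + V x2 y1 y2.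
  rewrite /V (intg_add (A := Num.min y0 (Num.min y1 y2)) (B := Num.max y0 (Num.max y1 y2))) //.
  - by apply: (rcont_vert fc) => y hy; split => //=; exact: between3 hy.
  - by rewrite ge_min le_max lexx.
  - by rewrite !ge_min !le_max !lexx !orbT.
  - by rewrite !ge_min !le_max !lexx !orbT.
have E3 : H y0 x1 x2 - H y1 x1 x2 + ci * (V x2 y0 y1 - V x1 y0 y1) = 0.
  exact: (rect_int0 Hf).
have hh := hc y1 x1 x2 zy zx wx; have vv := vc x2 y1 y2 wx zy wy.
have cst (k0 : R[i]) (A B : R) : @rcont R A B (fun=> k0) by move=> t _; exact: wc_cst.
have I1 : intg (fun t => f (t +i* y1) + - f z) x1 x2 = H y1 x1 x2 - f z * (x2 - x1)%:C.
  by rewrite (intgD hh (cst _ _ _)) ?mm // intg_cst mulNr.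
have I2 : intg (fun t => f (x2 +i* t) + - f z) y1 y2 = V x2 y1 y2 - f z * (y2 - y1)%:C.
  by rewrite (intgD vv (cst _ _ _)) ?mm // intg_cst mulNr.
have close u : N u -> cabs (u - z) < dl -> cabs (f u - f z) <= eps / 2 by exact: Hdl.
have dx : `|x2 - x1| <= cabs (w - z) by have := Re_le_cabs (w - z); rewrite cReD cReN.
have dy : `|y2 - y1| <= cabs (w - z) by have := Im_le_cabs (w - z); rewrite cImD cImN.
have B1 : cabs (intg (fun t => f (t +i* y1) + - f z) x1 x2) <= eps / 2 * `|x2 - x1|.
  apply: (@intg_bound R (Num.min x1 x2) (Num.max x1 x2)); rewrite ?mm //.
    by move=> t ht; apply: wcD; [exact: hh|exact: wc_cst].
  move=> t ht; apply: close.
    by split => //=; exact: between2 ht.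
  apply: (le_lt_trans (cabs_le_ReIm _)); rewrite cReD cImD cReN cImN /= subrr normr0 addr0.
  by have := between_dist ht; rewrite -/x1; lra.
have B2 : cabs (intg (fun t => f (x2 +i* t) + - f z) y1 y2) <= eps / 2 * `|y2 - y1|.
  apply: (@intg_bound R (Num.min y1 y2) (Num.max y1 y2)); rewrite ?mm //.
    by move=> t ht; apply: wcD; [exact: vv|exact: wc_cst].
  move=> t ht; apply: close.
    by split => //=; exact: between2 ht.
  apply: (le_lt_trans (cabs_le_ReIm _)); rewrite cReD cImD cReN cImN /=.
  by have := between_dist ht; rewrite -/x1 -/y1; lra.
have wzE : w - z = (x2 - x1)%:C + ci * (y2 - y1)%:C.
  by rewrite [LHS]complex_ReIm cReD cImD cReN cImN.
rewrite (_ : _ - _ - _ = intg (fun t => f (t +i* y1) + - f z) x1 x2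
    + ci * intg (fun t => f (x2 +i* t) + - f z) y1 y2); last first.
  rewrite I1 I2 wzE E1 E2; apply/eqP; rewrite -subr_eq0 -[X in _ == X]E3; apply/eqP; ring.
apply: (le_trans (cabsD _ _)); rewrite cabsM cabs_ci mul1r.
by nra.
Qed.

End Primitive.

(** * The complex exponential and Cauchy estimates *)

Section Exponential.
Context {R : realType}.
Implicit Types (x y t : R) (z w : R[i]).

Definition cexp z : R[i] :=
  (expR (cRe z) * cos (cIm z)) +i* (expR (cRe z) * sin (cIm z)).

Lemma cexp0 : cexp 0 = 1.
Proof. by rewrite /cexp /= expR0 cos0 sin0 mulr1 mulr0. Qed.

Lemma cexpD z w : cexp (z + w) = cexp z * cexp w.
Proof.
rewrite /cexp cReD cImD expRD sinD cosD.
by apply: complexP; rewrite ?cReM ?cImM /=; ring.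
Qed.

Lemma cabs_cexp z : cabs (cexp z) = expR (cRe z).
Proof.
apply/eqP; rewrite -(eqrXn2 (n := 2)) ?cabs_ge0 ?expR_ge0 //; apply/eqP.
rewrite cabs_sqr /= -[RHS]mulr1 -(cos2Dsin2 (cIm z)); ring.
Qed.

Lemma cexp_neq0 z : cexp z != 0.
Proof. by rewrite -cabs_gt0 cabs_cexp expR_gt0. Qed.

Lemma cexpN z : cexp (- z) = (cexp z)^-1.
Proof.
apply: (mulfI (cexp_neq0 z)); rewrite -cexpD subrr cexp0 divff //.
exact: cexp_neq0.
Qed.

Lemma cexp_2pi y : cexp (y +i* (pi *+ 2)) = cexp (y +i* 0).
Proof. by rewrite /cexp /= -[pi *+ 2]add0r cosD2pi sinD2pi. Qed.

Lemma cexp_pi_sqr (k : int) : cexp (0 +i* (pi * k%:~R)) ^+ 2 = 1.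
Proof.
have c2 (x : R) : sin x = 0 -> cos x ^+ 2 = 1.
  by move=> s0; rewrite -(cos2Dsin2 x) s0 expr0n addr0.
have sk (n : nat) : sin (pi * n%:R) = 0 :> R.
  elim: n => [|n IH]; first by rewrite mulr0 sin0.
  by rewrite -natr1 mulrDr mulr1 sinDpi IH oppr0.
have ski : sin (pi * k%:~R) = 0 :> R.
  case: k => n; first by rewrite -pmulrn sk.
  by rewrite NegzE mulrNz mulrN sinN -pmulrn sk oppr0.
rewrite /cexp /= expR0 !mul1r ski; apply: complexP; rewrite expr2 ?cReM ?cImM /=.
  by rewrite -expr2 c2 //; ring.
by ring.
Qed.

Lemma real_deriv_scaled (phi : R -> R) (dphi : R -> R) x t :
  (forall s, rwd setT (fun t => (phi t)%:C) s (dphi s)%:C) ->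
  rwd setT (fun t => (phi (t * x))%:C) t ((dphi (t * x))%:C * x%:C).
Proof.
move=> H; apply: (@wd_comp _ _ _ _ (real_complex R) _ setT (fun t => t * x)
  (fun t => (phi t)%:C)) => //; last exact: H.
have /= := wdM (rwd_id setT t) (wd_cst (real_complex R) setT x%:C t).
rewrite mul1r mulr0 addr0; apply: wd_ext => // s _.
by rewrite rmorphM.
Qed.

Lemma rwd_cexp_line w t :
  rwd setT (fun t => cexp (t%:C * w)) t (w * cexp (t%:C * w)).
Proof.
set x := cRe w; set y := cIm w.
have DE := real_deriv_scaled x t (fun s => is_derive_rwd (is_derive_expR s)).
have DC := real_deriv_scaled y t (fun s => is_derive_rwd (is_derive_cos s)).
have DS := real_deriv_scaled y t (fun s => is_derive_rwd (is_derive_sin s)).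
have E s : (expR (s * x))%:C * ((cos (s * y))%:C + ci * (sin (s * y))%:C) = cexp (s%:C * w).
  by rewrite /cexp cReM cImM /= !(mul0r, subr0, addr0); apply: complexP; rewrite ?cReM ?cImM /=; ring.
apply: (wd_ext I (fun s _ => E s)).
apply: (wd_eq (wdM DE (wdD DC (wdZ ci DS)))).
rewrite -E [w in RHS]complex_ReIm -/x -/y !rmorphN.
(* [ring] does not know the relation [ci * ci = -1], so the needed multiple of [1 + ci * ci],
   written as 0, is added by hand. *)
rewrite -[RHS]addr0 -[X in _ = _ + X](mulr0 (- ((expR (t * x))%:C * (sin (t * y))%:C * y%:C))).
have -> : 0 = 1 + ci * ci :> R[i] by rewrite ci2 subrr.
ring.
Qed.

(** Two mean value inequalities along the ray [t * w]: one for [cexp], one for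
    [cexp (t * w) - t * w], whose derivative is controlled by the first. *)
Lemma cexp_taylor w : cabs (cexp w - 1 - w) <= cabs w ^+ 2 * expR (cabs w).
Proof.
have H1 t : 0 <= t <= 1 -> cabs (cexp (t%:C * w) - 1) <= cabs w * expR (cabs w).
  move=> /andP[t0 t1].
  rewrite -cexp0 (_ : cexp 0 = cexp (0%:C * w)); last by rewrite mul0r.
  apply: (@le_trans _ _ (cabs w * expR (cabs w) * (t - 0))).
    apply: (@mean_value_bound _ 0 t (fun s => cexp (s%:C * w))
      (fun s => w * cexp (s%:C * w))) => // s /andP[s0 s1].
      by apply: wd_sub (rwd_cexp_line w s).
    rewrite cabsM; apply: ler_wpM2l; first exact: cabs_ge0.
    rewrite cabs_cexp ler_expR; apply: (le_trans (ler_norm _)).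
    apply: (le_trans (Re_le_cabs _)); rewrite cabsM cabs_real ger0_norm //.
    by rewrite ler_piMl ?cabs_ge0 //; lra.
  by rewrite subr0 ler_piMr // mulr_ge0 ?cabs_ge0 ?expR_ge0.
pose G t := cexp (t%:C * w) - t%:C * w.
have -> : cexp w - 1 - w = G 1 - G 0.
  rewrite /G (_ : 1%:C = 1) // (_ : 0%:C = 0) // mul1r mul0r cexp0; ring.
apply: (@le_trans _ _ (cabs w ^+ 2 * expR (cabs w) * (1 - 0))); last by rewrite subr0 mulr1.
apply: (@mean_value_bound _ 0 1 G (fun s => w * (cexp (s%:C * w) - 1))) => // s s01.
  rewrite mulrBr mulr1; apply: wdB; first by apply: wd_sub (rwd_cexp_line w s).
  apply: (wd_eq (wdM (rwd_id _ s) (wd_cst _ _ w s))).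
  by rewrite mul1r mulr0 addr0.
rewrite cabsM expr2 -mulrA; apply: ler_wpM2l; first exact: cabs_ge0.
exact: H1.
Qed.

Lemma cwd_cexp A z : cwd A cexp z (cexp z).
Proof.
move=> eps e0.
have Z0 : 0 < cabs (cexp z) by rewrite cabs_gt0 cexp_neq0.
pose K := cabs (cexp z) * expR 1.
have K0 : 0 < K by rewrite mulr_gt0 // expR_gt0.
exists (Num.min 1 (eps / K)); first by rewrite lt_min ltr01 divr_gt0.
move=> w _ /=; rewrite lt_min => /andP[h1 h2].
rewrite (_ : _ - _ - _ = cexp z * (cexp (w - z) - 1 - (w - z))); last first.
  have -> : cexp w = cexp z * cexp (w - z) by rewrite -cexpD subrKC.
  ring.
rewrite cabsM; set k := cabs (w - z) in h1 h2 *.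
have k0 : 0 <= k by exact: cabs_ge0.
apply: (@le_trans _ _ (cabs (cexp z) * (k ^+ 2 * expR 1))).
  apply: ler_wpM2l; first exact: ltW.
  apply: (le_trans (cexp_taylor _)); apply: ler_wpM2l; first exact: exprn_ge0.
  by rewrite ler_expR ltW.
rewrite (_ : cabs (cexp z) * _ = K * k * k); last by rewrite /K expr2; ring.
by apply: ler_wpM2r => //; rewrite mulrC -ler_pdivlMr // ltW.
Qed.

Lemma cexp_surj z : z != 0 -> exists w, cexp w = z.
Proof.
move=> z0; have r0 : 0 < cabs z by rewrite cabs_gt0.
pose a := cRe z / cabs z; pose b := cIm z / cabs z.
have ab : a ^+ 2 + b ^+ 2 = 1.
  by rewrite /a /b !expr_div_n -mulrDl -cabs_sqr divff // expf_neq0 // gt_eqF.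
have a1 : -1 <= a <= 1.
  by rewrite -ler_norml -[X in _ <= X](normr1 R) -ler_sqr ?nnegrE // !real_normK ?num_real //
     expr1n; have := sqr_ge0 b; lra.
have sa : sin (acos a) = `|b|.
  by rewrite sin_acos // (_ : 1 - a ^+ 2 = b ^+ 2) ?sqrtr_sqr //; lra.
have ca : cos (acos a) = a by rewrite acosK // in_itv.
exists ((ln (cabs z)) +i* (if 0 <= b then acos a else - acos a)).
rewrite /cexp /= lnK ?posrE //.
have Ea : cabs z * a = cRe z by rewrite /a mulrCA divff ?gt_eqF // mulr1.
have Eb : cabs z * b = cIm z by rewrite /b mulrCA divff ?gt_eqF // mulr1.
case: ifP => b0; apply: complexP => /=; rewrite ?cosN ?sinN ?ca ?sa //.
  by rewrite ger0_norm.
by rewrite ltr0_norm ?opprK // ltNge b0.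
Qed.

End Exponential.

(** * Cauchy's formula on circles and its consequences *)

Section Cauchy.
Context {R : realType}.
Implicit Types (x y t r s M : R) (z w : R[i]) (f df : R[i] -> R[i]) (K N : set R[i]).

Definition cis t : R[i] := cexp (t%:C * ci).
Definition cisN t : R[i] := cexp (t%:C * - ci).

Lemma cabs_cis t : cabs (cis t) = 1.
Proof. by rewrite cabs_cexp cReM /= !(mul0r, mulr0, subr0) expR0. Qed.

Lemma cabs_cisN t : cabs (cisN t) = 1.
Proof. by rewrite cabs_cexp cReM /= !(mul0r, mulr0, subr0, oppr0) expR0. Qed.

Lemma cisN_mul t : cisN t * cis t = 1.
Proof. by rewrite -cexpD mulrN addNr cexp0. Qed.

Lemma cisN_2pi : cisN (pi *+ 2) = cisN 0.
Proof.
rewrite /cisN (_ : (pi *+ 2)%:C * - ci = - (0 +i* (pi *+ 2)) :> R[i]); last first.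
  by apply: complexP; rewrite ?cReM ?cImM /=; ring.
by rewrite !cexpN cexp_2pi mul0r !cexp0 invr1.
Qed.

Lemma complex_polar x t : x +i* t = x%:C + t%:C * ci.
Proof. by apply: complexP; rewrite ?cReD ?cImD ?cReM ?cImM /=; ring. Qed.

Lemma cexp_ln r : 0 < r -> cexp (ln r)%:C = r%:C.
Proof. by move=> r0; rewrite /cexp /= cos0 sin0 mulr1 mulr0 lnK. Qed.

Lemma pi2_gt0 : 0 < pi *+ 2 :> R.
Proof. by rewrite mulrn_wgt0 // pi_gt0. Qed.

Lemma rwd_cis A t : rwd A cis t (ci * cis t).
Proof. exact: wd_sub (rwd_cexp_line _ t). Qed.

Lemma rwd_cisN A t : rwd A cisN t (- ci * cisN t).
Proof. exact: wd_sub (rwd_cexp_line _ t). Qed.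

Section Circle.
Variables (K : set R[i]) (f df : R[i] -> R[i]) (z : R[i]) (r : R).
Hypotheses (r0 : 0 < r) (HK : forall w, cabs (w - z) <= r -> K w).
Hypothesis Hf : deriv_on K f df.

Lemma disc_path s t : 0 <= s <= r -> cabs (z + s%:C * cis t - z) <= r.
Proof.
move=> /andP[s0 sr]; rewrite addrC addKr cabsM cabs_cis mulr1 cabs_real.
by rewrite ger0_norm.
Qed.

Lemma circle_rcont : rcont 0 (pi *+ 2) (fun t => cisN t * f (z + r%:C * cis t)).
Proof.
move=> t _; apply: wcM; first exact: wd_wc (rwd_cisN _ t).
apply: (@rwc_path _ _ K) => [s _||].
- by apply: HK; apply: disc_path; rewrite lexx ltW.
- apply: wcD; first exact: wc_cst.
  by apply: wcZ; exact: wd_wc (rwd_cis _ t).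
by apply: wd_wc; apply: Hf; apply: HK; apply: disc_path; rewrite lexx ltW.
Qed.

(* In the logarithmic coordinate [w = z + exp zeta] the concentric circles are
   vertical segments of length [2 pi], so that Goursat's theorem makes the
   integral independent of the radius. *)
Lemma circle_deriv :
  intg (fun t => cisN t * f (z + r%:C * cis t)) 0 (pi *+ 2)
  = (r * (pi *+ 2))%:C * df z.
Proof.
have pi0 := pi2_gt0.
pose g u := cexp (- u) * f (z + cexp u).
pose I s := intg (fun t => g (ln s +i* t)) 0 (pi *+ 2).
have gE s t : 0 < s -> g (ln s +i* t) = s^-1%:C * (cisN t * f (z + s%:C * cis t)).
  move=> s0; rewrite /g complex_polar opprD !cexpD cexpN cexp_ln // -mulrN.
  by rewrite (rmorphV (real_complex R)) ?unitfE ?gt_eqF // mulrA.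
have [dg Hg] : exists dg, forall s, 0 < s -> s <= r -> deriv_on (cbox (ln s) (ln r) 0 (pi *+ 2)) g dg.
  exists (fun u => (cexp (- u) * - 1) * f (z + cexp u) + cexp (- u) * (df (z + cexp u) * cexp u)).
  move=> s s0 sr u Ku.
  have inK v : cbox (ln s) (ln r) 0 (pi *+ 2) v -> K (z + cexp v).
    move=> [/andP[h3 h4] _]; apply: HK; rewrite addrC addKr cabs_cexp.
    by rewrite -[r]lnK ?posrE // ler_expR.
  apply: wdM.
    apply: (@wd_comp _ _ _ _ id _ setT (fun v => - v) cexp) => //.
      by apply: wdN; exact: wd_id.
    exact: cwd_cexp.
  apply: (@wd_comp _ _ _ _ id _ K (fun v => z + cexp v) f) => //.
    apply: (wd_eq (wdD (wd_cst _ _ _ _) (cwd_cexp _ _))); exact: add0r.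
  by apply: Hf; apply: inK.
have gc s t : 0 < s -> s <= r -> 0 <= t <= pi *+ 2 ->
    rwc (seg 0 (pi *+ 2)) (fun t => g (ln s +i* t)) t.
  move=> s0 sr ht; apply: (@rcont_vert _ (cbox (ln s) (ln r) 0 (pi *+ 2)) g) ht.
    by move=> u Ku; apply: wd_wc; exact: Hg.
  by move=> y hy; split; rewrite //= lexx ler_ln ?posrE.
have Ieq s : 0 < s -> s <= r -> I s = I r.
  move=> s0 sr.
  have lnsr : ln s <= ln r by rewrite ler_ln ?posrE.
  have := goursat lnsr (ltW pi0) (Hg s s0 sr).
  (* By the period 2 pi i of the exponential, the two horizontal sides cancel, and what remains
     compares the two vertical ones. *)
  rewrite /rect_int (_ : (fun t => g (t +i* (pi *+ 2))) = (fun t => g (t +i* 0))); last first.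
    apply/funext => t; rewrite /g cexp_2pi; congr (_ * _).
    by rewrite !cexpN cexp_2pi.
  have ci_neq0 : (ci : R[i]) != 0 by rewrite -cabs_gt0 cabs_ci.
  rewrite subrr add0r => /eqP; rewrite mulf_eq0 (negbTE ci_neq0) orFb subr_eq0 => /eqP h.
  exact: esym h.
have Jr : intg (fun t => cisN t * f (z + r%:C * cis t)) 0 (pi *+ 2) = r%:C * I r.
  rewrite /I (_ : (fun t => g _) = (fun t => r^-1%:C * (cisN t * f (z + r%:C * cis t)))).
    rewrite (intgZ _ circle_rcont) ?lexx ?(ltW pi0) //.
    by rewrite mulrA -rmorphM divff ?gt_eqF // mul1r.
  by apply/funext => t; exact: gE.
rewrite Jr rmorphM -mulrA; congr (_ * _); apply/eqP; rewrite -subr_eq0; apply/eqP.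
apply: cabs_small => e e0.
pose eta := e / (pi *+ 2); have eta0 : 0 < eta by rewrite divr_gt0.
have Kz : K z by apply: HK; rewrite subrr cabs0 ltW.
have [dl dl0 Hdl] := Hf Kz eta0.
pose s := Num.min r (dl / 2).
have s0 : 0 < s by rewrite lt_min r0 divr_gt0.
have sr : s <= r by rewrite ge_min lexx.
have sd : s < dl by rewrite gt_min; apply/orP; right; lra.
rewrite -(Ieq s) //.
(* This is the integrand for the affine Taylor polynomial of [f] at [z]: its first term integrates
   to 0 over a period and its second gives the value of the formula. *)
pose h t := (f z / s%:C) * cisN t + df z.
have hD t : 0 <= t <= pi *+ 2 -> rwd (seg 0 (pi *+ 2)) (fun t => (f z / s%:C) * (ci * cisN t) + df z * t%:C) t (h t).
  move=> _; apply: (wd_eq (wdD (wdZ _ (wdZ _ (rwd_cisN _ t))) (wdZ _ (rwd_id _ t)))).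
  rewrite (_ : ci * (- ci * cisN t) = cisN t) ?mulr1 //.
  by rewrite mulrA mulrN ci2 opprK mul1r.
have hI : intg h 0 (pi *+ 2) = (pi *+ 2)%:C * df z.
  rewrite (intgE _ _ hD) ?lexx ?(ltW pi0) // cisN_2pi (_ : 0%:C = 0) //; ring.
have hc : rcont 0 (pi *+ 2) (fun t => - h t).
  move=> t _; apply: wcN; apply: wcD; last exact: wc_cst.
  by apply: wcZ; exact: wd_wc (rwd_cisN _ t).
have hNI : intg (fun t => - h t) 0 (pi *+ 2) = - ((pi *+ 2)%:C * df z).
  rewrite -hI (@intgE _ _ _ _ _ _ _ _ _ (fun t Ht => wdN (hD t Ht))) ?lexx ?(ltW pi0) //.
  by rewrite (intgE _ _ hD) ?lexx ?(ltW pi0) //; ring.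
have gcs : rcont 0 (pi *+ 2) (fun t => g (ln s +i* t)) by move=> t ht; exact: gc.
rewrite /I -hNI -(intgD gcs hc) ?lexx ?(ltW pi0) //.
rewrite (_ : e = eta * `|pi *+ 2 - 0|); last first.
  by rewrite subr0 gtr0_norm // /eta divfK // gt_eqF.
apply: (@intg_bound R 0 (pi *+ 2)); rewrite ?lexx ?(ltW pi0) //.
  by move=> t ht; apply: wcD; [exact: gcs|exact: hc].
move=> t _; rewrite gE //.
have s0' : s%:C != 0 :> R[i] by rewrite -cabs_gt0 cabs_real gtr0_norm.
rewrite (rmorphV (real_complex R)) ?unitfE ?gt_eqF //.
rewrite (_ : _ + _ = s%:C^-1 * cisN t * (f (z + s%:C * cis t) - f z
    - (z + s%:C * cis t - z) * df z)); last first.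
  rewrite /h.
  have E : df z = s%:C^-1 * s%:C * (cisN t * cis t) * df z.
    by rewrite cisN_mul mulVf // !mul1r.
  by rewrite [in LHS]E; ring.
rewrite !cabsM cabs_cisN mulr1 cabsV cabs_real gtr0_norm //.
rewrite mulrC ler_pdivrMr //.
have ws : cabs (z + s%:C * cis t - z) = s.
  by rewrite addrC addKr cabsM cabs_cis mulr1 cabs_real gtr0_norm.
rewrite (_ : eta * s = eta * cabs (z + s%:C * cis t - z)); last by rewrite ws.
apply: Hdl; last by rewrite /= ws.
by apply: HK; rewrite ws.
Qed.

Lemma cauchy_estimate M : (forall w, cabs (w - z) <= r -> cabs (f w) <= M) ->
  cabs (df z) <= M / r.
Proof.
move=> HM; rewrite ler_pdivlMr //.
have pi0 := pi2_gt0.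
rewrite -(ler_pM2r pi0) (_ : M * _ = M * `|pi *+ 2 - 0|); last by rewrite subr0 gtr0_norm.
rewrite (_ : _ * _ * _ = cabs ((r * (pi *+ 2))%:C * df z)).
  rewrite -circle_deriv; apply: (@intg_bound R 0 (pi *+ 2)); rewrite ?lexx ?(ltW pi0) //.
    exact: circle_rcont.
  move=> t _; rewrite cabsM cabs_cisN mul1r; apply: HM.
  by apply: disc_path; rewrite lexx ltW.
by rewrite cabsM cabs_real gtr0_norm ?mulr_gt0 //; ring.
Qed.

End Circle.

(** The formula [circle_deriv] for derivatives, applied to [(w - z) * f w], whose derivative at [z]
    is [f z], becomes a formula for the value itself. *)
Lemma mean_value_bound_disc K f df z r M : 0 < r ->
  (forall w, cabs (w - z) <= r -> K w) -> deriv_on K f df ->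
  (forall w, cabs (w - z) = r -> cabs (f w) <= M) -> cabs (f z) <= M.
Proof.
move=> r0 HK Hf HM; have pi0 := pi2_gt0.
pose F w := (w - z) * f w.
have HF : deriv_on K F (fun w => 1 * f w + (w - z) * df w).
  move=> w Kw; apply: wdM; last exact: Hf.
  by apply: (wd_eq (wdB (wd_id _ _ _) (wd_cst _ _ _ _))); rewrite subr0.
have := circle_deriv r0 HK HF; rewrite mul1r subrr mul0r addr0 => E.
have rp : 0 < r * (pi *+ 2) by rewrite mulr_gt0.
rewrite -(ler_pM2l rp) (_ : _ * M = r * M * `|pi *+ 2 - 0|); last first.
  by rewrite subr0 gtr0_norm //; ring.
rewrite (_ : r * (pi *+ 2) * _ = cabs ((r * (pi *+ 2))%:C * f z)); last first.
  by rewrite cabsM cabs_real gtr0_norm.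
rewrite -E; apply: (@intg_bound R 0 (pi *+ 2)); rewrite ?lexx ?(ltW pi0) //.
  exact: (circle_rcont r0 HK HF).
move=> t _; have wr : cabs (z + r%:C * cis t - z) = r.
  by rewrite addrC addKr cabsM cabs_cis mulr1 cabs_real gtr0_norm.
rewrite /F !cabsM cabs_cisN mul1r wr; apply: ler_wpM2l; first exact: ltW.
exact: HM.
Qed.

(** The minimum modulus principle: without a zero, 1 / f would be holomorphic on the disc and larger
    at the centre than on the circle. *)
Lemma zero_in_disc K f df z r m : 0 < r ->
  (forall w, cabs (w - z) <= r -> K w) -> deriv_on K f df ->
  cabs (f z) < m -> (forall w, cabs (w - z) = r -> m <= cabs (f w)) ->
  exists2 w, cabs (w - z) <= r & f w = 0.
Proof.
move=> r0 HK Hf fz fm; apply: contrapT => nz.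
have nz' w : cabs (w - z) <= r -> f w != 0.
  by move=> wr; apply/eqP => fw; apply: nz; exists w.
pose D := [set w | cabs (w - z) <= r].
have HD : deriv_on D (fun w => (f w)^-1) (fun w => - df w / f w ^+ 2).
  move=> w Dw; apply: wdV; last exact: nz'.
  by apply: (@wd_sub _ _ _ _ K); [exact: HK|apply: Hf; exact: HK].
have m0 : 0 < m by apply: le_lt_trans fz; exact: cabs_ge0.
have := @mean_value_bound_disc D _ _ z r m^-1 r0 (fun w h => h) HD.
have fz0 : 0 < cabs (f z) by rewrite cabs_gt0 nz' // subrr cabs0 ltW.
rewrite cabsV lef_pV2 ?posrE // leNgt fz => H; apply: notF; apply: H => w wr.
rewrite cabsV lef_pV2 ?posrE ?fm // cabs_gt0 nz' // wr lexx //.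
Qed.

End Cauchy.

(** * Holomorphy of the derivative *)

Section SecondDerivative.
Context {R : realType}.
Variables (N N' : set R[i]) (f df : R[i] -> R[i]) (M r : R).
Hypotheses (r0 : 0 < r).
Hypothesis HN : forall z, N' z -> forall w, cabs (w - z) <= 4 * r -> N w.
Hypothesis Hf : deriv_on N f df.
Hypothesis HM : forall w, N w -> cabs (f w) <= M.

Lemma deriv_bound z : N' z -> cabs (df z) <= M / r.
Proof.
move=> Nz; apply: (@cauchy_estimate R N f df z r) => // w wz.
  by apply: (HN Nz); have := r0; lra.
by apply: HM; apply: (HN Nz); have := r0; lra.
Qed.

(** The margin [4 * r] around [N'] is spent step by step: Cauchy's estimate bounds [df] up to
    distance [3 * r], and circles of radius [r] then give Lipschitz and Taylor estimates up to
    distance [2 * r]. *)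
Let df_bound z u : N' z -> cabs (u - z) <= 3 * r -> cabs (df u) <= M / r.
Proof.
move=> Nz uz; have H w : cabs (w - u) <= r -> N w.
  by move=> wu; apply: (HN Nz); have := cabs_dist w z u; lra.
by apply: (@cauchy_estimate R N f df u r) => // w /H; exact: HM.
Qed.

Let dist_seg (u v z : R[i]) (t rho : R) : 0 <= t <= 1 ->
  cabs (u - z) <= rho -> cabs (v - z) <= rho -> cabs (u + t%:C * (v - u) - z) <= rho.
Proof.
move=> /andP[t0 t1] h1 h2.
rewrite (_ : _ - z = (1 - t)%:C * (u - z) + t%:C * (v - z)); last by rewrite rmorphB rmorph1; ring.
apply: (le_trans (cabsD _ _)); rewrite !cabsM !cabs_real !ger0_norm ?subr_ge0 //.
have p1 : (1 - t) * cabs (u - z) <= (1 - t) * rho by apply: ler_wpM2l => //; lra.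
have p2 : t * cabs (v - z) <= t * rho by apply: ler_wpM2l.
by lra.
Qed.

Let M0 z : N' z -> 0 <= M.
Proof. by move=> Nz; apply: le_trans (cabs_ge0 _) (HM (HN Nz (w := z) _)); rewrite subrr cabs0; have := r0; lra. Qed.

Let f_lip z u v : N' z -> cabs (u - z) <= 3 * r -> cabs (v - z) <= 3 * r ->
  cabs (f v - f u) <= M / r * cabs (v - u).
Proof.
move=> Nz uz vz; apply: (@segment_mean_value R N f df) => // t t01.
  by apply: (HN Nz); have := dist_seg t01 uz vz; have := r0; lra.
by apply: (df_bound Nz); exact: dist_seg.
Qed.

Let near_circle z u t : cabs (u - z) <= 2 * r -> cabs (u + r%:C * cis t - z) <= 3 * r.
Proof.
move=> uz; rewrite addrAC; apply: (le_trans (cabsD _ _)).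
by rewrite cabsM cabs_cis mulr1 cabs_real gtr0_norm //; lra.
Qed.

Let disc_sub z u : N' z -> cabs (u - z) <= 2 * r -> forall w, cabs (w - u) <= r -> N w.
Proof.
move=> Nz uz w wu; apply: (HN Nz); have := cabs_dist w z u; have := r0; lra.
Qed.

Let rp : 0 < r * (pi *+ 2).
Proof. by rewrite mulr_gt0 // pi2_gt0. Qed.

Let cutdown (X : R[i]) Y : cabs ((r * (pi *+ 2))%:C * X) <= Y * r * (pi *+ 2) -> cabs X <= Y.
Proof.
have := rp => h; rewrite cabsM cabs_real gtr0_norm // -[Y * r * _]mulrA [leLHS]mulrC ler_pM2r //.
Qed.

Let intg2pi (g : R -> R[i]) Y : rcont 0 (pi *+ 2) g ->
  (forall t, cabs (g t) <= Y) -> cabs (intg g 0 (pi *+ 2)) <= Y * (pi *+ 2).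
Proof.
have p0 := @pi2_gt0 R; move=> gc gY.
rewrite (_ : Y * _ = Y * `|pi *+ 2 - 0|); last by rewrite subr0 gtr0_norm.
by apply: (@intg_bound R 0 (pi *+ 2)); rewrite ?lexx ?(ltW p0).
Qed.

(** Cauchy's formulas at [u] and [v] are subtracted on circles of equal radius, so that
    corresponding points differ by [v - u] and the Lipschitz bound for [f] applies under the
    integral. *)
Let df_lip z u v : N' z -> cabs (u - z) <= 2 * r -> cabs (v - z) <= 2 * r ->
  cabs (df v - df u) <= M / r ^+ 2 * cabs (v - u).
Proof.
move=> Nz uz vz; have p0 := @pi2_gt0 R; apply: cutdown.
have cu := circle_rcont r0 (disc_sub Nz uz) Hf.
have cv := circle_rcont r0 (disc_sub Nz vz) Hf.
have cu' : rcont 0 (pi *+ 2) (fun t => - (cisN t * f (u + r%:C * cis t))).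
  by move=> t ht; apply: wcN; exact: cu.
have E : intg (fun t => - (cisN t * f (u + r%:C * cis t))) 0 (pi *+ 2)
   = - intg (fun t => cisN t * f (u + r%:C * cis t)) 0 (pi *+ 2).
  rewrite -mulN1r -(intgZ _ cu) ?lexx ?(ltW p0) //.
  by congr (intg _ _ _); apply/funext => t; rewrite mulN1r.
rewrite mulrBr -(circle_deriv r0 (disc_sub Nz uz) Hf) -(circle_deriv r0 (disc_sub Nz vz) Hf).
rewrite -E -(intgD cv cu') ?lexx ?(ltW p0) //.
apply: intg2pi => [t ht|t]; first by apply: wcD; [exact: cv|exact: cu'].
rewrite -mulrBr cabsM cabs_cisN mul1r.
have := f_lip Nz (near_circle t uz) (near_circle t vz).
rewrite (_ : v + _ - _ = v - u); last by ring.
rewrite (_ : M / r ^+ 2 * _ * r = M / r * cabs (v - u)) //.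
by field; rewrite gt_eqF.
Qed.

Let f_taylor z u v : N' z -> cabs (u - z) <= 2 * r -> cabs (v - z) <= 2 * r ->
  cabs (f v - f u - (v - u) * df u) <= M / r ^+ 2 * cabs (v - u) * cabs (v - u).
Proof.
move=> Nz uz vz.
have := @segment_mean_value R N (fun w => f w - w * df u) (fun w => df w - df u) u v
   (M / r ^+ 2 * cabs (v - u)).
rewrite (_ : f v - v * df u - (f u - u * df u) = f v - f u - (v - u) * df u); last by ring.
apply.
- move=> t t01; apply: (HN Nz); have := dist_seg t01 uz vz; have := r0; lra.
- move=> w Nw; apply: wdB; first exact: Hf.
  by apply: (wd_eq (wdM (wd_id _ _ _) (wd_cst _ _ _ _))); rewrite mul1r mulr0 addr0.
move=> t t01; apply: (le_trans (df_lip Nz uz (dist_seg t01 uz vz))).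
apply: ler_wpM2l; first by rewrite divr_ge0 ?exprn_ge0 ?(ltW r0) // (M0 Nz).
rewrite addrC addKr cabsM cabs_real; case/andP: t01 => t0 t1.
by rewrite ger0_norm // ler_piMl // cabs_ge0.
Qed.

(** Cauchy's formula for [df] is differentiated under the integral sign. The candidate [l] averages
    [df] over a circle as that formula averages [f], and [f_taylor] bounds the remainder
    quadratically. *)
Lemma second_deriv : exists2 ddf, deriv_on N' df ddf &
  forall z, N' z -> cabs (ddf z) <= M / r ^+ 2.
Proof.
have p0 := @pi2_gt0 R.
pose l z := (r * (pi *+ 2))^-1%:C * intg (fun t => cisN t * df (z + r%:C * cis t)) 0 (pi *+ 2).
have cdf z : N' z -> rcont 0 (pi *+ 2) (fun t => cisN t * df (z + r%:C * cis t)).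
  move=> Nz t _; apply: wcM; first exact: wd_wc (rwd_cisN _ t).
  apply: (@rwc_path _ _ [set w | cabs (w - z) <= r]) => [s _||].
  - by rewrite /= addrC addKr cabsM cabs_cis mulr1 cabs_real gtr0_norm.
  - apply: wcD; first exact: wc_cst.
    by apply: wcZ; exact: wd_wc (rwd_cis _ t).
  set u := z + _; have uz : cabs (u - z) <= r.
    by rewrite addrC addKr cabsM cabs_cis mulr1 cabs_real gtr0_norm.
  have L0 : 0 < M / r ^+ 2 + 1.
    by rewrite ltr_wpDl // divr_ge0 ?exprn_ge0 ?(ltW r0) // (M0 Nz).
  move=> e e0; exists (e / (M / r ^+ 2 + 1)); first by rewrite divr_gt0.
  move=> w /= wz wu; have := r0 => rr.
  apply: (le_trans (@df_lip z u w Nz _ _)); try lra.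
  apply: (@le_trans _ _ ((M / r ^+ 2 + 1) * cabs (w - u))).
    by apply: ler_wpM2r; [exact: cabs_ge0|lra].
  by rewrite mulrC -ler_pdivlMr // ltW.
have lE z : (r * (pi *+ 2))%:C * l z = intg (fun t => cisN t * df (z + r%:C * cis t)) 0 (pi *+ 2).
  by rewrite /l mulrA -rmorphM divff ?gt_eqF ?rp // mul1r.
exists l => [z Nz|z Nz]; last first.
  apply: cutdown; rewrite lE; apply: intg2pi; first exact: cdf.
  move=> t; rewrite cabsM cabs_cisN mul1r.
  rewrite (_ : M / r ^+ 2 * r = M / r); last by field; rewrite gt_eqF.
  apply: (df_bound Nz); rewrite addrC addKr cabsM cabs_cis mulr1 cabs_real gtr0_norm //.
  by have := r0; lra.
move=> e e0.
pose Q := M / r ^+ 3; have Q0 : 0 <= Q by rewrite divr_ge0 ?exprn_ge0 ?(ltW r0) // (M0 Nz).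
exists (Num.min r (e / (Q + 1))); first by rewrite lt_min r0 divr_gt0 // ltr_wpDl.
move=> w Nw; rewrite /= lt_min => /andP[wr we].
have zz : cabs (z - z) <= 2 * r by rewrite subrr cabs0; have := r0; lra.
have wz : cabs (w - z) <= 2 * r by have := r0; lra.
have cz := circle_rcont r0 (disc_sub Nz zz) Hf.
have cw := circle_rcont r0 (disc_sub Nz wz) Hf.
have cz' : rcont 0 (pi *+ 2) (fun t => -1 * (cisN t * f (z + r%:C * cis t))).
  by move=> t ht; apply: wcZ; exact: cz.
have cl' : rcont 0 (pi *+ 2) (fun t => - (w - z) * (cisN t * df (z + r%:C * cis t))).
  by move=> t ht; apply: wcZ; exact: cdf.
apply: (@le_trans _ _ (Q * cabs (w - z) * cabs (w - z))); last first.
  apply: ler_wpM2r; first exact: cabs_ge0.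
  have Q1 : 0 < Q + 1 by lra.
  have : (Q + 1) * cabs (w - z) <= e by rewrite mulrC -ler_pdivlMr // ltW.
  by have := cabs_ge0 (w - z); nra.
apply: cutdown; rewrite /= !mulrBr mulrCA lE.
rewrite -(circle_deriv r0 (disc_sub Nz zz) Hf) -(circle_deriv r0 (disc_sub Nz wz) Hf).
rewrite -[X in _ - X - _]mul1r -!mulNr.
rewrite -(intgZ _ cz) ?lexx ?(ltW p0) // -(intgZ _ (cdf _ Nz)) ?lexx ?(ltW p0) //.
have cwz : rcont 0 (pi *+ 2) (fun t => cisN t * f (w + r%:C * cis t)
    + -1 * (cisN t * f (z + r%:C * cis t))).
  by move=> t ht; apply: wcD; [exact: cw|exact: cz'].
rewrite -(intgD cw cz') ?lexx ?(ltW p0) // -(intgD cwz cl') ?lexx ?(ltW p0) //.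
apply: intg2pi => [t ht|t]; first by apply: wcD; [exact: cwz|exact: cl'].
set a : R[i] := z + r%:C * cis t; set b : R[i] := w + r%:C * cis t.
have ba : b - a = w - z by rewrite /a /b; ring.
rewrite -ba (_ : cisN t * f b + _ + _ = cisN t * (f b - f a - (b - a) * df a)); last by ring.
have az : cabs (a - z) <= 2 * r.
  by rewrite /a addrC addKr cabsM cabs_cis mulr1 cabs_real gtr0_norm //; have := r0; lra.
have bz : cabs (b - z) <= 2 * r.
  rewrite /b addrAC; apply: (le_trans (cabsD _ _)).
  by rewrite cabsM cabs_cis mulr1 cabs_real gtr0_norm //; lra.
rewrite cabsM cabs_cisN mul1r; apply: (le_trans (f_taylor Nz az bz)).
rewrite le_eqVlt; apply/orP; left; apply/eqP; rewrite /Q; field.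
by rewrite gt_eqF.
Qed.

End SecondDerivative.

(** * Linear equations in a box *)

Section Sequences.
Context {R : realType}.

Lemma geometric_cvg_real (x : nat -> R) C :
  (forall n, `|x n.+1 - x n| <= C / 2 ^+ n) ->
  exists l, forall n, `|x n - l| <= 2 * C / 2 ^+ n.
Proof.
move=> H; pose lo n := x n - 2 * C / 2 ^+ n; pose hi n := x n + 2 * C / 2 ^+ n.
have hS n : 2 * C / 2 ^+ n.+1 = C / 2 ^+ n.
  by rewrite exprS; field; rewrite expf_neq0.
have C0 n : 0 <= C / 2 ^+ n by apply: le_trans (H n); exact: normr_ge0.
have C02 n : 0 <= 2 * C / 2 ^+ n by rewrite -mulrA mulr_ge0.
have hE n : 2 * C / 2 ^+ n = C / 2 ^+ n + C / 2 ^+ n by rewrite -mulrA; ring.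
have lo_mono n k : lo n <= lo (n + k)%N.
  elim: k => [|k IH]; rewrite ?addn0 // addnS (le_trans IH) // /lo hS hE.
  by have := H (n + k)%N; rewrite ler_norml => /andP[h1 h2]; lra.
have hi_mono n k : hi (n + k)%N <= hi n.
  elim: k => [|k IH]; rewrite ?addn0 // addnS (le_trans _ IH) // /hi hS hE.
  by have := H (n + k)%N; rewrite ler_norml => /andP[h1 h2]; lra.
have lohi n k : lo n <= hi k.
  apply: (le_trans (lo_mono n k)); rewrite addnC; apply: (le_trans _ (hi_mono k n)).
  by rewrite /lo /hi; have := C02 (k + n)%N; lra.
have hs : has_sup (range lo).
  by split; [exists (lo 0%N); exists 0%N | exists (hi 0%N) => _ [n _ <-]].
exists (sup (range lo)) => n.
have h1 : lo n <= sup (range lo) by apply: (ub_le_sup hs.2); exists n.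
have h2 : sup (range lo) <= hi n by apply: (ge_sup hs.1) => _ [k _ <-].
by rewrite ler_norml; rewrite /lo /hi in h1 h2; apply/andP; split; lra.
Qed.

Lemma geometric_cvg (x : nat -> R[i]) C :
  (forall n, cabs (x n.+1 - x n) <= C / 2 ^+ n) ->
  exists l, forall n, cabs (x n - l) <= 4 * C / 2 ^+ n.
Proof.
move=> H.
have [|a Ha] := @geometric_cvg_real (fun n => cRe (x n)) C.
  by move=> n; rewrite -cReN -cReD; apply: le_trans (Re_le_cabs _) (H n).
have [|b Hb] := @geometric_cvg_real (fun n => cIm (x n)) C.
  by move=> n; rewrite -cImN -cImD; apply: le_trans (Im_le_cabs _) (H n).
exists (a +i* b) => n; apply: (le_trans (cabs_le_ReIm _)).
rewrite cReD cImD cReN cImN /=.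
have -> : 4 * C / 2 ^+ n = 2 * C / 2 ^+ n + 2 * C / 2 ^+ n by rewrite -!mulrA; ring.
exact: lerD.
Qed.

End Sequences.

Section LinearODE.
Context {R : realType}.
Variables (a b c d : R).
Let N := box a b c d.
Implicit Types (f g W : R[i] -> R[i]) (z w y : R[i]).

Definition hol f := exists df, deriv_on N f df.

Lemma holD f g : hol f -> hol g -> hol (fun z => f z + g z).
Proof.
move=> [df Hf] [dg Hg]; exists (fun z => df z + dg z) => z Nz.
by apply: wdD; [exact: Hf|exact: Hg].
Qed.

Lemma holM f g : hol f -> hol g -> hol (fun z => f z * g z).
Proof.
move=> [df Hf] [dg Hg]; exists (fun z => df z * g z + f z * dg z) => z Nz.
by apply: wdM; [exact: Hf|exact: Hg].
Qed.

Lemma hol_cst k : hol (fun=> k).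
Proof. by exists (fun=> 0) => z _; exact: wd_cst. Qed.

Lemma hol_primitive z0 f : hol f -> exists F, deriv_on N F f /\ F z0 = 0.
Proof.
move=> [df Hf]; have [F HF] := box_primitive Hf.
exists (fun z => F z - F z0); split; last by rewrite subrr.
move=> z Nz; apply: (wd_eq (wdB (HF z Nz) (wd_cst _ _ _ _))).
by rewrite subr0.
Qed.

(** Each integration gains a factor 1 / lam in the norm weighted by [expR (lam * cabs (z - z0))].
    With [lam] large, Picard iteration contracts on the whole box, whatever its size. *)
Lemma weighted_primitive z0 F g A lam : N z0 -> deriv_on N F g -> F z0 = 0 ->
  0 < lam -> (forall z, N z -> cabs (g z) <= A * expR (lam * cabs (z - z0))) ->
  forall z, N z -> cabs (F z) <= A / lam * expR (lam * cabs (z - z0)).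
Proof.
move=> Nz0 HF F0 lam0 Hg z Nz.
have A0 : 0 <= A.
  have := Hg z0 Nz0; rewrite subrr cabs0 mulr0 expR0 mulr1.
  by apply: le_trans; exact: cabs_ge0.
set k := cabs (z - z0); have k0 : 0 <= k by exact: cabs_ge0.
have seg01 t : 0 <= t <= 1 -> N (z0 + t%:C * (z - z0)) by move=> ?; exact: box_convex.
pose G t := F (z0 + t%:C * (z - z0)).
have -> : F z = G 1 - G 0.
  by rewrite /G rmorph1 rmorph0 mul1r mul0r addr0 F0 subr0 subrKC.
apply: (@le_trans _ _ (A / lam * expR (1 * (lam * k)) - A / lam * expR (0 * (lam * k)))).
  apply: (@mean_value_ineq R 0 1 G (fun t => g (z0 + t%:C * (z - z0)) * (z - z0))
    (fun t => A / lam * expR (t * (lam * k))) (fun t => A * k * expR (t * (lam * k)))) => //.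
  - move=> t t01; apply: (@rwd_path _ _ N) => //; first exact: rwd_segment.
    by apply: HF; exact: seg01.
  - move=> t t01.
    have D := real_deriv_scaled (lam * k) t (fun s => is_derive_rwd (is_derive_expR s)).
    apply: (@wd_ext _ _ _ _ (fun t => (A / lam)%:C * (expR (t * (lam * k)))%:C)) => //.
      by move=> s _; rewrite -rmorphM.
    apply: (wd_eq (wdZ _ (wd_sub (subsetT _) D))).
    by rewrite -!rmorphM; congr (_%:C); field; rewrite gt_eqF.
  move=> t t01; rewrite cabsM -/k mulrAC; apply: ler_wpM2r => //.
  apply: (le_trans (Hg _ (seg01 t t01))).
  rewrite addrC addKr cabsM cabs_real -/k ger0_norm; last by case/andP: t01.
  by rewrite mulrCA.
rewrite mul1r mul0r expR0 mulr1 gerBl.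
by rewrite divr_ge0 // ltW.
Qed.

(** The mean value inequality turns the uniform convergence of the derivatives into a bound on
    Taylor remainders that does not depend on the index, and so passes to the limit. *)
Lemma limit_deriv (F g : nat -> R[i] -> R[i]) F' g' C :
  (forall n, deriv_on N (F n) (g n)) -> (forall n, hol (g n)) ->
  (forall n z, N z -> cabs (F n z - F' z) <= C / 2 ^+ n) ->
  (forall n z, N z -> cabs (g n z - g' z) <= C / 2 ^+ n) ->
  deriv_on N F' g'.
Proof.
move=> HF Hg HF' Hg' z Nz e e0.
have e8 : 0 < e / 8 by rewrite divr_gt0.
(* The index [n] depends on [e] only and yields the radius [dl]; the index [m] below also depends on
   [w], since the error in [F] has to be small relative to [cabs (w - z)]. *)
have [n Hn] := half_pow_small C e8.
have [dg Hdg] := Hg n.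
have [dl dl0 Hdl] := wd_wc (Hdg z Nz) e8.
exists dl => // w Nw /= wz.
have [->|wz0] := eqVneq w z; first by rewrite !subrr mul0r subrr cabs0 mulr0.
set k := cabs (w - z) in wz *.
have k0 : 0 < k by rewrite cabs_gt0 subr_eq0.
have e1 : 0 < Num.min (e / 8) (e * k / 8) by rewrite lt_min e8 divr_gt0 ?mulr_gt0.
have [m] := half_pow_small C e1.
rewrite lt_min => /andP[Hm1 Hm2].
have S : cabs (F m w - F m z - (w - z) * g m z) <= (e / 8 + e / 8 + e / 8 + e / 8 + e / 8) * k.
  have := @segment_mean_value R N (fun y => F m y - y * g m z) (fun y => g m y - g m z) z w
     (e / 8 + e / 8 + e / 8 + e / 8 + e / 8).
  rewrite (_ : F m w - w * g m z - (F m z - z * g m z) = F m w - F m z - (w - z) * g m z);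
    last by ring.
  apply.
  - by move=> t t01; exact: box_convex.
  - move=> y Ny; apply: wdB; first exact: HF.
    by apply: (wd_eq (wdM (wd_id _ _ _) (wd_cst _ _ _ _))); rewrite mul1r mulr0 addr0.
  move=> t t01; set u := z + _.
  have Nu : N u by exact: box_convex.
  have uz : cabs (u - z) < dl.
    apply: le_lt_trans wz; rewrite addrC addKr cabsM cabs_real.
    by case/andP: t01 => t0 t1; rewrite ger0_norm // ler_piMl // cabs_ge0.
  rewrite (_ : g m u - g m z = (g m u - g' u) - (g n u - g' u) + (g n u - g n z)
     + (g n z - g' z) - (g m z - g' z)); last by ring.
  have := Hg' m u Nu; have := Hg' n u Nu; have := Hg' n z Nz; have := Hg' m z Nz.
  have := Hdl u Nu uz => h1 h2 h3 h4 h5.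
  apply: (le_trans (cabs_sub_le _ _)); apply: lerD; last by lra.
  apply: (le_trans (cabsD _ _)); apply: lerD; last by lra.
  apply: (le_trans (cabsD _ _)); apply: lerD => //.
  by apply: (le_trans (cabs_sub_le _ _)); apply: lerD; lra.
rewrite (_ : _ - _ - _ = (F m w - F m z - (w - z) * g m z) - (F m w - F' w)
   + (F m z - F' z) + (w - z) * (g m z - g' z)); last by ring.
have := HF' m w Nw; have := HF' m z Nz; have := Hg' m z Nz => h1 h2 h3.
apply: (le_trans (cabsD _ _)); rewrite cabsM -/k.
have : k * cabs (g m z - g' z) <= k * (e / 8) by apply: ler_wpM2l; [exact: ltW|lra].
have := cabsD (F m w - F m z - (w - z) * g m z - (F m w - F' w)) (F m z - F' z).
have := cabs_sub_le (F m w - F m z - (w - z) * g m z) (F m w - F' w).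
lra.
Qed.

(** Picard iteration for the first-order system in [(u, v)]. Primitives exist on the whole box, so
    the solutions are holomorphic there and can be followed along curved paths. *)
Lemma linear_ode_exists W M z0 u0 v0 : hol W ->
  (forall z, N z -> cabs (W z) <= M) -> N z0 ->
  exists u v, [/\ deriv_on N u v, deriv_on N v (fun z => W z * u z), u z0 = u0 & v z0 = v0].
Proof.
move=> HW WM Nz0.
have M0 : 0 <= M by apply: le_trans (cabs_ge0 _) (WM z0 Nz0).
have [P HP] : exists P : (R[i] -> R[i]) -> R[i] -> R[i],
    forall f, hol f -> deriv_on N (P f) f /\ P f z0 = 0.
  have H f : exists F, hol f -> deriv_on N F f /\ F z0 = 0.
    have [hf|hf] := pselect (hol f); last by exists f.
    by have [F HF] := hol_primitive z0 hf; exists F.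
  by have [P HP] := choice H; exists P.
pose s := fix s n : (R[i] -> R[i]) * (R[i] -> R[i]) := if n is m.+1 then
   ((fun z => u0 + P (s m).2 z), (fun z => v0 + P (fun y => W y * (s m).1 y) z))
  else ((fun=> u0), (fun=> v0)).
pose u n := (s n).1; pose v n := (s n).2.
have hs n : hol (u n) /\ hol (v n).
  elim: n => [|n [hu hv]]; first by split; exact: hol_cst.
  have [D1 _] := HP _ hv; have [D2 _] := HP _ (holM HW hu).
  split; (apply: holD; first exact: hol_cst); first by exists (v n).
  by exists (fun z => W z * u n z).
have du n : deriv_on N (u n.+1) (v n).
  move=> z Nz; have [D _] := HP _ (hs n).2.
  by apply: (wd_eq (wdD (wd_cst _ _ _ _) (D z Nz))); rewrite add0r.
have dv n : deriv_on N (v n.+1) (fun z => W z * u n z).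
  move=> z Nz; have [D _] := HP _ (holM HW (hs n).1).
  by apply: (wd_eq (wdD (wd_cst _ _ _ _) (D z Nz))); rewrite add0r.
have u0E n : u n.+1 z0 = u0 by rewrite /u /= (HP _ (hs n).2).2 addr0.
have v0E n : v n.+1 z0 = v0 by rewrite /v /= (HP _ (holM HW (hs n).1)).2 addr0.
(* This value makes both 1 / lam and M / lam at most 1/2, so both components contract by a factor
   2. *)
pose lam := 2 * (1 + M); have lam0 : 0 < lam by rewrite /lam; lra.
pose A := cabs u0 * M / lam + cabs v0 / lam.
have U0 := cabs_ge0 u0; have V0 := cabs_ge0 v0.
have L0 := ltW lam0.
have A1 : 0 <= cabs u0 * M / lam by apply: divr_ge0 => //; exact: mulr_ge0.
have A2 : 0 <= cabs v0 / lam by exact: divr_ge0.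
have A0 : 0 <= A by exact: addr_ge0.
have ge1 z : 1 <= expR (lam * cabs (z - z0)).
  by rewrite -expR0 ler_expR mulr_ge0 ?cabs_ge0 // ltW.
have step n : (forall z, N z -> cabs (u n.+1 z - u n z) <= A / 2 ^+ n * expR (lam * cabs (z - z0)))
   /\ (forall z, N z -> cabs (v n.+1 z - v n z) <= A / 2 ^+ n * expR (lam * cabs (z - z0))).
  elim: n => [|n [IHu IHv]].
    rewrite expr0 divr1; split => z Nz.
      apply: (@le_trans _ _ (cabs v0 / lam * expR (lam * cabs (z - z0)))); last first.
        apply: ler_wpM2r; first exact: expR_ge0.
        by rewrite /A lerDr.
      apply: (@weighted_primitive z0 (fun z => u 1%N z - u 0%N z) (fun=> v0)) => //.
      - move=> y Ny; apply: (wd_eq (wdB (du 0%N y Ny) (wd_cst _ _ _ _))).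
        by rewrite subr0.
      - by rewrite u0E subrr.
      by move=> y Ny; rewrite ler_peMr.
    apply: (@le_trans _ _ (cabs u0 * M / lam * expR (lam * cabs (z - z0)))); last first.
      apply: ler_wpM2r; first exact: expR_ge0.
      by rewrite /A lerDl.
    apply: (@weighted_primitive z0 (fun z => v 1%N z - v 0%N z) (fun z => W z * u0)) => //.
    - move=> y Ny; apply: (wd_eq (wdB (dv 0%N y Ny) (wd_cst _ _ _ _))).
      by rewrite subr0.
    - by rewrite v0E subrr.
    move=> y Ny; rewrite cabsM mulrC; apply: (@le_trans _ _ (cabs u0 * M)).
      by apply: ler_wpM2l => //; exact: WM.
    by rewrite ler_peMr // mulr_ge0.
  have hA : A / 2 ^+ n.+1 = A / 2 ^+ n / 2 by rewrite exprS; field; rewrite expf_neq0.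
  have q0 : 0 <= A / 2 ^+ n by rewrite divr_ge0 // exprn_ge0.
  rewrite hA; split => z Nz.
    apply: (@le_trans _ _ (A / 2 ^+ n / lam * expR (lam * cabs (z - z0)))); last first.
      apply: ler_wpM2r; first exact: expR_ge0.
      apply: ler_wpM2l => //; rewrite lef_pV2 ?posrE //; rewrite /lam; lra.
    apply: (@weighted_primitive z0 (fun z => u n.+2 z - u n.+1 z) (fun z => v n.+1 z - v n z)) => //.
      by move=> y Ny; apply: wdB; exact: du.
    by rewrite !u0E subrr.
  apply: (@le_trans _ _ (A / 2 ^+ n * M / lam * expR (lam * cabs (z - z0)))); last first.
    apply: ler_wpM2r; first exact: expR_ge0.
    rewrite -mulrA; apply: ler_wpM2l => //; rewrite ler_pdivrMr // /lam; lra.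
  apply: (@weighted_primitive z0 (fun z => v n.+2 z - v n.+1 z)
    (fun z => W z * u n.+1 z - W z * u n z)) => //.
  - by move=> y Ny; apply: wdB; exact: dv.
  - by rewrite !v0E subrr.
  move=> y Ny; rewrite -mulrBr cabsM mulrC mulrAC.
  apply: ler_pM; rewrite ?cabs_ge0 //; first exact: IHu.
  exact: WM.
pose Dm := `|b - a| + `|d - c|.
pose C := A * expR (lam * Dm).
have dist z : N z -> cabs (z - z0) <= Dm.
  move=> [zx zy]; have [z0x z0y] := Nz0.
  apply: (le_trans (cabs_le_ReIm _)); rewrite cReD cImD cReN cImN.
  have := ler_norm (b - a); have := ler_norm (d - c) => h1 h2.
  by clear -zx zy z0x z0y h1 h2; apply: lerD; rewrite ler_norml; lra.
have weight z n : N z -> A / 2 ^+ n * expR (lam * cabs (z - z0)) <= C / 2 ^+ n.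
  move=> Nz; rewrite /C mulrAC; apply: ler_wpM2r; first by rewrite invr_ge0 exprn_ge0.
  by apply: ler_wpM2l => //; rewrite ler_expR; apply: ler_wpM2l; [exact: ltW|exact: dist].
have limu z : exists l, N z -> forall n, cabs (u n z - l) <= 4 * C / 2 ^+ n.
  have [Nz|nN] := pselect (N z); last by exists 0.
  have [|l Hl] := @geometric_cvg R (fun n => u n z) C; last by exists l.
  by move=> n; apply: le_trans (weight z n Nz); exact: (step n).1.
have limv z : exists l, N z -> forall n, cabs (v n z - l) <= 4 * C / 2 ^+ n.
  have [Nz|nN] := pselect (N z); last by exists 0.
  have [|l Hl] := @geometric_cvg R (fun n => v n z) C; last by exists l.
  by move=> n; apply: le_trans (weight z n Nz); exact: (step n).2.
have [U HU] := choice limu; have [V HV] := choice limv.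
have C0 : 0 <= C by rewrite mulr_ge0 // expR_ge0.
have pw n : 2 * (4 * C / 2 ^+ n.+1) = 4 * C / 2 ^+ n :> R.
  by rewrite exprS; field; rewrite expf_neq0.
have pw0 n : 0 <= 4 * C / 2 ^+ n by rewrite divr_ge0 ?mulr_ge0 ?exprn_ge0.
have ini (x : nat -> R[i]) l k : (forall n, x n.+1 = k) ->
    (forall n, cabs (x n - l) <= 4 * C / 2 ^+ n) -> l = k.
  move=> xk xl; apply/eqP; rewrite -subr_eq0; apply/eqP/cabs_small => e e0.
  have [n Hn] := half_pow_small (4 * C) e0.
  have := xl n.+1; rewrite xk cabsB => h; apply: (le_trans h).
  by have := pw n; have := pw0 n.+1; lra.
exists U, V; split.
- apply: (@limit_deriv (fun n => u n.+1) v U V (4 * C)) => //.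
  + by move=> n; exact: (hs n).2.
  + by move=> n z Nz; apply: (le_trans (HU z Nz n.+1)); have := pw n; have := pw0 n.+1; lra.
  + by move=> n z Nz; exact: HV.
- apply: (@limit_deriv (fun n => v n.+1) (fun n z => W z * u n z) V _ (4 * C * (1 + M))) => //.
  + by move=> n; apply: holM => //; exact: (hs n).1.
  + move=> n z Nz; apply: (le_trans (HV z Nz n.+1)).
    rewrite mulrAC; have := pw n; have := pw0 n.+1; have := pw0 n => *.
    have : 0 <= 4 * C / 2 ^+ n * M by rewrite mulr_ge0.
    lra.
  move=> n z Nz; rewrite -mulrBr cabsM mulrC mulrAC; apply: ler_pM; rewrite ?cabs_ge0 //.
    exact: HU.
  by have := WM z Nz; lra.
- by apply: (ini (fun n => u n z0)) => // n; exact: HU.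
- by apply: (ini (fun n => v n z0)) => // n; exact: HV.
Qed.

End LinearODE.

(** * WKB asymptotics along one arm *)

Section SquareRoot.
Context {R : realType}.
Implicit Types (z w : R[i]) (k : R).

Lemma Re_sqrtc_ge0 z : 0 <= cRe (sqrtc z).
Proof. by case: z => x y; rewrite /sqrtc /= sqrtr_ge0. Qed.

Lemma Re_add1 z : 0 <= cRe z -> 1 <= cabs (z + 1).
Proof.
move=> z0; apply: (le_trans _ (Re_le_cabs _)); rewrite cReD /= ger0_norm; lra.
Qed.

(** Factor z - 1 through the root: the principal root has nonnegative real part, so [sqrtc z + 1]
    has modulus at least 1. *)
Lemma sqrtc_sub1 z : cabs (sqrtc z - 1) <= cabs (z - 1).
Proof.
rewrite -[in X in _ <= X](sqr_sqrtc z).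
rewrite (_ : _ ^+ 2 - 1 = (sqrtc z - 1) * (sqrtc z + 1)); last by rewrite expr2; ring.
rewrite cabsM ler_peMr ?cabs_ge0 //; exact: Re_add1 (Re_sqrtc_ge0 z).
Qed.

Definition near1 : set R[i] := [set z | cabs (z - 1) <= 1 / 2].

Lemma Re_sqrtc_near1 z : near1 z -> 1 / 2 <= cRe (sqrtc z).
Proof.
move=> hz; have h := le_trans (Re_le_cabs _) (le_trans (sqrtc_sub1 z) hz).
by move: h; rewrite cReD cReN /= ler_norml => /andP[h1 h2]; lra.
Qed.

Lemma sqrtc_sum z w : near1 z -> near1 w -> 1 <= cabs (sqrtc z + sqrtc w).
Proof.
move=> hz hw; apply: (le_trans _ (le_trans (ler_norm _) (Re_le_cabs _))).
by rewrite cReD; have := Re_sqrtc_near1 hz; have := Re_sqrtc_near1 hw; lra.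
Qed.

Lemma sqrtc_near1_neq0 z : near1 z -> sqrtc z != 0.
Proof.
move=> hz; rewrite -cabs_gt0; apply: (lt_le_trans _ (le_trans (ler_norm _) (Re_le_cabs _))).
by apply: lt_le_trans (Re_sqrtc_near1 hz); rewrite divr_gt0.
Qed.

Lemma sqrtc_lip z w : near1 z -> near1 w -> cabs (sqrtc z - sqrtc w) <= cabs (z - w).
Proof.
move=> hz hw; rewrite -[in X in _ <= X](sqr_sqrtc z) -[in X in _ <= X](sqr_sqrtc w).
rewrite (_ : _ ^+ 2 - _ = (sqrtc z - sqrtc w) * (sqrtc z + sqrtc w)); last by rewrite !expr2; ring.
by rewrite cabsM ler_peMr ?cabs_ge0 //; exact: sqrtc_sum.
Qed.

Lemma cwd_sqrtc z : near1 z -> cwd near1 (@sqrtc R) z (2 * sqrtc z)^-1.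
Proof.
move=> hz e e0; exists e => // w hw /= wz.
have sw := sqrtc_sum hw hz; have sz := sqrtc_sum hz hz.
set y := sqrtc w in sw *; set x := sqrtc z in sw sz *.
have x0 : x != 0 by exact: sqrtc_near1_neq0.
have yx0 : y + x != 0 by rewrite -cabs_gt0 (lt_le_trans _ sw).
have wzE : w - z = (y - x) * (y + x).
  by rewrite -(sqr_sqrtc w) -(sqr_sqrtc z) -/x -/y !expr2; ring.
have -> : y - x - (w - z) * (2 * x)^-1 = - ((w - z) * (y - x) / ((y + x) * (x + x))).
  rewrite wzE; field; rewrite x0 yx0 !andbT -cabs_gt0.
  exact: lt_le_trans ltr01 sz.
rewrite cabsN !cabsM cabsV cabsM.
apply: (@le_trans _ _ (cabs (w - z) * cabs (y - x))).
  rewrite ler_piMr ?mulr_ge0 ?cabs_ge0 // invf_le1 ?mulr_gt0 //.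
  - by rewrite mulr_ege1.
  - by rewrite (lt_le_trans _ sw).
  by rewrite (lt_le_trans _ sz).
rewrite mulrC; apply: ler_wpM2r; first exact: cabs_ge0.
by apply: le_trans (sqrtc_lip hw hz) _; exact: ltW.
Qed.

End SquareRoot.

(** * Paths along which the action is affine *)

Section Path.
Context {R : realType}.
Variables (a b c d : R).
Let N := box a b c d.
Variables (S g : R[i] -> R[i]) (z0 z1 : R[i]) (r k : R).
Hypotheses (r0 : 0 < r) (k0 : 0 < k) (k4 : k <= 1 / 4).
Let L := z1 - z0.
Hypothesis kr : k * (r + 2 * cabs L) <= r.
Hypothesis tube : forall t : R, 0 <= t <= 1 -> forall w, cabs (w - (z0 + t%:C * L)) <= r -> N w.
Hypothesis HS : deriv_on N S g.
Hypothesis g1 : forall z, N z -> cabs (g z - 1) <= k.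

Let quasi_id z w : N z -> N w -> cabs (S w - S z - (w - z)) <= k * cabs (w - z).
Proof.
move=> Nz Nw; have := @segment_mean_value R N (fun z => S z - z) (fun z => g z - 1) z w k.
rewrite (_ : S w - w - (S z - z) = S w - S z - (w - z)); last by ring.
apply.
- by move=> t t01; exact: box_convex.
- by move=> y Ny; apply: wdB; [exact: HS|exact: wd_id].
by move=> t t01; apply: g1; exact: box_convex.
Qed.

Let expand z w : N z -> N w -> cabs (w - z) <= 2 * cabs (S w - S z).
Proof.
move=> Nz Nw; have := quasi_id Nz Nw; rewrite cabsB => h.
have := cabs_triangle (w - z) (S w - S z).
have : k * cabs (w - z) <= 1 / 4 * cabs (w - z) by apply: ler_wpM2r => //; exact: cabs_ge0.
have := cabs_ge0 (S w - S z); lra.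
Qed.

Let Nz0 : N z0.
Proof. by apply: (tube (t := 0)); rewrite ?lexx ?ler01 // rmorph0 mul0r addr0 subrr cabs0 ltW. Qed.

Let Nz1 : N z1.
Proof.
apply: (tube (t := 1)); rewrite ?lexx ?ler01 //.
by rewrite rmorph1 mul1r /L subrKC subrr cabs0 ltW.
Qed.

Let sg := S z1 - S z0.

(** Since [g] is within [k] of 1, [S] minus the identity is [k]-Lipschitz. The equation is thus the
    fixed point problem of a contraction [T], iterated from the point [m] of the straight
    segment. *)
Let path_point (t : R) : 0 <= t <= 1 ->
  exists2 z, N z & S z - S z0 = t%:C * sg.
Proof.
move=> t01; set m := z0 + t%:C * L; have Nt := tube t01; rewrite -/m in Nt.
pose T z := z - (S z - S z0) + t%:C * sg.
have sgL : cabs (sg - L) <= k * cabs L by exact: quasi_id.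
have tk : cabs (t%:C * (sg - L)) <= k * cabs L.
  rewrite cabsM cabs_real; case/andP: t01 => t0 t1; rewrite ger0_norm //.
  by apply: le_trans sgL; rewrite ler_piMl // cabs_ge0.
have tL : cabs (m - z0) <= cabs L.
  rewrite /m addrC addKr cabsM cabs_real; case/andP: t01 => t0 t1; rewrite ger0_norm //.
  by rewrite ler_piMl // cabs_ge0.
(* The distance from [T z] to [m] is at most k |L| + k (r + |L|), which is where the hypothesis [kr]
   comes from. *)
have TB z : cabs (z - m) <= r -> cabs (T z - m) <= r.
  move=> zm; have Nz := Nt _ zm; apply: le_trans kr.
  rewrite (_ : T z - m = t%:C * (sg - L) - (S z - S z0 - (z - z0))); last by rewrite /T /m; ring.
  apply: (le_trans (cabs_sub_le _ _)); have := quasi_id Nz0 Nz.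
  have : k * cabs (z - z0) <= k * (r + cabs L).
    apply: ler_wpM2l; first exact: ltW.
    by apply: (le_trans (cabs_dist _ _ m)); exact: lerD.
  by rewrite mulrDr [k * (r + _)]mulrDr; lra.
have TT z w : N z -> N w -> cabs (T w - T z) <= k * cabs (w - z).
  move=> Nz Nw; rewrite (_ : T w - T z = - (S w - S z - (w - z))); last by rewrite /T; ring.
  by rewrite cabsN; exact: quasi_id.
pose x n := iter n T m.
have xB n : cabs (x n - m) <= r.
  elim: n => [|n IH]; first by rewrite subrr cabs0 ltW.
  exact: TB.
have xN n : N (x n) by exact: Nt.
have step n : cabs (x n.+1 - x n) <= r / 2 ^+ n.
  elim: n => [|n IH]; first by rewrite expr0 divr1; exact: (xB 1%N).
  apply: (le_trans (TT _ _ (xN n) (xN n.+1))).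
  apply: (@le_trans _ _ (1 / 2 * (r / 2 ^+ n))).
    apply: ler_pM; rewrite ?cabs_ge0 //; first exact: ltW.
    by have := k4; lra.
  by rewrite exprS le_eqVlt; apply/orP; left; apply/eqP; field; rewrite expf_neq0.
have [l Hl] := geometric_cvg step.
have small n : 4 * r / 2 ^+ n.+1 <= 4 * r / 2 ^+ n.
  apply: ler_wpM2l; first by rewrite mulr_ge0 // ltW.
  have p2 : (0 : R) < 2 ^+ n by rewrite exprn_gt0.
  by rewrite lef_pV2 ?posrE ?exprn_gt0 // exprS; lra.
have lm : cabs (l - m) <= r.
  apply/ler_addgt0Pr => e e0; have [n Hn] := half_pow_small (4 * r) e0.
  apply: (le_trans (cabs_dist _ _ (x n))); rewrite addrC; apply: lerD; first exact: xB.
  by rewrite cabsB; apply: le_trans (Hl n) _; exact: ltW.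
have Nl := Nt _ lm; exists l => //.
have Tl : T l - l = 0.
  apply: cabs_small => e e0; have e2 : 0 < e / 2 by rewrite divr_gt0.
  have [n Hn] := half_pow_small (4 * r) e2.
  rewrite (_ : T l - l = (T l - T (x n)) + (x n.+1 - l)); last by rewrite /x /=; ring.
  apply: (le_trans (cabsD _ _)).
  have h1 := TT _ _ (xN n) Nl; have h2 := Hl n; have h3 := Hl n.+1.
  rewrite cabsB in h2.
  have : k * cabs (l - x n) <= 1 * cabs (l - x n).
    by apply: ler_wpM2r; [exact: cabs_ge0|have := k4; lra].
  by have := small n; lra.
apply/eqP; rewrite -subr_eq0 -oppr_eq0 -Tl /T; apply/eqP; ring.
Qed.

(** [S] is injective by [expand], so the points given by [path_point] form the preimage of the
    segment from [S z0] to [S z1]. The derivative is that of an inverse function, [expand] providing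
    the Lipschitz bound. *)
Lemma straightening_path : exists psi : R -> R[i],
  [/\ psi 0 = z0, psi 1 = z1, forall t, 0 <= t <= 1 -> N (psi t) &
      forall t, 0 <= t <= 1 -> rwd (seg 0 1) psi t (sg / g (psi t))].
Proof.
have H t : exists z, 0 <= t <= 1 -> N z /\ S z - S z0 = t%:C * sg.
  have [t01|nt] := pselect (0 <= t <= 1 : Prop); last by exists z0.
  by have [z Nz Sz] := path_point t01; exists z.
have [psi Hpsi] := choice H.
have inj z w : N z -> N w -> S z = S w -> z = w.
  move=> Nz Nw E; apply/eqP; rewrite -subr_eq0 -cabs_eq0 eq_le cabs_ge0 andbT.
  by have := expand Nw Nz; rewrite E subrr cabs0 mulr0.
exists psi; split.
- have [|h1 h2] := Hpsi 0; first by rewrite lexx ler01.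
  by apply: inj => //; apply/eqP; rewrite -subr_eq0 h2 rmorph0 mul0r.
- have [|h1 h2] := Hpsi 1; first by rewrite lexx ler01.
  apply: inj => //; move: h2; rewrite rmorph1 mul1r /sg => /eqP.
  by rewrite -subr_eq0 opprB addrA subrK subr_eq0 => /eqP.
- by move=> t /Hpsi[].
move=> t t01; have [Nt Et] := Hpsi t t01.
have gt : 1 / 2 <= cabs (g (psi t)).
  have := cabs_triangle 1 (g (psi t)); rewrite cabs1 (cabsB 1); have := g1 Nt; have := k4; lra.
have gt0 : g (psi t) != 0 by rewrite -cabs_gt0; lra.
move=> e e0; have sg0 := cabs_ge0 sg.
have e4 : 0 < e / (4 * (cabs sg + 1)) by rewrite divr_gt0 // mulr_gt0 //; lra.
have [dl dl0 Hdl] := HS Nt e4.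
exists (dl / (2 * (cabs sg + 1))); first by rewrite divr_gt0 // mulr_gt0 //; lra.
move=> s s01; rewrite cabs_rdist => st; have [Ns Es] := Hpsi s s01.
have SE : S (psi s) - S (psi t) = (s - t)%:C * sg.
  by rewrite rmorphB mulrBl -Es -Et; ring.
have close : cabs (psi s - psi t) <= 2 * (cabs sg + 1) * `|s - t|.
  apply: (le_trans (expand Nt Ns)); rewrite SE cabsM cabs_real.
  by have := normr_ge0 (s - t); nra.
have lt : cabs (psi s - psi t) < dl.
  by apply: (le_lt_trans close); rewrite mulrC -ltr_pdivlMr // mulr_gt0 //; lra.
have := Hdl _ Ns lt; rewrite /= SE => h.
rewrite (_ : _ - _ - _ = - ((s - t)%:C * sg - (psi s - psi t) * g (psi t)) / g (psi t)); last first.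
  by rewrite rmorphB; field.
rewrite cabsM cabsN cabsV ler_pdivrMr; last by rewrite cabs_gt0.
apply: (le_trans h); apply: (@le_trans _ _ (e / (4 * (cabs sg + 1)) * (2 * (cabs sg + 1) * `|s - t|))).
  by apply: ler_wpM2l => //; exact: ltW.
rewrite (_ : _ * _ = e * `|s - t| * (1 / 2)); last by field; rewrite gt_eqF //; lra.
by apply: ler_wpM2l => //; rewrite mulr_ge0 // ltW.
Qed.

End Path.

(** * Perturbation of the system solved by sinh and cosh *)

Section Volterra.
Context {R : realType}.
Implicit Types (X Y q : R -> R[i]) (tau : R[i]) (K : R).

Definition csinh (z : R[i]) := (cexp z - cexp (- z)) / 2.
Definition ccosh (z : R[i]) := (cexp z + cexp (- z)) / 2.

Lemma rwc_cabs A (F : R -> R[i]) x : rwc A F x -> rwc A (fun t => (cabs (F t))%:C) x.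
Proof.
move=> H e e0; have [dl dl0 Hd] := H e e0; exists dl => // s As sd.
apply: (le_trans _ (Hd s As sd)); rewrite cabs_rdist ler_norml.
have := cabs_triangle (F s) (F x); have := cabs_triangle (F x) (F s).
by rewrite (cabsB (F x)); lra.
Qed.

(** For [q = 0] the quantities [fp] and [fm] are constant. In general their derivatives are
    controlled by [em * X], hence by [phi], and the estimate closes at a point where [phi] is
    maximal. *)
Let volterra_ge0 X Y q tau K : 0 <= cRe tau -> K <= 1 / 2 ->
  X 0 = 0 -> Y 0 = 1 ->
  (forall s, 0 <= s <= 1 -> rwd (seg 0 1) X s (tau * Y s)) ->
  (forall s, 0 <= s <= 1 -> rwd (seg 0 1) Y s (tau * X s + q s * X s)) ->
  (forall s, 0 <= s <= 1 -> cabs (q s) <= K) ->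
  cabs (X 1 - csinh tau) <= 2 * K * expR (cRe tau) /\
  cabs (Y 1 - ccosh tau) <= 2 * K * expR (cRe tau).
Proof.
move=> tau0 K2 X0 Y0 HX HY Hq.
have i01 : 0 <= (0 : R) <= 1 by rewrite lexx ler01.
have i11 : 0 <= (1 : R) <= 1 by rewrite lexx ler01.
have K0 : 0 <= K by apply: le_trans (cabs_ge0 _) (Hq 0 i01).
pose ep (s : R) := cexp (s%:C * tau); pose em (s : R) := cexp (s%:C * - tau).
have epm s : ep s * em s = 1 by rewrite -cexpD mulrN subrr cexp0.
have cep s : cabs (ep s) = expR (s * cRe tau).
  by rewrite cabs_cexp cReM /= mul0r subr0.
have cem s : cabs (em s) = expR (- (s * cRe tau)).
  by rewrite cabs_cexp cReM /= mul0r subr0 cReN mulrN.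
pose fp s := em s * (X s + Y s); pose fm s := ep s * (X s - Y s).
(* The decaying weight compensates the possible growth of [fm] like [expR (2 * s * Re tau)]; without
   it the bound would not be uniform in [tau]. *)
pose phi s := cabs (fp s) + expR (- (2 * (s * cRe tau))) * cabs (fm s).
have XE s : X s = (ep s * fp s + em s * fm s) / 2.
  by rewrite /fp /fm !mulrA epm (mulrC (em s)) epm; field.
have YE s : Y s = (ep s * fp s - em s * fm s) / 2.
  by rewrite /fp /fm !mulrA epm (mulrC (em s)) epm; field.
have Dfp s : 0 <= s <= 1 -> rwd (seg 0 1) fp s (em s * (q s * X s)).
  move=> s01.
  apply: (wd_eq (wdM (wd_sub (@subsetT _ _) (rwd_cexp_line (- tau) s)) (wdD (HX s s01) (HY s s01)))).
  rewrite /em; ring.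
have Dfm s : 0 <= s <= 1 -> rwd (seg 0 1) fm s (- (ep s * (q s * X s))).
  move=> s01.
  apply: (wd_eq (wdM (wd_sub (@subsetT _ _) (rwd_cexp_line tau s)) (wdB (HX s s01) (HY s s01)))).
  rewrite /ep; ring.
have Xphi s : cabs (em s * X s) <= phi s / 2.
  have -> : em s * X s = (fp s + em s * em s * fm s) / 2.
    by rewrite XE -[fp s in RHS]mul1r -(epm s); field; rewrite !cexp_neq0.
  rewrite cabsM cabsV cabs_nat; apply: ler_wpM2r; first by rewrite invr_ge0.
  apply: (le_trans (cabsD _ _)); rewrite (cabsM (em s * em s)) (cabsM (em s)) cem -expRD /phi.
  by rewrite (_ : - (2 * (s * cRe tau)) = - (s * cRe tau) - s * cRe tau); last by ring.
have phic s : 0 <= s <= 1 -> rwc (seg 0 1) (fun s => (phi s)%:C) s.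
  move=> s01; have C1 := rwc_cabs (wd_wc (Dfp s s01)).
  have C2 := rwc_cabs (wd_wc (Dfm s s01)).
  have C3 := rwc_cabs (wcM (wd_wc (wd_sub (@subsetT _ (seg 0 1)) (rwd_cexp_line (- tau) s)))
     (wd_wc (wd_sub (@subsetT _ (seg 0 1)) (rwd_cexp_line (- tau) s)))).
  apply: wc_ext (wcD C1 (wcM C3 C2)); first exact: s01.
  move=> u _; rewrite -rmorphM -rmorphD /phi cabsM cem -expRD.
  by congr (_ + expR _ * _)%:C; ring.
have [s s01 Hs] := seg_max ler01 phic.
have phi0 u : 0 <= phi u by rewrite addr_ge0 ?mulr_ge0 ?expR_ge0 ?cabs_ge0.
have {}Hs u : 0 <= u <= 1 -> phi u <= phi s.
  by move=> u01; have := Hs u u01; rewrite !cabs_real !ger0_norm.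
have Bp u : 0 <= u <= 1 -> cabs (fp u - 1) <= K * (phi s / 2).
  move=> u01; have [u0 u1] := andP u01.
  have -> : (1 : R[i]) = fp 0 by rewrite /fp /em rmorph0 mul0r cexp0 mul1r X0 Y0 add0r.
  apply: (@le_trans _ _ (K * (phi s / 2) * (u - 0))); last first.
    by rewrite subr0 ler_piMr // mulr_ge0 // divr_ge0.
  apply: (@mean_value_bound R 0 u fp (fun s => em s * (q s * X s))) => // v /andP[v0 vu].
    have v01 : 0 <= v <= 1 by lra.
    by apply: wd_sub (Dfp v v01) => y /andP[h1 h2]; apply/andP; split; lra.
  have v01 : 0 <= v <= 1 by lra.
  rewrite mulrCA cabsM; apply: ler_pM; rewrite ?cabs_ge0 //; first exact: Hq.
  by apply: (le_trans (Xphi v)); have := Hs v v01; lra.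
have Bm u : 0 <= u <= 1 -> cabs (fm u + 1) <= K * (phi s / 2) * expR (2 * (u * cRe tau)).
  move=> u01; have [u0 u1] := andP u01.
  have -> : (1 : R[i]) = - fm 0.
    by rewrite /fm /ep rmorph0 mul0r cexp0 mul1r X0 Y0 sub0r opprK.
  have cst0 : 0 <= K * (phi s / 2) * expR (2 * (u * cRe tau)).
    by rewrite !mulr_ge0 ?expR_ge0 // invr_ge0.
  apply: (@le_trans _ _ (K * (phi s / 2) * expR (2 * (u * cRe tau)) * (u - 0))); last first.
    by rewrite subr0 ler_piMr.
  apply: (@mean_value_bound R 0 u fm (fun s => - (ep s * (q s * X s)))) => // v /andP[v0 vu].
    have v01 : 0 <= v <= 1 by lra.
    by apply: wd_sub (Dfm v v01) => y /andP[h1 h2]; apply/andP; split; lra.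
  have v01 : 0 <= v <= 1 by lra.
  have -> : - (ep v * (q v * X v)) = - (q v * ((ep v * ep v) * (em v * X v))).
    by rewrite -[ep v * ep v * _]mulrA [ep v * (em v * _)]mulrA epm mul1r; ring.
  rewrite cabsN cabsM -[K * _ * _]mulrA; apply: ler_pM; rewrite ?cabs_ge0 //; first exact: Hq.
  rewrite cabsM mulrC; apply: ler_pM; rewrite ?cabs_ge0 //.
    by apply: (le_trans (Xphi v)); have := Hs v v01; lra.
  by rewrite cabsM cep -expRD ler_expR; have := ler_wpM2r tau0 vu; lra.
(* At the maximum, phi <= 2 + K phi, and [K <= 1 / 2] absorbs the last term. *)
have phi4 : phi s <= 4.
  have h1 := Bp s s01; have h2 := Bm s s01.
  have e1 : expR (- (2 * (s * cRe tau))) <= 1.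
    by rewrite expR_le1 oppr_le0 !mulr_ge0 //; case/andP: s01.
  have e0 := expR_ge0 (- (2 * (s * cRe tau))).
  have f1 : cabs (fp s) <= 1 + K * (phi s / 2).
    by have := cabs_triangle (fp s) 1; rewrite cabs1; lra.
  have f2 : cabs (fm s) <= 1 + K * (phi s / 2) * expR (2 * (s * cRe tau)).
    by have := cabs_triangle (fm s) (-1); rewrite cabsN cabs1 opprK; lra.
  have : expR (- (2 * (s * cRe tau))) * cabs (fm s) <= 1 + K * (phi s / 2).
    apply: (@le_trans _ _ (expR (- (2 * (s * cRe tau))) *
       (1 + K * (phi s / 2) * expR (2 * (s * cRe tau))))); first exact: ler_wpM2l.
    rewrite mulrDr mulr1 [X in _ + X]mulrCA -expRD addNr expR0 mulr1; lra.
  have : K * phi s <= 1 / 2 * phi s by apply: ler_wpM2r.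
  have phiE : phi s = cabs (fp s) + expR (- (2 * (s * cRe tau))) * cabs (fm s) by [].
  move: phiE f1; set p := phi s; set q1 := cabs (fp s); set q2 := expR _ * _.
  by move=> -> *; lra.
have P1 : cabs (fp 1 - 1) <= 2 * K.
  apply: (le_trans (Bp 1 i11)); rewrite mulrC; apply: ler_wpM2r => //; lra.
have P2 : cabs (fm 1 + 1) <= 2 * K * expR (2 * cRe tau).
  apply: (le_trans (Bm 1 i11)); rewrite mul1r; apply: ler_wpM2r; first exact: expR_ge0.
  by rewrite mulrC; apply: ler_wpM2r => //; lra.
have ep1 : ep 1 = cexp tau by rewrite /ep rmorph1 mul1r.
have em1 : em 1 = cexp (- tau) by rewrite /em rmorph1 mul1r.
have Q1 : cabs (cexp tau * (fp 1 - 1)) <= 2 * K * expR (cRe tau).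
  rewrite cabsM cabs_cexp mulrC; apply: ler_wpM2r => //; exact: expR_ge0.
have Q2 : cabs (cexp (- tau) * (fm 1 + 1)) <= 2 * K * expR (cRe tau).
  rewrite cabsM cabs_cexp cReN.
  apply: (@le_trans _ _ (expR (- cRe tau) * (2 * K * expR (2 * cRe tau)))).
    by apply: ler_wpM2l => //; exact: expR_ge0.
  rewrite mulrCA -expRD le_eqVlt; apply/orP; left; apply/eqP.
  by congr (_ * expR _); ring.
split.
  rewrite XE /csinh ep1 em1 (_ : _ - _ = (cexp tau * (fp 1 - 1) + cexp (- tau) * (fm 1 + 1)) / 2); last by field.
  rewrite cabsM cabsV cabs_nat ler_pdivrMr //.
  by apply: (le_trans (cabsD _ _)); lra.
rewrite YE /ccosh ep1 em1 (_ : _ - _ = (cexp tau * (fp 1 - 1) - cexp (- tau) * (fm 1 + 1)) / 2); last by field.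
rewrite cabsM cabsV cabs_nat ler_pdivrMr //.
by apply: (le_trans (cabs_sub_le _ _)); lra.
Qed.

(** Changing the signs of [X], [tau] and [q] preserves the system and reduces negative real parts to
    the previous case. *)
Lemma volterra X Y q tau K : K <= 1 / 2 -> X 0 = 0 -> Y 0 = 1 ->
  (forall s, 0 <= s <= 1 -> rwd (seg 0 1) X s (tau * Y s)) ->
  (forall s, 0 <= s <= 1 -> rwd (seg 0 1) Y s (tau * X s + q s * X s)) ->
  (forall s, 0 <= s <= 1 -> cabs (q s) <= K) ->
  cabs (X 1 - csinh tau) <= 2 * K * expR `|cRe tau| /\
  cabs (Y 1 - ccosh tau) <= 2 * K * expR `|cRe tau|.
Proof.
move=> K2 X0 Y0 HX HY Hq; have [t0|t0] := leP 0 (cRe tau).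
  by rewrite ger0_norm //; apply: (volterra_ge0 (q := q)).
rewrite ltr0_norm // -cReN.
have -> : csinh tau = - csinh (- tau) by rewrite /csinh opprK; field.
have -> : ccosh tau = ccosh (- tau) by rewrite /ccosh opprK; field.
have [] := @volterra_ge0 (fun s => - X s) Y (fun s => - q s) (- tau) K => //.
- by rewrite cReN oppr_ge0 ltW.
- by rewrite X0 oppr0.
- by move=> s s01; apply: (wd_eq (wdN (HX s s01))); ring.
- by move=> s s01; apply: (wd_eq (HY s s01)); ring.
- by move=> s s01; rewrite cabsN Hq.
by move=> h1 h2; split => //; rewrite opprK -cabsN opprD.
Qed.

End Volterra.

(** * Liouville-Green transformation on one arm *)

Section Arm.
Context {R : realType}.
Implicit Types (E z w : R[i]).

Lemma csinh_bound (z : R[i]) : cabs (csinh z) <= expR `|cRe z|.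
Proof.
rewrite /csinh cabsM cabsV cabs_nat ler_pdivrMr //.
apply: (le_trans (cabs_sub_le _ _)); rewrite !cabs_cexp cReN.
have h1 : expR (cRe z) <= expR `|cRe z| by rewrite ler_expR ler_norm.
have h2 : expR (- cRe z) <= expR `|cRe z| by rewrite ler_expR -normrN ler_norm.
lra.
Qed.

Lemma ccosh_bound (z : R[i]) : cabs (ccosh z) <= expR `|cRe z|.
Proof.
rewrite /ccosh cabsM cabsV cabs_nat ler_pdivrMr //.
apply: (le_trans (cabsD _ _)); rewrite !cabs_cexp cReN.
have h1 : expR (cRe z) <= expR `|cRe z| by rewrite ler_expR ler_norm.
have h2 : expR (- cRe z) <= expR `|cRe z| by rewrite ler_expR -normrN ler_norm.
lra.
Qed.

Variables (a b c d : R).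
Let N := box a b c d.
Variables (U dU ddU : R[i] -> R[i]) (M r k : R) (z0 z1 : R[i]).
Hypotheses (HU : deriv_on N U dU) (HdU : deriv_on N dU ddU).
Hypotheses (MU : forall z, N z -> cabs (U z) <= M)
  (MdU : forall z, N z -> cabs (dU z) <= M) (MddU : forall z, N z -> cabs (ddU z) <= M).
Hypotheses (M0 : 0 < M) (r0 : 0 < r) (k0 : 0 < k) (k4 : k <= 1 / 4).
Let L := z1 - z0.
Hypothesis kr : k * (r + 2 * cabs L) <= r.
Hypothesis tube : forall t : R, 0 <= t <= 1 ->
  forall w, cabs (w - (z0 + t%:C * L)) <= r -> N w.
Variables (E0 s0 : R[i]).
Hypotheses (s0E : s0 ^+ 2 = - E0) (E0large : 4 * M / k <= cabs E0).

Let Nz0 : N z0.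
Proof. by apply: (tube (t := 0)); rewrite ?lexx ?ler01 // rmorph0 mul0r addr0 subrr cabs0 ltW. Qed.

Let Nz1 : N z1.
Proof.
apply: (tube (t := 1)); rewrite ?lexx ?ler01 //.
by rewrite rmorph1 mul1r /L subrKC subrr cabs0 ltW.
Qed.

Let e0 := cabs E0.

Let e0_gt0 : 0 < e0.
Proof. by apply: lt_le_trans E0large; rewrite divr_gt0 // mulr_gt0. Qed.

Let E0_neq0 : E0 != 0.
Proof. by rewrite -cabs_gt0. Qed.

Let s0sq : cabs s0 ^+ 2 = e0.
Proof. by rewrite -cabsX s0E cabsN. Qed.

Let s0_gt0 : 0 < cabs s0.
Proof.
rewrite lt_def cabs_ge0 andbT; apply/eqP => h.
by have := e0_gt0; rewrite -s0sq h expr0n ltxx.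
Qed.

Let s0_neq0 : s0 != 0.
Proof. by rewrite -cabs_gt0. Qed.

Let near_E0 E := cabs (E - E0) <= k * e0 / 2.

(** Division by [E0] brings the radicand near 1, where the principal roots are holomorphic and [g],
    [kk] stay near 1. Since [s0 ^+ 2 = - E0], the product [s0 * g E] is a branch of (U - E)^(1/2),
    and [P] is a branch of (U - E)^(1/4). *)
Let x E z := (E - U z) / E0.
Let g E z := sqrtc (x E z).
Let kk E z := sqrtc (g E z).
Let t0 := sqrtc s0.
Let P E z := t0 * kk E z.

Let x1 E z : near_E0 E -> N z -> cabs (x E z - 1) <= k.
Proof.
move=> hE Nz; have := e0_gt0 => e00.
have -> : x E z - 1 = (E - E0 - U z) / E0 by rewrite /x; field; exact: E0_neq0.
rewrite cabsM cabsV -/e0 ler_pdivrMr //.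
apply: (le_trans (cabs_sub_le _ _)).
have h1 : 4 * M <= k * e0 by rewrite [k * _]mulrC -ler_pdivrMr //.
by have := MU Nz; have := M0; rewrite /near_E0 in hE; lra.
Qed.

Let le_half u : u <= k -> u <= 1 / 2.
Proof. by have := k4; lra. Qed.

Let x_near1 E z : near_E0 E -> N z -> near1 (x E z).
Proof. by move=> hE Nz; apply: le_half; exact: x1. Qed.

Let g1 E z : near_E0 E -> N z -> cabs (g E z - 1) <= k.
Proof. by move=> hE Nz; apply: le_trans (sqrtc_sub1 _) (x1 hE Nz). Qed.

Let g_near1 E z : near_E0 E -> N z -> near1 (g E z).
Proof. by move=> hE Nz; apply: le_half; exact: g1. Qed.

Let kk1 E z : near_E0 E -> N z -> cabs (kk E z - 1) <= k.
Proof. by move=> hE Nz; apply: le_trans (sqrtc_sub1 _) (g1 hE Nz). Qed.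

Let g_neq0 E z : near_E0 E -> N z -> g E z != 0.
Proof. by move=> hE Nz; apply: sqrtc_near1_neq0; exact: x_near1. Qed.

Let kk_neq0 E z : near_E0 E -> N z -> kk E z != 0.
Proof. by move=> hE Nz; apply: sqrtc_near1_neq0; exact: g_near1. Qed.

Let t0_sq : t0 ^+ 2 = s0. Proof. exact: sqr_sqrtc. Qed.

Let t0_neq0 : t0 != 0.
Proof. by have := s0_neq0; rewrite -t0_sq expf_eq0. Qed.

Let P_neq0 E z : near_E0 E -> N z -> P E z != 0.
Proof. by move=> hE Nz; rewrite mulf_neq0 // kk_neq0. Qed.

Let P2 E z : P E z ^+ 2 = s0 * g E z.
Proof. by rewrite /P exprMn t0_sq sqr_sqrtc. Qed.

Let P4 E z : P E z ^+ 4 = U z - E.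
Proof.
rewrite (_ : 4 = 2 * 2)%N // exprM P2 exprMn sqr_sqrtc s0E /x; field.
exact: E0_neq0.
Qed.

Let dg E z := (2 * g E z)^-1 * (- dU z / E0).

Let Hg E : near_E0 E -> deriv_on N (g E) (dg E).
Proof.
move=> hE z Nz; apply: (@wd_comp _ _ _ id id N near1 (x E) (@sqrtc R)) => //.
- by move=> s Ns; exact: x_near1.
- apply: (wd_eq (wdM (wdB (wd_cst _ _ E _) (HU Nz)) (wd_cst _ _ E0^-1 _))).
  by rewrite mulr0 addr0 sub0r.
by apply: cwd_sqrtc; exact: x_near1.
Qed.

Let dP E z := dU z / (4 * P E z ^+ 3).

Let HP E : near_E0 E -> deriv_on N (P E) (dP E).
Proof.
move=> hE z Nz.
have D : cwd N (kk E) z ((2 * kk E z)^-1 * dg E z).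
  apply: (@wd_comp _ _ _ id id N near1 (g E) (@sqrtc R)) => //.
  - by move=> s Ns; exact: g_near1.
  - exact: Hg.
  by apply: cwd_sqrtc; exact: g_near1.
apply: (wd_eq (wdZ t0 D)).
have gE : g E z = kk E z ^+ 2 by rewrite sqr_sqrtc.
have E0E : E0 = - t0 ^+ 4 by rewrite (_ : 4 = 2 * 2)%N // exprM t0_sq s0E opprK.
rewrite /dP /dg /P gE E0E; field.
by rewrite (kk_neq0 hE Nz) t0_neq0.
Qed.

Let ddP E z := ddU z / (4 * P E z ^+ 3) - 3 * dU z * dP E z / (4 * P E z ^+ 4).

Let HdP E : near_E0 E -> deriv_on N (dP E) (ddP E).
Proof.
move=> hE z Nz.
have DP := HP hE Nz.
have D3 : cwd N (fun w => 4 * P E w ^+ 3) z (12 * P E z ^+ 2 * dP E z).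
  apply: (@wd_ext _ _ _ _ (fun w => 4 * (P E w * (P E w * P E w)))) => //.
  by apply: (wd_eq (wdZ 4 (wdM DP (wdM DP DP)))); ring.
have n0 : 4 * P E z ^+ 3 != 0 by rewrite mulf_neq0 ?pnatr_eq0 // expf_neq0 // P_neq0.
apply: (wd_eq (wdM (HdU Nz) (wdV D3 n0))).
by rewrite /ddP; field; rewrite P_neq0.
Qed.

Let bb := cabs s0 / 2.
Let bb0 : 0 < bb. Proof. by rewrite divr_gt0. Qed.

Let P_low E z : near_E0 E -> N z -> bb <= cabs (P E z) ^+ 2.
Proof.
move=> hE Nz; rewrite -cabsX P2 cabsM /bb; apply: ler_wpM2l; first exact: ltW.
have := cabs_triangle 1 (g E z); rewrite cabs1 (cabsB 1).
by have := g1 hE Nz; have := k4; lra.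
Qed.

Let P_low_pow E z n : near_E0 E -> N z -> (cabs (P E z) ^+ (2 * n))^-1 <= (bb ^+ n)^-1.
Proof.
move=> hE Nz; rewrite lef_pV2 ?posrE ?exprn_gt0 //; last by rewrite cabs_gt0 P_neq0.
by rewrite exprM; apply: lerXn2r (P_low hE Nz); rewrite nnegrE ?exprn_ge0 ?cabs_ge0 // ltW.
Qed.

(** Equal to - P^(-3) (1/P)'', this is the correction left by the Liouville-Green change of unknown
    and variable. Its bound needs two derivatives of [U] and a lower bound on |P|. *)
Let Q E z := (ddP E z * P E z - 2 * dP E z ^+ 2) / P E z ^+ 6.
Let Qb := M / bb ^+ 4 + M ^+ 2 / bb ^+ 6.

Let Q_bound E z : near_E0 E -> N z -> cabs (Q E z) <= Qb.
Proof.
move=> hE Nz.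
have -> : Q E z = 4^-1 * (ddU z / P E z ^+ 8) - (5 / 16) * (dU z ^+ 2 / P E z ^+ 12).
  by rewrite /Q /ddP /dP; field; rewrite P_neq0.
have c4 : cabs (4^-1 : R[i]) <= 1 by rewrite cabsV cabs_nat; lra.
have c5 : cabs (5 / 16 : R[i]) <= 1 by rewrite cabsM cabsV !cabs_nat; lra.
apply: (le_trans (cabs_sub_le _ _)); rewrite /Qb.
apply: lerD; rewrite cabsM.
  apply: (@le_trans _ _ (1 * (M / bb ^+ 4))); last by rewrite mul1r.
  apply: ler_pM; rewrite ?cabs_ge0 //.
  rewrite cabsM cabsV cabsX; apply: ler_pM; rewrite ?cabs_ge0 ?invr_ge0 ?exprn_ge0 ?cabs_ge0 //.
    exact: MddU.
  exact: (@P_low_pow E z 4).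
apply: (@le_trans _ _ (1 * (M ^+ 2 / bb ^+ 6))); last by rewrite mul1r.
apply: ler_pM; rewrite ?cabs_ge0 //.
rewrite cabsM cabsV !cabsX; apply: ler_pM; rewrite ?invr_ge0 ?exprn_ge0 ?cabs_ge0 //.
  by apply: lerXn2r (MdU Nz); rewrite nnegrE ?cabs_ge0 // ltW.
exact: (@P_low_pow E z 6).
Qed.

Let seg_in t : 0 <= t <= 1 -> N (z0 + t%:C * (z1 - z0)).
Proof. by move=> t01; exact: box_convex. Qed.

Section FixedEnergy.
Variables (E : R[i]) (S : R[i] -> R[i]).
Hypotheses (hE : near_E0 E) (HS : deriv_on N S (g E)).
Let sg := S z1 - S z0.
Let sigma := s0 * sg.

Lemma sigma_bound : cabs sigma <= 2 * cabs s0 * cabs L.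
Proof.
rewrite cabsM mulrAC mulrC; apply: ler_wpM2r; first exact: cabs_ge0.
apply: (@le_trans _ _ (2 * cabs (z1 - z0))); last by rewrite mulrC mulrC.
apply: (segment_mean_value (K := N) (df := g E)) => // t t01.
have := g1 hE (seg_in t01); have := cabs_triangle (g E (z0 + t%:C * (z1 - z0))) 1.
by rewrite cabs1; have := k4; lra.
Qed.

Variables (h : R) (u v : R[i] -> R[i]).
Hypotheses (h0 : 0 < h) (Hu : deriv_on N u v).
Hypothesis Hv : deriv_on N v (fun z => (U z - E) / (h ^+ 2)%:C * u z).
Hypotheses (uz0 : u z0 = 0) (vz0 : v z0 = 1).

(* The WKB asymptotics come from the Liouville substitution
   [w = (U - E)^(1/4) u] along the path on which the action is an affine
   function of the parameter. *)
Lemma wkb_fixed : h * (2 * cabs s0 * cabs L * Qb) <= 1 / 2 ->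
  cabs (P E z0 * P E z1 * u z1 / h%:C - csinh (sigma / h%:C))
    <= 2 * (h * (2 * cabs s0 * cabs L * Qb)) * expR `|cRe (sigma / h%:C)| /\
  cabs (P E z0 * P E z1 * v z1 / (s0 * g E z1) - ccosh (sigma / h%:C))
    <= (2 * (h * (2 * cabs s0 * cabs L * Qb)) + 2 * h * (M / bb ^+ 3)) * expR `|cRe (sigma / h%:C)|.
Proof.
set K := h * _ => K2.
have hC : h%:C != 0 :> R[i] by rewrite -cabs_gt0 cabs_real gtr0_norm.
have h2E : (h ^+ 2)%:C = h%:C ^+ 2 :> R[i] by rewrite rmorphXn.
have [psi [psi0 psi1 psiN Dpsi]] := straightening_path r0 k0 k4 kr tube HS (fun z => g1 hE (z := z)).
have hP z Nz := HP hE (z := z) Nz; have hdP z Nz := HdP hE (z := z) Nz.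
pose P0 := P E z0.
have P00 : P0 != 0 by exact: P_neq0.
pose X t := P0 / h%:C * (P E (psi t) * u (psi t)).
(* [F] is the derivative of P u divided by P^2, that is, its derivative with respect to the action.
   The factors in [X] and [Y] normalize the initial data to (0, 1). *)
pose F z := dP E z * u z * (P E z * P E z)^-1 + v z * (P E z)^-1.
pose Y t := P0 * F (psi t).
pose tau := sigma / h%:C.
have X0 : X 0 = 0 by rewrite /X psi0 uz0 !mulr0.
have Y0 : Y 0 = 1 by rewrite /Y /F psi0 uz0 vz0 mulr0 mul0r add0r mul1r divff.
have gP z : N z -> s0 / (P E z ^+ 2) = (g E z)^-1.
  move=> Nz; rewrite P2; field; by rewrite s0_neq0 g_neq0.
have HX t : 0 <= t <= 1 -> rwd (seg 0 1) X t (tau * Y t).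
  move=> t01; have Nt := psiN t t01.
  have D : rwd (seg 0 1) (fun t => P E (psi t) * u (psi t)) t
     ((dP E (psi t) * u (psi t) + P E (psi t) * v (psi t)) * (sg / g E (psi t))).
    apply: (@rwd_path _ _ N (fun z => P E z * u z) psi) => //; first exact: Dpsi.
    by apply: wdM; [exact: hP|exact: Hu].
  apply: (wd_eq (wdZ _ D)).
  rewrite -(gP _ Nt) /tau /sigma /Y /F; field.
  by rewrite hC P_neq0.
have HF z : N z -> cwd N F z ((ddP E z * u z + dP E z * v z) * (P E z * P E z)^-1
    + dP E z * u z * (- (dP E z * P E z + P E z * dP E z) / (P E z * P E z) ^+ 2)
    + ((U z - E) / (h ^+ 2)%:C * u z * (P E z)^-1 + v z * (- dP E z / P E z ^+ 2))).
  move=> Nz; have Pz := P_neq0 hE Nz.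
  apply: wdD.
    apply: wdM; first by apply: wdM; [exact: hdP|exact: Hu].
    by apply: wdV; [apply: wdM; exact: hP|exact: mulf_neq0].
  by apply: wdM; [exact: Hv|apply: wdV; [exact: hP|]].
pose q t := sigma * h%:C * Q E (psi t).
have HY t : 0 <= t <= 1 -> rwd (seg 0 1) Y t (tau * X t + q t * X t).
  move=> t01; have Nt := psiN t t01.
  have D := @rwd_path _ (seg 0 1) N F psi t _ _ psiN (Dpsi t t01) (HF _ Nt).
  apply: (wd_eq (wdZ P0 D)).
  rewrite -(gP _ Nt) -(P4 E) /tau /sigma /X /q /Q h2E. rewrite /sigma /sg; field.
  by rewrite hC P_neq0.
have Hq t : 0 <= t <= 1 -> cabs (q t) <= K.
  move=> t01; rewrite /q (cabsM (sigma * h%:C)) (cabsM sigma) cabs_real gtr0_norm //.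
  rewrite (_ : K = 2 * cabs s0 * cabs L * h * Qb); last by rewrite /K; ring.
  apply: ler_pM; rewrite ?cabs_ge0 ?mulr_ge0 ?cabs_ge0 ?(ltW h0) //.
    by apply: ler_wpM2r; [exact: ltW|exact: sigma_bound].
  by apply: Q_bound => //; exact: psiN.
have [B1 B2] := volterra K2 X0 Y0 HX HY Hq.
have X1E : X 1 = P E z0 * P E z1 * u z1 / h%:C by rewrite /X psi1 /P0; ring.
(* Differentiating the amplitude [P] contributes the extra term of order [h], whence the second
   constant in the bound for [v]. *)
have Y1E : P E z0 * P E z1 * v z1 / (s0 * g E z1) = Y 1 - h%:C * X 1 * (dP E z1 / P E z1 ^+ 3).
  rewrite -P2 /X /Y /F psi1 /P0; field; by rewrite hC P_neq0.
rewrite -X1E Y1E; split => //.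
have XB : cabs (X 1) <= 2 * expR `|cRe tau|.
  have := cabs_triangle (X 1) (csinh tau); have := csinh_bound tau.
  have : 2 * K * expR `|cRe tau| <= 1 * expR `|cRe tau|.
    by apply: ler_wpM2r; [exact: expR_ge0|lra].
  by lra.
have PB : cabs (dP E z1 / P E z1 ^+ 3) <= M / bb ^+ 3.
  rewrite /dP invfM mulrA -mulrA.
  have -> : dU z1 / 4 * ((P E z1 ^+ 3)^-1 / P E z1 ^+ 3) = 4^-1 * (dU z1 / P E z1 ^+ 6).
    by field; rewrite P_neq0.
  rewrite cabsM; apply: (@le_trans _ _ (1 * (M / bb ^+ 3))); last by rewrite mul1r.
  apply: ler_pM; rewrite ?cabs_ge0 //; first by rewrite cabsV cabs_nat; lra.
  rewrite cabsM cabsV cabsX; apply: ler_pM; rewrite ?cabs_ge0 ?invr_ge0 ?exprn_ge0 ?cabs_ge0 //.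
    exact: MdU.
  exact: (@P_low_pow E z1 3).
rewrite (_ : _ - _ = (Y 1 - ccosh tau) - h%:C * X 1 * (dP E z1 / P E z1 ^+ 3)); last by rewrite /tau; ring.
apply: (le_trans (cabs_sub_le _ _)); rewrite mulrDl; apply: lerD => //.
rewrite (cabsM (h%:C * X 1)) (cabsM h%:C) cabs_real gtr0_norm //.
have := ler_pM (cabs_ge0 _) (cabs_ge0 _) XB PB => h3.
have := ler_wpM2l (ltW h0) h3.
rewrite -/tau; set p1 := cabs (X 1); set p2 := cabs (dP _ _ / _); lra.
Qed.

End FixedEnergy.
Let g_low E z : near_E0 E -> N z -> 1 / 2 <= cabs (g E z).
Proof.
move=> hE Nz; have := cabs_triangle 1 (g E z); rewrite cabs1 (cabsB 1).
by have := g1 hE Nz; have := k4; lra.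
Qed.

Let E0_near : near_E0 E0.
Proof. by rewrite /near_E0 subrr cabs0 !mulr_ge0 // ltW. Qed.

Let g_lip E z : near_E0 E -> N z -> cabs (g E z - g E0 z) <= cabs (E - E0) / e0.
Proof.
move=> hE Nz; apply: le_trans (sqrtc_lip (x_near1 hE Nz) (x_near1 E0_near Nz)) _.
by rewrite (_ : _ - _ = (E - E0) / E0) ?cabsM ?cabsV // /x; field; exact: E0_neq0.
Qed.

(** Here [al] is the product of the fourth roots at the two ends, [p] the momentum at [z1], and
    [sigma1] the derivative of the action at [E0]. The branch [q] and its primitive [S] are exported
    because the condition on the real integral will be read off from them. *)
Lemma arm : exists (sigma p al : R[i] -> R[i]) (sigma1 : R[i]) (rho C : R),
  [/\ 0 < rho, 0 < C, cabs (sigma1 + L / (2 * s0)) <= k * cabs L / cabs s0,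
    exists q S, [/\ deriv_on N S q, exists dq, deriv_on N q dq,
       forall z, N z -> q z ^+ 2 = U z - E0 /\ q z != 0 & sigma E0 = S z1 - S z0] &
    forall E, cabs (E - E0) <= rho ->
    [/\ p E ^+ 2 = U z1 - E, cabs (p E - s0) <= k * cabs s0,
        cabs (p E - p E0) <= C * cabs (E - E0),
        cabs (sigma E - sigma E0 - sigma1 * (E - E0)) <= C * cabs (E - E0) ^+ 2 &
        (cabs s0 / 2 <= cabs (al E) <= 2 * cabs s0) /\
        forall h u v, 0 < h -> C * h <= 1 -> deriv_on N u v ->
          deriv_on N v (fun z => (U z - E) / (h ^+ 2)%:C * u z) ->
          u z0 = 0 -> v z0 = 1 ->
          cabs (al E * u z1 / h%:C - csinh (sigma E / h%:C))
             <= C * h * expR `|cRe (sigma E / h%:C)| /\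
          cabs (al E * v z1 / p E - ccosh (sigma E / h%:C))
             <= C * h * expR `|cRe (sigma E / h%:C)|]].
Proof.
have [S HS] : exists S : R[i] -> R[i] -> R[i], forall E, near_E0 E -> deriv_on N (S E) (g E).
  have H E : exists S, near_E0 E -> deriv_on N S (g E).
    have [hE|nE] := pselect (near_E0 E : Prop); last by exists (fun=> 0).
    by have [S HS] := box_primitive (Hg hE); exists S.
  by have [S HS] := choice H; exists S.
have Hig : deriv_on N (fun z => (g E0 z)^-1) (fun z => - dg E0 z / g E0 z ^+ 2).
  by move=> z Nz; apply: wdV; [exact: (Hg E0_near)|exact: g_neq0].
(* The derivative of the action in the energy is - 1/2 times the integral of (U - E0)^(-1/2), and
   [T] is a primitive of the corresponding normalized integrand. *)
have [T HT] := box_primitive Hig.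
have QB0 : 0 <= Qb.
  by rewrite addr_ge0 // divr_ge0 ?exprn_ge0 ?(ltW bb0) ?(ltW M0).
have L0 := cabs_ge0 L; have s00 := ltW s0_gt0; have e00 := ltW e0_gt0.
pose C1 := 4 * cabs s0 * cabs L * Qb; pose C2 := 2 * (M / bb ^+ 3).
pose C3 := cabs s0 / e0; pose C4 := cabs s0 * cabs L / e0 ^+ 2.
have C10 : 0 <= C1 by rewrite !mulr_ge0.
have C20 : 0 <= C2 by rewrite mulr_ge0 // divr_ge0 ?exprn_ge0 ?(ltW bb0) ?(ltW M0).
have C30 : 0 <= C3 by rewrite divr_ge0.
have C40 : 0 <= C4 by rewrite divr_ge0 ?mulr_ge0 ?exprn_ge0.
pose C := 1 + C1 + C2 + C3 + C4.
exists (fun E => s0 * (S E z1 - S E z0)), (fun E => s0 * g E z1),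
  (fun E => P E z0 * P E z1), (- (T z1 - T z0) / (2 * s0)), (k * e0 / 2), C.
split.
- by rewrite divr_gt0 // mulr_gt0.
- by rewrite /C; lra.
- rewrite (_ : _ + _ = - (T z1 - z1 - (T z0 - z0)) / (2 * s0)); last first.
    by rewrite /L; field; exact: s0_neq0.
  rewrite cabsM cabsN cabsV cabsM cabs_nat.
  have : cabs (T z1 - z1 - (T z0 - z0)) <= 2 * k * cabs L.
    apply: (segment_mean_value (K := N) (f := fun z => T z - z) (df := fun z => (g E0 z)^-1 - 1)).
    + exact: seg_in.
    + by move=> z Nz; apply: wdB; [exact: HT|exact: wd_id].
    move=> t t01; set z := z0 + _; have Nz : N z by exact: seg_in.
    rewrite (_ : _ - 1 = - (g E0 z - 1) / g E0 z); last by field; exact: g_neq0.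
    rewrite cabsM cabsN cabsV ler_pdivrMr ?cabs_gt0 ?g_neq0 //.
    have h1 := g1 E0_near Nz; have h2 := g_low E0_near Nz.
    have := ler_wpM2l (ltW k0) h2; lra.
  move=> h; rewrite ler_pdivrMr ?mulr_gt0 //; apply: (le_trans h).
  rewrite le_eqVlt; apply/orP; left; apply/eqP; field.
  by rewrite gt_eqF.
- exists (fun z => s0 * g E0 z), (fun z => s0 * S E0 z); split.
  + by move=> z Nz; apply: wdZ; exact: (HS E0 E0_near).
  + by exists (fun z => s0 * dg E0 z) => z Nz; apply: wdZ; exact: (Hg E0_near).
  + move=> z Nz; split; last by rewrite mulf_neq0 // g_neq0.
    by rewrite -P2 -exprM P4.
  by rewrite mulrBr.
move=> E hE; split.
- by rewrite -P2 -exprM P4.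
- rewrite (_ : _ - s0 = s0 * (g E z1 - 1)); last by ring.
  by rewrite cabsM mulrC; apply: ler_wpM2r => //; exact: g1.
- rewrite -mulrBr cabsM; apply: (@le_trans _ _ (C3 * cabs (E - E0))); last first.
    by apply: ler_wpM2r; [exact: cabs_ge0|rewrite /C; lra].
  rewrite /C3 -mulrA [e0^-1 * _]mulrC; apply: ler_wpM2l => //; exact: g_lip.
- pose G z := s0 * S E z - s0 * S E0 z + (E - E0) / (2 * s0) * T z.
  rewrite (_ : _ - _ - _ = G z1 - G z0); last by rewrite /G; field; exact: s0_neq0.
  apply: (@le_trans _ _ (C4 * cabs (E - E0) ^+ 2)); last first.
    by apply: ler_wpM2r; [rewrite exprn_ge0 // cabs_ge0|rewrite /C; lra].
  rewrite (_ : C4 * _ = cabs s0 * (cabs (E - E0) / e0) ^+ 2 * cabs L); last first.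
    by rewrite /C4; field; rewrite gt_eqF.
  apply: (segment_mean_value (K := N) (f := G)
     (df := fun z => s0 * g E z - s0 * g E0 z + (E - E0) / (2 * s0) * (g E0 z)^-1)).
  + exact: seg_in.
  + move=> z Nz; apply: wdD; last by apply: wdZ; exact: HT.
    by apply: wdB; apply: wdZ; [exact: (HS E hE)|exact: (HS E0 E0_near)].
  move=> t t01; set z := z0 + _; have Nz : N z by exact: seg_in.
  have gz0 := g_neq0 E0_near Nz.
  (* With this identity, the root minus its linear part in [E - E0] collapses to a multiple of the
     square of [g E z - g E0 z], which is quadratic in [E - E0]. *)
  have EE : E - E0 = - s0 ^+ 2 * (g E z ^+ 2 - g E0 z ^+ 2).
    rewrite /g !sqr_sqrtc s0E /x; field; exact: E0_neq0.
  rewrite (_ : _ + _ = - (s0 / 2 * ((g E z - g E0 z) ^+ 2 / g E0 z))); last first.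
    by rewrite EE; field; rewrite gz0 s0_neq0.
  rewrite cabsN cabsM cabsM cabsV cabs_nat -mulrA; apply: ler_wpM2l => //.
  rewrite mulrC cabsM cabsV ler_pdivrMr // ler_pdivrMr ?cabs_gt0 //.
  have g2 : cabs ((g E z - g E0 z) ^+ 2) <= (cabs (E - E0) / e0) ^+ 2.
    rewrite cabsX; apply: lerXn2r; rewrite ?nnegrE ?cabs_ge0 ?divr_ge0 ?cabs_ge0 //.
    exact: g_lip.
  have h2 := g_low E0_near Nz.
  have q0 : 0 <= (cabs (E - E0) / e0) ^+ 2 by rewrite exprn_ge0 // divr_ge0 ?cabs_ge0.
  apply: (le_trans g2); rewrite -mulrA ler_peMr //; lra.
split.
  have kkb z : N z -> 3 / 4 <= cabs (kk E z) <= 5 / 4.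
    move=> Nz; have := kk1 hE Nz; have := k4.
    have := cabs_triangle (kk E z) 1; have := cabs_triangle 1 (kk E z).
    rewrite cabs1 (cabsB 1) => *; apply/andP; split; lra.
  have -> : P E z0 * P E z1 = s0 * (kk E z0 * kk E z1) by rewrite /P -t0_sq; ring.
  rewrite cabsM (cabsM (kk E z0)).
  have /andP[a1 a2] := kkb _ Nz0; have /andP[a3 a4] := kkb _ Nz1.
  have b1 : 3 / 4 * (3 / 4) <= cabs (kk E z0) * cabs (kk E z1) by apply: ler_pM.
  have b2 : cabs (kk E z0) * cabs (kk E z1) <= 5 / 4 * (5 / 4) by apply: ler_pM; rewrite ?cabs_ge0.
  apply/andP; split.
    by apply: ler_wpM2l => //; lra.
  by rewrite mulrC; apply: ler_wpM2r => //; lra.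
move=> h u v h0 Ch Hu Hv uz0 vz0.
have hC1 : h * C1 <= 1.
  by apply: le_trans Ch; rewrite mulrC; apply: ler_wpM2r; [exact: ltW|rewrite /C; lra].
have hE1 : h * (2 * cabs s0 * cabs L * Qb) = h * C1 / 2 by rewrite /C1; field.
have [|B1 B2] := wkb_fixed hE (HS E hE) h0 Hu Hv uz0 vz0.
  by rewrite hE1; lra.
split.
  apply: (le_trans B1); apply: ler_wpM2r; first exact: expR_ge0.
  rewrite hE1 (_ : 2 * _ = C1 * h); last by field.
  by apply: ler_wpM2r; [exact: ltW|rewrite /C; lra].
apply: (le_trans B2); apply: ler_wpM2r; first exact: expR_ge0.
rewrite hE1 (_ : 2 * _ + _ = (C1 + C2) * h); last by rewrite /C2; field; rewrite gt_eqF.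
by apply: ler_wpM2r; [exact: ltW|rewrite /C; lra].
Qed.

End Arm.

(** * Lebesgue integrals of complex functions *)

Section Lebesgue.
Context {R : realType}.
Local Notation mu := (@lebesgue_measure R).
Local Notation I := (`[(-1)%R : R, 1%R]%classic).
Implicit Types (a b x y : R) (phi psi : R -> R) (f g : R -> R[i]).

Lemma itv_measure_fin a b : (mu `[a, b]%classic < +oo)%E.
Proof.
rewrite lebesgue_measure_itv /=; case: ifP => _; last exact: ltry.
by rewrite -EFinD ltry.
Qed.

Lemma integrable_bounded a b phi M : measurable_fun `[a, b]%classic phi ->
  (forall x, a <= x <= b -> `|phi x| <= M) ->
  mu.-integrable `[a, b]%classic (EFin \o phi).
Proof.
move=> mphi H; apply: measurable_bounded_integrable => //.
  exact: itv_measure_fin.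
exists M; split; first exact: num_real.
move=> y My x; rewrite /= in_itv /= => xab.
by apply: (le_trans (H x xab)); exact: ltW.
Qed.

Lemma rcont_measurable a b phi : rcont a b (fun t => (phi t)%:C) ->
  measurable_fun `[a, b]%classic phi.
Proof.
move=> H; apply: subspace_continuous_measurable_fun => //.
exact: rwc_within.
Qed.

Lemma rcont_integrable a b phi : a <= b -> rcont a b (fun t => (phi t)%:C) ->
  mu.-integrable `[a, b]%classic (EFin \o phi).
Proof.
move=> ab H; have [M _ HM] := seg_bounded ab H.
apply: (@integrable_bounded _ _ _ M); first exact: rcont_measurable.
by move=> x xab; have := HM x xab; rewrite cabs_real.
Qed.

Lemma Rintegral_sub a b x phi : a <= x <= b ->
  mu.-integrable `[a, b]%classic (EFin \o phi) ->
  (\int[mu]_(t in `[a, b]) phi t - \int[mu]_(t in `[a, x]) phi t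
   = \int[mu]_(t in `[x, b]) phi t)%R.
Proof.
move=> /andP[ax xb] H; rewrite Rintegral_itvB ?bnd_simp //.
rewrite Rintegral_itv_obnd_cbnd //.
apply: integrableS H => //; apply: subset_itv; rewrite ?bnd_simp //.
Qed.

Lemma real_FTC a b Phi phi : a <= b ->
  (forall x, a <= x <= b -> rwd (seg a b) (fun t => (Phi t)%:C) x (phi x)%:C) ->
  rcont a b (fun t => (phi t)%:C) ->
  (\int[mu]_(t in `[a, b]) phi t)%R = Phi b - Phi a.
Proof.
move=> ab HPhi Hphi; pose psi t := phi (Num.max a (Num.min t b)).
have cpsi x : rwc setT (fun t => (psi t)%:C) x by exact: (rwc_clamp ab Hphi x).
have cl x : a <= x <= b -> psi x = phi x.
  by move=> /andP[ax xb]; rewrite /psi min_l // max_r.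
pose P y := (\int[mu]_(t in `[(a - 1)%R, y]) psi t)%R.
have HP : forall x, a <= x <= b -> rwd setT (fun t => (P t)%:C) x (psi x)%:C.
  exact: (@real_primitive R a b psi cpsi).
have E : (P b)%:C - (P a)%:C = (Phi b)%:C - (Phi a)%:C.
  apply: (@same_deriv_eq R a b (fun t => (P t)%:C) (fun t => (Phi t)%:C)
    (fun t => (phi t)%:C) ab) => // x xab.
  by rewrite -cl //; apply: wd_sub (HP x xab).
have -> : (\int[mu]_(t in `[a, b]) phi t = \int[mu]_(t in `[a, b]) psi t)%R.
  by apply: eq_Rintegral => x; rewrite inE /= in_itv /= => xab; rewrite cl.
rewrite -(@Rintegral_sub (a - 1) b a psi); last 2 first.
- by lra.
- apply: rcont_integrable; first lra.
  by move=> x _; apply: wc_sub (cpsi x).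
by apply: complexI; rewrite rmorphB E rmorphB.
Qed.

Lemma wd_Im (A : set R) (F : R -> R[i]) x l : rwd A F x l ->
  rwd A (fun s => (cIm (F s))%:C) x (cIm l)%:C.
Proof.
move=> H.
have E (z : R[i]) : cIm z = cRe (- ci * z) by case: z => u w /=; ring.
rewrite E; have /(@wd_Re R R (real_complex R)) := wdZ (- ci) H.
by move=> /(_ (fun=> erefl)) D e e0; have [dl dl0 Hd] := D e e0; exists dl => // s As sd;
  rewrite !E; exact: Hd.
Qed.

Lemma cint_FTC a b F f : a <= b ->
  (forall x, a <= x <= b -> rwd (seg a b) F x (f x)) -> rcont a b f ->
  cint a b f = F b - F a.
Proof.
move=> ab HF Hf.
have E1 := @real_FTC a b (fun x => cRe (F x)) (fun x => cRe (f x)) ab.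
have E2 := @real_FTC a b (fun x => cIm (F x)) (fun x => cIm (f x)) ab.
apply: complexP; rewrite ?cReD ?cImD ?cReN ?cImN /=.
  apply: E1 => x xab; first by apply: wd_Re => //; exact: HF.
  by apply: rwc_Re; exact: Hf.
apply: E2 => x xab; first by apply: wd_Im => //; exact: HF.
by apply: rwc_Im; exact: Hf.
Qed.

Definition cinteg a b f :=
  mu.-integrable `[a, b]%classic (EFin \o (fun x => cRe (f x))) /\
  mu.-integrable `[a, b]%classic (EFin \o (fun x => cIm (f x))).

Lemma cint_sub a b x f : a <= x <= b -> cinteg a b f ->
  cint a b f = cint a x f + cint x b f.
Proof.
move=> axb [H1 H2]; apply: complexP; rewrite ?cReD ?cImD /=.
  by rewrite -(Rintegral_sub axb H1) subrKC.
by rewrite -(Rintegral_sub axb H2) subrKC.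
Qed.

Lemma cint_eq a b f g : (forall x, a <= x <= b -> f x = g x) -> cint a b f = cint a b g.
Proof.
move=> fg; apply: complexP => /=; apply: eq_Rintegral => x; rewrite inE /= in_itv /= => xab;
by rewrite fg.
Qed.

(** A single point is negligible. This serves on the right arm, where glued functions take their
    left value at [beta]. *)
Lemma cint_eq_oc a b f g : rcont a b g -> a <= b ->
  (forall x, a < x <= b -> f x = g x) -> cint a b f = cint a b g.
Proof.
move=> gc ab fg.
have H (p q : R -> R) : (forall x, a < x <= b -> p x = q x) -> rcont a b (fun t => (q t)%:C) ->
   (\int[mu]_(t in `[a, b]) p t)%R = (\int[mu]_(t in `[a, b]) q t)%R.
  move=> pq qc; have qi : mu.-integrable `]a, b]%classic (EFin \o q).
    apply: integrableS (rcont_integrable ab qc) => //.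
    by apply: subset_itv; rewrite ?bnd_simp.
  have pi : mu.-integrable `]a, b]%classic (EFin \o p).
    by apply: eq_integrable qi => // x; rewrite inE /= in_itv /= => h; rewrite /= pq.
  rewrite -(Rintegral_itv_obnd_cbnd pi) -(Rintegral_itv_obnd_cbnd qi).
  by apply: eq_Rintegral => x; rewrite inE /= in_itv /= => h; rewrite pq.
apply: complexP => /=; apply: H => x xab.
- by rewrite fg.
- by apply: rwc_Re; exact: gc.
- by rewrite fg.
- by apply: rwc_Im; exact: gc.
Qed.

Definition cmeas f := measurable_fun I (fun x => cRe (f x)) /\
  measurable_fun I (fun x => cIm (f x)).

(** The left branch is taken at [beta] itself, in agreement with [shifted_potential]. *)
Definition pw (T : Type) (beta : R) (fl fr : R -> T) x := if beta < x then fr x else fl x.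

Lemma pw_measurable beta phil phir : -1 <= beta <= 1 ->
  rcont (-1) beta (fun t => (phil t)%:C) -> rcont beta 1 (fun t => (phir t)%:C) ->
  measurable_fun I (pw beta phil phir).
Proof.
move=> /andP[b1 b2] Hl Hr.
have -> : I = `[-1, beta]%classic `|` `]beta, 1]%classic.
  by rewrite -itv_bndbnd_setU // ?bnd_simp.
apply/measurable_funU => //; split.
  apply: (eq_measurable_fun phil); last exact: rcont_measurable.
  by move=> x; rewrite inE /= in_itv /= => /andP[_ xb]; rewrite /pw ltNge xb.
apply: (eq_measurable_fun phir).
  by move=> x; rewrite inE /= in_itv /= => /andP[xb _]; rewrite /pw xb.
apply: (measurable_funS _ _ (rcont_measurable Hr)) => //.
by apply: subset_itv; rewrite ?bnd_simp.
Qed.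

Lemma pw_Re beta (fl fr : R -> R[i]) :
  (fun x => cRe (pw beta fl fr x)) = pw beta (fun x => cRe (fl x)) (fun x => cRe (fr x)).
Proof. by apply/funext => x; rewrite /pw; case: ifP. Qed.

Lemma pw_Im beta (fl fr : R -> R[i]) :
  (fun x => cIm (pw beta fl fr x)) = pw beta (fun x => cIm (fl x)) (fun x => cIm (fr x)).
Proof. by apply/funext => x; rewrite /pw; case: ifP. Qed.

Lemma pw_cmeas beta (fl fr : R -> R[i]) : -1 <= beta <= 1 ->
  rcont (-1) beta fl -> rcont beta 1 fr -> cmeas (pw beta fl fr).
Proof.
move=> hb Hl Hr; rewrite /cmeas pw_Re pw_Im; split; apply: pw_measurable => //.
- by move=> x hx; apply: rwc_Re; exact: Hl.
- by move=> x hx; apply: rwc_Re; exact: Hr.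
- by move=> x hx; apply: rwc_Im; exact: Hl.
- by move=> x hx; apply: rwc_Im; exact: Hr.
Qed.

Lemma pw_bounded beta (fl fr : R -> R[i]) : -1 <= beta <= 1 ->
  rcont (-1) beta fl -> rcont beta 1 fr ->
  exists2 M, 0 < M & forall x, -1 <= x <= 1 -> cabs (pw beta fl fr x) <= M.
Proof.
move=> /andP[b1 b2] Hl Hr.
have [M1 M10 H1] := seg_bounded b1 Hl; have [M2 M20 H2] := seg_bounded b2 Hr.
exists (M1 + M2); first lra.
move=> x xab; rewrite /pw; case: ltP => xb.
  by have := H2 x; rewrite (ltW xb) => /(_ _)/le_trans h; apply: h; lra.
by have := H1 x; rewrite xb andbT => /(_ _)/le_trans h; apply: h; lra.
Qed.

Lemma bounded_cinteg f M a b : -1 <= a -> b <= 1 -> cmeas f ->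
  (forall x, -1 <= x <= 1 -> cabs (f x) <= M) -> cinteg a b f.
Proof.
move=> ha hb [m1 m2] H.
have sub : `[a, b]%classic `<=` I by apply: subset_itv; rewrite bnd_simp.
split; apply: (@integrable_bounded _ _ _ M).
- exact: (measurable_funS _ sub m1).
- by move=> x xab; apply: (le_trans (Re_le_cabs _)); apply: H; lra.
- exact: (measurable_funS _ sub m2).
- by move=> x xab; apply: (le_trans (Im_le_cabs _)); apply: H; lra.
Qed.

(** Only the primitives have to agree at [beta]; the integrands may jump there, as the second
    derivative of a solution does. *)
Lemma pw_FTC beta Fl Fr fl fr : -1 <= beta <= 1 ->
  (forall x, -1 <= x <= beta -> rwd (seg (-1) beta) Fl x (fl x)) ->
  (forall x, beta <= x <= 1 -> rwd (seg beta 1) Fr x (fr x)) ->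
  rcont (-1) beta fl -> rcont beta 1 fr -> Fl beta = Fr beta ->
  indefinite_integral (-1) 1 (pw beta Fl Fr) (pw beta fl fr).
Proof.
move=> hb HFl HFr Hl Hr E x; rewrite in_itv /= => /andP[x1 x2].
have /andP[b1 b2] := hb.
have F1 : pw beta Fl Fr (-1) = Fl (-1) by rewrite /pw ltNge b1.
rewrite F1.
have [xb|xb] := leP x beta.
  rewrite {1}/pw ltNge xb /= (@cint_eq _ _ _ fl); last first.
    by move=> y hy; rewrite /pw ltNge; have -> : y <= beta by lra.
  rewrite (@cint_FTC (-1) x Fl fl) //; first by rewrite subrKC.
    move=> y hy; apply: (@wd_sub _ _ _ _ (seg (-1) beta)); last by apply: HFl; lra.
    by move=> u /andP[h1 h2]; apply/andP; split; lra.
  by apply: rcont_sub Hl.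
rewrite {1}/pw xb.
have [M _ HM] := pw_bounded hb Hl Hr.
have fi : cinteg (-1) x (pw beta fl fr) by apply: (bounded_cinteg _ _ (pw_cmeas hb Hl Hr) HM).
rewrite (@cint_sub (-1) x beta _ _ fi); last lra.
rewrite (@cint_eq (-1) beta _ fl); last first.
  by move=> y hy; rewrite /pw ltNge; have -> : y <= beta by lra.
rewrite (@cint_FTC (-1) beta Fl fl) //.
rewrite (@cint_eq_oc beta x _ fr) //; last 3 first.
- by apply: rcont_sub Hr => //.
- exact: ltW.
- by move=> y /andP[hy _]; rewrite /pw hy.
rewrite (@cint_FTC beta x Fr fr); last 3 first.
- exact: ltW.
- move=> y hy; apply: (@wd_sub _ _ _ _ (seg beta 1)); last by apply: HFr; lra.
  by move=> u /andP[h1 h2]; apply/andP; split; lra.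
- by apply: rcont_sub Hr.
rewrite E; ring.
Qed.

End Lebesgue.

(** * Square-integrable functions on [-1, 1] *)

Section L2.
Context {R : realType}.
Local Notation mu := (@lebesgue_measure R).
Local Notation I := (`[(-1)%R : R, 1%R]%classic).
Implicit Types (a b x y : R) (phi psi : R -> R) (f g u v : R -> R[i]).

Lemma II x : x \in `[-1, 1] = (-1 <= x <= 1).
Proof. by rewrite in_itv. Qed.

Lemma cabs2_measurable f : cmeas f -> measurable_fun I (fun x => cabs (f x) ^+ 2).
Proof.
move=> [m1 m2].
have -> : (fun x => cabs (f x) ^+ 2) = (fun x => cRe (f x) ^+ 2 + cIm (f x) ^+ 2).
  by apply/funext => x; rewrite cabs_sqr.
by apply: measurable_funD; apply: measurable_funX.
Qed.

Lemma inL2P f : inL2 f <-> cmeas f /\ mu.-integrable I (EFin \o (fun x => cabs (f x) ^+ 2)).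
Proof.
have E : (fun x => `| (cabs (f x) ^+ 2)%:E |%E) = (fun x => (cabs (f x) ^+ 2)%:E).
  by apply/funext => x; rewrite abse_EFin ger0_norm // exprn_ge0 // cabs_ge0.
split => [[m1 m2 H]|[[m1 m2] /integrableP[_ H]]].
  split => //; apply/integrableP; split.
    by apply/measurable_EFinP; exact: cabs2_measurable.
  by rewrite /comp E.
by split => //; rewrite /comp E in H.
Qed.

Lemma inL2_bounded f M : cmeas f -> (forall x, -1 <= x <= 1 -> cabs (f x) <= M) -> inL2 f.
Proof.
move=> mf H; apply/inL2P; split => //.
apply: (@integrable_bounded _ _ _ _ (M ^+ 2)); first exact: cabs2_measurable.
move=> x hx; rewrite ger0_norm ?exprn_ge0 ?cabs_ge0 //.
have := H x hx; have := cabs_ge0 (f x) => h0 h1.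
by apply: lerXn2r; rewrite ?nnegrE // (le_trans h0).
Qed.

Lemma inL2_le f phi : cmeas f -> mu.-integrable I (EFin \o phi) ->
  (forall x, -1 <= x <= 1 -> cabs (f x) ^+ 2 <= phi x) -> inL2 f.
Proof.
move=> mf ip H; apply/inL2P; split => //.
apply: (le_integrable _ _ _ ip) => //.
  by apply/measurable_EFinP; exact: cabs2_measurable.
move=> x; rewrite /= in_itv /= => hx; rewrite lee_fin ger0_norm ?exprn_ge0 ?cabs_ge0 //.
by apply: (le_trans (H x hx)); exact: ler_norm.
Qed.

Lemma cmeasD f g : cmeas f -> cmeas g -> cmeas (fun x => f x + g x).
Proof.
move=> [m1 m2] [m3 m4]; split.
  have -> : (fun x => cRe (f x + g x)) = (fun x => cRe (f x) + cRe (g x)).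
    by apply/funext => x; rewrite cReD.
  exact: measurable_funD.
have -> : (fun x => cIm (f x + g x)) = (fun x => cIm (f x) + cIm (g x)).
  by apply/funext => x; rewrite cImD.
exact: measurable_funD.
Qed.

Lemma cmeasZ k f : cmeas f -> cmeas (fun x => k * f x).
Proof.
move=> [m1 m2]; split.
  have -> : (fun x => cRe (k * f x)) = (fun x => cRe k * cRe (f x) - cIm k * cIm (f x)).
    by apply/funext => x; rewrite cReM.
  by apply: measurable_funB; apply: measurable_funM.
have -> : (fun x => cIm (k * f x)) = (fun x => cRe k * cIm (f x) + cIm k * cRe (f x)).
  by apply/funext => x; rewrite cImM.
by apply: measurable_funD; apply: measurable_funM.
Qed.

Lemma integrable_sum phi psi : mu.-integrable I (EFin \o phi) -> mu.-integrable I (EFin \o psi) ->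
  mu.-integrable I (EFin \o (fun x => phi x + psi x)).
Proof. by move=> h1 h2; apply: eq_integrable (integrableD _ h1 h2). Qed.

Lemma integrable_scale k phi : mu.-integrable I (EFin \o phi) ->
  mu.-integrable I (EFin \o (fun x => k * phi x)).
Proof. by move=> h1; apply: eq_integrable (integrableZl _ k h1). Qed.

Lemma inL2D f g : inL2 f -> inL2 g -> inL2 (fun x => f x + g x).
Proof.
move=> /inL2P[m1 i1] /inL2P[m2 i2].
apply: (inL2_le (cmeasD m1 m2) (integrable_sum (integrable_scale 2 i1) (integrable_scale 2 i2))).
move=> x _; have := cabsD (f x) (g x); have := cabs_ge0 (f x); have := cabs_ge0 (g x).
have := cabs_ge0 (f x + g x); set p := cabs (f x + g x); set q := cabs (f x); set s := cabs (g x).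
move=> p0 s0 q0 h; apply: (@le_trans _ _ ((q + s) ^+ 2)).
  by apply: lerXn2r; rewrite ?nnegrE // addr_ge0.
rewrite -subr_ge0 (_ : _ - _ = (q - s) ^+ 2) ?sqr_ge0 //; ring.
Qed.

Lemma inL2Z k f : inL2 f -> inL2 (fun x => k * f x).
Proof.
move=> /inL2P[m1 i1]; apply: (inL2_le (cmeasZ k m1) (integrable_scale (cabs k ^+ 2) i1)).
by move=> x _; rewrite cabsM exprMn.
Qed.

Lemma inL2_ext f g : (forall x, f x = g x) -> inL2 f -> inL2 g.
Proof. by move=> fg; have -> : g = f by apply/funext. Qed.

Lemma one_integrable (k : R) : mu.-integrable I (EFin \o (fun=> k)).
Proof. by apply: (@integrable_bounded _ _ _ _ `|k|) => //; exact: measurable_cst. Qed.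

Lemma inL2_cinteg f : inL2 f -> cinteg (-1) 1 f.
Proof.
move=> /inL2P[[m1 m2] i1].
have i2 := integrable_sum (one_integrable 1) i1.
have H (p : R) q : 0 <= q -> `|p| <= q -> `|p| <= `|1 + q ^+ 2|.
  move=> q0 pq; rewrite [X in _ <= X]ger0_norm; first by (have := sqr_ge0 (q - 1 / 2); lra).
  by rewrite addr_ge0 // sqr_ge0.
split; apply: (le_integrable _ _ _ i2) => //; try exact/measurable_EFinP.
  move=> x _; rewrite lee_fin; apply: H; [exact: cabs_ge0|exact: Re_le_cabs].
move=> x _; rewrite lee_fin; apply: H; [exact: cabs_ge0|exact: Im_le_cabs].
Qed.

Lemma L2norm_ge0 f : 0 <= L2norm f.
Proof. exact: sqrtr_ge0. Qed.

Lemma L2norm_sqr f : L2norm f ^+ 2 = (\int[mu]_(x in I) (cabs (f x) ^+ 2))%R.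
Proof.
rewrite sqr_sqrtr //; apply: Rintegral_ge0 => x _.
by rewrite exprn_ge0 // cabs_ge0.
Qed.

Lemma measure_I : fine (mu I) = 2.
Proof. by rewrite lebesgue_measure_itv /= lte_fin; case: ltP => /=; lra. Qed.

Lemma L1_le_L2 phi f : inL2 f -> mu.-integrable I (EFin \o phi) ->
  (forall x, -1 <= x <= 1 -> `|phi x| <= cabs (f x)) ->
  (\int[mu]_(x in I) `|phi x|)%R <= 2 * L2norm f.
Proof.
move=> f2 pi H; have /inL2P[mf fi] := f2.
have key t : 0 < t -> (\int[mu]_(x in I) `|phi x|)%R <= t + (2 * t)^-1 * L2norm f ^+ 2.
  move=> t0; rewrite L2norm_sqr.
  have i1 := one_integrable (t / 2); have i2 := integrable_scale (2 * t)^-1 fi.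
  apply: (@le_trans _ _ (\int[mu]_(x in I) (t / 2 + (2 * t)^-1 * cabs (f x) ^+ 2))%R).
    apply: le_Rintegral => //; [exact: integrable_norm|exact: integrable_sum|].
    move=> x; rewrite /= in_itv /= => hx; apply: (le_trans (H x hx)).
    set q := cabs (f x).
    rewrite -subr_ge0 (_ : _ - _ = (2 * t)^-1 * (t - q) ^+ 2); last by field; rewrite gt_eqF.
    by rewrite mulr_ge0 ?sqr_ge0 // invr_ge0 mulr_ge0 // ltW.
  rewrite RintegralD // Rintegral_cst // measure_I divfK // lerD2l.
  by rewrite RintegralZl.
have n0 := L2norm_ge0 f; have [n00|n00] := leP (L2norm f) 0.
  have n1 : L2norm f = 0 by apply/eqP; rewrite eq_le n00.
  rewrite n1 mulr0; apply/ler_addgt0Pr => e e0; rewrite add0r.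
  by have := key e e0; rewrite n1 expr0n mulr0 addr0.
apply: (le_trans (key _ n00)).
rewrite (_ : (2 * L2norm f)^-1 * L2norm f ^+ 2 = L2norm f / 2); last by field; rewrite gt_eqF.
lra.
Qed.

Lemma cint_L2_bound f x : inL2 f -> -1 <= x <= 1 -> cabs (cint (-1) x f) <= 4 * L2norm f.
Proof.
move=> f2 hx; have [i1 i2] := inL2_cinteg f2.
have sub : `[-1, x]%classic `<=` I by apply: subset_itv; rewrite bnd_simp //; lra.
have key phi : mu.-integrable I (EFin \o phi) ->
    (forall x, -1 <= x <= 1 -> `|phi x| <= cabs (f x)) ->
    `|(\int[mu]_(t in `[-1, x]) phi t)%R| <= 2 * L2norm f.
  move=> pi H.
  have pi' : mu.-integrable `[-1, x]%classic (EFin \o phi) by apply: integrableS pi.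
  apply: (le_trans (le_normr_Rintegral _ pi')) => //.
  apply: (le_trans _ (L1_le_L2 f2 pi H)).
  have ni := integrable_norm pi.
  have := @Rintegral_sub R (-1) 1 x (fun t => `|phi t|) hx ni.
  have : 0 <= (\int[mu]_(t in `[x, 1]) `|phi t|)%R.
    by apply: Rintegral_ge0 => t _; exact: normr_ge0.
  move=> h1 h2; rewrite -h2 in h1; move: h1; rewrite subr_ge0; exact.
apply: (le_trans (cabs_le_ReIm _)); rewrite /cint /=.
have := key _ i1 (fun x _ => Re_le_cabs (f x)); have := key _ i2 (fun x _ => Im_le_cabs (f x)).
by move=> h1 h2; rewrite (_ : 4 * _ = 2 * L2norm f + 2 * L2norm f) ?lerD //; ring.
Qed.

Lemma L2norm_bound f M : cmeas f -> 0 <= M ->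
  (forall x, -1 <= x <= 1 -> cabs (f x) <= M) -> L2norm f <= 2 * M.
Proof.
move=> mf M0 H; have f2 := inL2_bounded mf H; have /inL2P[_ fi] := f2.
rewrite -(ler_pXn2r (n := 2)) ?nnegrE ?L2norm_ge0 ?mulr_ge0 // L2norm_sqr.
apply: (@le_trans _ _ (\int[mu]_(x in I) (M ^+ 2))%R).
  apply: le_Rintegral => //; first exact: one_integrable.
  move=> x; rewrite /= in_itv /= => hx; apply: lerXn2r; rewrite ?nnegrE ?cabs_ge0 //.
  exact: H.
rewrite Rintegral_cst // measure_I; nra.
Qed.

Lemma L2norm_eq f g : (forall x, -1 <= x <= 1 -> f x = g x) -> L2norm f = L2norm g.
Proof.
move=> fg; congr Num.sqrt; apply: eq_Rintegral => x; rewrite inE /= in_itv /= => hx.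
by rewrite fg.
Qed.

Lemma cint_ae f g x : -1 <= x <= 1 -> cmeas f -> cmeas g -> ae_eqI f g ->
  cint (-1) x f = cint (-1) x g.
Proof.
move=> hx [m1 m2] [m3 m4] fg.
have sub : `[-1, x]%classic `<=` I by apply: subset_itv; rewrite bnd_simp //; lra.
have key (p q : R -> R) : measurable_fun I p -> measurable_fun I q ->
    (forall t, f t = g t -> p t = q t) ->
    (\int[mu]_(t in `[-1, x]) p t)%R = (\int[mu]_(t in `[-1, x]) q t)%R.
  move=> mp mq pq; congr fine; apply: ae_eq_integral => //.
  - by apply/measurable_EFinP; exact: measurable_funS mp.
  - by apply/measurable_EFinP; exact: measurable_funS mq.
  have [A [mA A0 subA]] := fg; exists A; split => // t /= nt; apply: subA => /= h.
  apply: nt => ht; congr EFin; apply: pq; apply: h; rewrite II.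
  by move: ht; rewrite in_itv /=; lra.
apply: complexP => /=; apply: key => // t ->; reflexivity.
Qed.

Lemma within_rwc a b phi : {within `[a, b], continuous phi} ->
  rcont a b (fun t => (phi t)%:C).
Proof.
move=> /subspace_continuousP H x xab e e0.
have /H /cvgrPdist_le /(_ _ e0) : `[a, b]%classic x by rewrite /= in_itv.
move=> /nbhs_ballP[dl /= dl0 Hd]; exists dl => // s sab; rewrite !cabs_rdist => sd.
rewrite distrC; apply: Hd; last by rewrite /= in_itv.
by rewrite /ball /= distrC.
Qed.

Lemma cint_rcont f : cinteg (-1) 1 f -> rcont (-1) 1 (fun x => cint (-1) x f).
Proof.
move=> [i1 i2] x hx.
have c1 := within_rwc (parameterized_integral_continuous _ i1).
have c2 := within_rwc (parameterized_integral_continuous _ i2).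
have n11 : (-1 : R) <= 1 by lra.
have := wcD (c1 n11 x hx) (wcZ ci (c2 n11 x hx)); apply: wc_ext => //.
by move=> s _; rewrite [RHS]complex_ReIm.
Qed.

Lemma cintD a b f g : cinteg a b f -> cinteg a b g ->
  cint a b (fun x => f x + g x) = cint a b f + cint a b g.
Proof.
move=> [i1 i2] [i3 i4]; apply: complexP; rewrite ?cReD ?cImD /=.
  rewrite -RintegralD //; apply: eq_Rintegral => x _; exact: cReD.
rewrite -RintegralD //; apply: eq_Rintegral => x _; exact: cImD.
Qed.

Lemma cintN a b f : cinteg a b f -> cint a b (fun x => - f x) = - cint a b f.
Proof.
move=> [i1 i2]; apply: complexP; rewrite ?cReN ?cImN /= -mulN1r -RintegralZl //;
by apply: eq_Rintegral => x _; rewrite ?cReN ?cImN mulN1r.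
Qed.

Lemma cinteg_sub a b f : -1 <= a -> b <= 1 -> cinteg (-1) 1 f -> cinteg a b f.
Proof.
move=> ha hb [i1 i2].
have sub : `[a, b]%classic `<=` I by apply: subset_itv; rewrite bnd_simp.
by split; [apply: integrableS i1|apply: integrableS i2].
Qed.

Lemma cint_point a f : cint a a f = 0.
Proof. by apply: complexP; rewrite /= set_itv1 Rintegral_set1. Qed.

Lemma indefinite_integralD f g f' g' : cinteg (-1) 1 f' -> cinteg (-1) 1 g' ->
  indefinite_integral (-1) 1 f f' -> indefinite_integral (-1) 1 g g' ->
  indefinite_integral (-1) 1 (fun x => f x + g x) (fun x => f' x + g' x).
Proof.
move=> i1 i2 Hf Hg x hx; rewrite (Hf x hx) (Hg x hx) cintD; first by ring.
  by move: hx; rewrite II => /andP[_ h]; exact: cinteg_sub i1.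
by move: hx; rewrite II => /andP[_ h]; exact: cinteg_sub i2.
Qed.

Lemma indefinite_integralN f f' : cinteg (-1) 1 f' -> indefinite_integral (-1) 1 f f' ->
  indefinite_integral (-1) 1 (fun x => - f x) (fun x => - f' x).
Proof.
move=> i1 Hf x hx; rewrite (Hf x hx) cintN; first by ring.
by move: hx; rewrite II => /andP[_ h]; exact: cinteg_sub i1.
Qed.

Lemma indefinite_rcont f f' : cinteg (-1) 1 f' -> indefinite_integral (-1) 1 f f' ->
  rcont (-1) 1 f.
Proof.
move=> i1 Hf x hx; apply: (@wc_ext _ _ _ _ (fun y => f (-1) + cint (-1) y f')) => //.
  by move=> s hs; rewrite -Hf // II.
by apply: wcD; [exact: wc_cst|exact: cint_rcont].
Qed.

(** Upgrades a weak derivative to a classical one: on [[a, b]] the given derivative has the same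
    integrals as the continuous [g], and a primitive of [g] differs from [f] by a constant. *)
Lemma indefinite_rwd f f' g a b : -1 <= a -> b <= 1 -> a <= b ->
  cinteg (-1) 1 f' -> indefinite_integral (-1) 1 f f' -> rcont a b g ->
  (forall x, a <= x <= b -> cint a x f' = cint a x g) ->
  forall x, a <= x <= b -> rwd (seg a b) f x (g x).
Proof.
move=> ha hb ab i1 Hf gc fg; have [P HP] := primitive_exists ab gc.
have E y : a <= y <= b -> f y = f a + (P y - P a).
  move=> hy; rewrite (Hf y); last by rewrite II; lra.
  rewrite (Hf a); last by rewrite II; lra.
  rewrite (@cint_sub _ (-1) y a); last 2 first.
  - by lra.
  - by apply: cinteg_sub i1 => //; lra.
  rewrite fg // (@cint_FTC _ a y P g); last 3 first.
  - by lra.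
  - move=> t ht; apply: (@wd_sub _ _ _ _ (seg a b)); last by apply: HP; lra.
    by move=> s /andP[h1 h2]; apply/andP; split; lra.
  - by apply: rcont_sub gc; lra.
  by ring.
move=> x hx; apply: (@wd_ext _ _ _ _ (fun y => f a + (P y - P a))) => //.
  by move=> s hs; rewrite -E.
apply: (wd_eq (wdD (wd_cst _ _ _ _) (wdB (HP x hx) (wd_cst _ _ _ _)))).
by rewrite add0r subr0.
Qed.

Lemma ae_interval (P : R -> Prop) a b : -1 <= a -> a < b -> b <= 1 ->
  {ae mu, forall x, x \in `[-1, 1] -> P x} -> ~ (forall x, a < x < b -> ~ P x).
Proof.
move=> ha ab hb [A [mA A0 subA]] H.
have sub : `]a, b[%classic `<=` A.
  move=> x; rewrite /= in_itv /= => hx; apply: subA => h; apply: (H x hx); apply: h.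
  by rewrite II; lra.
have h : (mu `]a, b[%classic <= mu A)%E by apply: le_measure; rewrite ?inE.
suff : (mu `]a, b[%classic <= 0)%E.
  by rewrite lebesgue_measure_itv /= lte_fin ab -EFinB lee_fin; lra.
by apply: (le_trans h); rewrite A0.
Qed.

End L2.

(** * Spectrum and Wronskian *)

Lemma cintZ (R : realType) (a b k : R) (f : R -> R[i]) :
  cinteg a b f -> cint a b (fun x => k%:C * f x) = k%:C * cint a b f.
Proof.
move=> [i1 i2]; apply: complexP; rewrite ?cReM ?cImM /= mul0r ?subr0 ?addr0 -RintegralZl //.
  by apply: eq_Rintegral => t _; rewrite cReM /= mul0r subr0.
by apply: eq_Rintegral => t _; rewrite cImM /= mul0r addr0.
Qed.

(** * Homogeneous and inhomogeneous equations on a segment *)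

Section SecondOrder.
Context {R : realType}.
Implicit Types (a b x t : R) (q y dy w dw f : R -> R[i]).

Definition sol a b q y dy :=
  (forall x, a <= x <= b -> rwd (seg a b) y x (dy x)) /\
  (forall x, a <= x <= b -> rwd (seg a b) dy x (q x * y x)).

Lemma seg_const a b F : (forall x, a <= x <= b -> rwd (seg a b) F x 0) ->
  forall x t, a <= x <= b -> a <= t <= b -> F x = F t :> R[i].
Proof.
move=> H x t hx ht; wlog xt : x t hx ht / t <= x.
  by move=> W; have [h|/ltW h] := leP t x; [exact: W|apply/esym; exact: W].
apply: zero_deriv_eq => // s hs; apply: (@wd_sub _ _ _ _ (seg a b)); last by apply: H; lra.
by move=> u /andP[h1 h2]; apply/andP; split; lra.
Qed.

Lemma sol_wronskian a b q y dy w dw x t : sol a b q y dy -> sol a b q w dw ->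
  a <= x <= b -> a <= t <= b -> y x * dw x - dy x * w x = y t * dw t - dy t * w t.
Proof.
move=> [H1 H2] [H3 H4].
apply: (@seg_const a b (fun x => y x * dw x - dy x * w x)) => s hs.
apply: (wd_eq (wdB (wdM (H1 s hs) (H4 s hs)) (wdM (H2 s hs) (H3 s hs)))); ring.
Qed.

Lemma sol_rcont a b q y dy : sol a b q y dy -> rcont a b y /\ rcont a b dy.
Proof. by move=> [H1 H2]; split=> x hx; [exact: wd_wc (H1 x hx)|exact: wd_wc (H2 x hx)]. Qed.

(* By variation of constants. *)
Lemma inhomogeneous a b q y dy w dw K x0 : a <= b -> a <= x0 <= b -> b - a <= 2 ->
  sol a b q y dy -> sol a b q w dw -> rcont a b q ->
  (forall x, a <= x <= b -> y x * dw x - dy x * w x = 1) ->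
  (forall x, a <= x <= b -> [/\ cabs (y x) <= K, cabs (dy x) <= K, cabs (w x) <= K,
     cabs (dw x) <= K & cabs (q x) <= K]) ->
  exists C : R, 0 <= C /\ forall f B, rcont a b f -> (forall x, a <= x <= b -> cabs (f x) <= B) ->
  exists v dv, [/\ forall x, a <= x <= b -> rwd (seg a b) v x (dv x),
     forall x, a <= x <= b -> rwd (seg a b) dv x (q x * v x + q x * f x),
     v x0 = 0, dv x0 = 0 &
     forall x, a <= x <= b -> cabs (v x) <= C * B /\ cabs (dv x) <= C * B].
Proof.
move=> ab hx0 ba2 Hy Hw qc W1 HK.
have K0 : 0 <= K by have [h _ _ _ _] := HK x0 hx0; apply: le_trans h; exact: cabs_ge0.
have [cy _] := sol_rcont Hy; have [cw _] := sol_rcont Hw.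
(* Each of the two coefficients is a primitive bounded by 2 K^2 B on an interval of length at most
   2, and each is multiplied by a solution bounded by [K]. *)
exists (4 * K ^+ 3); split; first by rewrite mulr_ge0 // exprn_ge0.
move=> f B fc fB.
have B0 : 0 <= B by apply: le_trans (fB x0 hx0); exact: cabs_ge0.
have prim (k : R -> R[i]) : rcont a b k -> (forall x, a <= x <= b -> cabs (k x) <= K) ->
    exists P, [/\ forall x, a <= x <= b -> rwd (seg a b) P x (k x * (q x * f x)), P x0 = 0 &
      forall x, a <= x <= b -> cabs (P x) <= 2 * K ^+ 2 * B].
  move=> kc kK.
  have [P HP] : exists P : R -> R[i], forall x, a <= x <= b -> rwd (seg a b) P x (k x * (q x * f x)).
    apply: primitive_exists => // x hx; apply: wcM; first exact: kc.
    by apply: wcM; [exact: qc|exact: fc].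
  have HP0 x : a <= x <= b -> rwd (seg a b) (fun x => P x - P x0) x (k x * (q x * f x)).
    by move=> hx; apply: (wd_eq (wdB (HP x hx) (wd_cst _ _ _ _))); rewrite subr0.
  exists (fun x => P x - P x0); split => //; first by rewrite subrr.
  move=> x hx.
  have bd s : a <= s <= b -> cabs (k s * (q s * f s)) <= K ^+ 2 * B.
    move=> hs; rewrite !cabsM expr2 -mulrA; apply: ler_pM; rewrite ?cabs_ge0 ?mulr_ge0 ?cabs_ge0 //.
      exact: kK.
    by apply: ler_pM; rewrite ?cabs_ge0 //; [case: (HK s hs)|exact: fB].
  have c0 : 0 <= K ^+ 2 * B by rewrite mulr_ge0 // exprn_ge0.
  have sub u t : a <= u -> t <= b -> u <= t -> cabs (P t - P u) <= 2 * K ^+ 2 * B.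
    move=> au tb ut; apply: (@le_trans _ _ (K ^+ 2 * B * (t - u))).
      apply: (@mean_value_bound _ u t P (fun x => k x * (q x * f x))) => // s hs.
        apply: (@wd_sub _ _ _ _ (seg a b)); last by apply: HP; lra.
        by move=> p /andP[h1 h2]; apply/andP; split; lra.
      by apply: bd; lra.
    rewrite -[2 * _ * _]mulrA [2 * _]mulrC; apply: ler_wpM2l => //; lra.
  by have [h|/ltW h] := leP x0 x; [|rewrite cabsB]; apply: sub => //; lra.
have [A1 [D1 A10 B1]] := prim y cy (fun x hx => let: And5 h _ _ _ _ := HK x hx in h).
have [A2 [D2 A20 B2]] := prim w cw (fun x hx => let: And5 _ _ h _ _ := HK x hx in h).
have Q0 : 0 <= 2 * K ^+ 2 * B by rewrite !mulr_ge0 // exprn_ge0.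
exists (fun x => w x * A1 x - y x * A2 x), (fun x => dw x * A1 x - dy x * A2 x); split.
- move=> x hx; apply: (wd_eq (wdB (wdM (Hw.1 x hx) (D1 x hx)) (wdM (Hy.1 x hx) (D2 x hx)))); ring.
- move=> x hx; apply: (wd_eq (wdB (wdM (Hw.2 x hx) (D1 x hx)) (wdM (Hy.2 x hx) (D2 x hx)))).
  by rewrite -[X in _ = _ + X]mul1r -(W1 x hx); ring.
- by rewrite A10 A20 !mulr0 subr0.
- by rewrite A10 A20 !mulr0 subr0.
move=> x hx; have [k1 k2 k3 k4 _] := HK x hx.
have E : 4 * K ^+ 3 * B = K * (2 * K ^+ 2 * B) + K * (2 * K ^+ 2 * B) by ring.
rewrite E; split; apply: (le_trans (cabs_sub_le _ _)); rewrite !cabsM;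
  by apply: lerD; apply: ler_pM; rewrite ?cabs_ge0 //; [exact: B1|exact: B2].
Qed.

End SecondOrder.

(** * Resolvent and spectrum through the Wronskian at [beta] *)

Section Spectrum.
Context {R : realType}.
Local Notation mu := (@lebesgue_measure R).
Variables (beta delta h : R) (V : R[i] -> R[i]) (z : R[i]).
Hypotheses (hb : -1 < beta < 1) (h0 : 0 < h).
Let ql (x : R) := (V x%:C - delta *i - z) / (h ^+ 2)%:C.
Let qr (x : R) := (V x%:C + delta *i - z) / (h ^+ 2)%:C.
Hypotheses (cql : rcont (-1) beta ql) (cqr : rcont beta 1 qr).
Variables (m dm n dn p dp r dr : R -> R[i]).
Hypotheses (Hm : sol (-1) beta ql m dm) (Hn : sol (-1) beta ql n dn).
Hypotheses (Hp : sol beta 1 qr p dp) (Hr : sol beta 1 qr r dr).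
Hypotheses (m0 : m (-1) = 0) (dm0 : dm (-1) = 1) (n0 : n (-1) = 1) (dn0 : dn (-1) = 0).
Hypotheses (p1 : p 1 = 0) (dp1 : dp 1 = 1) (r1 : r 1 = 1) (dr1 : dr 1 = 0).

Let Wr := m beta * dp beta - dm beta * p beta.

Let hb' : -1 <= beta <= 1. Proof. by have := hb; lra. Qed.
Let lbeta : -1 <= beta <= beta. Proof. by have := hb; lra. Qed.
Let rbeta : beta <= beta <= 1. Proof. by have := hb; lra. Qed.
Let lend : -1 <= (-1 : R) <= beta. Proof. by have := hb; lra. Qed.
Let rend : beta <= (1 : R) <= 1. Proof. by have := hb; lra. Qed.

Let h2 : (h ^+ 2)%:C != 0 :> R[i].
Proof. by rewrite -cabs_gt0 cabs_real gtr0_norm exprn_gt0. Qed.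

Let Wl x : -1 <= x <= beta -> n x * dm x - dn x * m x = 1.
Proof. by move=> hx; rewrite (sol_wronskian Hn Hm hx lend) n0 dm0 dn0 mulr1 mul0r subr0. Qed.

Let Wrt x : beta <= x <= 1 -> r x * dp x - dr x * p x = 1.
Proof. by move=> hx; rewrite (sol_wronskian Hr Hp hx rend) r1 dp1 dr1 mulr1 mul0r subr0. Qed.

Let shiftE x : shifted_potential delta beta V x = z + (h ^+ 2)%:C * pw beta ql qr x.
Proof. by rewrite /shifted_potential /pw /ql /qr; case: ifP => _; rewrite [_%:C * _]mulrC divfK ?h2 // subrKC. Qed.

Let pwE (T : Type) (fl fr : R -> T) : fl beta = fr beta ->
  (forall x, -1 <= x <= beta -> pw beta fl fr x = fl x) /\
  (forall x, beta <= x <= 1 -> pw beta fl fr x = fr x).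
Proof.
move=> E; split=> x /andP[h1 h3]; rewrite /pw; case: ltP => // hx.
  by clear E; exfalso; lra.
by have -> : x = beta by apply/eqP; rewrite eq_le hx h1.
Qed.

Let rcM a b (f g : R -> R[i]) : rcont a b f -> rcont a b g -> rcont a b (fun x => f x * g x).
Proof. by move=> hf hg x hx; apply: wcM; [exact: hf|exact: hg]. Qed.

(** The function [G], with G'' = - f / h^2, absorbs the merely square-integrable right-hand side.
    The rest [y] of the solution satisfies y'' = q (y + G) with continuous data on each side, so
    classical solutions can be glued. *)
Let pw_domain (yl dyl yr dyr f G G1 : R -> R[i]) : inL2 f ->
  (forall x, -1 <= x <= beta -> rwd (seg (-1) beta) yl x (dyl x)) ->
  (forall x, -1 <= x <= beta -> rwd (seg (-1) beta) dyl x (ql x * (yl x + G x))) ->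
  (forall x, beta <= x <= 1 -> rwd (seg beta 1) yr x (dyr x)) ->
  (forall x, beta <= x <= 1 -> rwd (seg beta 1) dyr x (qr x * (yr x + G x))) ->
  yl beta = yr beta -> dyl beta = dyr beta ->
  (forall x, -1 <= x <= 1 -> rwd (seg (-1) 1) G x (G1 x)) ->
  rcont (-1) 1 G1 ->
  indefinite_integral (-1) 1 G1 (fun x => - ((h ^+ 2)%:C)^-1 * f x) ->
  yl (-1) + G (-1) = 0 -> yr 1 + G 1 = 0 ->
  schrodinger delta beta V h (fun x => pw beta yl yr x + G x)
    (fun x => f x + z * (pw beta yl yr x + G x)).
Proof.
move=> f2 Hyl Hdyl Hyr Hdyr Ey Edy HG G1c HG1 b1 b2.
have /andP[bm1 bp1] := hb'.
have cyl : rcont (-1) beta yl by move=> x hx; exact: wd_wc (Hyl x hx).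
have cyr : rcont beta 1 yr by move=> x hx; exact: wd_wc (Hyr x hx).
have cdyl : rcont (-1) beta dyl by move=> x hx; exact: wd_wc (Hdyl x hx).
have cdyr : rcont beta 1 dyr by move=> x hx; exact: wd_wc (Hdyr x hx).
have cG : rcont (-1) 1 G by move=> x hx; exact: wd_wc (HG x hx).
have cGl : rcont (-1) beta G by apply: rcont_sub cG.
have cGr : rcont beta 1 G by apply: rcont_sub cG.
have pw2 fl fr : rcont (-1) beta fl -> rcont beta 1 fr -> inL2 (pw beta fl fr).
  by move=> c1 c2; have [M _ HM] := pw_bounded hb' c1 c2; apply: inL2_bounded (pw_cmeas hb' c1 c2) HM.
have G2 : inL2 G.
  apply: (inL2_ext _ (pw2 G G cGl cGr)) => x; by rewrite /pw; case: ifP.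
have G12 : inL2 G1.
  apply: (inL2_ext _ (pw2 G1 G1 _ _)) => [x||]; first by rewrite /pw; case: ifP.
    by apply: rcont_sub G1c.
  by apply: rcont_sub G1c.
have u2 : inL2 (fun x => pw beta yl yr x + G x) by apply: inL2D => //; exact: pw2.
have cl2 : rcont (-1) beta (fun x => ql x * (yl x + G x)).
  by apply: rcM => // x hx; apply: wcD; [exact: cyl|exact: cGl].
have cr2 : rcont beta 1 (fun x => qr x * (yr x + G x)).
  by apply: rcM => // x hx; apply: wcD; [exact: cyr|exact: cGr].
have q2 := pw2 _ _ cl2 cr2.
have f2' : inL2 (fun x => - ((h ^+ 2)%:C)^-1 * f x) by exact: inL2Z.
split => //.
- by apply: inL2D => //; exact: inL2Z.
- by rewrite (pwE Ey).1.
- by rewrite (pwE Ey).2.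
exists (fun x => pw beta dyl dyr x + G1 x),
  (fun x => pw beta (fun x => ql x * (yl x + G x)) (fun x => qr x * (yr x + G x)) x
            + - ((h ^+ 2)%:C)^-1 * f x); split.
- by apply: inL2D.
- apply: indefinite_integralD.
  + by apply: inL2_cinteg; exact: pw2.
  + exact: inL2_cinteg.
  + exact: pw_FTC.
  move=> x; rewrite II => hx; rewrite (@cint_FTC _ (-1) x G G1); first by rewrite subrKC.
  + by lra.
  + move=> t ht; apply: (@wd_sub _ _ _ _ (seg (-1) 1)); last by apply: HG; lra.
    by move=> s /andP[h1 h3]; apply/andP; split; lra.
  by apply: rcont_sub G1c; lra.
- apply: indefinite_integralD => //.
  + exact: inL2_cinteg.
  + exact: inL2_cinteg.
  exact: pw_FTC.
apply: aeW => x _; rewrite shiftE /pw.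
have A (H a y k : R[i]) : H != 0 -> k + z * y = - H * (a * y + - H^-1 * k) + (z + H * a) * y.
  by move=> H0; field.
by case: ifP => _; exact: A.
Qed.

(** The two Dirichlet solutions are then proportional at [beta] and glue to an eigenfunction. It and
    the zero function both solve the equation with right-hand side 0, which contradicts uniqueness
    in the resolvent set. *)
Lemma wronskian0_spectrum : Wr = 0 -> spectrum (schrodinger delta beta V h) z.
Proof.
move=> W0 [_ uniq _].
have pnz : ~ (p beta = 0 /\ dp beta = 0).
  by move=> [e1 e2]; have := Wrt rbeta; rewrite e1 e2 !mulr0 subr0 => /eqP; rewrite eq_sym oner_eq0.
have mnz : ~ (m beta = 0 /\ dm beta = 0).
  by move=> [e1 e2]; have := Wl lbeta; rewrite e1 e2 !mulr0 subr0 => /eqP; rewrite eq_sym oner_eq0.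
have [lam [l1 l2]] : exists lam, p beta = lam * m beta /\ dp beta = lam * dm beta.
  have E : m beta * dp beta = dm beta * p beta by apply/eqP; rewrite -subr_eq0; apply/eqP.
  have [mb|mb] := eqVneq (m beta) 0.
    have dmb : dm beta != 0 by apply/eqP => e; apply: mnz.
    exists (dp beta / dm beta); rewrite divfK // mb mulr0; split => //.
    by move: E; rewrite mb mul0r => /esym/eqP; rewrite mulf_eq0 (negbTE dmb) => /eqP.
  exists (p beta / m beta); rewrite divfK //; split => //.
  by rewrite mulrAC [p beta * _]mulrC -E; field.
pose y := fun x => lam * m x; pose dy := fun x => lam * dm x.
have T1 : schrodinger delta beta V h (fun x => pw beta y p x + 0) (fun x => 0 + z * (pw beta y p x + 0)).
  have z2 : inL2 (fun=> 0 : R[i]).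
    have -> : (fun=> 0 : R[i]) = (pw beta (fun=> 0) (fun=> 0)).
      by apply/funext => x; rewrite /pw; case: ifP.
    have c1 a b : rcont a b (fun=> 0 : R[i]) by move=> x _; exact: wc_cst.
    have [M _ HM] := pw_bounded hb' (c1 _ _) (c1 _ _).
    by apply: inL2_bounded (pw_cmeas hb' (c1 _ _) (c1 _ _)) HM.
  apply: (@pw_domain y dy p dp (fun=> 0) (fun=> 0) (fun=> 0)) => //.
  - by move=> x hx; apply: wdZ; exact: Hm.1.
  - by move=> x hx; apply: (wd_eq (wdZ lam (Hm.2 x hx))); rewrite /y; ring.
  - by move=> x hx; exact: Hp.1.
  - by move=> x hx; rewrite addr0; exact: Hp.2.
  - by move=> x hx; exact: wd_cst.
  - by move=> x hx; exact: wc_cst.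
  - move=> x; rewrite II => hx.
    rewrite (@cint_eq _ _ _ _ (fun=> 0)); last by move=> t _; rewrite mulr0.
    rewrite (@cint_FTC _ (-1) x (fun=> 0)); [by rewrite subr0 addr0|lra| |].
      by move=> t _; exact: wd_cst.
    by move=> t _; exact: wc_cst.
  - by rewrite /y m0 mulr0 addr0.
  - by rewrite p1 addr0.
have T0 : schrodinger delta beta V h (fun=> 0) (fun x => 0 + z * 0).
  have -> : (fun=> 0 + z * 0) = (fun=> 0) :> (R -> R[i]).
    by apply/funext => x; rewrite mulr0 addr0.
  have [e2 _ _ _ [u1 [u2 [H1 H2 H3 H4]]]] := T1.
  have z2 : inL2 (fun=> 0 : R[i]).
    by apply: (inL2_ext _ (inL2Z 0 e2)) => x; rewrite mul0r.
  have zi : indefinite_integral (-1) 1 (fun=> 0 : R[i]) (fun=> 0).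
    move=> x; rewrite II => hx; rewrite (@cint_FTC _ (-1) x (fun=> 0)); [by rewrite subr0 addr0|lra| |].
      by move=> t _; exact: wd_cst.
    by move=> t _; exact: wc_cst.
  split => //; exists (fun=> 0), (fun=> 0); split => //.
  by apply: aeW => x _; rewrite !mulr0 addr0.
have ae0 := uniq _ _ (fun=> 0) T1 T0.
(* Since [p] vanishes at 1 with derivative 1, it has no zero just to the left of 1, so the glued
   function is not zero almost everywhere. *)
have [d d0 Hd] : exists2 d : R, 0 < d & forall x, beta <= x -> 1 - d < x -> x < 1 -> p x != 0.
  have h2' : (0 : R) < 1 / 2 by lra.
  have [d d0 Hd] := Hp.1 1 rend _ h2'; exists d => // x bx dx x1; apply/eqP => px.
  have := Hd x; rewrite cabs_rdist px p1 dp1 mulr1 subrr sub0r cabsN cabs_rdist.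
  rewrite ltr0_norm ?subr_lt0 // => H.
  have : - (x - 1) <= 1 / 2 * - (x - 1) by apply: H; [apply/andP; split; lra|lra].
  by lra.
have bb := hb.
apply: (@ae_interval _ (fun x => pw beta y p x + 0 = 0) (Num.max beta (1 - d)) 1 _ _ _ ae0) => //.
- by rewrite le_max; apply/orP; left; lra.
- by rewrite gt_max; apply/andP; split; lra.
move=> x /andP[]; rewrite gt_max => /andP[bx dx] x1; rewrite addr0 /pw bx => /eqP.
by apply/negP; apply: Hd => //; exact: ltW.
Qed.

(** Cramer's rule at [beta]: the coefficients of [m] and [p] are chosen so that both the values and
    the derivatives of the two sides match. *)
Let cramer1 (a da : R[i]) : Wr != 0 ->
  (a * dp beta - da * p beta) / Wr * m beta - (a * dm beta - da * m beta) / Wr * p beta - a = 0.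
Proof. by rewrite /Wr => W0; field. Qed.

Let cramer2 (a da : R[i]) : Wr != 0 ->
  (a * dp beta - da * p beta) / Wr * dm beta - (a * dm beta - da * m beta) / Wr * dp beta - da = 0.
Proof. by rewrite /Wr => W0; field. Qed.

Section Resolvent.
Hypothesis W0 : Wr != 0.

(** Start from the particular solutions with zero data at the ends, given by variation of constants.
    On the right a multiple of [r] corrects the boundary value at 1, and multiples of [m] and [p],
    which vanish at their ends, are then free to match both sides at [beta]. *)
Let resolvent_exists : exists C : R, 0 <= C /\ forall f, inL2 f -> exists u,
  schrodinger delta beta V h u (fun x => f x + z * u x) /\ L2norm u <= C * L2norm f.
Proof.
have /andP[bm1 bp1] := hb'.
have wl : beta - (-1) <= 2 by lra.
have wr : 1 - beta <= 2 by lra.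
have m11 : (-1 : R) <= 1 by lra.
have inI : -1 <= (1 : R) <= 1 by rewrite m11 lexx.
have bdl (k : R -> R[i]) : rcont (-1) beta k -> exists2 M, 0 < M & forall x, -1 <= x <= beta -> cabs (k x) <= M.
  by move=> kc; exact: seg_bounded.
have bdr (k : R -> R[i]) : rcont beta 1 k -> exists2 M, 0 < M & forall x, beta <= x <= 1 -> cabs (k x) <= M.
  by move=> kc; exact: seg_bounded.
have [cm cdm] := sol_rcont Hm; have [cn cdn] := sol_rcont Hn.
have [cp cdp] := sol_rcont Hp; have [cr cdr] := sol_rcont Hr.
have [M1 M10 B1] := bdl _ cm; have [M2 M20 B2] := bdl _ cdm.
have [M3 M30 B3] := bdl _ cn; have [M4 M40 B4] := bdl _ cdn; have [M5 M50 B5] := bdl _ cql.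
have [N1 N10 D1] := bdr _ cp; have [N2 N20 D2] := bdr _ cdp.
have [N3 N30 D3] := bdr _ cr; have [N4 N40 D4] := bdr _ cdr; have [N5 N50 D5] := bdr _ cqr.
pose K := M1 + M2 + M3 + M4 + M5 + N1 + N2 + N3 + N4 + N5.
have K0 : 0 < K by rewrite /K; lra.
have KM : [/\ M1 <= K, M2 <= K, M3 <= K, M4 <= K & M5 <= K]. by rewrite /K; split; lra.
have KN : [/\ N1 <= K, N2 <= K, N3 <= K, N4 <= K & N5 <= K]. by rewrite /K; split; lra.
have [K1 K2 K3 K4 K5] := KM; have [L1 L2 L3 L4 L5] := KN.
have bl x : -1 <= x <= beta -> [/\ cabs (n x) <= K, cabs (dn x) <= K, cabs (m x) <= K,
     cabs (dm x) <= K & cabs (ql x) <= K].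
  move=> hx; split; [exact: le_trans (B3 x hx) K3|exact: le_trans (B4 x hx) K4|
    exact: le_trans (B1 x hx) K1|exact: le_trans (B2 x hx) K2|exact: le_trans (B5 x hx) K5].
have br x : beta <= x <= 1 -> [/\ cabs (r x) <= K, cabs (dr x) <= K, cabs (p x) <= K,
     cabs (dp x) <= K & cabs (qr x) <= K].
  move=> hx; split; [exact: le_trans (D3 x hx) L3|exact: le_trans (D4 x hx) L4|
    exact: le_trans (D1 x hx) L1|exact: le_trans (D2 x hx) L2|exact: le_trans (D5 x hx) L5].
have [Cl [Cl0 HCl]] := inhomogeneous bm1 lend wl Hn Hm cql Wl bl.
have [Cr [Cr0 HCr]] := inhomogeneous bp1 rend wr Hr Hp cqr Wrt br.
clear bdl bdr B1 B2 B3 B4 B5 D1 D2 D3 D4 D5 M10 M20 M30 M40 M50 N10 N20 N30 N40 N50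
  K1 K2 K3 K4 K5 L1 L2 L3 L4 L5 KM KN.
(* The 4 is the constant of [cint_L2_bound], so [c0] times the norm of [f] bounds [G1]; one more
   integration over a length of at most 2 doubles it for [G]. *)
pose c0 := 4 * (h ^+ 2)^-1.
have c00 : 0 <= c0 by rewrite mulr_ge0 // invr_ge0 exprn_ge0 // ltW.
pose S := Cl + Cr + K.
have S0 : 0 <= S by rewrite /S; lra.
pose T := 2 * S * K / cabs Wr.
have W00 : 0 < cabs Wr by rewrite cabs_gt0.
have T0 : 0 <= T by rewrite divr_ge0 ?mulr_ge0 ?cabs_ge0 // ltW.
pose C1 := (T * K + S + 1) * (2 * c0).
have C10 : 0 <= C1.
  have TK := mulr_ge0 T0 (ltW K0).
  by apply: mulr_ge0; [lra|rewrite mulr_ge0].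
exists (2 * C1); split; first by rewrite mulr_ge0.
move=> f f2.
pose g x := - ((h ^+ 2)%:C)^-1 * f x.
have g2 : inL2 g by exact: inL2Z.
have gi := inL2_cinteg g2.
pose G1 x := cint (-1) x g.
have G1c : rcont (-1) 1 G1 by exact: cint_rcont.
have G1i : indefinite_integral (-1) 1 G1 g.
  by move=> x _; rewrite /G1 cint_point add0r.
have nf := L2norm_ge0 f.
pose B := c0 * L2norm f; have B0 : 0 <= B by rewrite mulr_ge0.
have B2 : 0 <= 2 * B by rewrite mulr_ge0.
have G1b x : -1 <= x <= 1 -> cabs (G1 x) <= B.
  move=> hx; have -> : G1 x = - ((h ^+ 2)%:C)^-1 * cint (-1) x f.
    have k1 : - ((h ^+ 2)%:C)^-1 = (- (h ^+ 2)^-1)%:C :> R[i] by rewrite rmorphN (fmorphV (real_complex R)).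
    have fi : cinteg (-1) x f by apply: cinteg_sub (inL2_cinteg f2) => //; case/andP: hx.
    by rewrite /G1 /g k1 cintZ.
  rewrite cabsM cabsN cabsV cabs_real ger0_norm ?exprn_ge0 ?(ltW h0) // /B /c0.
  rewrite [4 * _]mulrC -mulrA; apply: ler_wpM2l; first by rewrite invr_ge0 exprn_ge0 // ltW.
  exact: cint_L2_bound.
have [P HP] := primitive_exists m11 G1c.
pose G x := P x - P (-1).
have HG x : -1 <= x <= 1 -> rwd (seg (-1) 1) G x (G1 x).
  by move=> hx; apply: (wd_eq (wdB (HP x hx) (wd_cst _ _ _ _))); rewrite subr0.
have G0 : G (-1) = 0 by rewrite /G subrr.
have Gb x : -1 <= x <= 1 -> cabs (G x) <= 2 * B.
  move=> hx; apply: (@le_trans _ _ (B * (x - (-1)))); last by nra.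
  apply: (@mean_value_bound _ (-1) x P G1); [lra| |].
    move=> t ht; apply: (@wd_sub _ _ _ _ (seg (-1) 1)); last by apply: HP; lra.
    by move=> s /andP[h1 h3]; apply/andP; split; lra.
  by move=> t ht; apply: G1b; lra.
have cG : rcont (-1) 1 G by move=> x hx; exact: wd_wc (HG x hx).
have cGl : rcont (-1) beta G by apply: rcont_sub cG.
have cGr : rcont beta 1 G by apply: rcont_sub cG.
have [|yl [dyl [Y1 Y2 Y3 Y4 Y5]]] := HCl G (2 * B) cGl.
  by move=> x hx; apply: Gb; lra.
have [|yr [dyr [Z1 Z2 Z3 Z4 Z5]]] := HCr G (2 * B) cGr.
  by move=> x hx; apply: Gb; lra.
pose al := yr beta - G 1 * r beta - yl beta; pose dal := dyr beta - G 1 * dr beta - dyl beta.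
have G1b1 := Gb 1 inI.
have alB : cabs al <= S * (2 * B) /\ cabs dal <= S * (2 * B).
  have [q1 q2 _ _ _] := br beta rbeta; have [q3 q4] := Y5 beta lbeta; have [q5 q6] := Z5 beta rbeta.
  have t1 := ler_pM (cabs_ge0 _) (cabs_ge0 _) G1b1 q1.
  have t2 := ler_pM (cabs_ge0 _) (cabs_ge0 _) G1b1 q2.
  rewrite -!cabsM in t1 t2; rewrite /S.
  rewrite (_ : (Cl + Cr + K) * (2 * B) = Cr * (2 * B) + 2 * B * K + Cl * (2 * B)); last by ring.
  by split; apply: (le_trans (cabs_sub_le _ _)); apply: lerD => //;
    apply: (le_trans (cabs_sub_le _ _)); apply: lerD.
have [alB1 alB2] := alB.
pose c := (al * dp beta - dal * p beta) / Wr; pose d := (al * dm beta - dal * m beta) / Wr.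
have [kl1 kl2 kl3 kl4 _] := bl beta lbeta; have [kr1 kr2 kr3 kr4 _] := br beta rbeta.
have cT : forall e1 e2 : R[i], cabs e1 <= K -> cabs e2 <= K ->
    cabs ((al * e1 - dal * e2) / Wr) <= T * (2 * B).
  move=> e1 e2 he1 he2; rewrite cabsM cabsV ler_pdivrMr //.
  rewrite (_ : T * (2 * B) * cabs Wr = S * (2 * B) * K + S * (2 * B) * K); last first.
    by rewrite /T; field; rewrite gt_eqF.
  by apply: (le_trans (cabs_sub_le _ _)); rewrite !cabsM; apply: lerD; apply: ler_pM; rewrite ?cabs_ge0.
have cB : cabs c <= T * (2 * B) by exact: cT.
have dB : cabs d <= T * (2 * B) by exact: cT.
pose wl' x := c * m x + yl x; pose dwl x := c * dm x + dyl x.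
(* As [r 1 = 1], the term in [r] cancels the value [G 1] that [G] brings to the right end; on the
   left, [G] already vanishes. *)
pose wr' x := d * p x - G 1 * r x + yr x; pose dwr x := d * dp x - G 1 * dr x + dyr x.
have WrE : Wr = m beta * dp beta - dm beta * p beta by [].
exists (fun x => pw beta wl' wr' x + G x); split.
  apply: (@pw_domain wl' dwl wr' dwr f G G1) => //.
  - by move=> x hx; apply: wdD; [apply: wdZ; exact: Hm.1|exact: Y1].
  - move=> x hx; apply: (wd_eq (wdD (wdZ c (Hm.2 x hx)) (Y2 x hx))); rewrite /wl'; ring.
  - move=> x hx; apply: wdD; last exact: Z1.
    by apply: wdB; apply: wdZ; [exact: Hp.1|exact: Hr.1].
  - move=> x hx; apply: (wd_eq (wdD (wdB (wdZ d (Hp.2 x hx)) (wdZ (G 1) (Hr.2 x hx))) (Z2 x hx))).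
    rewrite /wr'; ring.
  - apply/eqP; rewrite -subr_eq0; apply/eqP.
    rewrite (_ : _ - _ = c * m beta - d * p beta - al); last by rewrite /wl' /wr' /al; ring.
    exact: cramer1.
  - apply/eqP; rewrite -subr_eq0; apply/eqP.
    rewrite (_ : _ - _ = c * dm beta - d * dp beta - dal); last by rewrite /dwl /dwr /dal; ring.
    exact: cramer2.
  - by rewrite /wl' m0 mulr0 Y3 G0 !addr0.
  - by rewrite /wr' p1 r1 Z3 mulr0 mulr1 addr0 add0r addNr.
have EB : C1 * L2norm f = T * (2 * B) * K + S * (2 * B) + 2 * B.
  by rewrite /C1 /B; ring.
rewrite -mulrA; apply: L2norm_bound.
- have cwl : rcont (-1) beta wl'.
    by move=> x hx; apply: wcD; [apply: wcZ; exact: cm|exact: wd_wc (Y1 x hx)].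
  have cwr : rcont beta 1 wr'.
    move=> x hx; apply: wcD; last exact: wd_wc (Z1 x hx).
    by apply: wcB; apply: wcZ; [exact: cp|exact: cr].
  apply: cmeasD; first exact: pw_cmeas.
  have := pw_cmeas hb' cGl cGr.
  by have -> : pw beta G G = G by apply/funext => x; rewrite /pw; case: ifP.
- by rewrite mulr_ge0.
move=> x hx; rewrite EB.
apply: (le_trans (cabsD _ _)); apply: lerD; last exact: Gb.
rewrite /pw; case: ltP => bx.
  have hx' : beta <= x <= 1 by rewrite (ltW bx); case/andP: hx.
  have [e1 _ e3 _ _] := br x hx'; have [e6 _] := Z5 x hx'.
  rewrite /wr' -addrA; apply: (le_trans (cabsD _ _)); apply: lerD.
    by rewrite cabsM; apply: ler_pM; rewrite ?cabs_ge0.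
  have t1 := ler_pM (cabs_ge0 _) (cabs_ge0 _) G1b1 e1.
  rewrite (_ : S * (2 * B) = 2 * B * K + Cr * (2 * B) + Cl * (2 * B)); last by rewrite /S; ring.
  apply: ler_wpDr; first exact: mulr_ge0 Cl0 B2.
  by apply: (le_trans (cabsD _ _)); apply: lerD; rewrite // cabsN cabsM.
have hx' : -1 <= x <= beta by rewrite bx andbT; case/andP: hx.
have [_ _ e3 _ _] := bl x hx'; have [e6 _] := Y5 x hx'.
apply: (le_trans (cabsD _ _)); apply: lerD.
  by rewrite cabsM; apply: ler_pM; rewrite ?cabs_ge0.
apply: (le_trans e6); apply: ler_wpM2r => //.
by rewrite /S -addrA lerDl addr_ge0 // ltW.
Qed.

(** The difference of two solutions solves the homogeneous equation almost everywhere, hence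
    classically on each side. Its Wronskians with [m] and [p] vanish at the ends, so at [beta] they
    form a linear system of determinant [Wr], which forces zero Cauchy data there. *)
Let resolvent_unique u v f : schrodinger delta beta V h u (fun x => f x + z * u x) ->
  schrodinger delta beta V h v (fun x => f x + z * v x) ->
  forall x, -1 <= x <= 1 -> u x = v x.
Proof.
have /andP[bm1 bp1] := hb'.
move=> [u2 _ u0 u1 [du [ddu [ddu2 Hu Hdu Eu]]]] [v2 _ v0 v1 [dv [ddv [ddv2 Hv Hdv Ev]]]].
pose d x := u x - v x; pose dd x := du x - dv x; pose ddd x := ddu x - ddv x.
have ddu_i := inL2_cinteg ddu2; have ddv_i := inL2_cinteg ddv2.
have cdu := indefinite_rcont ddu_i Hdu; have cdv := indefinite_rcont ddv_i Hdv.
have ci2 (k : R -> R[i]) : rcont (-1) 1 k -> inL2 k.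
  move=> kc; have kl : rcont (-1) beta k by apply: rcont_sub kc.
  have kr : rcont beta 1 k by apply: rcont_sub kc.
  have E : pw beta k k = k by apply/funext => x; rewrite /pw; case: ifP.
  have [M _ HM] := pw_bounded hb' kl kr; have mk := pw_cmeas hb' kl kr.
  by rewrite E in HM mk; apply: inL2_bounded mk HM.
have du_i := inL2_cinteg (ci2 _ cdu); have dv_i := inL2_cinteg (ci2 _ cdv).
have cNi k : cinteg (-1) 1 k -> cinteg (-1) 1 (fun x : R => - k x : R[i]).
  move=> [i1 i2]; split; [apply: eq_integrable (integrable_scale (-1) i1)|
     apply: eq_integrable (integrable_scale (-1) i2)] => // x _ /=;
     by rewrite mulN1r -?cReN -?cImN.
have ddd2 : inL2 ddd.
  by apply: (inL2_ext _ (inL2D ddu2 (inL2Z (-1) ddv2))) => x; rewrite mulN1r.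
have Hd : indefinite_integral (-1) 1 d dd.
  by apply: indefinite_integralD (indefinite_integralN dv_i Hv) => //; exact: cNi.
have Hdd : indefinite_integral (-1) 1 dd ddd.
  by apply: indefinite_integralD (indefinite_integralN ddv_i Hdv) => //; exact: cNi.
have cdd : rcont (-1) 1 dd by exact: indefinite_rcont (inL2_cinteg ddd2) Hdd.
have m11 : (-1 : R) <= 1 by lra.
have Dd : forall x, -1 <= x <= 1 -> rwd (seg (-1) 1) d x (dd x).
  exact: (indefinite_rwd (lexx _) (lexx _) m11 (inL2_cinteg (ci2 _ cdd)) Hd cdd).
have cd : rcont (-1) 1 d by move=> x hx; exact: wd_wc (Dd x hx).
have cdl : rcont (-1) beta d by apply: rcont_sub cd.
have cdr : rcont beta 1 d by apply: rcont_sub cd.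
have cl : rcont (-1) beta (fun x => ql x * d x) by exact: rcM.
have cr : rcont beta 1 (fun x => qr x * d x) by exact: rcM.
pose qd := pw beta (fun x => ql x * d x) (fun x => qr x * d x).
have mqd : cmeas qd by exact: pw_cmeas.
have [M _ HM] := pw_bounded hb' cl cr.
have qd_i : cinteg (-1) 1 qd by apply: (bounded_cinteg _ _ mqd HM).
have aeE : ae_eqI ddd qd.
  have [A [mA A0 sA]] := Eu; have [B [mB B0 sB]] := Ev.
  exists (A `|` B); split; first exact: measurableU.
    by rewrite measureU0.
  move=> x /= nx; apply: contrapT => /not_orP[nA nB]; apply: nx => hx.
  have {nA} E1 : x \in `[-1, 1] -> f x + z * u x = - (h ^+ 2)%:C * ddu x
      + shifted_potential delta beta V x * u x by apply: contrapT => k; apply: nA; exact: sA.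
  have {nB} E2 : x \in `[-1, 1] -> f x + z * v x = - (h ^+ 2)%:C * ddv x
      + shifted_potential delta beta V x * v x by apply: contrapT => k; apply: nB; exact: sB.
  have := E1 hx; have := E2 hx; rewrite shiftE => e2 e1.
  apply: (mulfI h2); rewrite /ddd.
  have -> : (h ^+ 2)%:C * qd x = (h ^+ 2)%:C * pw beta ql qr x * d x.
    by rewrite /qd /pw; case: ifP => _; ring.
  have k1 : (h ^+ 2)%:C * ddu x = (z + (h ^+ 2)%:C * pw beta ql qr x) * u x - (f x + z * u x).
    by rewrite e1; ring.
  have k2 : (h ^+ 2)%:C * ddv x = (z + (h ^+ 2)%:C * pw beta ql qr x) * v x - (f x + z * v x).
    by rewrite e2; ring.
  by rewrite mulrBr k1 k2 /d; ring.
have mddd : cmeas ddd by case/inL2P: ddd2.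
have Hdd' : indefinite_integral (-1) 1 dd qd.
  by move=> x hx; rewrite (Hdd x hx) (@cint_ae _ ddd qd) //.
have Dl : sol (-1) beta ql d dd.
  split=> x hx.
    apply: (@wd_sub _ _ _ _ (seg (-1) 1)); last by apply: Dd; lra.
    by move=> s /andP[k1 k2]; apply/andP; split; lra.
  apply: (indefinite_rwd _ _ _ qd_i Hdd' cl) hx => // y hy.
  by apply: cint_eq => t ht; rewrite /qd /pw ltNge; have -> : t <= beta by lra.
have Dr : sol beta 1 qr d dd.
  split=> x hx.
    apply: (@wd_sub _ _ _ _ (seg (-1) 1)); last by apply: Dd; lra.
    by move=> s /andP[k1 k2]; apply/andP; split; lra.
  apply: (indefinite_rwd _ _ _ qd_i Hdd' cr) hx => // y hy.
  apply: cint_eq_oc => [||t /andP[ht _]]; [by apply: rcont_sub cr; lra|lra|].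
  by rewrite /qd /pw ht.
have d_l : d (-1) = 0 by rewrite /d u0 v0 subrr.
have d_r : d 1 = 0 by rewrite /d u1 v1 subrr.
have w1 : m beta * dd beta = dm beta * d beta.
  have := sol_wronskian Hm Dl lbeta lend; rewrite m0 dm0 d_l mul0r mulr0 subrr => /eqP.
  by rewrite subr_eq0 => /eqP.
have w2 : p beta * dd beta = dp beta * d beta.
  have := sol_wronskian Hp Dr rbeta rend; rewrite p1 dp1 d_r mul0r mulr0 subrr => /eqP.
  by rewrite subr_eq0 => /eqP.
have db : d beta = 0.
  apply: (mulfI W0); rewrite mulr0 /Wr.
  rewrite (_ : _ * d beta = m beta * (dp beta * d beta) - p beta * (dm beta * d beta)); last by ring.
  by rewrite -w1 -w2; ring.
have ddb : dd beta = 0.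
  apply: (mulfI W0); rewrite mulr0 /Wr.
  rewrite (_ : _ * dd beta = dp beta * (m beta * dd beta) - dm beta * (p beta * dd beta)); last by ring.
  by rewrite w1 w2; ring.
have dl x : -1 <= x <= beta -> d x = 0.
  move=> hx; have k1 := sol_wronskian Hm Dl hx lbeta; have k2 := sol_wronskian Hn Dl hx lbeta.
  rewrite db ddb !mulr0 subrr in k1 k2.
  rewrite -[d x]mul1r -(Wl hx).
  rewrite (_ : _ * d x = m x * (n x * dd x - dn x * d x) - n x * (m x * dd x - dm x * d x)); last by ring.
  by rewrite k1 k2 !mulr0 subrr.
have dr' x : beta <= x <= 1 -> d x = 0.
  move=> hx; have k1 := sol_wronskian Hp Dr hx rbeta; have k2 := sol_wronskian Hr Dr hx rbeta.
  rewrite db ddb !mulr0 subrr in k1 k2.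
  rewrite -[d x]mul1r -(Wrt hx).
  rewrite (_ : _ * d x = p x * (r x * dd x - dr x * d x) - r x * (p x * dd x - dp x * d x)); last by ring.
  by rewrite k1 k2 !mulr0 subrr.
move=> x hx; apply/eqP; rewrite -subr_eq0; apply/eqP.
have [bx|bx] := leP x beta; first by apply: dl; rewrite bx andbT; case/andP: hx.
by apply: dr'; rewrite (ltW bx); case/andP: hx.
Qed.

Lemma wronskian_neq0_resolvent : resolvent_set (schrodinger delta beta V h) z.
Proof.
have [C [C0 HC]] := resolvent_exists; split.
- by move=> f /HC[u [Hu _]]; exists u.
- move=> u v f Hu Hv; apply: aeW => x; rewrite II; exact: (resolvent_unique Hu Hv).
exists C => u f Hu.
have [u2 fu2 _ _ _] := Hu.
(* The graph only says that f + z u is square-integrable, so [z * u] has to be subtracted. *)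
have f2 : inL2 f.
  by apply: (inL2_ext _ (inL2D fu2 (inL2Z (- z) u2))) => x; ring.
have [v [Hv vC]] := HC f f2.
by rewrite (L2norm_eq (resolvent_unique Hu Hv)).
Qed.

End Resolvent.
End Spectrum.

(** * Holomorphic dependence of solutions on the energy *)

Section EnergyDependence.
Context {R : realType}.
Implicit Types (a b x t : R).

Lemma quadratic_cwd (F : R[i] -> R[i]) E l r C : 0 < r ->
  (forall E', cabs (E' - E) <= r -> cabs (F E' - F E - (E' - E) * l) <= C * cabs (E' - E) ^+ 2) ->
  cwd setT F E l.
Proof.
move=> r0 H eps e0; pose K := 1 + `|C|.
have K0 : 0 < K by rewrite /K; have := normr_ge0 C; lra.
exists (Num.min r (eps / K)); first by rewrite lt_min r0 divr_gt0.
move=> E' _; rewrite lt_min => /andP[/ltW d1 d2]; apply: (le_trans (H E' d1)).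
rewrite expr2 mulrA; apply: ler_wpM2r; first exact: cabs_ge0.
apply: (@le_trans _ _ (K * cabs (E' - E))).
  by apply: ler_wpM2r; [exact: cabs_ge0|rewrite /K; have := ler_norm C; lra].
by rewrite mulrC -ler_pdivlMr //; exact: ltW.
Qed.

Lemma seg_growth a b F dF M x t : (forall x, a <= x <= b -> rwd (seg a b) F x (dF x)) ->
  (forall x, a <= x <= b -> cabs (dF x) <= M) -> a <= x <= b -> a <= t <= b ->
  cabs (F x - F t : R[i]) <= M * (b - a).
Proof.
move=> HF HM hx ht; wlog xt : x t hx ht / t <= x.
  by move=> W; have [h|/ltW h] := leP t x; [exact: W|rewrite cabsB; exact: W].
have M0 : 0 <= M by apply: le_trans (HM x hx); exact: cabs_ge0.
apply: (@le_trans _ _ (M * (x - t))); last by apply: ler_wpM2l; lra.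
apply: (@mean_value_bound _ t x F dF) => // s hs; last by apply: HM; lra.
apply: (@wd_sub _ _ _ _ (seg a b)); last by apply: HF; lra.
by move=> u /andP[h1 h2]; apply/andP; split; lra.
Qed.

Variables (a b : R) (q : R -> R[i]) (kap : R[i]) (y dy w dw : R[i] -> R -> R[i]).
Variables (x0 x1 : R) (E : R[i]) (y0 dy0 : R[i]).
Hypotheses (ab : a <= b) (hx0 : a <= x0 <= b) (hx1 : a <= x1 <= b).
Hypothesis Hy : forall E, sol a b (fun x => q x - kap * E) (y E) (dy E).
Hypothesis Hw : sol a b (fun x => q x - kap * E) (w E) (dw E).
Hypothesis W1 : forall x, a <= x <= b -> y E x * dw E x - dy E x * w E x = 1.
Hypotheses (Y0 : forall E, y E x0 = y0) (dY0 : forall E, dy E x0 = dy0).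

(** The difference [d] between energies [E'] and [E] solves the equation at [E] with source
    [kap * (E' - E) * y E']. Variation of constants first gives d = O(|E' - E|); replacing [y E'] by
    [y E] in the source then costs only a quadratic error, and [l], [l'] are the resulting
    integrals. *)
Lemma parameter_cwd : exists l l', cwd setT (fun E => y E x1) E l /\ cwd setT (fun E => dy E x1) E l'.
Proof.
have [cy cdy] := sol_rcont (Hy E); have [cw cdw] := sol_rcont Hw.
have [M1 M10 B1] := seg_bounded ab cy; have [M2 M20 B2] := seg_bounded ab cdy.
have [M3 M30 B3] := seg_bounded ab cw; have [M4 M40 B4] := seg_bounded ab cdw.
pose K := 1 + M1 + M2 + M3 + M4; have K0 : 0 < K by rewrite /K; lra.
have bK x : a <= x <= b -> [/\ cabs (y E x) <= K, cabs (dy E x) <= K, cabs (w E x) <= K &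
    cabs (dw E x) <= K].
  move=> hx; have := B1 x hx; have := B2 x hx; have := B3 x hx; have := B4 x hx.
  by rewrite /K; split; lra.
clear B1 B2 B3 B4.
have mc f g : rcont a b f -> rcont a b g -> rcont a b (fun x => f x * g x : R[i]).
  by move=> cf cg x hx; apply: wcM; [exact: cf|exact: cg].
have [P1 HP1] := primitive_exists ab (mc _ _ cw cy).
have [P2 HP2] := primitive_exists ab (mc _ _ cy cy).
pose l := - kap * (w E x1 * (P2 x1 - P2 x0) - y E x1 * (P1 x1 - P1 x0)).
pose l' := - kap * (dw E x1 * (P2 x1 - P2 x0) - dy E x1 * (P1 x1 - P1 x0)).
pose A := cabs kap * K * (b - a).
have A0 : 0 <= A by rewrite !mulr_ge0 ?cabs_ge0 ?subr_ge0 // ltW.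
(* Within this radius the term containing the maximum [del] of |d| is at most half of [del], and can
   be absorbed. *)
pose rr := (1 + 4 * K * A)^-1.
have KA : 0 <= K * A by rewrite mulr_ge0 // ltW.
have rr0 : 0 < rr by rewrite invr_gt0; lra.
suff H E' : cabs (E' - E) <= rr ->
   cabs (y E' x1 - y E x1 - (E' - E) * l) <= 8 * A ^+ 2 * K ^+ 3 * cabs (E' - E) ^+ 2 /\
   cabs (dy E' x1 - dy E x1 - (E' - E) * l') <= 8 * A ^+ 2 * K ^+ 3 * cabs (E' - E) ^+ 2.
  exists l, l'; split; apply: (quadratic_cwd rr0) => E' hE'; [exact: (H E' hE').1|exact: (H E' hE').2].
move=> hE'; set D := E' - E.
pose d x := y E' x - y E x; pose dd x := dy E' x - dy E x.
have Dd x : a <= x <= b -> rwd (seg a b) d x (dd x).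
  by move=> hx; apply: wdB; [exact: (Hy E').1|exact: (Hy E).1].
have Ddd x : a <= x <= b -> rwd (seg a b) dd x ((q x - kap * E) * d x - kap * D * y E' x).
  move=> hx; apply: (wd_eq (wdB ((Hy E').2 x hx) ((Hy E).2 x hx))).
  by rewrite /d /D; ring.
pose c1 x := w E x * dd x - dw E x * d x; pose c2 x := y E x * dd x - dy E x * d x.
have Dc1 x : a <= x <= b -> rwd (seg a b) c1 x (- kap * D * (w E x * y E' x)).
  move=> hx; apply: (wd_eq (wdB (wdM (Hw.1 x hx) (Ddd x hx)) (wdM (Hw.2 x hx) (Dd x hx)))).
  by ring.
have Dc2 x : a <= x <= b -> rwd (seg a b) c2 x (- kap * D * (y E x * y E' x)).
  move=> hx; apply: (wd_eq (wdB (wdM ((Hy E).1 x hx) (Ddd x hx)) (wdM ((Hy E).2 x hx) (Dd x hx)))).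
  by ring.
have d0 : d x0 = 0 by rewrite /d !Y0 subrr.
have dd0 : dd x0 = 0 by rewrite /dd !dY0 subrr.
have c10 : c1 x0 = 0 by rewrite /c1 d0 dd0 !mulr0 subrr.
have c20 : c2 x0 = 0 by rewrite /c2 d0 dd0 !mulr0 subrr.
have dE x : a <= x <= b -> d x = w E x * c2 x - y E x * c1 x.
  by move=> hx; rewrite -[LHS]mulr1 -(W1 hx) /c1 /c2; ring.
have ddE x : a <= x <= b -> dd x = dw E x * c2 x - dy E x * c1 x.
  by move=> hx; rewrite -[LHS]mulr1 -(W1 hx) /c1 /c2; ring.
have cd : rcont a b d by move=> x hx; exact: wd_wc (Dd x hx).
have [xm hxm dmax] := seg_max ab cd.
pose del := cabs (d xm); have del0 : 0 <= del by exact: cabs_ge0.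
have D0 := cabs_ge0 D.
have ybd x : a <= x <= b -> cabs (y E' x) <= K + del.
  move=> hx; rewrite (_ : y E' x = y E x + d x); last by rewrite /d; ring.
  by apply: (le_trans (cabsD _ _)); apply: lerD; [case: (bK x hx)|exact: dmax].
have Ab : cabs kap * cabs D * (K * (K + del)) * (b - a) = A * cabs D * (K + del).
  by rewrite /A; ring.
have cb x : a <= x <= b -> cabs (c1 x) <= A * cabs D * (K + del) /\ cabs (c2 x) <= A * cabs D * (K + del).
  move=> hx; rewrite -[c1 x]subr0 -[c2 x]subr0 -{1}c10 -c20 -Ab.
  split; [apply: (@seg_growth a b c1 _ _ _ _ Dc1)|apply: (@seg_growth a b c2 _ _ _ _ Dc2)] => // t ht;
    have [b1 b2 b3 b4] := bK t ht; rewrite !cabsM cabsN;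
    (apply: ler_wpM2l; first by rewrite mulr_ge0 ?cabs_ge0);
    apply: ler_pM; rewrite ?cabs_ge0 //; exact: ybd.
have rrA : 4 * K * A * cabs D <= 1.
  have : cabs D * (1 + 4 * K * A) <= 1 by rewrite -ler_pdivlMr ?div1r //; lra.
  by lra.
have delb : del <= 4 * A * K ^+ 2 * cabs D.
  have [b1 b2 b3 b4] := bK xm hxm; have [k1 k2] := cb xm hxm.
  have : del <= 2 * (K * (A * cabs D * (K + del))).
    have := cabs_sub_le (w E xm * c2 xm) (y E xm * c1 xm).
    rewrite -(dE xm hxm) -/del (cabsM (w E xm)) (cabsM (y E xm)).
    have t1 := ler_pM (cabs_ge0 _) (cabs_ge0 _) b3 k2.
    have t2 := ler_pM (cabs_ge0 _) (cabs_ge0 _) b1 k1.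
    by lra.
  have : 4 * K * A * cabs D * del <= 1 * del by apply: ler_wpM2r.
  by lra.
(* The second pass: the source with [y E] is integrated exactly by [P1] and [P2], and what remains
   contains [d], hence a second factor [E' - E]. *)
have eb x : a <= x <= b -> cabs (c1 x + kap * D * (P1 x - P1 x0)) <= A * cabs D * del /\
    cabs (c2 x + kap * D * (P2 x - P2 x0)) <= A * cabs D * del.
  have Ab' : cabs kap * cabs D * (K * del) * (b - a) = A * cabs D * del by rewrite /A; ring.
  move=> hx; rewrite -Ab'.
  pose F1 x := c1 x + kap * D * P1 x; pose F2 x := c2 x + kap * D * P2 x.
  rewrite (_ : c1 x + _ = F1 x - F1 x0); last by rewrite /F1 c10; ring.
  rewrite (_ : c2 x + _ = F2 x - F2 x0); last by rewrite /F2 c20; ring.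
  split.
    apply: (@seg_growth _ _ F1 (fun x => - kap * D * (w E x * d x))) => // t ht.
      by apply: (wd_eq (wdD (Dc1 t ht) (wdZ (kap * D) (HP1 t ht)))); rewrite /d; ring.
    have [b1 b2 b3 b4] := bK t ht; rewrite !cabsM cabsN.
    apply: ler_wpM2l; first by rewrite mulr_ge0 ?cabs_ge0.
    by apply: ler_pM; rewrite ?cabs_ge0 //; exact: dmax.
  apply: (@seg_growth _ _ F2 (fun x => - kap * D * (y E x * d x))) => // t ht.
    by apply: (wd_eq (wdD (Dc2 t ht) (wdZ (kap * D) (HP2 t ht)))); rewrite /d; ring.
  have [b1 b2 b3 b4] := bK t ht; rewrite !cabsM cabsN.
  apply: ler_wpM2l; first by rewrite mulr_ge0 ?cabs_ge0.
  by apply: ler_pM; rewrite ?cabs_ge0 //; exact: dmax.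
have [b1 b2 b3 b4] := bK x1 hx1; have [e1 e2] := eb x1 hx1.
have fin : 2 * (K * (A * cabs D * del)) <= 8 * A ^+ 2 * K ^+ 3 * cabs D ^+ 2.
  have : K * A * cabs D * del <= K * A * cabs D * (4 * A * K ^+ 2 * cabs D).
    by apply: ler_wpM2l => //; rewrite mulr_ge0.
  rewrite (_ : 8 * A ^+ 2 * K ^+ 3 * cabs D ^+ 2 = 2 * (K * A * cabs D * (4 * A * K ^+ 2 * cabs D))); last by ring.
  by lra.
split; apply: le_trans fin.
  rewrite (_ : _ - _ - _ = w E x1 * (c2 x1 + kap * D * (P2 x1 - P2 x0))
     - y E x1 * (c1 x1 + kap * D * (P1 x1 - P1 x0))); last first.
    by rewrite -/(d x1) (dE x1 hx1) /l; ring.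
  apply: (le_trans (cabs_sub_le _ _)); rewrite (cabsM (w E x1)) (cabsM (y E x1)).
  have t1 := ler_pM (cabs_ge0 _) (cabs_ge0 _) b3 e2.
  have t2 := ler_pM (cabs_ge0 _) (cabs_ge0 _) b1 e1.
  by lra.
rewrite (_ : _ - _ - _ = dw E x1 * (c2 x1 + kap * D * (P2 x1 - P2 x0))
     - dy E x1 * (c1 x1 + kap * D * (P1 x1 - P1 x0))); last first.
  by rewrite -/(dd x1) (ddE x1 hx1) /l'; ring.
apply: (le_trans (cabs_sub_le _ _)); rewrite (cabsM (dw E x1)) (cabsM (dy E x1)).
have t1 := ler_pM (cabs_ge0 _) (cabs_ge0 _) b4 e2.
have t2 := ler_pM (cabs_ge0 _) (cabs_ge0 _) b2 e1.
by lra.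
Qed.

End EnergyDependence.

(** * The entire function whose zeros are the spectrum *)

Section Characteristic.
Context {R : realType}.
Variables (a b c d : R).
Let N := box a b c d.

Section OneSide.
Variables (U dU : R[i] -> R[i]) (M h al be x0 x1 : R).
Hypotheses (HU : deriv_on N U dU) (MU : forall z, N z -> cabs (U z) <= M).
Hypotheses (Nseg : forall x, al <= x <= be -> N x%:C) (alb : al <= be).
Hypotheses (hx0 : al <= x0 <= be) (hx1 : al <= x1 <= be).
Let H := (h ^+ 2)%:C : R[i].
Let Q E z := (U z - E) / H.

Let Q_deriv E : deriv_on N (Q E) (fun z => H^-1 * dU z).
Proof.
move=> z Nz; apply: (@wd_ext _ _ _ _ (fun z => H^-1 * (U z - E))) => //.
  by move=> s _; rewrite mulrC.
apply: wdZ; apply: (wd_eq (wdB (HU Nz) (wd_cst _ _ _ _))); by rewrite subr0.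
Qed.

Let Q_bound E z : N z -> cabs (Q E z) <= (M + cabs E) * cabs (H^-1).
Proof.
move=> Nz; rewrite cabsM; apply: ler_wpM2r; first exact: cabs_ge0.
by apply: (le_trans (cabs_sub_le _ _)); rewrite lerD2r; exact: MU.
Qed.

Let restrict E u v : deriv_on N u v -> deriv_on N v (fun z => Q E z * u z) ->
  sol al be (fun x => Q E x%:C) (fun x => u x%:C) (fun x => v x%:C).
Proof.
move=> Hu Hv; split=> x hx; rewrite -[X in rwd _ _ _ X]mulr1;
  apply: (@rwd_path _ _ N) => //.
- exact: rwd_id.
- by apply: Hu; exact: Nseg.
- exact: rwd_id.
- by apply: Hv; exact: Nseg.
Qed.

(** The companion family [n] completes [m] to a basis of Wronskian 1; it serves both the derivative
    in [E] and the construction of the resolvent. *)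
Lemma arm_family : exists m dm n dn : R[i] -> R[i] -> R[i],
  [/\ forall E, [/\ deriv_on N (m E) (dm E), deriv_on N (dm E) (fun z => (U z - E) / (h ^+ 2)%:C * m E z),
        m E x0%:C = 0 & dm E x0%:C = 1],
      forall E, n E x0%:C = 1 /\ dn E x0%:C = 0,
      forall E, sol al be (fun x => (U x%:C - E) / (h ^+ 2)%:C) (fun x => m E x%:C) (fun x => dm E x%:C) /\
        sol al be (fun x => (U x%:C - E) / (h ^+ 2)%:C) (fun x => n E x%:C) (fun x => dn E x%:C) &
      exists l l', deriv_on setT (fun E => m E x1%:C) l /\ deriv_on setT (fun E => dm E x1%:C) l'].
Proof.
have ex u0 v0 : exists uv : R[i] -> (R[i] -> R[i]) * (R[i] -> R[i]), forall E,
    [/\ deriv_on N (uv E).1 (uv E).2, deriv_on N (uv E).2 (fun z => Q E z * (uv E).1 z),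
     (uv E).1 x0%:C = u0 & (uv E).2 x0%:C = v0].
  have H1 E : exists uv : (R[i] -> R[i]) * (R[i] -> R[i]),
      [/\ deriv_on N uv.1 uv.2, deriv_on N uv.2 (fun z => Q E z * uv.1 z),
       uv.1 x0%:C = u0 & uv.2 x0%:C = v0].
    have HQ : hol a b c d (Q E) by exists (fun z => H^-1 * dU z); exact: Q_deriv.
    have [u [v Huv]] := linear_ode_exists u0 v0 HQ (Q_bound E) (Nseg hx0).
    by exists (u, v).
  by have [uv Huv] := choice H1; exists uv.
have [m Hm] := ex 0 1; have [n Hn] := ex 1 0.
have sm E : sol al be (fun x => Q E x%:C) (fun x => (m E).1 x%:C) (fun x => (m E).2 x%:C).
  by have [h1 h2 _ _] := Hm E; exact: restrict.
have sn E : sol al be (fun x => Q E x%:C) (fun x => (n E).1 x%:C) (fun x => (n E).2 x%:C).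
  by have [h1 h2 _ _] := Hn E; exact: restrict.
exists (fun E => (m E).1), (fun E => (m E).2), (fun E => (n E).1), (fun E => (n E).2); split.
- exact: Hm.
- by move=> E; have [_ _] := Hn E.
- by move=> E; split; [exact: sm|exact: sn].
have QE E : (fun x : R => Q E x%:C) = (fun x : R => U x%:C / H - H^-1 * E).
  by apply/funext => x; rewrite /Q mulrBl [E / H]mulrC.
have P E : exists ll : R[i] * R[i], cwd setT (fun E => (m E).1 x1%:C) E ll.1 /\
    cwd setT (fun E => (m E).2 x1%:C) E ll.2.
  (* Minus [n] is passed as the second solution, which gives the Wronskian the sign that
     [parameter_cwd] expects. *)
  have [|||||l [l' [H1 H2]]] := @parameter_cwd R al be (fun x => U x%:C / H) H^-1
     (fun E x => (m E).1 x%:C) (fun E x => (m E).2 x%:C)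
     (fun E x => - (n E).1 x%:C) (fun E x => - (n E).2 x%:C) x0 x1 E 0 1 alb hx0 hx1.
  - by move=> E'; rewrite -QE.
  - rewrite -QE; split=> x hx; first by apply: wdN; exact: (sn E).1.
    by apply: (wd_eq (wdN ((sn E).2 x hx))); rewrite mulrN.
  - move=> x hx; have := sol_wronskian (sn E) (sm E) hx hx0.
    have [_ _ -> ->] := Hm E; have [_ _ -> ->] := Hn E.
    by rewrite mulr1 mulr0 subr0 => <-; ring.
  - by move=> E'; have [_ _ ->] := Hm E'.
  - by move=> E'; have [_ _ _ ->] := Hm E'.
  by exists (l, l').
have [ll Hll] := choice P.
exists (fun E => (ll E).1), (fun E => (ll E).2).
by split=> E _; [exact: (Hll E).1|exact: (Hll E).2].
Qed.

End OneSide.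

Variables (V dV : R[i] -> R[i]) (M beta delta h : R).
Hypotheses (HV : deriv_on N V dV) (MV : forall z, N z -> cabs (V z) <= M) (h0 : 0 < h).
Hypotheses (Nseg : forall x, -1 <= x <= 1 -> N x%:C) (hb : -1 < beta < 1).

(** The arm solutions are exported on the complex box and not only on the interval, because the
    asymptotics follow them along deformed paths. *)
Lemma characteristic_function : exists W dW : R[i] -> R[i], deriv_on setT W dW /\
  forall E, (spectrum (schrodinger delta beta V h) E <-> W E = 0) /\
  exists u v u' v', [/\
    [/\ deriv_on N u v, deriv_on N v (fun z => (V z - delta*i - E) / (h ^+ 2)%:C * u z),
       u (-1) = 0 & v (-1) = 1],
    [/\ deriv_on N u' v', deriv_on N v' (fun z => (V z + delta*i - E) / (h ^+ 2)%:C * u' z),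
       u' 1 = 0 & v' 1 = 1] &
    W E = u beta%:C * v' beta%:C - v beta%:C * u' beta%:C].
Proof.
have H1 : deriv_on N (fun z => V z - delta*i) dV.
  by move=> z Nz; apply: (wd_eq (wdB (HV Nz) (wd_cst _ _ _ _))); rewrite subr0.
have H2 : deriv_on N (fun z => V z + delta*i) dV.
  by move=> z Nz; apply: (wd_eq (wdD (HV Nz) (wd_cst _ _ _ _))); rewrite addr0.
have M1 z : N z -> cabs (V z - delta*i) <= M + cabs (delta*i).
  by move=> Nz; apply: (le_trans (cabs_sub_le _ _)); rewrite lerD2r; exact: MV.
have M2 z : N z -> cabs (V z + delta*i) <= M + cabs (delta*i).
  by move=> Nz; apply: (le_trans (cabsD _ _)); rewrite lerD2r; exact: MV.
have S1 x : -1 <= x <= beta -> N x%:C by move=> hx; apply: Nseg; have := hb; lra.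
have S2 x : beta <= x <= 1 -> N x%:C by move=> hx; apply: Nseg; have := hb; lra.
have l1 : -1 <= beta by have := hb; lra.
have l2 : beta <= 1 by have := hb; lra.
have i1 : -1 <= (-1 : R) <= beta by lra.
have i2 : -1 <= beta <= beta by lra.
have i3 : beta <= (1 : R) <= 1 by lra.
have i4 : beta <= beta <= 1 by lra.
have [m [dm [n [dn [Hm Hn Hs [l [l' [Hl Hl']]]]]]]] :=
  arm_family h H1 M1 S1 l1 i1 i2.
have [p [dp [r [dr [Hp Hr Ht [k [k' [Hk Hk']]]]]]]] :=
  arm_family h H2 M2 S2 l2 i3 i4.
have cm1 : (-1)%:C = -1 :> R[i] by rewrite rmorphN1.
have c1 : 1%:C = 1 :> R[i] by rewrite rmorph1.
pose W E := m E beta%:C * dp E beta%:C - dm E beta%:C * p E beta%:C.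
exists W, (fun E => (l E * dp E beta%:C + m E beta%:C * k' E)
                   - (l' E * p E beta%:C + dm E beta%:C * k E)); split.
  move=> E _; apply: wdB; apply: wdM; [exact: Hl|exact: Hk'|exact: Hl'|exact: Hk].
have cq U dU al be E : deriv_on N U dU -> (forall x, al <= x <= be -> N x%:C) ->
    rcont al be (fun x => (U x%:C - E) / (h ^+ 2)%:C).
  move=> HU S x hx; apply: wcM; last exact: wc_cst.
  apply: wcB; last exact: wc_cst.
  apply: (@rwc_path _ _ N) => //; first exact: wd_wc (rwd_id _ _).
  by apply: wd_wc (HU _ _); exact: S.
move=> E; have [m1 m2 m3 m4] := Hm E; have [n3 n4] := Hn E; have [s1 s2] := Hs E.
have [p1 p2 p3 p4] := Hp E; have [r3 r4] := Hr E; have [t1 t2] := Ht E.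
rewrite cm1 in m3 m4 n3 n4; rewrite c1 in p3 p4 r3 r4.
split; last by exists (m E), (dm E), (p E), (dp E).
rewrite -cm1 in m3 m4 n3 n4; rewrite -c1 in p3 p4 r3 r4.
split=> [sp|WE].
  apply: contrapT => /eqP W0; apply: sp.
  exact: (wronskian_neq0_resolvent hb h0 (cq _ _ _ _ E H1 S1) (cq _ _ _ _ E H2 S2)
    s1 s2 t1 t2 m3 m4 n3 n4 p3 p4 r3 r4 W0).
exact: (wronskian0_spectrum hb h0 (cq _ _ _ _ E H1 S1) (cq _ _ _ _ E H2 S2)
    s1 s2 t1 t2 m3 m4 n3 n4 p3 p4 r3 r4 WE).
Qed.

End Characteristic.

(** * Complex limits, branches of the root, and the neighbourhood of the segment *)

Section Topology.
Context {R : realType}.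

Lemma normcE (z : R[i]) : `|z| = (cabs z)%:C. Proof. by []. Qed.

Lemma pos_complex (e : R[i]) : 0 < e -> e = (cRe e)%:C /\ 0 < cRe e.
Proof. by case: e => a b; rewrite ltcE /= => /andP[/eqP -> ?]. Qed.

Lemma nbhs_cabsP (z : R[i]) (A : set R[i]) :
  nbhs z A <-> exists2 e : R, 0 < e & forall w, cabs (w - z) < e -> A w.
Proof.
split=> [/nbhs_ballP[e /= /pos_complex[eE e0] H]|[e e0 H]].
  by exists (cRe e) => // w hw; apply: H; rewrite -ball_normE /= distrC normcE eE ltcR.
apply/nbhs_ballP; exists e%:C; first by rewrite /= ltcR.
by move=> w; rewrite -ball_normE /= distrC normcE ltcR; exact: H.
Qed.

Lemma cvg_seqP (u : nat -> R[i]) l : (u @ \oo --> l) <->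
  forall e : R, 0 < e -> exists n0, forall n, (n0 <= n)%N -> cabs (u n - l) < e.
Proof.
split=> [/cvgrPdist_lt H e e0|H].
  have [|n _ Hn] := H e%:C; first by rewrite ltcR.
  by exists n => m nm; have := Hn m nm; rewrite distrC normcE ltcR.
apply/cvgrPdist_lt => e /pos_complex[eE e0]; have [n Hn] := H _ e0; exists n => // m nm.
by rewrite eE distrC normcE ltcR; exact: Hn.
Qed.

Lemma cvg_real_seqP (u : nat -> R) l : (u @ \oo --> l) <->
  forall e : R, 0 < e -> exists n0, forall n, (n0 <= n)%N -> `|u n - l| < e.
Proof.
split=> [/cvgrPdist_lt H e e0|H].
  by have [n _ Hn] := H e e0; exists n => m nm; rewrite distrC; exact: Hn.
apply/cvgrPdist_lt => e e0; have [n Hn] := H _ e0; exists n => // m nm.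
by rewrite distrC; exact: Hn.
Qed.

Lemma within_rcontP (a b : R) (p : R -> R[i]) :
  {within `[a, b], continuous p} <-> rcont a b p.
Proof.
split=> [/subspace_continuousP H x xab e e0|H].
  have /H /cvgrPdist_le /(_ e%:C) : `[a, b]%classic x by rewrite /= in_itv.
  rewrite ltcR => /(_ e0) /nbhs_ballP[dl /= dl0 Hd]; exists dl => // s sab.
  rewrite cabs_rdist => sd; rewrite -lecR -normcE distrC; apply: Hd; last by rewrite /= in_itv.
  by rewrite /ball /= distrC.
apply/subspace_continuousP => x /=; rewrite in_itv /= => xab.
apply/cvgrPdist_le => e /pos_complex[eE e0]; have [dl dl0 Hd] := H x xab _ e0.
near=> y; rewrite eE distrC normcE lecR; apply: Hd; first (change (a <= y <= b)).
  have : `[a, b]%classic y by near: y; exact: withinT.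
  by rewrite /= in_itv.
rewrite cabs_rdist distrC; near: y; apply: cvg_within.
by apply/nbhs_ballP; exists dl.
Unshelve. all: by end_near. Qed.

Lemma derivable_cwd (V : R[i] -> R[i]) z : derivable V z 1 -> cwd setT V z ('D_1 V z).
Proof.
move=> /cvgrPdist_le H e e0.
have /nbhs_cabsP[d d0 Hd] := H e%:C (ltac:(by rewrite ltcR)).
exists d => // w _ wd.
have [->|wz] := eqVneq w z; first by rewrite !subrr mul0r subrr cabs0 mulr0.
have wz0 : w - z != 0 by rewrite subr_eq0.
have := Hd (w - z); rewrite subr0 => /(_ wd wz0).
rewrite /= scaler1 subrK normcE lecR -cabsN => h.
rewrite (_ : _ - _ - _ = (w - z) * - ('D_1 V z - (w - z)^-1 *: (V w - V z))).
  by rewrite cabsM mulrC; apply: ler_wpM2r => //; exact: cabs_ge0.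
by rewrite -[_ *: _]/(_ * _); field.
Qed.

(* Any two continuous square roots of a nonvanishing function on an interval
   differ by a constant sign. *)
Lemma Re_int_sqrt_eq0P (a b : R) (f q Q : R -> R[i]) : a <= b ->
  (forall x, a <= x <= b -> rwd (seg a b) Q x (q x)) -> rcont a b q ->
  (forall x, a <= x <= b -> q x ^+ 2 = f x /\ q x != 0) ->
  Re_int_sqrt_eq0 a b f <-> cRe (Q b - Q a) = 0.
Proof.
move=> ab HQ cq Hq; have ia : a <= a <= b by rewrite lexx.
split=> [[p [[/within_rcontP cp Hp] Re0]]|Re0]; last first.
  exists q; rewrite (@cint_FTC _ a b Q) //; split => //; split; first exact/within_rcontP.
  by move=> x; rewrite in_itv /= => /Hq[].
pose c x := p x * (q x)^-1.
have cc : rcont a b c.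
  by move=> x hx; apply: wcM; [exact: cp|apply: wcV; [exact: cq|exact: (Hq x hx).2]].
have c2 x : a <= x <= b -> (c x - 1) * (c x + 1) = 0.
  move=> hx; have [q1 q2] := Hq x hx.
  have := Hp x; rewrite in_itv /= => /(_ hx); rewrite -q1 /c => pq.
  rewrite (_ : _ * _ = (p x ^+ 2 - q x ^+ 2) / q x ^+ 2); last by field.
  by rewrite pq subrr mul0r.
have c1 x : a <= x <= b -> c x = 1 \/ c x = -1.
  move=> hx; have /eqP := c2 x hx; rewrite mulf_eq0 subr_eq0 addr_eq0 => /orP[/eqP|/eqP]; by [left|right].
have dc x : a <= x <= b -> rwd (seg a b) c x 0.
  move=> hx e e0; have [d d0 Hd] := cc x hx 1 ltr01; exists d => // s hs sd.
  have : cabs (c s - c x) <= 1 by exact: Hd.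
  suff [->|E] : c s - c x = 0 \/ cabs (c s - c x) = 2.
  - by move=> _; rewrite mulr0 subrr cabs0 mulr_ge0 ?cabs_ge0 // ltW.
  - by rewrite E; lra.
  case: (c1 x hx) => ->; case: (c1 s hs) => ->.
  - by left; rewrite subrr.
  - by right; rewrite -opprD cabsN -[1 + 1]/(2%:R) cabs_nat.
  - by right; rewrite opprK -[1 + 1]/(2%:R) cabs_nat.
  - by left; rewrite subrr.
have cE x : a <= x <= b -> p x = c a * q x.
  move=> hx; have [_ q2] := Hq x hx.
  rewrite -[p x](divfK q2) -/(c x); congr (_ * _).
  have /andP[ax xb] := hx; apply: (zero_deriv_eq ax) => t ht.
  apply: (@wd_sub _ _ _ _ (seg a b)); last by apply: dc; lra.
  by move=> s /andP[h1 h2]; apply/andP; split; lra.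
move: Re0; rewrite (@cint_eq _ a b _ (fun x => c a * q x)) //.
rewrite (@cint_FTC _ a b (fun x => c a * Q x)) //; last 2 first.
- by move=> x hx; apply: wdZ; exact: HQ.
- by move=> x hx; apply: wcZ; exact: cq.
rewrite -mulrBr; case: (c1 a ia) => ->; first by rewrite mul1r.
by rewrite mulN1r cReN => /eqP; rewrite oppr_eq0 => /eqP.
Qed.

Variables (D : set R[i]) (V : R[i] -> R[i]).
Hypotheses (D_open : open D) (D_segment : forall x : R, x \in `[-1, 1] -> D x%:C).
Hypothesis V_holo : holomorphic_on D V.

(** By compactness of the segment. A single index [n] controls both the radius 1 / (n + 1) and the
    bound n + 1, so one near-covering argument yields both constants. *)
Lemma near_segment : exists r M : R, [/\ 0 < r, 0 < M & forall x : R, -1 <= x <= 1 ->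
  forall w, cabs (w - x%:C) <= r -> D w /\ cabs (V w) <= M].
Proof.
have cpt := iffLR (compact_near_coveringP _) (@segment_compact R (-1) 1).
have key : \forall n \near \oo, `[-1, 1]%classic `<=` [set x : R | forall w, cabs (w - x%:C) <= n.+1%:R^-1 ->
     D w /\ cabs (V w) <= n.+1%:R].
  apply: (cpt nat \oo (fun n => [set x : R | forall w, cabs (w - x%:C) <= n.+1%:R^-1 ->
     D w /\ cabs (V w) <= n.+1%:R])) => x xI.
  have /nbhs_cabsP[d1 d10 H1] : nbhs x%:C D by apply: open_nbhs_nbhs; split => //; exact: D_segment.
  have [d2 d20 H2] := wd_wc (derivable_cwd (V_holo (D_segment xI))) ltr01.
  pose d := Num.min d1 d2; have d0 : 0 < d by rewrite lt_min d10.
  have d2' : 0 < d / 2 by rewrite divr_gt0.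
  near=> x' n => /= w hw.
  have wx : cabs (w - x%:C) < d.
    apply: (le_lt_trans (cabs_triangle _ (w - x'%:C))).
    rewrite (_ : w - x%:C - _ = x'%:C - x%:C); last by ring.
    have : cabs (x'%:C - x%:C) < d / 2.
      rewrite cabs_rdist distrC; near: x'; apply/nbhs_ballP.
      by exists (d / 2) => // y; rewrite /ball.
    have : n.+1%:R^-1 < d / 2 :> R by near: n; exact: near_infty_natSinv_lt (PosNum d2').
    by move=> i1 i2; rewrite [d]splitr; apply: ltrD => //; exact: le_lt_trans hw i1.
  move: wx; rewrite lt_min => /andP[w1 w2]; split; first exact: H1.
  have := H2 w Logic.I w2; have := cabs_triangle (V w) (V x%:C).
  have : 1 + cabs (V x%:C) <= n.+1%:R.
    near: n; near=> n; apply: (@le_trans _ _ n%:R); last by rewrite ler_nat.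
    by near: n; exact: nbhs_infty_ger.
  by lra.
have [n _ /(_ n (leqnn n)) Hn] := key; exists n.+1%:R^-1, n.+1%:R; split.
- by rewrite invr_gt0.
- by [].
- exact: Hn.
Unshelve. all: by end_near. Qed.

Lemma box_extension : exists (r M : R) (dV ddV : R[i] -> R[i]),
  let N := box (-1 - r) (1 + r) (- r) r in
  [/\ 0 < r, 0 < M, deriv_on N V dV, deriv_on N dV ddV &
    forall z, N z -> [/\ cabs (V z) <= M, cabs (dV z) <= M & cabs (ddV z) <= M]].
Proof.
have [r0 [M0 [r00 M00 H]]] := near_segment.
(* Points of the box are within [2 * r] of the segment and [second_deriv] asks for discs of radius
   [4 * r] around them: in all 6 r, below r0 = 8 r. *)
pose r := r0 / 8; have rp : 0 < r by rewrite divr_gt0.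
pose N' := box (-1 - r) (1 + r) (- r) r : set R[i].
pose N := [set z : R[i] | D z /\ cabs (V z) <= M0].
pose dV z := 'D_1 V z.
have near z : N' z -> exists2 x : R, -1 <= x <= 1 & cabs (z - x%:C) <= 2 * r.
  case: z => u v [/= /andP[u1 u2] /andP[v1 v2]].
  have [x [x1 x2]] : exists x : R, -1 <= x <= 1 /\ `|u - x| <= r.
    have [h1|h1] := ltP u (-1); first by exists (-1); rewrite ler_norml; split; lra.
    have [h2|h2] := ltP 1 u; first by exists 1; rewrite ler_norml; split; lra.
    by exists u; rewrite ler_norml; split; lra.
  exists x => //; apply: (le_trans (cabs_le_ReIm _)) => /=.
  have : `|v - 0| <= r by rewrite subr0 ler_norml; lra.
  by lra.
have HN z : N' z -> forall w, cabs (w - z) <= 4 * r -> N w.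
  move=> Nz w hw; have [x xI hx] := near z Nz; apply: (H x xI).
  apply: (le_trans (cabs_triangle _ (w - z))).
  by rewrite (_ : w - x%:C - _ = z - x%:C); [rewrite /r in hw hx *; lra|ring].
have HV : deriv_on N V dV.
  by move=> z [Dz _]; apply: (wd_sub (B := setT)) => //; apply: derivable_cwd; exact: V_holo.
have MV z : N z -> cabs (V z) <= M0 by case.
have [ddV HddV bddV] := second_deriv rp HN HV MV.
have bdV z : N' z -> cabs (dV z) <= M0 / r by exact: (deriv_bound rp HN HV MV).
have N'N z : N' z -> N z by move=> Nz; apply: (HN z Nz); rewrite subrr cabs0; lra.
exists r, (M0 + M0 / r + M0 / r ^+ 2), dV, ddV.
have M1 : 0 < M0 / r by rewrite divr_gt0.
have M2 : 0 < M0 / r ^+ 2 by rewrite divr_gt0 ?exprn_gt0.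
split => //; first by lra.
  by move=> z Nz; apply: (wd_sub N'N); apply: HV; exact: N'N.
move=> z Nz; have := MV z (N'N z Nz); have := bdV z Nz; have := bddV z Nz.
by split; lra.
Qed.

End Topology.

(** * Zeros of the Wronskian *)

Section Elementary.
Context {R : realType}.
Implicit Types (h eps K : R) (z w T : R[i]).

Let e1 : R := expR 1.
Let e1_ge1 : 1 <= e1. Proof. by have := @expR_ge1Dx R 1; rewrite /e1; lra. Qed.

Lemma cexp_sub1 z : cabs z <= 1 -> cabs (cexp z - 1) <= (1 + expR 1) * cabs z.
Proof.
move=> z1; have z0 := cabs_ge0 z.
have := cabs_triangle (cexp z - 1) z; have := cexp_taylor z.
have : cabs z ^+ 2 * expR (cabs z) <= cabs z * expR 1.
  rewrite expr2 -mulrA; apply: ler_wpM2l => //; rewrite -[leRHS]mul1r.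
  by apply: ler_pM; rewrite ?expR_ge0 ?ler_expR.
by rewrite -/e1; lra.
Qed.

Lemma cexp_lip z w : cabs (z - w) <= 1 ->
  cabs (cexp z - cexp w) <= expR (cRe w) * ((1 + expR 1) * cabs (z - w)).
Proof.
move=> zw; rewrite -{1}(subrKC w z) cexpD -{2}[cexp w]mulr1 -mulrBr cabsM cabs_cexp.
by apply: ler_wpM2l; [exact: expR_ge0|exact: cexp_sub1].
Qed.

Let hyp_lip z w : cabs (z - w) <= 1 ->
  cabs (cexp z - cexp w) <= expR `|cRe w| * ((1 + expR 1) * cabs (z - w)) /\
  cabs (cexp (- z) - cexp (- w)) <= expR `|cRe w| * ((1 + expR 1) * cabs (z - w)).
Proof.
move=> zw; have Y0 : 0 <= (1 + expR 1) * cabs (z - w).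
  by rewrite mulr_ge0 ?cabs_ge0 //; rewrite -/e1; lra.
have e : cabs (- z - - w) = cabs (z - w) by rewrite -opprD cabsN.
split; (apply: le_trans (cexp_lip _) _; first by rewrite ?e);
  rewrite ?e; apply: ler_wpM2r => //; rewrite ler_expR ?cReN ?ler_norm //.
by rewrite -normrN ler_norm.
Qed.

Lemma csinh_lip z w : cabs (z - w) <= 1 ->
  cabs (csinh z - csinh w) <= expR `|cRe w| * ((1 + expR 1) * cabs (z - w)).
Proof.
move=> /hyp_lip[h1 h2].
rewrite (_ : _ - _ = ((cexp z - cexp w) - (cexp (- z) - cexp (- w))) / 2); last by rewrite /csinh; field.
rewrite cabsM cabsV cabs_nat ler_pdivrMr //.
by have := cabs_sub_le (cexp z - cexp w) (cexp (- z) - cexp (- w)); lra.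
Qed.

Lemma ccosh_lip z w : cabs (z - w) <= 1 ->
  cabs (ccosh z - ccosh w) <= expR `|cRe w| * ((1 + expR 1) * cabs (z - w)).
Proof.
move=> /hyp_lip[h1 h2].
rewrite (_ : _ - _ = ((cexp z - cexp w) + (cexp (- z) - cexp (- w))) / 2); last by rewrite /ccosh; field.
rewrite cabsM cabsV cabs_nat ler_pdivrMr //.
by have := cabsD (cexp z - cexp w) (cexp (- z) - cexp (- w)); lra.
Qed.

Lemma csinhN z : csinh (- z) = - csinh z.
Proof. by rewrite /csinh opprK; field. Qed.

Lemma ccoshN z : ccosh (- z) = ccosh z.
Proof. by rewrite /ccosh opprK addrC. Qed.

Lemma csinhB z w : csinh (z - w) = csinh z * ccosh w - ccosh z * csinh w.
Proof. by rewrite /csinh /ccosh opprB !cexpD; field. Qed.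

(** The radius is such that |z| e = 1/2, so the Taylor remainders of exp z and exp (- z) are each at
    most half of |z| and the linear term dominates. *)
Lemma csinh_near z : cabs z = (2 * expR 1)^-1 -> (2 * expR 1)^-1 / 2 <= cabs (csinh z).
Proof.
move=> ze; have z0 := cabs_ge0 z.
have ee : cabs z * e1 = 1 / 2 by rewrite ze /e1; field; rewrite gt_eqF ?expR_gt0.
have z1 : cabs z <= 1 by have : cabs z * 1 <= cabs z * e1 by [apply: ler_wpM2l]; lra.
have B w : cabs w = cabs z -> cabs (cexp w - 1 - w) <= cabs z / 2.
  move=> wz; apply: (le_trans (cexp_taylor w)); rewrite wz expr2 -mulrA; apply: ler_wpM2l => //.
  apply: (@le_trans _ _ (cabs z * e1)); last by rewrite ee; lra.
  by apply: ler_wpM2l => //; rewrite ler_expR.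
have := B _ (erefl _); have := B (- z) (cabsN z).
have := cabs_sub_le (cexp z - 1 - z) (cexp (- z) - 1 - - z).
have := cabs_triangle (2 * z) (cexp z - cexp (- z)).
rewrite (_ : 2 * z - _ = - (cexp z - 1 - z - (cexp (- z) - 1 - - z))); last by ring.
rewrite cabsN cabsM cabs_nat /csinh -ze => h1 h2 h3 h4.
rewrite (cabsM (cexp z - cexp (- z))) cabsV cabs_nat; lra.
Qed.

Lemma csinh_pi (k : int) z : cabs (csinh (0 +i* (pi * k%:~R) + z)) = cabs (csinh z).
Proof.
set e := 0 +i* _; have e2 := @cexp_pi_sqr R k; rewrite -/e in e2.
have e0 := cexp_neq0 e.
have eV : (cexp e)^-1 = cexp e by apply: (mulfI e0); rewrite mulfV // -expr2 e2.
have ce : cabs (cexp e) = 1 by rewrite cabs_cexp /e /= expR0.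
rewrite /csinh opprD !cexpD (cexpN e) eV -mulrBr -mulrA (cabsM (cexp e)) ce mul1r.
by [].
Qed.

(** Zeros of sinh are spaced by i pi; this selects one at bounded distance from an imaginary part
    that blows up as h tends to 0. *)
Lemma pi_multiple (y : R) : exists k : int, `|pi * k%:~R - y| <= pi.
Proof.
have p0 := @pi_gt0 R; exists (Num.floor (y / pi)).
have h1 := ge_floor (y / pi); have h2 := floorD1_gt (y / pi).
rewrite intrD in h2; move: h1 h2; set f := (Num.floor _)%:~R => h1 h2.
have yE : y = pi * (y / pi) by rewrite mulrC divfK // gt_eqF // p0.
rewrite {1}yE -mulrBr normrM gtr0_norm // -[leRHS]mulr1; apply: ler_wpM2l; first exact: ltW.
by rewrite ler_norml; lra.
Qed.

Lemma expRN_le_inv (y : R) : 0 < y -> expR (- y) <= y^-1.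
Proof.
move=> y0; rewrite expRN lef_pV2 ?posrE ?expR_gt0 //.
by have := expR_ge1Dx y; lra.
Qed.

Lemma prod3_dist (x y z x0 y0 z0 : R[i]) K eps : 0 <= eps <= 1 ->
  cabs x0 <= K -> cabs y0 <= K -> cabs z0 <= K ->
  cabs (x - x0) <= K * eps -> cabs (y - y0) <= K * eps -> cabs (z - z0) <= K * eps ->
  cabs (x * y * z - x0 * y0 * z0) <= 12 * K ^+ 3 * eps.
Proof.
move=> /andP[e0 e1'] hx hy hz dx dy dz.
have K0 : 0 <= K by apply: le_trans hx; exact: cabs_ge0.
have Ke : K * eps <= K by rewrite -[leRHS]mulr1; apply: ler_wpM2l.
have bnd (t t0 : R[i]) : cabs t0 <= K -> cabs (t - t0) <= K * eps -> cabs t <= 2 * K.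
  by move=> h1 h2; have := cabs_triangle t t0; lra.
have hy' := bnd _ _ hy dy; have hz' := bnd _ _ hz dz.
rewrite (_ : _ - _ = (x - x0) * (y * z) + x0 * ((y - y0) * z) + x0 * (y0 * (z - z0))); last by ring.
have P (s t : R[i]) (S T : R) : cabs s <= S -> cabs t <= T -> cabs (s * t) <= S * T.
  by move=> h1 h2; rewrite cabsM; apply: ler_pM; rewrite ?cabs_ge0.
have t1 := P _ _ _ _ dx (P _ _ _ _ hy' hz').
have t2 := P _ _ _ _ hx (P _ _ _ _ dy hz').
have t3 := P _ _ _ _ hx (P _ _ _ _ hy dz).
have K3 : 0 <= K ^+ 3 * eps by rewrite mulr_ge0 ?exprn_ge0.
apply: (le_trans (cabsD _ _)); apply: (le_trans (lerD (cabsD _ _) (lexx _))).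
apply: (le_trans (lerD (lerD t1 t2) t3)).
(* Telescoping, with the replaced factors bounded by 2 K, gives 4 + 2 + 1 = 7, below the stated
   12. *)
rewrite (_ : _ + _ = 7 * (K ^+ 3 * eps)); last by ring.
by lra.
Qed.

Lemma cRe_div z h : cRe (z / h%:C) = cRe z / h.
Proof. by rewrite -(fmorphV (real_complex R)) cReM /= mulr0 subr0. Qed.

Lemma cIm_div z h : cIm (z / h%:C) = cIm z / h.
Proof. by rewrite -(fmorphV (real_complex R)) cImM /= mulr0 add0r. Qed.

End Elementary.

(** * One arm in the growing and in the oscillating regime *)

Section Arms.
Context {R : realType}.
Implicit Types (h rho C S X : R) (u v : R -> R[i] -> R[i]) (p a s : R[i] -> R[i]) (E x d : R[i]).

(* Endpoint values [u, v] of a solution and of its derivative, whose leading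
   behaviour is governed by the action [s] (with derivative [d] at [E0]), the
   momentum [p] and the amplitude [a]. *)
Definition wkb_arm (E0 : R[i]) rho C S u v p a s d := forall E, cabs (E - E0) <= rho ->
  [/\ p E != 0, cabs (p E - p E0) <= C * cabs (E - E0),
      cabs (s E - s E0 - d * (E - E0)) <= C * cabs (E - E0) ^+ 2,
      S / 2 <= cabs (a E) <= 2 * S &
      forall h, 0 < h -> C * h <= 1 ->
        cabs (a E * u h E / h%:C - csinh (s E / h%:C)) <= C * h * expR `|cRe (s E / h%:C)| /\
        cabs (a E * v h E / p E - ccosh (s E / h%:C)) <= C * h * expR `|cRe (s E / h%:C)|].

(** The other branch of the root reverses momentum, amplitude and action while the solution stays
    the same. A nonzero real part of an action may thus be assumed positive. *)
Lemma wkb_arm_flip E0 rho C S u v p a s d : wkb_arm E0 rho C S u v p a s d ->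
  wkb_arm E0 rho C S u v (fun E => - p E) (fun E => - a E) (fun E => - s E) (- d).
Proof.
move=> H E /H[h1 h2 h3 h4 h5]; split.
- by rewrite oppr_eq0.
- by rewrite -opprD cabsN.
- by rewrite (_ : _ - _ = - (s E - s E0 - d * (E - E0))) ?cabsN //; ring.
- by rewrite cabsN.
move=> h h0 Ch; have [h6 h7] := h5 h h0 Ch; rewrite !mulNr cReN normrN; split.
  by rewrite csinhN -opprD cabsN.
by rewrite ccoshN invrN mulrN opprK.
Qed.

Variables (E0 : R[i]) (rho C S : R) (u v : R -> R[i] -> R[i]) (p a s : R[i] -> R[i]) (d : R[i]).
Hypotheses (rho0 : 0 < rho) (C0 : 0 < C) (arm_hyp : wkb_arm E0 rho C S u v p a s d).
Let A h E := a E * u h E / h%:C.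
Let B h E := a E * v h E / p E.

(** After division by exp (s / h), sinh and cosh both equal 1/2 up to an exponentially small term,
    which is bounded by h / c through exp (- y) <= 1 / y. The factor c / Z in [eta] keeps the real
    part of the action above [c]. *)
Lemma growing_arm : 0 < cRe (s E0) -> exists K eta : R, [/\ 0 < K, 0 < eta &
  forall h E, 0 < h -> h <= eta -> cabs (E - E0) <= eta ->
   cabs (cexp (- (s E / h%:C)) * A h E - 1 / 2) <= K * h /\
   cabs (cexp (- (s E / h%:C)) * B h E - 1 / 2) <= K * h].
Proof.
have C0' := C0; have r0' := rho0.
move=> s0; pose c := cRe (s E0) / 2; have c0 : 0 < c by rewrite divr_gt0.
have dd := cabs_ge0 d.
pose Z := cabs d + C + 1; have Z0 : 0 < Z by rewrite /Z; lra.
exists (C + c^-1), (Num.min (Num.min rho 1) (Num.min (c / Z) (C^-1))).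
have cV : 0 < c^-1 by rewrite invr_gt0.
split; first by lra.
  by rewrite !lt_min rho0 ltr01 divr_gt0 // invr_gt0.
move=> h E h0; rewrite !le_min => /andP[_ /andP[_ hC]] /andP[/andP[E1 E2] /andP[E3 _]].
have Ch : C * h <= 1 by rewrite mulrC -ler_pdivlMr // div1r.
have [_ _ h3 _ h5] := arm_hyp E1; have [h6 h7] := h5 h h0 Ch; clear h5.
have E0' := cabs_ge0 (E - E0).
have Rs : c <= cRe (s E).
  have : cabs (s E - s E0) <= c.
    apply: (le_trans (cabs_triangle _ (d * (E - E0)))).
    apply: (@le_trans _ _ (Z * cabs (E - E0))); last by rewrite mulrC -ler_pdivlMr.
    rewrite (cabsM d); have : C * cabs (E - E0) ^+ 2 <= C * cabs (E - E0).
      by apply: ler_wpM2l; [exact: ltW|rewrite expr2 -[leRHS]mulr1; apply: ler_wpM2l].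
    by rewrite /Z; lra.
  have := Re_le_cabs (s E - s E0); rewrite cReD cReN ler_norml /c => /andP[+ _].
  by lra.
set tau := s E / h%:C in h6 h7 *.
have Rt : c / h <= cRe tau by rewrite /tau cRe_div ler_pM2r // invr_gt0.
have ch0 : 0 < c / h by rewrite divr_gt0.
have Rt0 : 0 < cRe tau by lra.
have xb : cabs (cexp (- tau)) <= c^-1 * h.
  rewrite cabs_cexp cReN; apply: (@le_trans _ _ (expR (- (c / h)))).
    by rewrite ler_expR lerN2.
  by apply: (le_trans (expRN_le_inv ch0)); rewrite invf_div mulrC.
have x1 : cabs (cexp (- tau)) <= 1.
  by rewrite cabs_cexp cReN -expR0 ler_expR; lra.
have x2 : cabs (cexp (- tau) * cexp (- tau) / 2) <= c^-1 * h.
  rewrite !cabsM cabsV cabs_nat ler_pdivrMr //.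
  have : cabs (cexp (- tau)) * cabs (cexp (- tau)) <= 1 * (c^-1 * h).
    by apply: ler_pM; rewrite ?cabs_ge0.
  have : 0 <= c^-1 * h by rewrite mulr_ge0 // ltW.
  by lra.
have ee : cexp (- tau) * cexp tau = 1 by rewrite -cexpD addNr cexp0.
have err (Y Y0 : R[i]) : cabs (Y - Y0) <= C * h * expR `|cRe tau| ->
    cabs (cexp (- tau) * Y0 - 1 / 2) <= c^-1 * h ->
    cabs (cexp (- tau) * Y - 1 / 2) <= (C + c^-1) * h.
  move=> y1 y2; rewrite mulrDl; apply: (le_trans (cabs_dist _ _ (cexp (- tau) * Y0))).
  apply: lerD => //; rewrite -mulrBr cabsM cabs_cexp cReN.
  apply: (@le_trans _ _ (expR (- cRe tau) * (C * h * expR `|cRe tau|))).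
    by apply: ler_wpM2l => //; exact: expR_ge0.
  rewrite gtr0_norm // mulrCA -expRD addNr expR0 mulr1 //.
split; [apply: err h6 _|apply: err h7 _].
  rewrite (_ : _ - _ = - (cexp (- tau) * cexp (- tau) / 2)) ?cabsN //.
  by rewrite /csinh mulrA mulrBr ee; field.
rewrite (_ : _ - _ = cexp (- tau) * cexp (- tau) / 2) //.
by rewrite /ccosh mulrA mulrDr ee; field.
Qed.

(** On the scale E - E0 = h x, the quadratic remainder of the action is O(h^2), and remains O(h)
    after division by [h]. *)
Lemma action_shift X : 0 <= X -> exists2 eta, 0 < eta & forall h x, 0 < h -> h <= eta -> cabs x <= X ->
  [/\ cabs (E0 + h%:C * x - E0) <= rho, C * h <= 1,
     cabs (s (E0 + h%:C * x) / h%:C - (s E0 / h%:C + d * x)) <= C * X ^+ 2 * h &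
     cabs (s (E0 + h%:C * x) / h%:C - (s E0 / h%:C + d * x)) <= 1].
Proof.
have C0' := C0; have r0' := rho0.
move=> X0; have CX : 0 <= C * X ^+ 2 by rewrite mulr_ge0 ?exprn_ge0 // ltW.
exists (Num.min (Num.min (rho / (X + 1)) (C^-1)) ((C * X ^+ 2 + 1)^-1)).
  by rewrite !lt_min divr_gt0 ?invr_gt0 //; lra.
move=> h x h0; rewrite !le_min => /andP[/andP[h1 h2] h3] xX.
have hX1 : h * (X + 1) <= rho by rewrite -ler_pdivlMr //; lra.
have Ch : C * h <= 1 by rewrite mulrC -ler_pdivlMr // div1r.
have CXh : C * X ^+ 2 * h <= 1.
  have : h * (C * X ^+ 2 + 1) <= 1 by rewrite -ler_pdivlMr ?div1r //; lra.
  by lra.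
have hc : cabs (h%:C : R[i]) = h by rewrite cabs_real gtr0_norm.
have EE : cabs (E0 + h%:C * x - E0) = h * cabs x by rewrite addrC addKr cabsM hc.
have Er : cabs (E0 + h%:C * x - E0) <= rho.
  rewrite EE; apply: le_trans hX1; apply: ler_wpM2l; [exact: ltW|lra].
have hC0 : (h%:C : R[i]) != 0 by rewrite -cabs_gt0 hc.
have main : cabs (s (E0 + h%:C * x) / h%:C - (s E0 / h%:C + d * x)) <= C * X ^+ 2 * h.
  have [_ _ h4 _ _] := arm_hyp Er.
  rewrite (_ : _ - _ = (s (E0 + h%:C * x) - s E0 - d * (E0 + h%:C * x - E0)) / h%:C); last by field.
  rewrite cabsM cabsV hc ler_pdivrMr //; apply: (le_trans h4).
  rewrite EE exprMn (_ : C * X ^+ 2 * h * h = C * (h ^+ 2 * X ^+ 2)); last by ring.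
  apply: ler_wpM2l; first exact: ltW.
  by apply: ler_wpM2l; [exact: exprn_ge0 (ltW h0)|apply: lerXn2r; rewrite ?nnegrE ?cabs_ge0].
by split => //; exact: le_trans main CXh.
Qed.

(** With an imaginary action at [E0], no exponential growth occurs for bounded [x], so the relative
    errors of the asymptotics are absolute ones and [s E / h] may be replaced by the affine function
    [T] of [x]. *)
Lemma center_arm X : cRe (s E0) = 0 -> 0 <= X ->
  exists K eta, [/\ 0 < K, 0 < eta & forall h x, 0 < h -> h <= eta -> cabs x <= X ->
  let E := E0 + h%:C * x in let T := s E0 / h%:C + d * x in
  [/\ cabs (A h E - csinh T) <= K * h, cabs (B h E - ccosh T) <= K * h,
      cabs (csinh T) <= expR (cabs d * X) & cabs (ccosh T) <= expR (cabs d * X)]].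
Proof.
have C0' := C0.
move=> s0 X0; have [eta eta0 H] := action_shift X0.
have dX : 0 <= cabs d * X by rewrite mulr_ge0 ?cabs_ge0.
pose K := C * expR (cabs d * X + 1) + expR (cabs d * X) * ((1 + expR 1) * (C * X ^+ 2)).
exists (K + 1), eta.
have K0 : 0 <= K.
  have e1 := expR_ge0 (1 : R).
  by rewrite addr_ge0 ?mulr_ge0 ?expR_ge0 ?exprn_ge0 ?addr_ge0 // ltW.
split => //; first by lra.
move=> h x h0 h1 xX /=; have [Er Ch t1 t2] := H h x h0 h1 xX.
set E := E0 + h%:C * x in Er t1 t2 *; set T := _ + d * x in t1 t2 *.
have RT : `|cRe T| <= cabs d * X.
  rewrite /T cReD cRe_div s0 mul0r add0r; apply: (le_trans (Re_le_cabs _)).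
  by rewrite cabsM; apply: ler_wpM2l => //; exact: cabs_ge0.
have Rt : `|cRe (s E / h%:C)| <= cabs d * X + 1.
  rewrite -(subrK T (s E / h%:C)) cReD addrC; apply: (le_trans (ler_normD _ _)); apply: lerD => //.
  by apply: le_trans t2; exact: Re_le_cabs.
have eT : expR `|cRe T| <= expR (cabs d * X) by rewrite ler_expR.
have [_ _ _ _ h5] := arm_hyp Er; have [h6 h7] := h5 h h0 Ch.
have eA : C * h * expR `|cRe (s E / h%:C)| <= C * expR (cabs d * X + 1) * h.
  rewrite mulrAC; apply: ler_wpM2r; first exact: ltW.
  by apply: ler_wpM2l; [exact: ltW|rewrite ler_expR].
have eB : expR `|cRe T| * ((1 + expR 1) * cabs (s E / h%:C - T))
    <= expR (cabs d * X) * ((1 + expR 1) * (C * X ^+ 2)) * h.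
  rewrite -!mulrA; apply: ler_pM; rewrite ?expR_ge0 //.
    by rewrite mulr_ge0 ?cabs_ge0 // addr_ge0 ?expR_ge0.
  by apply: ler_wpM2l; [rewrite addr_ge0 ?expR_ge0|move: t1; rewrite -!mulrA].
have Kh : (K + 1) * h = C * expR (cabs d * X + 1) * h
   + expR (cabs d * X) * ((1 + expR 1) * (C * X ^+ 2)) * h + h by rewrite /K; ring.
split; [| |exact: le_trans (csinh_bound _) eT|exact: le_trans (ccosh_bound _) eT]; rewrite Kh.
  have := cabs_dist (A h E) (csinh T) (csinh (s E / h%:C)); have := csinh_lip t2.
  by move: h6; rewrite -/(A h E); lra.
have := cabs_dist (B h E) (ccosh T) (ccosh (s E / h%:C)); have := ccosh_lip t2.
by move: h7; rewrite -/(B h E); lra.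
Qed.

End Arms.

(** * Zeros of the Wronskian of two arms *)

Section Pair.
Context {R : realType}.
Implicit Types (rho C S h k eps : R) (W dW u v : R -> R[i] -> R[i]) (p a s : R[i] -> R[i]).
Implicit Types (E d : R[i]).

Definition wkb_pair E0 rho C S W dW u1 v1 p1 a1 s1 d1 u2 v2 p2 a2 s2 d2 :=
  [/\ [/\ 0 < rho, 0 < C & 0 < S],
      forall h, 0 < h -> deriv_on setT (W h) (dW h),
      forall h E, 0 < h -> W h E = u1 h E * v2 h E - v1 h E * u2 h E,
      wkb_arm E0 rho C S u1 v1 p1 a1 s1 d1 &
      wkb_arm E0 rho C S u2 v2 p2 a2 s2 d2].

Lemma wkb_pair_flipl E0 rho C S W dW u1 v1 p1 a1 s1 d1 u2 v2 p2 a2 s2 d2 :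
  wkb_pair E0 rho C S W dW u1 v1 p1 a1 s1 d1 u2 v2 p2 a2 s2 d2 ->
  wkb_pair E0 rho C S W dW u1 v1 (fun E => - p1 E) (fun E => - a1 E) (fun E => - s1 E) (- d1)
    u2 v2 p2 a2 s2 d2.
Proof. by move=> [h1 h2 h3 h4 h5]; split => //; exact: wkb_arm_flip. Qed.

Lemma wkb_pair_swap E0 rho C S W dW u1 v1 p1 a1 s1 d1 u2 v2 p2 a2 s2 d2 :
  wkb_pair E0 rho C S W dW u1 v1 p1 a1 s1 d1 u2 v2 p2 a2 s2 d2 ->
  wkb_pair E0 rho C S (fun h E => - W h E) (fun h E => - dW h E) u2 v2 p2 a2 s2 d2 u1 v1 p1 a1 s1 d1.
Proof.
move=> [h1 h2 h3 h4 h5]; split => // [h h0 E _|h E h0]; first by apply: wdN; exact: h2.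
by rewrite h3 //; ring.
Qed.

Lemma wkb_pair_flipr E0 rho C S W dW u1 v1 p1 a1 s1 d1 u2 v2 p2 a2 s2 d2 :
  wkb_pair E0 rho C S W dW u1 v1 p1 a1 s1 d1 u2 v2 p2 a2 s2 d2 ->
  wkb_pair E0 rho C S W dW u1 v1 p1 a1 s1 d1
    u2 v2 (fun E => - p2 E) (fun E => - a2 E) (fun E => - s2 E) (- d2).
Proof. by move=> [h1 h2 h3 h4 h5]; split => //; exact: wkb_arm_flip. Qed.

(* The Wronskian at the junction, up to the factor [h / (a1 E * a2 E)]. *)
Definition wkb_sum u1 v1 p1 a1 u2 v2 p2 a2 h E :=
  p2 E * (a1 E * u1 h E / h%:C) * (a2 E * v2 h E / p2 E)
  - p1 E * (a1 E * v1 h E / p1 E) * (a2 E * u2 h E / h%:C).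

Section Bounds.
Variables (E0 : R[i]) (rho C S : R) (W dW u1 v1 u2 v2 : R -> R[i] -> R[i]).
Variables (p1 a1 s1 p2 a2 s2 : R[i] -> R[i]) (d1 d2 : R[i]).
Hypothesis pair : wkb_pair E0 rho C S W dW u1 v1 p1 a1 s1 d1 u2 v2 p2 a2 s2 d2.
Local Notation G := (wkb_sum u1 v1 p1 a1 u2 v2 p2 a2).

Lemma wkb_factor h E : 0 < h -> cabs (E - E0) <= rho -> a1 E * a2 E * W h E = h%:C * G h E.
Proof.
have [_ _ WE arm1 arm2] := pair.
move=> h0 Er; have [n1 _ _ _ _] := arm1 _ Er; have [n2 _ _ _ _] := arm2 _ Er.
have hC0 : (h%:C : R[i]) != 0 by rewrite -cabs_gt0 cabs_real gtr0_norm.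
by rewrite WE // /wkb_sum; field; rewrite n1 n2 hC0.
Qed.

(** Only [W] is known to be holomorphic, so estimates on the sum [G] must be carried over to it. The
    amplitudes lie between S / 2 and 2 S, which costs a factor 4 here and another in [wkb_lower]. *)
Lemma wkb_upper h E g : 0 < h -> cabs (E - E0) <= rho -> cabs (G h E) <= g ->
  cabs (W h E) <= h / S ^+ 2 * (4 * g).
Proof.
have [[_ _ S0] _ _ arm1 arm2] := pair.
move=> h0 Er Gg; have [_ _ _ /andP[l1 _] _] := arm1 _ Er; have [_ _ _ /andP[l2 _] _] := arm2 _ Er.
have S2 : 0 < S ^+ 2 by rewrite exprn_gt0.
have := congr1 (@cabs R) (wkb_factor h0 Er).
rewrite (cabsM (a1 E * a2 E)) (cabsM (a1 E)) (cabsM h%:C) cabs_real gtr0_norm // => e.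
have w0 := cabs_ge0 (W h E).
have : S / 2 * (S / 2) * cabs (W h E) <= h * g.
  apply: (@le_trans _ _ (h * cabs (G h E))); last by apply: ler_wpM2l; [exact: ltW|].
  rewrite -e; apply: ler_wpM2r => //.
  by apply: ler_pM => //; rewrite divr_ge0 // ltW.
rewrite (_ : h / S ^+ 2 * (4 * g) = 4 * (h * g) / S ^+ 2); last by field; rewrite gt_eqF.
by rewrite ler_pdivlMr //; lra.
Qed.

Lemma wkb_lower h E g : 0 < h -> cabs (E - E0) <= rho -> 0 <= g -> g <= cabs (G h E) ->
  h / S ^+ 2 * (g / 4) <= cabs (W h E).
Proof.
have [[_ _ S0] _ _ arm1 arm2] := pair.
move=> h0 Er g0 Gg; have [_ _ _ /andP[_ l1] _] := arm1 _ Er; have [_ _ _ /andP[_ l2] _] := arm2 _ Er.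
have S2 : 0 < S ^+ 2 by rewrite exprn_gt0.
have := congr1 (@cabs R) (wkb_factor h0 Er).
rewrite (cabsM (a1 E * a2 E)) (cabsM (a1 E)) (cabsM h%:C) cabs_real gtr0_norm // => e.
have w0 := cabs_ge0 (W h E).
have : h * g <= 2 * S * (2 * S) * cabs (W h E).
  apply: (@le_trans _ _ (h * cabs (G h E))); first by apply: ler_wpM2l; [exact: ltW|].
  rewrite -e; apply: ler_wpM2r => //.
  by apply: ler_pM => //; exact: cabs_ge0.
rewrite (_ : h / S ^+ 2 * (g / 4) = (h * g) / 4 / S ^+ 2); last by field; rewrite gt_eqF.
by rewrite ler_pdivrMr //; lra.
Qed.

End Bounds.

(** Divided by both exponential growths, [G] tends to (p2 - p1) / 4 uniformly for E near E0, so the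
    error is eventually too small for [G] to vanish. *)
Lemma no_root E0 rho C S W dW u1 v1 p1 a1 s1 d1 u2 v2 p2 a2 s2 d2 :
  wkb_pair E0 rho C S W dW u1 v1 p1 a1 s1 d1 u2 v2 p2 a2 s2 d2 ->
  p1 E0 != p2 E0 -> 0 < cRe (s1 E0) -> 0 < cRe (s2 E0) ->
  exists2 eta, 0 < eta & forall h E, 0 < h -> h <= eta -> cabs (E - E0) <= eta -> W h E != 0.
Proof.
set G := wkb_sum u1 v1 p1 a1 u2 v2 p2 a2.
move=> pair; have [[rho0 C0 S0] _ _ arm1 arm2] := pair; move=> p12 r1 r2.
have [K1 [e1 [K10 e10 H1]]] := growing_arm rho0 C0 arm1 r1.
have [K2 [e2 [K20 e20 H2]]] := growing_arm rho0 C0 arm2 r2.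
pose K := K1 + K2 + C + cabs (p1 E0) + cabs (p2 E0) + 1.
have q1 := cabs_ge0 (p1 E0); have q2 := cabs_ge0 (p2 E0).
have [K0 kk1 kk2 CK] : [/\ 0 < K, K1 <= K, K2 <= K & C <= K].
  by clear -K10 K20 C0 q1 q2; rewrite /K; split; lra.
have [P1 P2 half1] : [/\ cabs (p1 E0) <= K, cabs (p2 E0) <= K & 1 / 2 <= K].
  by clear -K10 K20 C0 q1 q2; rewrite /K; split; lra.
have g0 : 0 < cabs (p2 E0 - p1 E0) by rewrite cabs_gt0 subr_eq0 eq_sym.
set g := cabs _ in g0; pose K3 := 24 * K ^+ 3.
have K30 : 0 < K3 by rewrite mulr_gt0 ?exprn_gt0.
exists (Num.min (Num.min e1 e2) (Num.min (Num.min 1 rho) (g / (8 * K3)))).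
  by rewrite !lt_min e10 e20 ltr01 rho0 divr_gt0 // mulr_gt0.
set eta := Num.min _ _ => h E h0 heta Eeta.
have /andP[/andP[k1 k2] /andP[/andP[k3 k4] k5]] : (eta <= e1) && (eta <= e2) && ((eta <= 1) && (eta <= rho) && (eta <= g / (8 * K3))).
  by rewrite /eta !ge_min !lexx !orbT.
have eta0 : 0 <= eta by apply: le_trans heta; exact: ltW.
have [f1 f2] := H1 h E h0 (le_trans heta k1) (le_trans Eeta k1).
have [f3 f4] := H2 h E h0 (le_trans heta k2) (le_trans Eeta k2).
have Er := le_trans Eeta k4.
have [_ m1 _ _ _] := arm1 _ Er; have [_ m2 _ _ _] := arm2 _ Er.
have half : cabs (1 / 2 : R[i]) <= K.
  by rewrite cabsM cabs1 cabsV cabs_nat.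
have up (X : R) k : X <= k * h -> 0 <= k -> k <= K -> X <= K * eta.
  by move=> x1 x2 x3; apply: (le_trans x1); apply: ler_pM => //; exact: ltW.
have up' (X : R) : X <= C * cabs (E - E0) -> X <= K * eta.
  by move=> x1; apply: (le_trans x1); apply: ler_pM; rewrite ?cabs_ge0 // ltW.
have eta01 : 0 <= eta <= 1 by rewrite eta0.
have t1 := prod3_dist eta01 P2 half half (up' _ m2) (up _ _ f1 (ltW K10) kk1) (up _ _ f4 (ltW K20) kk2).
have t2 := prod3_dist eta01 P1 half half (up' _ m1) (up _ _ f2 (ltW K10) kk1) (up _ _ f3 (ltW K20) kk2).
apply/eqP => W0; have := wkb_factor pair h0 Er; rewrite W0 mulr0 => /esym/eqP.
rewrite mulf_eq0 -cabs_eq0 cabs_real gtr0_norm // gt_eqF //= => /eqP GE.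
pose x := cexp (- (s1 E / h%:C)); pose y := cexp (- (s2 E / h%:C)).
have xyG : p2 E * (x * (a1 E * u1 h E / h%:C)) * (y * (a2 E * v2 h E / p2 E)) - p1 E * (x * (a1 E * v1 h E / p1 E)) * (y * (a2 E * u2 h E / h%:C)) = 0.
  by rewrite -[RHS](mulr0 (x * y)) -GE /G /wkb_sum; ring.
have : g / 4 <= K3 * eta.
  have -> : g / 4 = cabs (p2 E * (x * (a1 E * u1 h E / h%:C)) * (y * (a2 E * v2 h E / p2 E)) - p2 E0 * (1 / 2) * (1 / 2)
     - (p1 E * (x * (a1 E * v1 h E / p1 E)) * (y * (a2 E * u2 h E / h%:C)) - p1 E0 * (1 / 2) * (1 / 2))).
    move: xyG; set P := p2 E * _ * _; set P' := p1 E * _ * _ => PP.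
    rewrite [X in _ = cabs X](_ : _ = (P - P') - (p2 E0 - p1 E0) / 4); last by field.
    by rewrite PP sub0r cabsN cabsM cabsV cabs_nat.
  apply: (le_trans (cabs_sub_le _ _)); rewrite (_ : K3 * eta = 12 * K ^+ 3 * eta + 12 * K ^+ 3 * eta); last by rewrite /K3; ring.
  exact: lerD.
have : K3 * eta <= g / 8.
  have -> : g / 8 = K3 * (g / (8 * K3)) by field; rewrite gt_eqF.
  by apply: ler_wpM2l => //; exact: ltW.
by clear -g0; lra.
Qed.

(* The second arm grows exponentially; dividing by that growth, the Wronskian at
   [E0 + h x] becomes a nonzero multiple of [csinh (d1 * (x - xc))], up to O(h). *)
Lemma one_root E0 rho C S W dW u1 v1 p1 a1 s1 d1 u2 v2 p2 a2 s2 d2 eps :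
  wkb_pair E0 rho C S W dW u1 v1 p1 a1 s1 d1 u2 v2 p2 a2 s2 d2 ->
  p1 E0 ^+ 2 != p2 E0 ^+ 2 -> d1 != 0 -> cRe (s1 E0) = 0 -> 0 < cRe (s2 E0) ->
  0 < eps -> exists h E, [/\ 0 < h, h < eps, cabs (E - E0) < eps & W h E = 0].
Proof.
set G := wkb_sum u1 v1 p1 a1 u2 v2 p2 a2.
move=> pair; have [[rho0 C0 S0] W_hol _ arm1 arm2] := pair.
move=> p12 d10 r1 r2 eps0; have pi0 := @pi_gt0 R.
have pm : p2 E0 - p1 E0 != 0.
  by apply: contra p12 => /eqP e; rewrite -subr_eq0 -oppr_eq0 opprB subr_sqr e mul0r.
have pp : p2 E0 + p1 E0 != 0.
  by apply: contra p12 => /eqP e; rewrite -subr_eq0 -oppr_eq0 opprB subr_sqr e mulr0.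
(* The shift [w] satisfies exp (2 w) = (p2 + p1) / (p2 - p1), which turns p2 sinh T - p1 cosh T into
   g sinh (T - w). Both factors are nonzero because the squares of the momenta differ. *)
have [w' ew'] := cexp_surj (mulf_neq0 pp (invr_neq0 pm)).
pose w := w' / 2.
have ww : cexp w * cexp w = (p2 E0 + p1 E0) / (p2 E0 - p1 E0).
  by rewrite -cexpD -ew' /w; congr cexp; field.
pose g := (p2 E0 - p1 E0) * cexp w.
have g0 : 0 < cabs g by rewrite cabs_gt0 mulf_neq0 // cexp_neq0.
have gE : g = (p2 E0 + p1 E0) * cexp (- w).
  by rewrite /g cexpN; apply: (mulIf (cexp_neq0 w)); rewrite divfK ?cexp_neq0 // -mulrA ww; field.
pose et : R := (2 * expR 1)^-1.
have et0 : 0 < et by rewrite invr_gt0 mulr_gt0 // expR_gt0.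
have D1 : 0 < cabs d1 by rewrite cabs_gt0.
(* A bound, independent of [h], for the centre [xc] plus the radius of the disc in the variable
   [x]. *)
pose X := (cabs w + pi + et) / cabs d1.
have X0 : 0 < X by rewrite divr_gt0 //; have := cabs_ge0 w; lra.
have [K1 [e1 [K10 e10 H1]]] := center_arm rho0 C0 arm1 r1 (ltW X0).
have [K2 [e2 [K20 e20 H2]]] := growing_arm rho0 C0 arm2 r2.
have [e3 e30 H3] := action_shift rho0 C0 arm2 (ltW X0).
pose M := expR (cabs d1 * X).
pose K := K1 + K2 + C * X + M + cabs (p1 E0) + cabs (p2 E0) + 1.
have q1 := cabs_ge0 (p1 E0); have q2 := cabs_ge0 (p2 E0).
have M0 : 0 < M by exact: expR_gt0.
have CX : 0 < C * X by rewrite mulr_gt0.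
have [K0 kk1 kk2 CXK] : [/\ 0 < K, K1 <= K, K2 <= K & C * X <= K].
  by clear -K10 K20 CX M0 q1 q2; rewrite /K; split; lra.
have [MK P1 P2 half1] : [/\ M <= K, cabs (p1 E0) <= K, cabs (p2 E0) <= K & 1 / 2 <= K].
  by clear -K10 K20 CX M0 q1 q2; rewrite /K; split; lra.
have half : cabs (1 / 2 : R[i]) <= K by rewrite cabsM cabs1 cabsV cabs_nat.
pose K3 := 24 * K ^+ 3.
have K30 : 0 < K3 by rewrite mulr_gt0 ?exprn_gt0.
(* [kap] bounds the variation of the growth factor of the second arm across the disc, see [tauE]. *)
pose kap := expR (cabs d2 * (2 * X) + 2).
have kap0 : 0 < kap by exact: expR_gt0.
have kap1 : 1 <= kap.
  rewrite -expR0 ler_expR; have := cabs_ge0 d2 => dd.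
  by have := mulr_ge0 dd (ltW X0); clear; lra.
(* The final comparison asks for 16 kap K3 h + K3 h below |g| et / 4, and [kap >= 1] merges the two
   terms into 17. *)
pose Z := 17 * kap * K3.
have Z0 : 0 < Z by rewrite !mulr_gt0.
pose h := Num.min (Num.min (Num.min e1 1) (Num.min e2 (e2 / X))) (Num.min e3 (Num.min (eps / (2 * (X + 1))) (cabs g * et / (8 * Z)))).
have h0 : 0 < h.
  have X1 : 0 < 2 * (X + 1) by clear -X0; lra.
  have Z8 : 0 < 8 * Z by clear -Z0; lra.
  have ge : 0 < cabs g * et by rewrite mulr_gt0.
  have [i1 i2 i3] := And3 (divr_gt0 e20 X0) (divr_gt0 eps0 X1) (divr_gt0 ge Z8).
  by rewrite !lt_min e10 ltr01 e20 e30 i1 i2 i3.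
have : [/\ h <= e1, h <= 1, h <= e2, h <= e2 / X & [/\ h <= e3, h <= eps / (2 * (X + 1)) & h <= cabs g * et / (8 * Z)]].
  by rewrite /h; do !split; rewrite !ge_min !lexx ?orbT.
move: h h0 => h h0 [he1 h1 he2 heX [he3 heps hZ]].
have hX : h * X <= e2 by rewrite -ler_pdivlMr.
have hX1 : h * (2 * (X + 1)) <= eps by rewrite -ler_pdivlMr //; clear -X0; lra.
have hZ1 : h * Z <= cabs g * et / 8.
  have -> : cabs g * et / 8 = cabs g * et / (8 * Z) * Z by field; rewrite gt_eqF.
  by apply: ler_wpM2r => //; exact: ltW.
have hc : cabs (h%:C : R[i]) = h by rewrite cabs_real gtr0_norm.
have hC0 : (h%:C : R[i]) != 0 by rewrite -cabs_gt0 hc.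
(* The multiple of i pi compensates the large imaginary number s1 E0 / h, so that the zero [xc] of
   the model stays bounded; it changes sinh and cosh only by a common sign. *)
have [k hk] := pi_multiple (cIm (s1 E0) / h).
pose ik : R[i] := 0 +i* (pi * k%:~R).
pose xc := (w + ik - s1 E0 / h%:C) / d1.
have xcb : cabs xc <= (cabs w + pi) / cabs d1.
  rewrite /xc cabsM cabsV ler_pM2r ?invr_gt0 // -addrA; apply: (le_trans (cabsD _ _)).
  rewrite lerD2l (_ : ik - s1 E0 / h%:C = ci * (pi * k%:~R - cIm (s1 E0) / h)%:C).
    by rewrite cabsM cabs_ci mul1r cabs_real.
  have sE : s1 E0 / h%:C = 0 +i* (cIm (s1 E0) / h).
    by apply: complexP; rewrite ?cRe_div ?cIm_div ?r1 ?mul0r.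
  by rewrite sE /ik; apply: complexP => /=; ring.
pose Ec := E0 + h%:C * xc.
pose r := h * et / cabs d1.
have r0 : 0 < r by rewrite divr_gt0 // mulr_gt0.
have co E : cabs (E - Ec) <= r -> exists x, [/\ E = E0 + h%:C * x, cabs x <= X & cabs (E - Ec) = h * cabs (x - xc)].
  move=> Er; exists ((E - E0) / h%:C).
  have E1 : cabs (E - Ec) = h * cabs ((E - E0) / h%:C - xc).
    rewrite (_ : E - Ec = h%:C * ((E - E0) / h%:C - xc)) ?cabsM ?hc // /Ec.
    by move: (xc) => t; field.
  split=> //; first by field.
  have : cabs ((E - E0) / h%:C - xc) <= et / cabs d1.
    rewrite -(ler_pM2l h0) -E1; apply: (le_trans Er); by rewrite /r mulrA.
  have := cabs_triangle ((E - E0) / h%:C) xc.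
  by rewrite /X (mulrDl (cabs w + pi)); clear -xcb; lra.
pose tau x := s2 (E0 + h%:C * x) / h%:C.
pose mod x := g * csinh (d1 * (x - xc)) / 2.
have approx x : cabs x <= X -> exists m, cabs m = cabs (mod x) /\
    cabs (cexp (- tau x) * G h (E0 + h%:C * x) - m) <= K3 * h.
  move=> xX; have [i1 i2 _ _] := H3 h x h0 he3 xX.
  have [a b c c'] := H1 h x h0 he1 xX; set E := E0 + _ in i1 a b *.
  set T := _ + d1 * x in a b c c'.
  have EE : cabs (E - E0) <= h * X.
    by rewrite /E addrC addKr cabsM hc; apply: ler_wpM2l => //; exact: ltW.
  have [f1 f2] := H2 h E h0 he2 (le_trans EE hX).
  have [_ m1 _ _ _] := arm1 _ i1; have [_ m2 _ _ _] := arm2 _ i1.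
  have up (Y : R) l : Y <= l * h -> l <= K -> Y <= K * h.
    by move=> x1 x3; apply: (le_trans x1); apply: ler_wpM2r => //; exact: ltW.
  have up' (Y : R) : Y <= C * cabs (E - E0) -> Y <= K * h.
    move=> y1; apply: (up _ (C * X)) => //.
    apply: (le_trans y1); rewrite -mulrA; apply: ler_wpM2l; [exact: ltW|by rewrite mulrC].
  have h01 : 0 <= h <= 1 by rewrite (ltW h0).
  have t1 := prod3_dist h01 P2 (le_trans c MK) half (up' _ m2) (up _ _ a kk1) (up _ _ f2 kk2).
  have t2 := prod3_dist h01 P1 (le_trans c' MK) half (up' _ m1) (up _ _ b kk1) (up _ _ f1 kk2).
  exists (p2 E0 * csinh T * (1 / 2) - p1 E0 * ccosh T * (1 / 2)); split; last first.
    rewrite (_ : _ - _ = (p2 E * (a1 E * u1 h E / h%:C) * (cexp (- (s2 E / h%:C)) * (a2 E * v2 h E / p2 E))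
        - p2 E0 * csinh T * (1 / 2))
      - (p1 E * (a1 E * v1 h E / p1 E) * (cexp (- (s2 E / h%:C)) * (a2 E * u2 h E / h%:C))
        - p1 E0 * ccosh T * (1 / 2))); last by rewrite /G /wkb_sum /tau -/E; ring.
    apply: (le_trans (cabs_sub_le _ _)).
    rewrite (_ : K3 * h = 12 * K ^+ 3 * h + 12 * K ^+ 3 * h); last by rewrite /K3; ring.
    exact: lerD.
  have TE : T = ik + (w + d1 * (x - xc)).
    by rewrite /T /xc; field; rewrite d10 hC0.
  have ce : cabs (cexp ik) = 1 by rewrite cabs_cexp /ik /= expR0.
  have e2' := @cexp_pi_sqr R k; rewrite -/ik in e2'.
  have eV : cexp (- ik) = cexp ik.
    by rewrite cexpN; apply: (mulfI (cexp_neq0 ik)); rewrite mulfV ?cexp_neq0 // -expr2 e2'.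
  set ze := d1 * (x - xc) in TE.
  have gz : g * cexp ze = (p2 E0 - p1 E0) * cexp (w + ze) by rewrite cexpD mulrA.
  have gz' : g * cexp (- ze) = (p2 E0 + p1 E0) * cexp (- (w + ze)) by rewrite gE opprD cexpD mulrA.
  have -> : p2 E0 * csinh T * (1 / 2) - p1 E0 * ccosh T * (1 / 2) = cexp ik * mod x.
    rewrite /mod -/ze /csinh /ccosh TE opprD (cexpD ik) (cexpD (- ik)) eV.
    rewrite (_ : g * _ / 2 = (g * cexp ze - g * cexp (- ze)) / 4); last by field.
    by rewrite gz gz'; field.
  by rewrite cabsM ce mul1r.
have xcX : cabs xc <= X.
  by apply: (le_trans xcb); rewrite /X ler_pM2r ?invr_gt0 //; clear -et0; lra.
have tauE x : cabs x <= X -> `|cRe (tau x) - cRe (tau xc)| <= cabs d2 * (2 * X) + 2.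
  move=> xX; have [_ _ _ i3] := H3 h x h0 he3 xX; have [_ _ _ i4] := H3 h xc h0 he3 xcX.
  rewrite -cReN -cReD; apply: (le_trans (Re_le_cabs _)).
  rewrite (_ : tau x - tau xc = (tau x - (s2 E0 / h%:C + d2 * x)) + (d2 * (x - xc)
      - (tau xc - (s2 E0 / h%:C + d2 * xc)))); last by ring.
  apply: (le_trans (cabsD _ _)); apply: (le_trans (lerD (lexx _) (cabs_sub_le _ _))).
  have : cabs (d2 * (x - xc)) <= cabs d2 * (2 * X).
    rewrite cabsM; apply: ler_wpM2l; first exact: cabs_ge0.
    by apply: (le_trans (cabs_sub_le _ _)); clear -xX xcX; lra.
  by move: i3 i4; rewrite -/(tau x) -/(tau xc); clear; lra.
have Gabs x : cabs (G h (E0 + h%:C * x)) = expR (cRe (tau x)) * cabs (cexp (- tau x) * G h (E0 + h%:C * x)).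
  by rewrite [in RHS]cabsM cabs_cexp cReN mulrA -expRD subrr expR0 mul1r.
(* The growth is frozen at the centre, so that centre and circle are compared against the same
   constant. *)
pose Q := h / S ^+ 2 * expR (cRe (tau xc)).
have Q0 : 0 < Q by rewrite mulr_gt0 ?expR_gt0 // divr_gt0 // exprn_gt0.
have Wc : cabs (W h Ec) <= Q * (4 * (K3 * h)).
  have [m [me mb]] := approx xc xcX.
  have m0 : m = 0 by apply/eqP; rewrite -cabs_eq0 me /mod subrr mulr0 /csinh oppr0 subrr mul0r mulr0 mul0r cabs0.
  rewrite m0 subr0 in mb.
  have [i1 _ _ _] := H3 h xc h0 he3 xcX.
  have := wkb_upper pair (g := expR (cRe (tau xc)) * (K3 * h)) h0 i1.
  rewrite (_ : h / S ^+ 2 * (4 * (expR (cRe (tau xc)) * (K3 * h))) = Q * (4 * (K3 * h))); last by rewrite /Q; ring.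
  by apply; rewrite Gabs; apply: ler_wpM2l => //; exact: expR_ge0.
pose g1 := cabs g * et / 4 - K3 * h.
have g10 : 0 <= g1.
  have : K3 * h <= h * Z.
    rewrite mulrC; apply: ler_wpM2l; first exact: ltW.
    rewrite /Z -[leLHS]mul1r; apply: ler_wpM2r; [exact: ltW|clear -kap1; lra].
  have : 0 < cabs g * et by rewrite mulr_gt0.
  by rewrite /g1; clear -hZ1; lra.
have Wr E : cabs (E - Ec) = r -> Q * (kap^-1 * (g1 / 4)) <= cabs (W h E).
  move=> Er; have [|x [Ex xX xr]] := co E; first by rewrite Er.
  have [m [me mb]] := approx x xX.
  have ze : cabs (d1 * (x - xc)) = et.
    rewrite cabsM; apply: (mulfI (lt0r_neq0 h0)); rewrite mulrCA -xr Er /r; field.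
    by rewrite gt_eqF.
  have mg : cabs g * et / 4 <= cabs m.
    rewrite me /mod (cabsM (g * csinh _)) (cabsM g) cabsV cabs_nat -!mulrA.
    apply: ler_wpM2l; first exact: ltW.
    by have := csinh_near ze; rewrite -/et; clear; lra.
  have Gl : g1 <= cabs (cexp (- tau x) * G h (E0 + h%:C * x)).
    have := cabs_triangle m (cexp (- tau x) * G h (E0 + h%:C * x)).
    by rewrite cabsB /g1; clear -mg mb; lra.
  have [i1 _ _ _] := H3 h x h0 he3 xX.
  rewrite Ex; have tl : expR (cRe (tau xc)) * kap^-1 <= expR (cRe (tau x)).
    rewrite /kap -expRN -expRD ler_expR; have := tauE x xX; rewrite ler_norml => /andP[+ _]; clear; lra.
  have := wkb_lower pair (g := expR (cRe (tau xc)) * kap^-1 * g1) h0 i1.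
  rewrite (_ : h / S ^+ 2 * _ = Q * (kap^-1 * (g1 / 4))); last by rewrite /Q; ring.
  apply; first by rewrite !mulr_ge0 ?expR_ge0 // invr_ge0 ltW.
  rewrite Gabs; apply: ler_pM => //.
  by rewrite mulr_ge0 ?expR_ge0 // invr_ge0 ltW.
have lt01 : 4 * (K3 * h) < kap^-1 * (g1 / 4).
  rewrite -(ltr_pM2l kap0) (mulrA kap kap^-1) mulfV ?gt_eqF // mul1r.
  have : K3 * h <= kap * K3 * h.
    by rewrite -[leLHS]mul1r -[leRHS]mulrA; apply: ler_wpM2r => //; rewrite mulr_ge0 // ltW.
  have : 0 < cabs g * et by rewrite mulr_gt0.
  by move: hZ1; rewrite /Z /g1; clear; lra.
have [|E Er W0] := @zero_in_disc R setT (W h) (dW h) Ec r (Q * (kap^-1 * (g1 / 4))) r0 (fun _ _ => Logic.I) (W_hol _ h0) _ Wr.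
  by apply: (le_lt_trans Wc); rewrite ltr_pM2l.
exists h, E; split => //.
- have : h * (2 * (X + 1)) = 2 * h + 2 * (h * X) by ring.
  have : 0 < h * X by rewrite mulr_gt0.
  by clear -h0 hX1; lra.
have [x [-> xX _]] := co E Er.
rewrite addrC addKr cabsM hc.
have : h * cabs x <= h * X by apply: ler_wpM2l => //; exact: ltW.
have : h * (2 * (X + 1)) = 2 * h + 2 * (h * X) by ring.
have : 0 <= h * cabs x by rewrite mulr_ge0 ?cabs_ge0 // ltW.
by clear -h0 hX1; lra.
Qed.

(* [p2 sinh T1 cosh T2 - p1 cosh T1 sinh T2] equals
   [p2 sinh (T1 - T2) + (p2 - p1) cosh T1 sinh T2], and the second term is
   negligible since both momenta are close to the same square root of [- E0]. *)
Lemma two_roots E0 rho C S W dW u1 v1 p1 a1 s1 d1 u2 v2 p2 a2 s2 d2 k eps :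
  wkb_pair E0 rho C S W dW u1 v1 p1 a1 s1 d1 u2 v2 p2 a2 s2 d2 ->
  d1 - d2 != 0 -> cabs d1 <= 3 * cabs (d1 - d2) -> cabs d2 <= 3 * cabs (d1 - d2) ->
  3 / 4 * S <= cabs (p2 E0) -> cabs (p2 E0 - p1 E0) <= 2 * k * S ->
  200 * k * expR (3 * (pi + (2 * expR 1)^-1)) ^+ 2 <= (2 * expR 1)^-1 ->
  cRe (s1 E0) = 0 -> cRe (s2 E0) = 0 ->
  0 < eps -> exists h E, [/\ 0 < h, h < eps, cabs (E - E0) < eps & W h E = 0].
Proof.
set Dl := d1 - d2; set et : R := (2 * expR 1)^-1; set M := expR _.
set G := wkb_sum u1 v1 p1 a1 u2 v2 p2 a2.
move=> pair; have [[rho0 C0 S0] W_hol _ arm1 arm2] := pair.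
move=> Dl0 dD1 dD2 pS dp kM r1 r2 eps0; have pi0 := @pi_gt0 R.
have et0 : 0 < et by rewrite invr_gt0 mulr_gt0 // expR_gt0.
have DD : 0 < cabs Dl by rewrite cabs_gt0.
(* The model is sinh (Dl (x - xc)): its zero is within pi / |Dl| of 0, and the circle has radius et
   / |Dl|. *)
pose X := (pi + et) / cabs Dl.
have X0 : 0 < X by rewrite divr_gt0 //; lra.
have XD : cabs Dl * X = pi + et by rewrite /X mulrC divfK // gt_eqF.
have [K1 [e1 [K10 e10 H1]]] := center_arm rho0 C0 arm1 r1 (ltW X0).
have [K2 [e2 [K20 e20 H2]]] := center_arm rho0 C0 arm2 r2 (ltW X0).
have [e3 e30 H3] := action_shift rho0 C0 arm2 (ltW X0).
have M0 : 0 < M by exact: expR_gt0.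
(* Both slopes are at most three times [cabs Dl], which explains the exponent 3 (pi + et) in [M] and
   keeps this bound independent of E0. *)
have dM (d : R[i]) : cabs d <= 3 * cabs Dl -> expR (cabs d * X) <= M.
  move=> dd; rewrite ler_expR -XD mulrA; apply: ler_wpM2r => //; exact: ltW.
pose K := K1 + K2 + C * X + M + cabs (p1 E0) + cabs (p2 E0).
have q1 := cabs_ge0 (p1 E0); have q2 := cabs_ge0 (p2 E0).
have CX : 0 < C * X by rewrite mulr_gt0.
have [K0 kk1 kk2 CXK] : [/\ 0 < K, K1 <= K, K2 <= K & C * X <= K].
  by clear -K10 K20 CX M0 q1 q2; rewrite /K; split; lra.
have [MK P1 P2] : [/\ M <= K, cabs (p1 E0) <= K & cabs (p2 E0) <= K].
  by clear -K10 K20 CX M0 q1 q2; rewrite /K; split; lra.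
pose K3 := 24 * K ^+ 3.
have K30 : 0 < K3 by rewrite mulr_gt0 ?exprn_gt0.
have [h [h0 he1 he2 he3 [h1 heps hZ1]]] : exists h, [/\ 0 < h, h <= e1, h <= e2, h <= e3 &
    [/\ h <= 1, h * (2 * (X + 1)) <= eps & 100 * (K3 * h) <= S * et]].
  have X1 : 0 < 2 * (X + 1) by clear -X0; lra.
  have K31 : 0 < 100 * K3 by clear -K30; lra.
  exists (Num.min (Num.min e1 1) (Num.min (Num.min e2 e3) (Num.min (eps / (2 * (X + 1))) (S * et / (100 * K3))))).
  set h := Num.min _ _; have : [/\ h <= e1, h <= e2, h <= e3, h <= 1 & h <= eps / (2 * (X + 1)) /\ h <= S * et / (100 * K3)].
    by rewrite /h; do !split; rewrite !ge_min !lexx ?orbT.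
  move=> [i1 i2 i3 i4 [i5 i6]]; split => //.
    by rewrite !lt_min e10 ltr01 e20 e30 !(divr_gt0 _ X1) // divr_gt0 // mulr_gt0.
  split => //; first by rewrite -ler_pdivlMr.
  by rewrite mulrA mulrC -ler_pdivlMr.
have hc : cabs (h%:C : R[i]) = h by rewrite cabs_real gtr0_norm.
have hC0 : (h%:C : R[i]) != 0 by rewrite -cabs_gt0 hc.
(* The zero is sought for T1 - T2, whose value at x = 0 is the action across [-1, 1] divided by
   [h]. *)
have [j hj] := pi_multiple (cIm (s1 E0 - s2 E0) / h).
pose ik : R[i] := 0 +i* (pi * j%:~R).
pose xc := (ik - (s1 E0 - s2 E0) / h%:C) / Dl.
have xcb : cabs xc <= pi / cabs Dl.
  rewrite /xc cabsM cabsV ler_pM2r ?invr_gt0 //.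
  have sE : (s1 E0 - s2 E0) / h%:C = 0 +i* (cIm (s1 E0 - s2 E0) / h).
    by apply: complexP; rewrite ?cRe_div ?cIm_div // cReD cReN r1 r2 subrr mul0r.
  rewrite sE (_ : ik - _ = ci * (pi * j%:~R - cIm (s1 E0 - s2 E0) / h)%:C).
    by rewrite cabsM cabs_ci mul1r cabs_real.
  by rewrite /ik; apply: complexP => /=; ring.
have xcX : cabs xc <= X.
  apply: (le_trans xcb); rewrite /X ler_pM2r ?invr_gt0 // lerDl; exact: ltW.
pose Ec := E0 + h%:C * xc.
pose r := h * et / cabs Dl.
have r0 : 0 < r by rewrite divr_gt0 // mulr_gt0.
have co E : cabs (E - Ec) <= r -> exists x, [/\ E = E0 + h%:C * x, cabs x <= X & cabs (E - Ec) = h * cabs (x - xc)].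
  move=> Er; exists ((E - E0) / h%:C).
  have E1 : cabs (E - Ec) = h * cabs ((E - E0) / h%:C - xc).
    rewrite (_ : E - Ec = h%:C * ((E - E0) / h%:C - xc)) ?cabsM ?hc // /Ec.
    by move: (xc) => t; field.
  split=> //; first by field.
  have : cabs ((E - E0) / h%:C - xc) <= et / cabs Dl.
    rewrite -(ler_pM2l h0) -E1; apply: (le_trans Er); by rewrite /r mulrA.
  rewrite /X (mulrDl pi) => t; apply: (le_trans (cabs_triangle _ xc)); exact: lerD.
(* The first term bounds (p2 - p1) cosh T1 sinh T2 and does not decrease with [h]; only a small [k]
   controls it. *)
pose er := 2 * k * S * M ^+ 2 + K3 * h.
(* The inequality 4 er < g1 / 4 amounts to this. The hypotheses give 34/200 + 17/100 = 0.34 times S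
   et, below 3/8. *)
have erS : 17 * er < 3 / 8 * (S * et).
  have : 200 * k * M ^+ 2 * S <= et * S by apply: ler_wpM2r => //; exact: ltW.
  have : 0 < S * et by rewrite mulr_gt0.
  by rewrite /er; move: hZ1; clear; lra.
have approx x : cabs x <= X -> exists2 m, cabs m = cabs (p2 E0) * cabs (csinh (Dl * (x - xc))) &
    cabs (G h (E0 + h%:C * x) - m) <= er.
  move=> xX; have [i1 _ _ _] := H3 h x h0 he3 xX.
  have [a b c c'] := H1 h x h0 he1 xX; have [a' b' f f'] := H2 h x h0 he2 xX.
  set E := E0 + _ in i1 a b a' b' *.
  set T1 := _ + d1 * x in a b c c'; set T2 := _ + d2 * x in a' b' f f'.
  have EE : cabs (E - E0) <= h * X.
    by rewrite /E addrC addKr cabsM hc; apply: ler_wpM2l => //; exact: ltW.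
  have [_ m1 _ _ _] := arm1 _ i1; have [_ m2 _ _ _] := arm2 _ i1.
  have up (Y : R) l : Y <= l * h -> l <= K -> Y <= K * h.
    by move=> x1 x3; apply: (le_trans x1); apply: ler_wpM2r => //; exact: ltW.
  have up' (Y : R) : Y <= C * cabs (E - E0) -> Y <= K * h.
    move=> y1; apply: (up _ (C * X)) => //.
    apply: (le_trans y1); rewrite -mulrA; apply: ler_wpM2l; [exact: ltW|by rewrite mulrC].
  have h01 : 0 <= h <= 1 by rewrite (ltW h0).
  have cM := le_trans c (dM _ dD1); have cM' := le_trans c' (dM _ dD1).
  have fM := le_trans f (dM _ dD2); have fM' := le_trans f' (dM _ dD2).
  have t1 := prod3_dist h01 P2 (le_trans cM MK) (le_trans fM' MK) (up' _ m2) (up _ _ a kk1) (up _ _ b' kk2).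
  have t2 := prod3_dist h01 P1 (le_trans cM' MK) (le_trans fM MK) (up' _ m1) (up _ _ b kk1) (up _ _ a' kk2).
  have TE : T1 - T2 = ik + Dl * (x - xc).
    rewrite mulrBr (_ : Dl * xc = ik - (s1 E0 - s2 E0) / h%:C); last by rewrite /xc mulrC divfK.
    by rewrite /T1 /T2 /Dl; ring.
  exists (p2 E0 * csinh (T1 - T2)); first by rewrite cabsM TE csinh_pi.
  rewrite (_ : G h E - _ = (p2 E * (a1 E * u1 h E / h%:C) * (a2 E * v2 h E / p2 E) - p2 E0 * csinh T1 * ccosh T2)
      - (p1 E * (a1 E * v1 h E / p1 E) * (a2 E * u2 h E / h%:C) - p1 E0 * ccosh T1 * csinh T2)
      + (p2 E0 - p1 E0) * (ccosh T1 * csinh T2)); last by rewrite /G /wkb_sum csinhB; ring.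
  apply: (le_trans (cabsD _ _)); rewrite /er addrC; apply: lerD.
    rewrite 2!cabsM; apply: ler_pM; rewrite ?mulr_ge0 ?cabs_ge0 // expr2.
    by apply: ler_pM; rewrite ?cabs_ge0.
  apply: (le_trans (cabs_sub_le _ _)).
  rewrite (_ : K3 * h = 12 * K ^+ 3 * h + 12 * K ^+ 3 * h); last by rewrite /K3; ring.
  exact: lerD.
pose Q := h / S ^+ 2.
have Q0 : 0 < Q by rewrite divr_gt0 // exprn_gt0.
have Wc : cabs (W h Ec) <= Q * (4 * er).
  have [m me mb] := approx xc xcX.
  have m0 : m = 0 by apply/eqP; rewrite -cabs_eq0 me subrr mulr0 /csinh oppr0 subrr mul0r cabs0 mulr0.
  rewrite m0 subr0 in mb.
  have [i1 _ _ _] := H3 h xc h0 he3 xcX.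
  exact: (wkb_upper pair).
pose g1 := 3 / 8 * (S * et) - er.
have g10 : 4 * er < g1 / 4 by clear -erS; rewrite /g1; lra.
have er0 : 0 <= er by have [m _ mb] := approx xc xcX; apply: le_trans mb; exact: cabs_ge0.
have g1p : 0 <= g1 by clear -er0 g10; lra.
have Wr E : cabs (E - Ec) = r -> Q * (g1 / 4) <= cabs (W h E).
  move=> Er; have [|x [Ex xX xr]] := co E; first by rewrite Er.
  have [m me mb] := approx x xX.
  have ze : cabs (Dl * (x - xc)) = et.
    rewrite cabsM; apply: (mulfI (lt0r_neq0 h0)); rewrite mulrCA -xr Er /r; field.
    by rewrite gt_eqF.
  have mg : 3 / 8 * (S * et) <= cabs m.
    have : 3 / 4 * S * (et / 2) <= cabs m.
      rewrite me; apply: ler_pM => //; last by have := csinh_near ze.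
        by rewrite mulr_ge0 // ltW.
      by rewrite divr_ge0 // ltW.
    by clear; lra.
  have [i1 _ _ _] := H3 h x h0 he3 xX.
  rewrite Ex; apply: (wkb_lower pair) => //.
  have := cabs_triangle m (G h (E0 + h%:C * x)).
  by rewrite cabsB /g1; clear -mg mb; lra.
have [|E Er W0] := @zero_in_disc R setT (W h) (dW h) Ec r (Q * (g1 / 4)) r0 (fun _ _ => Logic.I) (W_hol _ h0) _ Wr.
  by apply: (le_lt_trans Wc); rewrite ltr_pM2l.
have hX : h * (2 * (X + 1)) = 2 * h + 2 * (h * X) by ring.
have hX0 : 0 < h * X by rewrite mulr_gt0.
exists h, E; split => //; first by clear -h0 hX hX0 heps; lra.
have [x [-> xX _]] := co E Er.
rewrite addrC addKr cabsM hc.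
have : h * cabs x <= h * X by apply: ler_wpM2l => //; exact: ltW.
by clear -h0 hX hX0 heps; lra.
Qed.


Lemma no_root_neq0 E0 rho C S W dW u1 v1 p1 a1 s1 d1 u2 v2 p2 a2 s2 d2 :
  wkb_pair E0 rho C S W dW u1 v1 p1 a1 s1 d1 u2 v2 p2 a2 s2 d2 ->
  p1 E0 ^+ 2 != p2 E0 ^+ 2 -> cRe (s1 E0) != 0 -> cRe (s2 E0) != 0 ->
  exists2 eta, 0 < eta & forall h E, 0 < h -> h <= eta -> cabs (E - E0) <= eta -> W h E != 0.
Proof.
move=> P p12 r1 r2.
wlog {r1} r1 : p1 a1 s1 d1 P p12 / 0 < cRe (s1 E0).
  move=> H; case/lt_total/orP: r1 => r1; last exact: (H p1 a1 s1 d1).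
  by apply: (H _ _ _ _ (wkb_pair_flipl P)); rewrite ?sqrrN // cReN oppr_gt0.
wlog {r2} r2 : p2 a2 s2 d2 P p12 / 0 < cRe (s2 E0).
  move=> H; case/lt_total/orP: r2 => r2; last exact: (H p2 a2 s2 d2).
  by apply: (H _ _ _ _ (wkb_pair_flipr P)); rewrite ?sqrrN // cReN oppr_gt0.
by apply: (no_root P) => //; apply: contra_neq p12 => ->.
Qed.

Lemma one_root_neq0 E0 rho C S W dW u1 v1 p1 a1 s1 d1 u2 v2 p2 a2 s2 d2 eps :
  wkb_pair E0 rho C S W dW u1 v1 p1 a1 s1 d1 u2 v2 p2 a2 s2 d2 ->
  p1 E0 ^+ 2 != p2 E0 ^+ 2 -> d1 != 0 -> cRe (s1 E0) = 0 -> cRe (s2 E0) != 0 ->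
  0 < eps -> exists h E, [/\ 0 < h, h < eps, cabs (E - E0) < eps & W h E = 0].
Proof.
move=> P p12 d10 r1 r2 eps0; case/lt_total/orP: r2 => r2; last exact: (one_root P).
by apply: (one_root (wkb_pair_flipr P)); rewrite ?sqrrN // cReN oppr_gt0.
Qed.

End Pair.

(** * Constants valid for all large energies *)

Section Assembly.
Context {R : realType}.
Implicit Types (E : R[i]) (h : R).

(** Each slope is - L / (2 s0) up to half of its modulus. Both arms point to [beta], so L1 - L2 = 2
    and d1 - d2 has modulus at least 1 / (2 |s0|), while each slope is at most 3 / (2 |s0|). *)
Lemma slope_bounds (L1 L2 d1 d2 s0 : R[i]) (k : R) : s0 != 0 -> 0 < k <= 1 / 4 ->
  L1 != 0 -> L2 != 0 -> cabs L1 + cabs L2 <= 2 -> L1 - L2 = 2 ->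
  cabs (d1 + L1 / (2 * s0)) <= k * cabs L1 / cabs s0 ->
  cabs (d2 + L2 / (2 * s0)) <= k * cabs L2 / cabs s0 ->
  [/\ d1 != 0, d2 != 0, d1 - d2 != 0, cabs d1 <= 3 * cabs (d1 - d2) & cabs d2 <= 3 * cabs (d1 - d2)].
Proof.
move=> s00 /andP[k0 k4] L10 L20 L12 Ld h1 h2.
have S0 : 0 < cabs s0 by rewrite cabs_gt0.
pose t := (cabs s0)^-1; have t0 : 0 < t by rewrite invr_gt0.
have l1 : 0 < cabs L1 by rewrite cabs_gt0.
have l2 : 0 < cabs L2 by rewrite cabs_gt0.
have e (L : R[i]) : cabs (L / (2 * s0)) = cabs L * t / 2.
  by rewrite cabsM cabsV cabsM cabs_nat invfM [2^-1 * _]mulrC mulrA.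
have ek (L : R[i]) : k * cabs L / cabs s0 <= cabs L * t / 4.
  rewrite -/t -mulrA [cabs L * t / 4]mulrC -div1r; apply: ler_wpM2r => //.
  by rewrite mulr_ge0 ?cabs_ge0 // ltW.
have g1 := le_trans h1 (ek L1); have g2 := le_trans h2 (ek L2).
have nz (L d : R[i]) : 0 < cabs L -> cabs (d + L / (2 * s0)) <= cabs L * t / 4 -> d != 0 /\ cabs d <= 3 / 4 * (cabs L * t).
  move=> l H; have lt : 0 < cabs L * t by rewrite mulr_gt0.
  have a1 := cabs_triangle (L / (2 * s0)) (- d); have a2 := cabs_triangle d (- (L / (2 * s0))).
  rewrite opprK cabsN e (addrC _ d) in a1; rewrite opprK cabsN e in a2.
  by split; [rewrite -cabs_gt0; lra|lra].
have [n1 b1] := nz _ _ l1 g1; have [n2 b2] := nz _ _ l2 g2.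
have tl : cabs L1 * t + cabs L2 * t <= 2 * t by rewrite -mulrDl ler_pM2r.
have : t / 2 <= cabs (d1 - d2).
  have := cabs_triangle ((L1 - L2) / (2 * s0)) (- (d1 - d2)); rewrite e Ld cabs_nat cabsN.
  rewrite (_ : 2 / (2 * s0) - - (d1 - d2) = (d1 + L1 / (2 * s0)) - (d2 + L2 / (2 * s0))); last first.
    by rewrite -Ld; ring.
  have := cabs_sub_le (d1 + L1 / (2 * s0)) (d2 + L2 / (2 * s0)).
  by clear -g1 g2 tl; lra.
have p1 : 0 < cabs L1 * t by rewrite mulr_gt0.
have p2 : 0 < cabs L2 * t by rewrite mulr_gt0.
by split => //; [rewrite -cabs_gt0| |]; lra.
Qed.

Section Side.
Variables (a b c d : R).
Let N := box a b c d.
Variables (U dU ddU : R[i] -> R[i]) (M r k : R) (x0 x1 : R).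
Hypotheses (HU : deriv_on N U dU) (HdU : deriv_on N dU ddU).
Hypotheses (MU : forall z, N z -> [/\ cabs (U z) <= M, cabs (dU z) <= M & cabs (ddU z) <= M]).
Hypotheses (M0 : 0 < M) (r0 : 0 < r) (k0 : 0 < k) (k4 : k <= 1 / 4).
Hypothesis kr : k * (r + 2 * cabs (x1%:C - x0%:C : R[i])) <= r.
Hypothesis tube : forall t : R, 0 <= t <= 1 ->
  forall w, cabs (w - (x0%:C + t%:C * (x1%:C - x0%:C))) <= r -> N w.
Variables (E0 s0 : R[i]).
Hypotheses (s0E : s0 ^+ 2 = - E0) (E0large : 4 * M / k <= cabs E0).

(** The pair [(x, y)] orders the interval for the integral condition, whereas the arm runs from the
    endpoint [x0] to [x1]; on the right this reverses the sign of the action, which does not affect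
    the vanishing of its real part. Smaller [rho'] and larger [C'] are allowed so that both arms can
    share their constants. *)
Lemma side_wkb (x y : R) : x <= y -> (x = x0 /\ y = x1 \/ x = x1 /\ y = x0) ->
  (forall t, x <= t <= y -> N t%:C) ->
  exists (p al s : R[i] -> R[i]) (sl : R[i]) (rho C : R),
  [/\ 0 < rho, 0 < C,
     cabs (sl + (x1%:C - x0%:C) / (2 * s0)) <= k * cabs (x1%:C - x0%:C : R[i]) / cabs s0 /\
     (Re_int_sqrt_eq0 x y (fun t => U t%:C - E0) <-> cRe (s E0) = 0),
     p E0 ^+ 2 = U x1%:C - E0 /\ cabs (p E0 - s0) <= k * cabs s0 &
     forall rho' C' (u v : R -> R[i] -> R[i]), rho' <= rho -> C <= C' ->
       (forall h E, 0 < h -> exists f g, [/\ deriv_on N f g,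
          deriv_on N g (fun z => (U z - E) / (h ^+ 2)%:C * f z), f x0%:C = 0, g x0%:C = 1 &
          u h E = f x1%:C /\ v h E = g x1%:C]) ->
       wkb_arm E0 rho' C' (cabs s0) u v p al s sl].
Proof.
move=> xy xyE Nxy.
have M1 z : N z -> cabs (U z) <= M by case/MU.
have M2 z : N z -> cabs (dU z) <= M by case/MU.
have M3 z : N z -> cabs (ddU z) <= M by case/MU.
have [s [p [al [sl [rho [C [rho0 C0 slb [q [S [HS [dq Hdq] Hq sE0]]] H]]]]]]] :=
  arm HU HdU M1 M2 M3 M0 r0 k0 k4 kr tube s0E E0large.
have S0 : 0 < cabs s0.
  rewrite cabs_gt0; apply/eqP => e; move: s0E; rewrite e expr0n /= => /eqP.
  rewrite eq_sym oppr_eq0 => /eqP e0; move: E0large; rewrite e0 cabs0.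
  by have := divr_gt0 M0 k0; lra.
exists p, al, s, sl, rho, C; split => //.
- split => //.
  rewrite (@Re_int_sqrt_eq0P R x y _ (fun t => q t%:C) (fun t => S t%:C)) //; last first.
  + by move=> t /Nxy /Hq[].
  + move=> t ht; apply: (@rwc_path _ _ N) => //; first exact: wd_wc (rwd_id _ _).
    by apply: wd_wc (Hdq _ _); exact: Nxy.
  + move=> t ht; rewrite -[X in rwd _ _ _ X]mulr1.
    by apply: (@rwd_path _ _ N) => //; [exact: rwd_id|apply: HS; exact: Nxy].
  rewrite sE0; case: xyE => [[-> ->]|[-> ->]] //.
  rewrite -[S x0%:C - _]opprB cReN; split=> [/eqP|->]; last by rewrite oppr0.
  by rewrite oppr_eq0 => /eqP.
- by have [|h1 h2 _ _ _] := H E0; first by rewrite subrr cabs0 ltW.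
move=> rho' C' u v rr CC Huv E hE; have [h1 h2 h3 h4 [h5 h6]] := H E (le_trans hE rr).
split.
- rewrite -cabs_gt0; have := cabs_triangle s0 (p E); rewrite cabsB.
  have : k * cabs s0 <= 1 / 4 * cabs s0 by rewrite ler_pM2r.
  by lra.
- by apply: (le_trans h3); apply: ler_wpM2r => //; exact: cabs_ge0.
- by apply: (le_trans h4); apply: ler_wpM2r => //; rewrite exprn_ge0 ?cabs_ge0.
- exact: h5.
move=> h h0 Ch; have [f [g [f1 f2 f3 f4 [-> ->]]]] := Huv h E h0.
have Ch' : C * h <= 1 by apply: le_trans Ch; rewrite ler_pM2r.
have [g1 g2] := h6 h f g h0 Ch' f1 f2 f3 f4.
have CC' (e : R) : 0 <= e -> C * h * e <= C' * h * e.
  by move=> e0; apply: ler_wpM2r => //; rewrite ler_pM2r.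
by split; [apply: (le_trans g1)|apply: (le_trans g2)]; apply: CC'; exact: expR_ge0.
Qed.

End Side.


End Assembly.

Lemma quantization (R : realType) (D : set R[i]) (V : R[i] -> R[i]) (beta delta : R) :
  open D -> (forall x : R, x \in `[-1, 1] -> D x%:C) -> holomorphic_on D V ->
  -1 < beta < 1 -> 0 < delta -> exists2 Rad : R, 0 < Rad & forall E0, Rad <= cabs E0 ->
  exists rho C S k W dW u1 v1 p1 a1 s1 d1 u2 v2 p2 a2 s2 d2,
  [/\ wkb_pair E0 rho C S W dW u1 v1 p1 a1 s1 d1 u2 v2 p2 a2 s2 d2,
      forall (h : R) (E : R[i]), 0 < h -> (spectrum (schrodinger delta beta V h) E <-> W h E = 0),
      Re_int_sqrt_eq0 (-1) beta (fun x => V x%:C - delta*i - E0) <-> cRe (s1 E0) = 0,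
      Re_int_sqrt_eq0 beta 1 (fun x => V x%:C + delta*i - E0) <-> cRe (s2 E0) = 0 &
      [/\ p1 E0 ^+ 2 != p2 E0 ^+ 2,
         [/\ d1 != 0, d2 != 0, d1 - d2 != 0, cabs d1 <= 3 * cabs (d1 - d2) & cabs d2 <= 3 * cabs (d1 - d2)],
         3 / 4 * S <= cabs (p2 E0), cabs (p2 E0 - p1 E0) <= 2 * k * S &
         200 * k * expR (3 * (pi + (2 * expR 1)^-1)) ^+ 2 <= (2 * expR 1)^-1]].
Proof.
move=> D_open D_segment V_holo hb delta0; have hb' := hb; have d0' := delta0.
pose spec (h : R) := spectrum (schrodinger delta beta V h).
have [r [M [dV [ddV [r0 M0 HV HdV MV]]]]] := box_extension D_open D_segment V_holo.
set N := box _ _ _ _ in HV HdV MV.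
pose M' := M + delta; have M'0 : 0 < M' by rewrite /M'; lra.
(* Half of [r] keeps the closed tube around each arm inside the open box. *)
pose rt := r / 2; have rt0 : 0 < rt by rewrite divr_gt0.
pose et : R := (2 * expR 1)^-1; pose Mx : R := expR (3 * (pi + et)).
have et0 : 0 < et by rewrite invr_gt0 mulr_gt0 // expR_gt0.
have Mx0 : 0 < 200 * Mx ^+ 2 := mulr_gt0 (ltr0n R 200) (exprn_gt0 2 (expR_gt0 _)).
have rt4 : 0 < rt + 4 by lra.
(* The three bounds serve respectively the square roots near 1, the contraction that straightens the
   path (an arm has length at most 2, hence rt + 4), and the comparison in [two_roots]. *)
pose k := Num.min (1 / 4) (Num.min (rt / (rt + 4)) (et / (200 * Mx ^+ 2))).
have k0 : 0 < k.
  have [i1 i2 i3] := And3 (divr_gt0 rt0 rt4) (divr_gt0 et0 Mx0) (divr_gt0 ltr01 (ltr0n R 4)).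
  by rewrite !lt_min i1 i2 i3.
have [k4 kr kM] : [/\ k <= 1 / 4, k * (rt + 4) <= rt & 200 * k * Mx ^+ 2 <= et].
  split; first by rewrite ge_min lexx.
    by rewrite -ler_pdivlMr // /k !ge_min lexx orbT.
  rewrite (_ : 200 * k * _ = k * (200 * Mx ^+ 2)); last by ring.
  by rewrite -ler_pdivlMr // /k !ge_min lexx !orbT.
exists (4 * M' / k); first by rewrite divr_gt0 ?mulr_gt0.
move=> E0 E0large; pose s0 := sqrtc (- E0); have s0E : s0 ^+ 2 = - E0 by exact: sqr_sqrtc.
have cdelta : cabs (delta*i : R[i]) = delta.
  rewrite (_ : delta*i = ci * delta%:C); last by apply: complexP => /=; ring.
  by rewrite cabsM cabs_ci mul1r cabs_real gtr0_norm.
have Nreal (x : R) : -1 <= x <= 1 -> N x%:C by move=> hx; clear -hx r0; split => /=; lra.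
have HU1 : deriv_on N (fun z => V z - delta*i) dV.
  by move=> z Nz; apply: (wd_eq (wdB (HV z Nz) (wd_cst _ _ _ _))); rewrite subr0.
have HU2 : deriv_on N (fun z => V z + delta*i) dV.
  by move=> z Nz; apply: (wd_eq (wdD (HV z Nz) (wd_cst _ _ _ _))); rewrite addr0.
have MU1 z : N z -> [/\ cabs (V z - delta*i) <= M', cabs (dV z) <= M' & cabs (ddV z) <= M'].
  move=> /MV[m1 m2 m3]; have := cabs_sub_le (V z) (delta*i); rewrite cdelta /M'.
  by clear -m1 m2 m3 d0'; split; lra.
have MU2 z : N z -> [/\ cabs (V z + delta*i) <= M', cabs (dV z) <= M' & cabs (ddV z) <= M'].
  move=> /MV[m1 m2 m3]; have := cabsD (V z) (delta*i); rewrite cdelta /M'.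
  by clear -m1 m2 m3 d0'; split; lra.
have tube (x0 : R) : -1 <= x0 <= 1 -> forall t : R, 0 <= t <= 1 -> forall w,
    cabs (w - (x0%:C + t%:C * (beta%:C - x0%:C))) <= rt -> N w.
  move=> hx t /andP[t0 t1] w hw.
  pose x := x0 + t * (beta - x0).
  have hx1 : -1 <= x <= 1 by clear -hx t0 t1 hb'; rewrite /x; apply/andP; split; nra.
  have xE : x0%:C + t%:C * (beta%:C - x0%:C) = x%:C :> R[i].
    by rewrite /x rmorphD rmorphM rmorphB.
  rewrite xE in hw; have := le_trans (Re_le_cabs _) hw; have := le_trans (Im_le_cabs _) hw.
  rewrite cReD cImD cReN cImN /= oppr0 addr0 !ler_norml /rt => w1 w2.
  by clear -w1 w2 hx1 r0; split; lra.
have cl (x0 : R) : -1 <= x0 <= 1 -> k * (rt + 2 * cabs (beta%:C - x0%:C : R[i])) <= rt.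
  move=> hx; apply: le_trans kr; apply: ler_wpM2l; first exact: ltW.
  have : `|beta - x0| <= 2 by rewrite ler_norml; clear -hx hb'; lra.
  by rewrite cabs_rdist => t; rewrite [rt + 4]addrC [rt + _]addrC lerD2r; clear -t; lra.
have [b1 b2] : -1 <= beta /\ beta <= 1 by clear -hb'; split; lra.
have m11 : -1 <= (-1 : R) <= 1 by rewrite lexx (le_trans b1 b2).
have p11 : -1 <= (1 : R) <= 1 by rewrite lexx (le_trans b1 b2).
have S1 t : -1 <= t <= beta -> N t%:C by move=> ht; apply: Nreal; clear -ht b1 b2; lra.
have S2 t : beta <= t <= 1 -> N t%:C by move=> ht; apply: Nreal; clear -ht b1 b2; lra.
have [p1 [a1 [s1 [d1 [rho1 [C1 [rho10 C10 [sl1 Re1] [p1E p1s] H1]]]]]]] :=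
  side_wkb HU1 HdV MU1 M'0 rt0 k0 k4 (cl _ m11) (tube _ m11) s0E E0large b1 (or_introl (conj erefl erefl)) S1.
have [p2 [a2 [s2 [d2 [rho2 [C2 [rho20 C20 [sl2 Re2] [p2E p2s] H2]]]]]]] :=
  side_wkb HU2 HdV MU2 M'0 rt0 k0 k4 (cl _ p11) (tube _ p11) s0E E0large b2 (or_intror (conj erefl erefl)) S2.
have MV' z : N z -> cabs (V z) <= M by case/MV.
have Wex h : exists WW : (R[i] -> R[i]) * (R[i] -> R[i]), 0 < h -> deriv_on setT WW.1 WW.2 /\
  forall E, (spec h E <-> WW.1 E = 0) /\
  exists uv : (R[i] -> R[i]) * (R[i] -> R[i]) * ((R[i] -> R[i]) * (R[i] -> R[i])), [/\
    [/\ deriv_on N uv.1.1 uv.1.2, deriv_on N uv.1.2 (fun z => (V z - delta*i - E) / (h ^+ 2)%:C * uv.1.1 z),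
       uv.1.1 (-1) = 0 & uv.1.2 (-1) = 1],
    [/\ deriv_on N uv.2.1 uv.2.2, deriv_on N uv.2.2 (fun z => (V z + delta*i - E) / (h ^+ 2)%:C * uv.2.1 z),
       uv.2.1 1 = 0 & uv.2.2 1 = 1] &
    WW.1 E = uv.1.1 beta%:C * uv.2.2 beta%:C - uv.1.2 beta%:C * uv.2.1 beta%:C].
  (* Zero functions are default values for [h <= 0], needed only to make the choice total. *)
  have [h0|h0] := ltP 0 h; last by exists ((fun=> 0), (fun=> 0)).
  have [W [dW [HW HE]]] := characteristic_function delta HV MV' h0 Nreal hb.
  exists (W, dW) => _; split=> // E; have [E1 [u [v [u' [v' H]]]]] := HE E.
  by split => //; exists ((u, v), (u', v')).
have [WW HWW] := choice Wex.
have uvex (hE : R * R[i]) : exists uv : (R[i] -> R[i]) * (R[i] -> R[i]) * ((R[i] -> R[i]) * (R[i] -> R[i])),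
  0 < hE.1 -> [/\
    [/\ deriv_on N uv.1.1 uv.1.2, deriv_on N uv.1.2 (fun z => (V z - delta*i - hE.2) / (hE.1 ^+ 2)%:C * uv.1.1 z),
       uv.1.1 (-1) = 0 & uv.1.2 (-1) = 1],
    [/\ deriv_on N uv.2.1 uv.2.2, deriv_on N uv.2.2 (fun z => (V z + delta*i - hE.2) / (hE.1 ^+ 2)%:C * uv.2.1 z),
       uv.2.1 1 = 0 & uv.2.2 1 = 1] &
    (WW hE.1).1 hE.2 = uv.1.1 beta%:C * uv.2.2 beta%:C - uv.1.2 beta%:C * uv.2.1 beta%:C].
  have [h0|h0] := ltP 0 hE.1; last first.
    by exists (((fun=> 0), (fun=> 0)), ((fun=> 0), (fun=> 0))).
  by have [_ /(_ hE.2)[_ [uv Huv]]] := HWW _ h0; exists uv.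
have [uv Huv] := choice uvex.
pose u1 h E := (uv (h, E)).1.1 beta%:C; pose v1 h E := (uv (h, E)).1.2 beta%:C.
pose u2 h E := (uv (h, E)).2.1 beta%:C; pose v2 h E := (uv (h, E)).2.2 beta%:C.
pose rho := Num.min rho1 rho2; pose C := C1 + C2.
have S0 : 0 < cabs s0.
  rewrite cabs_gt0; apply/eqP => e; move: s0E; rewrite e expr0n /= => /eqP.
  rewrite eq_sym oppr_eq0 => /eqP e0; move: E0large; rewrite e0 cabs0.
  by have := divr_gt0 M'0 k0; clear; lra.
have cm1 : (-1)%:C = -1 :> R[i] by rewrite rmorphN1.
have c1 : 1%:C = 1 :> R[i] by rewrite rmorph1.
exists rho, C, (cabs s0), k, (fun h => (WW h).1), (fun h => (WW h).2), u1, v1, p1, a1, s1, d1, u2, v2, p2, a2, s2, d2.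
split.
- split.
  + by rewrite lt_min rho10 rho20 S0 addr_gt0.
  + by move=> h h0; have [] := HWW h h0.
  + by move=> h E h0; have [_ _ ->] := Huv (h, E) h0.
  + apply: H1; [by rewrite ge_min lexx|by rewrite /C lerDl ltW|] => h E h0.
    have [[f1 f2 f3 f4] _ _] := Huv (h, E) h0.
    by exists (uv (h, E)).1.1, (uv (h, E)).1.2; rewrite cm1.
  apply: H2; [by rewrite ge_min lexx orbT|by rewrite /C lerDr ltW|] => h E h0.
  have [_ [f1 f2 f3 f4] _] := Huv (h, E) h0.
  by exists (uv (h, E)).2.1, (uv (h, E)).2.2; rewrite c1.
- by move=> h E h0; have [_ /(_ E)[]] := HWW h h0.
- exact: Re1.
- exact: Re2.
split => //.
(* The squared momenta at [beta] are V - i delta - E0 and V + i delta - E0, whose imaginary parts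
   differ by 2 delta. *)
- rewrite p1E p2E; apply/eqP => /(congr1 (fun z : R[i] => cIm z)).
  by rewrite !cImD !cImN /= => e; clear -e d0'; lra.
- apply: (slope_bounds _ _ _ _ _ _ sl1 sl2); rewrite -?cabs_gt0 ?cabs_rdist ?k0 ?k4 //.
  + by rewrite normr_gt0; apply/eqP => e; clear -e hb'; lra.
  + by rewrite normr_gt0; apply/eqP => e; clear -e hb'; lra.
  + by rewrite gtr0_norm ?ltr0_norm; clear -hb'; lra.
  by rewrite cm1 c1; ring.
- have := cabs_triangle s0 (p2 E0); rewrite cabsB.
  have : k * cabs s0 <= 1 / 4 * cabs s0 by rewrite ler_pM2r.
  by clear -p2s; lra.
have := cabs_dist (p2 E0) (p1 E0) s0; rewrite (cabsB s0).
by clear -p1s p2s; lra.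
Qed.

Lemma roots_lim_spectrum (R : realType) (Sp : R -> set R[i]) (E0 : R[i]) :
  (forall eps : R, 0 < eps -> exists h E, [/\ 0 < h, h < eps, cabs (E - E0) < eps & Sp h E]) ->
  lim_spectrum Sp E0.
Proof.
move=> H.
have Hn (n : nat) : exists hE : R * R[i], [/\ 0 < hE.1, hE.1 < n.+1%:R^-1,
    cabs (hE.2 - E0) < n.+1%:R^-1 & Sp hE.1 hE.2].
  have n0 : 0 < n.+1%:R^-1 :> R by rewrite invr_gt0.
  by have [h [E HE]] := H _ n0; exists (h, E).
have small (e : R) : 0 < e -> exists n0, forall n, (n0 <= n)%N -> n.+1%:R^-1 < e.
  by move=> e0; have [n0 _ H0] := near_infty_natSinv_lt (PosNum e0); exists n0.
have [hE HE] := choice Hn; exists (fun n => (hE n).1), (fun n => (hE n).2); split.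
- by move=> n; have [] := HE n.
- apply/cvg_real_seqP => e /small[n0 Hs]; exists n0 => n /Hs; have [h0 h1 _ _] := HE n.
  by rewrite subr0 gtr0_norm //; exact: lt_trans.
- by move=> n; have [] := HE n.
apply/cvg_seqP => e /small[n0 Hs]; exists n0 => n /Hs; have [_ _ h1 _] := HE n.
exact: lt_trans.
Qed.

Lemma lim_spectrum_root (R : realType) (Sp : R -> set R[i]) (E0 : R[i]) (eta : R) :
  lim_spectrum Sp E0 -> 0 < eta ->
  exists h E, [/\ 0 < h, h <= eta, cabs (E - E0) <= eta & Sp h E].
Proof.
move=> [h [E [h0 /cvg_real_seqP ch SpE /cvg_seqP cE]]] eta0.
have [n1 H1] := ch eta eta0; have [n2 H2] := cE eta eta0.
pose n := maxn n1 n2; exists (h n), (E n); split => //.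
- by have := H1 n (leq_maxl _ _); rewrite subr0 gtr0_norm //; exact: ltW.
- by apply: ltW; apply: H2; exact: leq_maxr.
Qed.

Theorem theorem6 (R : realType) (D : set R[i]) (V : R[i] -> R[i])
  (beta delta : R)
  (D_open : open D) (D_connected : connected D)
  (D_segment : forall x : R, x \in `[-1, 1] -> D x%:C)
  (V_holo : holomorphic_on D V)
  (beta_in : beta \in `]-1, 1[) (delta_gt0 : 0 < delta)
  (h1 : hyp_H1 D V) (h3 : hyp_H3 D V beta) :
  exists Rad eps : R, [/\ 0 < Rad, 0 < eps &
    forall E0 : R[i], Rad <= cabs E0 -> `|complex.Im E0| <= eps * cabs E0 ->
      ((Re_int_sqrt_eq0 (-1) beta (fun x : R => V x%:C - delta *i - E0) \/
        Re_int_sqrt_eq0 beta 1 (fun x : R => V x%:C + delta *i - E0)) <->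
       lim_spectrum (fun h => spectrum (schrodinger delta beta V h)) E0)].
Proof.
have hb : -1 < beta < 1 by move: beta_in; rewrite in_itv.
have [Rad Rad0 Q] := quantization D_open D_segment V_holo hb delta_gt0.
exists Rad, 1; split => // E0 hE0 _.
have [rho [C [S [k [W [dW [u1 [v1 [p1 [a1 [s1 [d1 [u2 [v2 [p2 [a2 [s2 [d2
  [pair specW Re1 Re2 [p12 [d10 d20 d120 dd1 dd2] p2S p2p1 kS]]]]]]]]]]]]]]]]]]]] := Q E0 hE0.
split=> [H|lim].
  have {H} H : cRe (s1 E0) = 0 \/ cRe (s2 E0) = 0.
    by case: H => [/Re1|/Re2]; [left|right].
  apply: roots_lim_spectrum => eps eps0.
  suff [h [E [h0 he Ee WE]]] : exists h E, [/\ 0 < h, h < eps, cabs (E - E0) < eps & W h E = 0].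
    by exists h, E; split => //; exact/(specW _ _ h0).
  have [r1|r1] := eqVneq (cRe (s1 E0)) 0; have [r2|r2] := eqVneq (cRe (s2 E0)) 0.
  - exact: (two_roots pair d120 dd1 dd2 p2S p2p1 kS).
  - exact: (one_root_neq0 pair).
  (* The roles of the arms are exchanged, which replaces the Wronskian by its opposite. *)
  - have [||||h [E [h0 he Ee /eqP]]] := one_root_neq0 (wkb_pair_swap pair) _ _ _ _ eps0 => //.
      by rewrite eq_sym.
    by rewrite oppr_eq0 => /eqP; exists h, E.
  - by case: H => r; [move: r1|move: r2]; rewrite r eqxx.
apply: contrapT => /not_orP[n1 n2].
have r1 : cRe (s1 E0) != 0 by apply/eqP => /Re1.
have r2 : cRe (s2 E0) != 0 by apply/eqP => /Re2.
have [eta eta0 H] := no_root_neq0 pair p12 r1 r2.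
have [h [E [h0 he Ee /(specW _ _ h0) WE]]] := lim_spectrum_root lim eta0.
by have := H h E h0 he Ee; rewrite WE eqxx.
Qed.
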